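(* Let $\ell$ be a prime and let $k_0$ be an infinite perfect field of characteristic $\neq \ell$. Let $K_0$ be a regular function field over $k_0$ of transcendence degree $\geq 5$, and put $K = K_0\cdot k$ where $k = \bar k_0$. Let $\mathbf{a}$ be an arbitrary (possibly empty) finite tuple of elements of $k_0^\times$. Then the canonical map $$\rho_{k_0} : \operatorname{Gal}_{k_0} \rightarrow \underline{\operatorname{Aut}}^{\rm c}_{\mathbf{a}}(\mathcal{G}_K^a)$$ is an isomorphism (of groups).
   Context: $k$ is the algebraic closure of $k_0$, $\operatorname{Gal}_{k_0} = \operatorname{Gal}(k|k_0)$. A function field $K_0|k_0$ (finitely generated field extension) is regular if it has a separating transcendence base and $k_0$ is relatively algebraically closed in $K_0$. $K = K_0\otimes_{k_0}k = K_0\cdot k$, and $\operatorname{Gal}_{k_0}\cong\operatorname{Gal}(K|K_0)$ acts on $K$. $\mathcal{G}_K = \operatorname{Gal}(K(\ell)|K)$ is the maximal pro-$\ell$ Galois group of $K$. For a profinite group $\mathcal{G}$ put (closed subgroups) $\mathcal{G}^{(2)} = [\mathcal{G},\mathcal{G}]\cdot \mathcal{G}^\ell$ and $\mathcal{G}^{(3)} = [\mathcal{G},\mathcal{G}^{(2)}]\cdot \mathcal{G}^{\delta\ell}$ where $\delta = 1$ if $\ell\neq 2$ and $\delta = 2$ if $\ell = 2$; $\mathcal{G}^a = \mathcal{G}/\mathcal{G}^{(2)}$, $\mathcal{G}^c = \mathcal{G}/\mathcal{G}^{(3)}$. Let $\widehat\wedge^2(\mathcal{G}^a) = \varprojlim_H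 \wedge^2(\mathcal{G}^a/H)$, $H$ ranging over open subgroups of $\mathcal{G}^a$, where $\wedge^2(M) = M\otimes M/\langle x\otimes x\rangle$ for a $\mathbb{Z}/\ell$-module $M$. For $\sigma,\tau\in\mathcal{G}^a$ with lifts $\tilde\sigma,\tilde\tau\in\mathcal{G}^c$, $[\sigma,\tau] := \tilde\sigma^{-1}\tilde\tau^{-1}\tilde\sigma\tilde\tau$ is independent of the lifts and induces $[\bullet,\bullet] : \widehat\wedge^2(\mathcal{G}^a)\to\mathcal{G}^{(2)}/\mathcal{G}^{(3)}$, with kernel denoted $\mathcal{R}(\mathcal{G})$. $\operatorname{Aut}^{\rm c}(\mathcal{G}^a)$ is the group of (continuous) automorphisms $\phi$ of $\mathcal{G}^a$ such that $\widehat\wedge^2(\phi)$ and $\widehat\wedge^2(\phi^{-1})$ map $\mathcal{R}(\mathcal{G})$ into itself. For a normal geometrically integral $k_0$-variety $U$ (separated, of finite type), $\pi^a(U) = (\pi_1^{\text{ét}}(U\times_{k_0}k))^a$. For $\mathbf{a} = (a_1,\ldots,a_r)$ put $\mathrm{U}_{\mathbf{a}} = \mathbb{G}_{m,k_0}\smallsetminus\{a_1,\ldots,a_r\}$. Every non-constant $t\in K_0^\times$ (i.e. $t\notin k_0$) induces a dominant morphism $U\to\mathrm{U}_{\mathbf{a}}$ for some normal geometrically integral $k_0$-variety $U$ with function field $K_0$, hence a homomorphism $\pi_t : \mathcal{G}_K^a\twoheadrightarrow\pi^a(U)\to\pi^a(\mathrm{U}_{\mathbf{a}})$; let $\mathcal{H}_t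 = \ker\pi_t$. $\operatorname{Aut}^{\rm c}_{\mathbf{a}}(\mathcal{G}_K^a)$ is the subgroup of those $\phi\in\operatorname{Aut}^{\rm c}(\mathcal{G}_K^a)$ with $\phi\mathcal{H}_t = \mathcal{H}_t$ for all non-constant $t\in K_0^\times$. $(\mathbb{Z}/\ell)^\times$ acts on it by multiplication, and $\underline{\operatorname{Aut}}^{\rm c}_{\mathbf{a}}(\mathcal{G}_K^a) = \operatorname{Aut}^{\rm c}_{\mathbf{a}}(\mathcal{G}_K^a)/(\mathbb{Z}/\ell)^\times$. The canonical action of $\operatorname{Gal}_{k_0}\cong\operatorname{Gal}(K|K_0)$ on $\mathcal{G}_K^a$ (induced by its outer action on $\mathcal{G}_K$) lands in $\operatorname{Aut}^{\rm c}_{\mathbf{a}}(\mathcal{G}_K^a)$, and $\rho_{k_0}$ is the composite with the projection to $\underline{\operatorname{Aut}}^{\rm c}_{\mathbf{a}}(\mathcal{G}_K^a)$. *)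

(* Defs.v *)
From HB Require Import structures.
From mathcomp Require Import all_boot all_order all_algebra mxpoly.
From mathcomp Require Import generic_quotient ring_quotient separable.
From mathcomp Require Import all_classical topology.
From mathcomp Require Import freeg.
From mathcomp Require mpoly.
(* mpoly and the analysis library have incompatible notations *)
Import -(notations) mpoly.

Set Implicit Arguments.
Unset Strict Implicit.
Unset Printing Implicit Defensive.

Import GRing.Theory.
Local Open Scope classical_set_scope.
Local Open Scope quotient_scope.
Local Open Scope group_scope.

(** * Topological groups *)

#[short(type="preTopGroupType")]
HB.structure Definition PreTopGroup := {G of Group G & Topological G}.

HB.mixin Record PreTopGroup_isTopGroup G of PreTopGroup G := {
  mulg_continuous : continuous (fun p : G * G => p.1 * p.2);
  invg_continuous : continuous (fun x : G => x^-1)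
}.

#[short(type="topGroupType")]
HB.structure Definition TopGroup := {G of PreTopGroup_isTopGroup G & PreTopGroup G}.

Definition is_subgroup (G : groupType) (H : set G) : Prop :=
  [/\ H 1, forall x y, H x -> H y -> H (x * y) & forall x, H x -> H x^-1].

Record nsubgroup (G : groupType) := NSubgroup {
  nsub_set :> G -> Prop;
  nsub_subgroup : is_subgroup nsub_set;
  nsub_normal : forall x y, nsub_set x -> nsub_set (x ^ y)
}.

(** ** Quotient groups *)

Section QuotientGroup.
Variables (G : groupType) (N : nsubgroup G).

Definition coset_rel (x y : G) : bool := `[< N (x^-1 * y) >].

Lemma coset_rel_equiv : equiv_class_of coset_rel.
Proof.
have [N1 NM NV] := nsub_subgroup N.
split=> [x|x y|y x z].
- by apply/asboolP; rewrite mulVg.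
- by apply/asboolP/asboolP => /NV; rewrite invgM invgK.
- move=> /asboolP xy /asboolP yz; apply/asboolP.
  by have := NM _ _ xy yz; rewrite mulgA mulgK.
Qed.

Canonical coset_equiv := EquivRelPack coset_rel_equiv.
Canonical coset_encModRel := defaultEncModRel coset_rel.

Definition quotgrp := {eq_quot coset_rel}.

HB.instance Definition _ : EqQuotient G coset_rel quotgrp :=
  EqQuotient.on quotgrp.
HB.instance Definition _ := Choice.on quotgrp.

Definition qclass (x : G) : quotgrp := \pi_quotgrp x.

Lemma qclassP x y : qclass x = qclass y <-> N (x^-1 * y).
Proof.
rewrite /qclass; split; first by move/eqmodP => /asboolP.
by move=> h; apply/eqmodP/asboolP.
Qed.

Lemma qclass_surj (u : quotgrp) : exists x, u = qclass x.
Proof. by exists (repr u); rewrite /qclass reprK. Qed.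

Definition quotgrp_mul (u v : quotgrp) : quotgrp := qclass (repr u * repr v).
Definition quotgrp_inv (u : quotgrp) : quotgrp := qclass (repr u)^-1.

Lemma repr_qclass x : N ((repr (qclass x))^-1 * x).
Proof. by apply/qclassP; rewrite /qclass reprK. Qed.

Lemma quotgrp_mulE x y : quotgrp_mul (qclass x) (qclass y) = qclass (x * y).
Proof.
have [N1 NM NV] := nsub_subgroup N.
apply/qclassP; set a := repr _; set b := repr _.
have -> : (a * b)^-1 * (x * y) = (a^-1 * x) ^ b * (b^-1 * y).
  by rewrite /conjg invgM !mulgA mulgK.
by apply: NM; [apply: nsub_normal|]; exact: repr_qclass.
Qed.

Lemma quotgrp_invE x : quotgrp_inv (qclass x) = qclass x^-1.
Proof.
have [N1 NM NV] := nsub_subgroup N.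
apply/qclassP; set a := repr _; rewrite invgK.
have -> : a * x^-1 = ((a^-1 * x)^-1) ^ x^-1.
  by rewrite /conjg invgM !invgK !mulgA mulgV mul1g.
by apply: nsub_normal; apply: NV; exact: repr_qclass.
Qed.

Fact quotgrp_mulA : associative quotgrp_mul.
Proof.
move=> u v w; have [[x ->] [y ->] [z ->]] :=
  And3 (qclass_surj u) (qclass_surj v) (qclass_surj w).
by rewrite !quotgrp_mulE mulgA.
Qed.
Fact quotgrp_mul1 : left_id (qclass 1) quotgrp_mul.
Proof. by move=> u; have [x ->] := qclass_surj u; rewrite quotgrp_mulE mul1g. Qed.
Fact quotgrp_mulr1 : right_id (qclass 1) quotgrp_mul.
Proof. by move=> u; have [x ->] := qclass_surj u; rewrite quotgrp_mulE mulg1. Qed.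
Fact quotgrp_mulV : left_inverse (qclass 1) quotgrp_inv quotgrp_mul.
Proof.
by move=> u; have [x ->] := qclass_surj u; rewrite quotgrp_invE quotgrp_mulE mulVg.
Qed.
Fact quotgrp_mulrV : right_inverse (qclass 1) quotgrp_inv quotgrp_mul.
Proof.
by move=> u; have [x ->] := qclass_surj u; rewrite quotgrp_invE quotgrp_mulE mulgV.
Qed.

HB.instance Definition _ := isGroup.Build quotgrp
  quotgrp_mulA quotgrp_mul1 quotgrp_mulr1 quotgrp_mulV quotgrp_mulrV.

Lemma qclassM x y : qclass (x * y) = qclass x * qclass y.
Proof. by rewrite -quotgrp_mulE. Qed.
Lemma qclassV x : qclass x^-1 = (qclass x)^-1.
Proof. by rewrite -quotgrp_invE. Qed.

End QuotientGroup.

Section QuotientTopology.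
Variables (G : topGroupType) (N : nsubgroup G).
Local Notation Q := (quotgrp N).

Definition quotgrp_open (U : set Q) : Prop := open (qclass N @^-1` U).

Fact quotgrp_openT : quotgrp_open setT.
Proof. exact: openT. Qed.
Fact quotgrp_openI : setI_closed quotgrp_open.
Proof. by move=> A B oA oB; exact: openI. Qed.
Fact quotgrp_open_bigU (I : Type) (f : I -> set Q) :
  (forall i, quotgrp_open (f i)) -> quotgrp_open (\bigcup_i f i).
Proof. by move=> of_; apply: bigcup_open => i _; exact: of_. Qed.

HB.instance Definition _ := isOpenTopological.Build Q
  quotgrp_openT quotgrp_openI quotgrp_open_bigU.


Lemma qclass_continuous : continuous (qclass N).
Proof. exact/continuousP. Qed.

Lemma qclass_open (U : set G) : open U -> open (qclass N @` U).
Proof.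
move=> oU; rewrite /open /= /quotgrp_open.
have -> : qclass N @^-1` (qclass N @` U) =
          \bigcup_(n in nsub_set N) (fun x => x * n) @^-1` U.
  have [N1 NM NV] := nsub_subgroup N.
  rewrite eqEsubset; split=> x /=.
    move=> [u Uu] /qclassP ux; exists (u^-1 * x)^-1; first exact: NV.
    by rewrite /= invgM invgK mulgA mulgV mul1g.
  move=> [n Nn] /= Uxn; exists (x * n) => //; apply/qclassP.
  by rewrite invgM mulgVK; exact: NV.
apply: bigcup_open => n _; apply: open_comp => // x _.
move=> W /(@mulg_continuous G (x, n)) [[A B] /= [nA nB] AB].
apply: filterS nA => a Aa; apply: (AB (a, n)); split=> //.
exact: nbhs_singleton nB.
Qed.

Fact quotgrp_mul_continuous : continuous (fun p : Q * Q => p.1 * p.2).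
Proof.
case=> u v /=; have [[x ->] [y ->]] := conj (qclass_surj u) (qclass_surj v).
move=> W; rewrite -qclassM => hW.
have /(qclass_continuous (x := x * y)) /= := hW.
move=> /(@mulg_continuous G (x, y)) [[A B] /= [nA nB] AB].
move: nA; rewrite {1}nbhsE => -[A' [oA A'x] A'A].
move: nB; rewrite {1}nbhsE => -[B' [oB B'y] B'B].
suff h : filter_prod (nbhs (qclass N x)) (nbhs (qclass N y))
  [set p | W (p.1 * p.2)] by exact: h.
exists (qclass N @` A', qclass N @` B') => /=.
  by split; apply: open_nbhs_nbhs; split; [exact: qclass_open|exists x|
    exact: qclass_open|exists y].
move=> [_ _] /= [[a Aa <-] [b Bb <-]].
by rewrite -qclassM; apply: (AB (a, b)); split; [exact: A'A|exact: B'B].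
Qed.

Fact quotgrp_inv_continuous : continuous (fun u : Q => u^-1).
Proof.
apply/continuousP => W oW; rewrite /open /= /quotgrp_open.
have -> : qclass N @^-1` [set u | W u^-1] =
          (fun x : G => x^-1) @^-1` (qclass N @^-1` W).
  by rewrite eqEsubset; split=> x /=; rewrite qclassV.
by move/continuousP: (@invg_continuous G); apply; exact: oW.
Qed.

HB.instance Definition _ := PreTopGroup_isTopGroup.Build Q
  quotgrp_mul_continuous quotgrp_inv_continuous.

End QuotientTopology.

(** ** Topology of pointwise convergence *)

Definition pw_open (T I : Type) (X : I -> Type) (ev : forall i, T -> X i) :
    set_system T :=
  [set U | forall t, U t -> exists2 D : set I, finite_set D &
     forall t', (forall i, D i -> ev i t' = ev i t) -> U t'].

Section PointwiseTopology.
Variables (T I : Type) (X : I -> Type) (ev : forall i, T -> X i).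

Fact pw_openT : pw_open ev setT.
Proof. by move=> t _; exists set0. Qed.

Fact pw_openI : setI_closed (pw_open ev).
Proof.
move=> A B oA oB t [/oA [D fD hD] /oB [E fE hE]].
exists (D `|` E); first by rewrite finite_setU.
move=> t' h; split; first by apply: hD => i Di; apply: h; left.
by apply: hE => i Ei; apply: h; right.
Qed.

Fact pw_open_bigU (J : Type) (f : J -> set T) :
  (forall j, pw_open ev (f j)) -> pw_open ev (\bigcup_j f j).
Proof.
move=> of_ t [j _ /of_ [D fD hD]]; exists D => // t' h.
by exists j => //; exact: hD.
Qed.

Lemma pw_open_basic (D : set I) (t : T) : finite_set D ->
  pw_open ev [set t' | forall i, D i -> ev i t' = ev i t].
Proof. by move=> fD t' t't; exists D => // s st' i Di; rewrite st'// t't. Qed.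

End PointwiseTopology.

(* A group acting on a family of sets is given the topology of pointwise       *)
(* convergence, the sets acted upon being discrete; this is the Krull topology *)
(* on a Galois group and the profinite topology on the automorphism group of a *)
(* functor with values in finite sets.                                         *)
HB.factory Record Group_isPermTop G of Group G := {
  pt_idx : Type;
  pt_fib : pt_idx -> Type;
  pt_act : forall i, G -> pt_fib i -> pt_fib i;
  pt_act1 : forall i (f : pt_fib i), @pt_act i 1 f = f;
  pt_actM : forall i x y (f : pt_fib i), @pt_act i (x * y) f = @pt_act i x (@pt_act i y f)
}.

HB.builders Context G of Group_isPermTop G.

Let ev (p : {i : pt_idx & pt_fib i}) (g : G) : pt_fib (tag p) :=
  @pt_act (tag p) g (tagged p).

HB.instance Definition _ := isOpenTopological.Build G
  (pw_openT ev) (pw_openI (ev := ev)) (pw_open_bigU (ev := ev)).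

Let nbhsP (g : G) (U : set G) : nbhs g U <->
  exists2 D, finite_set D & forall h, (forall i, D i -> ev i h = ev i g) -> U h.
Proof.
split=> [|[D fD DU]]; first rewrite nbhsE => -[V [oV Vg] VU].
  have [D fD DV] := oV _ Vg; exists D => // h /DV; exact: VU.
rewrite nbhsE; exists [set h | forall i, D i -> ev i h = ev i g] => //.
by split=> //; exact: pw_open_basic.
Qed.

Let mul_continuous : continuous (fun p : G * G => p.1 * p.2).
Proof.
case=> g h U /nbhsP [D fD DU].
suff H : filter_prod (nbhs g) (nbhs h) [set p | U (p.1 * p.2)] by exact: H.
pose D' := (fun p => Tagged pt_fib (ev p h)) @` D.
exists ([set g' | forall i, D' i -> ev i g' = ev i g],
        [set h' | forall i, D i -> ev i h' = ev i h]) => /=.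
  split; apply/nbhsP; last by exists D.
  by exists D' => //; exact: finite_image.
move=> [g' h'] /= [g'g h'h]; apply: DU => p Dp.
rewrite /ev !pt_actM; have := h'h _ Dp; rewrite /ev => ->.
by have := g'g (Tagged pt_fib (ev p h)) (ex_intro2 _ _ p Dp erefl).
Qed.

Let inv_continuous : continuous (fun x : G => x^-1).
Proof.
move=> g U /nbhsP [D fD DU]; apply/nbhsP.
exists ((fun p => Tagged pt_fib (ev p g^-1)) @` D); first exact: finite_image.
move=> h hg; apply: DU => p Dp.
have /= := hg (Tagged pt_fib (ev p g^-1)) (ex_intro2 _ _ p Dp erefl).
rewrite /ev /=; move: (tagged p) => f E.
have := congr1 (@pt_act (tag p) h^-1) E.
by rewrite -[in LHS]pt_actM mulVg pt_act1 -(pt_actM g g^-1) mulgV pt_act1.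
Qed.

HB.instance Definition _ := PreTopGroup_isTopGroup.Build G
  mul_continuous inv_continuous.

HB.end.

(** ** Closed subgroups; the central descending series mod [l] *)

Section ClosedSubgroups.
Variable G : topGroupType.
Implicit Type S : set G.

Definition closed_gen S : set G :=
  \bigcap_(H in [set H : set G | [/\ is_subgroup H, closed H & S `<=` H]]) H.

Lemma closed_gen_subgroup S : is_subgroup (closed_gen S).
Proof.
split=> [H [[]]//|x y Sx Sy H HS|x Sx H HS].
  by have [[_ HM _] _ _] := HS; apply: HM; [exact: Sx|exact: Sy].
by have [[_ _ HV] _ _] := HS; apply: HV; exact: Sx.
Qed.

Lemma sub_closed_gen S : S `<=` closed_gen S.
Proof. by move=> x Sx H [_ _]; apply. Qed.

Lemma conjg_continuous (y : G) : continuous (fun x => x ^ y).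
Proof.
move=> x W /(@mulg_continuous G (y^-1, x * y)) [[A B] /= [nA nB] AB].
have [[C D] /= [nC nD] CD] := @mulg_continuous G (x, y) _ nB.
apply: filterS nC => c Cc; apply: (AB (y^-1, c * y)); split=> /=.
  exact: nbhs_singleton nA.
by apply: (CD (c, y)); split=> //; exact: nbhs_singleton nD.
Qed.

Lemma closed_gen_normal S : (forall x y, S x -> S (x ^ y)) ->
  forall x y, closed_gen S x -> closed_gen S (x ^ y).
Proof.
move=> SJ x y Sx H [[H1 HM HV] cH SH].
apply: (Sx [set z | H (z ^ y)]); split.
- split=> [|a b|a] /=; first by rewrite conj1g.
    by rewrite conjMg; exact: HM.
  by rewrite conjVg; exact: HV.
- by apply: closed_comp => // z _; exact: conjg_continuous.
- by move=> z Sz; apply/SH/SJ.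
Qed.

Variable l : nat.

Definition G2_set : set G :=
  closed_gen ([set z | exists x y, z = [~ x, y]] `|` [set z | exists x, z = x ^+ l]).

Definition G2 : nsubgroup G.
Proof.
exists G2_set; first exact: closed_gen_subgroup.
apply: closed_gen_normal => _ z [[x [y ->]]|[x ->]].
  by left; exists (x ^ z), (y ^ z); rewrite conjRg.
by right; exists (x ^ z); rewrite conjXg.
Defined.

Definition G3_set : set G :=
  let delta := if l == 2%N then 2%N else 1%N in
  closed_gen ([set z | exists x y, G2 y /\ z = [~ x, y]] `|`
              [set z | exists x, z = x ^+ (delta * l)%N]).

Definition G3 : nsubgroup G.
Proof.
exists G3_set; first exact: closed_gen_subgroup.
apply: closed_gen_normal => _ z [[x [y [Gy ->]]]|[x ->]].
  left; exists (x ^ z), (y ^ z); rewrite conjRg; split=> //.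
  exact: nsub_normal.
by right; exists (x ^ z); rewrite conjXg.
Defined.

Definition Ga : topGroupType := quotgrp G2.
Definition Gc : topGroupType := quotgrp G3.

Definition to_a (x : G) : Ga := qclass G2 x.
Definition to_c (x : G) : Gc := qclass G3 x.

End ClosedSubgroups.

(** ** Exterior squares *)

Section AdditiveSpan.
Local Open Scope ring_scope.
Variables (V : zmodType) (S : set V).

Definition zspan : {pred V} :=
  fun v => `[< forall T : set V, T 0 -> (forall x y, T x -> T y -> T (x - y)) ->
                 S `<=` T -> T v >].

Lemma zspanP v : reflect (forall T : set V, T 0 ->
    (forall x y, T x -> T y -> T (x - y)) -> S `<=` T -> T v) (v \in zspan).
Proof. exact: asboolP. Qed.

Fact zspan_closed : zmod_closed zspan.
Proof.
split=> [|x y /zspanP Tx /zspanP Ty]; apply/zspanP => // T T0 TB ST.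
exact: TB (Tx T T0 TB ST) (Ty T T0 TB ST).
Qed.

HB.instance Definition _ := GRing.isZmodClosed.Build V zspan zspan_closed.

Lemma sub_zspan v : S v -> v \in zspan.
Proof. by move=> Sv; apply/zspanP => T _ _; apply. Qed.

End AdditiveSpan.

Section FreeModuleMap.
Local Open Scope ring_scope.
Variable R : nzRingType.

Definition fgbasis (X : choiceType) (x : X) : {freeg X / R} := Freeg [:: (1, x)].

Definition fgmap (X Y : choiceType) (f : X -> Y) : {freeg X / R} -> {freeg Y / R} :=
  fglift (fun x => fgbasis (f x)).

Lemma fgmapB (X Y : choiceType) (f : X -> Y) : {morph fgmap f : u v / u - v}.
Proof. exact: lift_is_additive. Qed.

Lemma fgmap_scaled (X Y : choiceType) (f : X -> Y) c x :
  fgmap f (Freeg [:: (c, x)]) = Freeg [:: (c, f x)].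
Proof.
rewrite /fgmap liftU; apply/eqP/freeg_eqP => y.
by rewrite coeffZ /fgbasis !coeffU mul1r.
Qed.

Lemma fgmap_basis (X Y : choiceType) (f : X -> Y) x :
  fgmap f (fgbasis x) = fgbasis (f x).
Proof. exact: fgmap_scaled. Qed.

Lemma fg_additive_eq (X : choiceType) (V : zmodType) (g h : {freeg X / R} -> V) :
  {morph g : u v / u - v} -> {morph h : u v / u - v} ->
  (forall c x, g (Freeg [:: (c, x)]) = h (Freeg [:: (c, x)])) -> g =1 h.
Proof.
move=> gB hB gh D; rewrite -[D]freeg_sumE.
have zero (f : {freeg X / R} -> V) : {morph f : u v / u - v} -> f 0 = 0.
  by move=> fB; have := fB 0 0; rewrite !subrr.
have add (f : {freeg X / R} -> V) :
    {morph f : u v / u - v} -> forall u v, f (u + v) = f u + f v.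
  move=> fB u v; have fN w : f (- w) = - f w by rewrite -(sub0r w) fB zero // sub0r.
  by rewrite -[v in LHS]opprK fB fN opprK.
elim: (dom D) => [|x s IH]; first by rewrite big_nil !zero.
by rewrite big_cons !add // IH gh.
Qed.

Lemma fgmap_comp (X Y Z : choiceType) (f : X -> Y) (g : Y -> Z) w :
  fgmap g (fgmap f w) = fgmap (g \o f) w.
Proof.
apply: (fg_additive_eq (g := fun w => fgmap g (fgmap f w))) w => [u v|u v|c x].
- by rewrite !fgmapB.
- exact: fgmapB.
- by rewrite !fgmap_scaled.
Qed.

End FreeModuleMap.

(* [wedge2 l M] is the exterior square over Z/l of an abelian group [M] killed *)
(* by [l], the law of [M] being written multiplicatively: the free module on   *)
(* the pairs (x, y) modulo the bilinearity relations and the x (x) x.  As Z/l  *)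
(* is a prime field, the additive subgroup spanned by the relations is a       *)
(* submodule.                                                                  *)
Section Wedge2.
Local Open Scope ring_scope.
Variable l : nat.

Definition free2 (M : groupType) : zmodType := {freeg (M * M)%type / 'F_l}.

Definition pairg (M : groupType) (x y : M) : free2 M := fgbasis 'F_l (x, y).

Definition wedge_relators (M : groupType) : set (free2 M) :=
  [set w | [\/ exists x x' y, w = pairg (x * x')%g y - pairg x y - pairg x' y,
               exists x y y', w = pairg x (y * y')%g - pairg x y - pairg x y' |
               exists x, w = pairg x x]].

Definition wedge_null (M : groupType) : zmodClosed (free2 M) :=
  zspan (@wedge_relators M).

Definition wedge2 (M : groupType) : zmodType := Quotient.quot (wedge_null M).

Definition to_wedge2 (M : groupType) (w : free2 M) : wedge2 M :=
  \pi_(Quotient.quot (wedge_null M)) w.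

Definition wedge (M : groupType) (x y : M) : wedge2 M := to_wedge2 (pairg x y).

Definition pair_map (M M' : groupType) (f : M -> M') (p : M * M) : M' * M' :=
  (f p.1, f p.2).

Definition wedge2_map (M M' : groupType) (f : M -> M') (u : wedge2 M) : wedge2 M' :=
  to_wedge2 (fgmap (pair_map f) (repr u)).

Lemma to_wedge2P (M : groupType) (w w' : free2 M) :
  to_wedge2 w = to_wedge2 w' <-> w - w' \in wedge_null M.
Proof.
by rewrite Quotient.idealrBE; split=> /eqP.
Qed.

Lemma to_wedge2_repr (M : groupType) (u : wedge2 M) : to_wedge2 (repr u) = u.
Proof. exact: reprK. Qed.

Section Theory.
Variables (M M' : groupType) (f : M -> M').
Hypothesis fM : {morph f : x y / (x * y)%g}.

Lemma fgmap_null w : w \in wedge_null M -> fgmap (pair_map f) w \in wedge_null M'.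
Proof.
move=> /zspanP h.
apply: (h [set w | fgmap (pair_map f) w \in wedge_null M']) => /= [|x y|].
- by rewrite -(subrr 0) fgmapB subrr /= rpred0.
- by move=> fx fy; rewrite fgmapB rpredB.
- move=> _ [[x [x' [y ->]]]|[x [y [y' ->]]]|[x ->]];
    rewrite /= /pairg ?fgmapB !fgmap_basis /pair_map /=; apply: sub_zspan.
  + by apply: Or31; exists (f x), (f x'), (f y); rewrite fM.
  + by apply: Or32; exists (f x), (f y), (f y'); rewrite fM.
  + by apply: Or33; exists (f x).
Qed.

Lemma wedge2_mapE w :
  wedge2_map f (to_wedge2 w) = to_wedge2 (fgmap (pair_map f) w).
Proof.
rewrite /wedge2_map; apply/to_wedge2P; rewrite -fgmapB; apply: fgmap_null.
by apply/to_wedge2P; exact: to_wedge2_repr.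
Qed.

Lemma wedge2_map_wedge x y : wedge2_map f (wedge x y) = wedge (f x) (f y).
Proof. by rewrite wedge2_mapE /pairg fgmap_basis. Qed.

Lemma wedge2_mapB : {morph wedge2_map f : u v / u - v}.
Proof.
move=> u v; rewrite -[u]to_wedge2_repr -[v]to_wedge2_repr.
have toB (N : groupType) (w w' : free2 N) :
  to_wedge2 w - to_wedge2 w' = to_wedge2 (w - w').
  by apply/eqP; rewrite subr_eq -pi_addr subrK.
by rewrite toB !wedge2_mapE toB fgmapB.
Qed.

End Theory.

Lemma wedge2_map_comp (M M' M'' : groupType) (f : M -> M') (g : M' -> M'') u :
  {morph f : x y / (x * y)%g} -> {morph g : x y / (x * y)%g} ->
  wedge2_map g (wedge2_map f u) = wedge2_map (g \o f) u.
Proof.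
move=> fM gM; rewrite -[u]to_wedge2_repr !wedge2_mapE ?fgmap_comp //.
by move=> x y /=; rewrite fM gM.
Qed.

End Wedge2.

(** ** The completed exterior square *)

(* For abelian M normality is no restriction. *)
Record open_nsub (M : topGroupType) := OpenNSub {
  on_nsub :> nsubgroup M;
  on_open : open (nsub_set on_nsub)
}.

Record cont_hom (M M' : topGroupType) := ContHom {
  ch_fun :> M -> M';
  ch_morph : {morph ch_fun : x y / x * y};
  ch_cont : continuous ch_fun
}.

Section QuotientMap.
Variables (M M' : groupType) (H : nsubgroup M) (H' : nsubgroup M') (f : M -> M').

Definition qmap (u : quotgrp H) : quotgrp H' := qclass H' (f (repr u)).

Hypothesis fM : {morph f : x y / x * y}.
Hypothesis fH : forall x, H x -> H' (f x).

Lemma morph1 : f 1 = 1.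
Proof. by apply: (mulgI (f 1)); rewrite -fM !mulg1. Qed.

Lemma morphV x : f x^-1 = (f x)^-1.
Proof. by apply: (mulgI (f x)); rewrite -fM !mulgV morph1. Qed.

Lemma qmapE x : qmap (qclass H x) = qclass H' (f x).
Proof.
apply/qclassP; rewrite -morphV -fM; apply: fH.
by apply/qclassP; rewrite /qclass reprK.
Qed.

Lemma qmapM : {morph qmap : u v / u * v}.
Proof.
move=> u v; have [[x ->] [y ->]] := conj (qclass_surj u) (qclass_surj v).
by rewrite -qclassM !qmapE fM qclassM.
Qed.

End QuotientMap.

Section CompletedWedge.
Variables (l : nat) (M : topGroupType).

Record ext2hat := Ext2hat {
  eh_val :> forall H : open_nsub M, wedge2 l (quotgrp H);
  eh_compat : forall H H' : open_nsub M, (forall x, H x -> H' x) ->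
    wedge2_map (@qmap M M H H' idfun) (eh_val H) = eh_val H'
}.

HB.instance Definition _ := gen_eqMixin ext2hat.
HB.instance Definition _ := gen_choiceMixin ext2hat.

Lemma ext2hatP (u v : ext2hat) : (forall H, u H = v H) <-> u = v.
Proof.
split=> [|->//]; case: u v => [u Hu] [v Hv] /= uv.
have {}uv : u = v by apply: functional_extensionality_dep.
by subst v; congr Ext2hat; exact: Prop_irrelevance.
Qed.

Let id_morph (H H' : open_nsub M) : (forall x, H x -> H' x) ->
  {morph @qmap M M H H' idfun : u v / u * v}.
Proof. by move=> HH'; apply: qmapM. Qed.

Fact eh_zero_compat (H H' : open_nsub M) : (forall x, H x -> H' x) ->
  wedge2_map (@qmap M M H H' idfun) (0%R : wedge2 l _) = 0%R.
Proof.
by move=> /id_morph/(wedge2_mapB (l := l))/(_ 0%R 0%R); rewrite !subrr.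
Qed.

Fact eh_sub_compat (u v : ext2hat) (H H' : open_nsub M) : (forall x, H x -> H' x) ->
  wedge2_map (@qmap M M H H' idfun) (u H - v H)%R = (u H' - v H')%R.
Proof. by move=> HH'; rewrite (wedge2_mapB (id_morph HH')) !eh_compat. Qed.

Definition eh_zero := @Ext2hat (fun H => 0%R) eh_zero_compat.
Definition eh_sub u v := Ext2hat (eh_sub_compat u v).
Definition eh_opp u := eh_sub eh_zero u.
Definition eh_add u v := eh_sub u (eh_opp v).

Fact eh_addE u v H : eh_add u v H = (u H + v H)%R.
Proof. by rewrite /= sub0r opprK. Qed.

Fact eh_addA : associative eh_add.
Proof. by move=> u v w; apply/ext2hatP => H; rewrite !eh_addE addrA. Qed.
Fact eh_addC : commutative eh_add.
Proof. by move=> u v; apply/ext2hatP => H; rewrite !eh_addE addrC. Qed.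
Fact eh_add0 : left_id eh_zero eh_add.
Proof. by move=> u; apply/ext2hatP => H; rewrite eh_addE add0r. Qed.
Fact eh_addN : left_inverse eh_zero eh_opp eh_add.
Proof. by move=> u; apply/ext2hatP => H; rewrite eh_addE /= sub0r addNr. Qed.

HB.instance Definition _ :=
  GRing.isZmodule.Build ext2hat eh_addA eh_addC eh_add0 eh_addN.

Let ev (H : open_nsub M) (w : ext2hat) := w H.

(* the inverse limit topology, each wedge2 l (M / H) being discrete *)
HB.instance Definition _ := isOpenTopological.Build ext2hat
  (pw_openT ev) (pw_openI (ev := ev)) (pw_open_bigU (ev := ev)).

Fact hat_wedge_compat (x y : M) (H H' : open_nsub M) : (forall x, H x -> H' x) ->
  wedge2_map (@qmap M M H H' idfun) (wedge l (qclass H x) (qclass H y)) =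
  wedge l (qclass H' x) (qclass H' y).
Proof. by move=> HH'; rewrite wedge2_map_wedge ?qmapE //; exact: id_morph. Qed.

Definition hat_wedge (x y : M) : ext2hat := Ext2hat (hat_wedge_compat x y).

End CompletedWedge.

Section CompletedWedgeMap.
Variable l : nat.

Section Preimage.
Variables (M M' : topGroupType) (f : cont_hom M M') (H : open_nsub M').

Fact preim_subgroup : is_subgroup (f @^-1` nsub_set H).
Proof.
have [H1 HM HV] := nsub_subgroup H.
split=> [|x y|x] /=; first by rewrite (morph1 (@ch_morph _ _ f)).
  by rewrite ch_morph; exact: HM.
by rewrite (morphV (@ch_morph _ _ f)); exact: HV.
Qed.

Fact preim_normal x y :
  (f @^-1` nsub_set H) x -> (f @^-1` nsub_set H) (x ^ y).
Proof.
move=> /= Hx; rewrite /conjg !ch_morph (morphV (@ch_morph _ _ f)).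
exact: (nsub_normal (f y) Hx).
Qed.

Fact preim_open : open (f @^-1` nsub_set H).
Proof. by have /continuousP := @ch_cont _ _ f; apply; exact: on_open. Qed.

Definition preim_nsub : open_nsub M :=
  @OpenNSub M (NSubgroup preim_subgroup preim_normal) preim_open.

End Preimage.

Section Map.
Variables (M M' : topGroupType) (f : cont_hom M M').

Definition ext2hat_fun (w : ext2hat l M) (H : open_nsub M') :
    wedge2 l (quotgrp H) :=
  wedge2_map (@qmap M M' (preim_nsub f H) H f) (w (preim_nsub f H)).

Fact ext2hat_fun_compat w (H H' : open_nsub M') : (forall x, H x -> H' x) ->
  wedge2_map (@qmap M' M' H H' idfun) (ext2hat_fun w H) = ext2hat_fun w H'.
Proof.
move=> HH'; rewrite /ext2hat_fun.
have sub : forall x, preim_nsub f H x -> preim_nsub f H' x.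
  by move=> x; exact: HH'.
rewrite -(eh_compat w sub) !wedge2_map_comp.
- congr wedge2_map; apply/funext => u; have [x ->] := qclass_surj u.
  by rewrite /= !qmapE //; exact: ch_morph.
- by apply: qmapM.
- by apply: qmapM => //; exact: ch_morph.
- by apply: qmapM => //; exact: ch_morph.
- by apply: qmapM.
Qed.

Definition ext2hat_map (w : ext2hat l M) : ext2hat l M' :=
  Ext2hat (ext2hat_fun_compat w).

End Map.

Lemma ext2hat_map_comp (M M' M'' : topGroupType) (f : cont_hom M M')
    (g : cont_hom M' M'') (h : cont_hom M M'') w : h =1 g \o f ->
  ext2hat_map g (ext2hat_map f w) = ext2hat_map h w.
Proof.
move=> hE; apply/ext2hatP => H /=; rewrite /ext2hat_fun /= /ext2hat_fun.
set H1 := preim_nsub g H; set H2 := preim_nsub f H1; set H3 := preim_nsub h H.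
have sub : forall x, H3 x -> H2 x by move=> x /=; rewrite hE.
rewrite -(eh_compat w sub) !wedge2_map_comp.
- congr wedge2_map; apply/funext => u; have [x ->] := qclass_surj u.
  rewrite /= !qmapE ?hE //=; try exact: ch_morph.
- by move=> u v /=; rewrite !qmapM //; exact: ch_morph.
- by apply: qmapM => //; exact: ch_morph.
- by apply: qmapM.
- by apply: qmapM => //; exact: ch_morph.
Qed.

Lemma ext2hat_map_id (M : topGroupType) (f : cont_hom M M) w : f =1 idfun ->
  ext2hat_map f w = w.
Proof.
move=> fE; apply/ext2hatP => H /=; rewrite /ext2hat_fun.
have sub : forall x, preim_nsub f H x -> H x by move=> x /=; rewrite fE.
rewrite -(eh_compat w sub); congr wedge2_map; apply/funext => u.
have [x ->] := qclass_surj u.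
rewrite !qmapE //=; try exact: ch_morph.
by rewrite fE.
Qed.

End CompletedWedgeMap.

(** * Groups of permutations and of continuous automorphisms *)

Record bij (X : Type) := Bij {
  bij_fun :> X -> X;
  bij_invfun : X -> X;
  bij_funK : cancel bij_fun bij_invfun;
  bij_invfunK : cancel bij_invfun bij_fun
}.

Section BijGroup.
Variable X : Type.

HB.instance Definition _ := gen_eqMixin (bij X).
HB.instance Definition _ := gen_choiceMixin (bij X).

Lemma bijP (p q : bij X) : p =1 q <-> p = q.
Proof.
split=> [|->//]; case: p q => [p p' pK p'K] [q q' qK q'K] /= pq.
have {}pq : p = q by apply/funext.
subst q; have E : p' = q' by apply/funext => x; rewrite -{1}(q'K x) pK.
by subst q'; congr Bij; exact: Prop_irrelevance.
Qed.

Definition bij_one : bij X := @Bij X idfun idfun (frefl _) (frefl _).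
Definition bij_inv (p : bij X) : bij X := Bij (@bij_invfunK X p) (@bij_funK X p).
Definition bij_mul (p q : bij X) : bij X :=
  @Bij X (p \o q) (bij_inv q \o bij_inv p)
    (can_comp (@bij_funK X p) (@bij_funK X q))
    (can_comp (@bij_invfunK X q) (@bij_invfunK X p)).

Fact bij_mulA : associative bij_mul.
Proof. by move=> p q r; apply/bijP. Qed.
Fact bij_mul1 : left_id bij_one bij_mul.
Proof. by move=> p; apply/bijP. Qed.
Fact bij_mulr1 : right_id bij_one bij_mul.
Proof. by move=> p; apply/bijP. Qed.
Fact bij_mulV : left_inverse bij_one bij_inv bij_mul.
Proof. by move=> p; apply/bijP => x /=; rewrite bij_funK. Qed.
Fact bij_mulrV : right_inverse bij_one bij_inv bij_mul.
Proof. by move=> p; apply/bijP => x /=; rewrite bij_invfunK. Qed.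

HB.instance Definition _ := isGroup.Build (bij X)
  bij_mulA bij_mul1 bij_mulr1 bij_mulV bij_mulrV.

End BijGroup.

Section ContinuousAutomorphisms.
Variable M : topGroupType.

Definition is_autg (p : bij M) : Prop :=
  [/\ {morph p : x y / x * y}, continuous p & continuous (bij_invfun p)].

Definition autg_pred : {pred bij M} := fun p => `[< is_autg p >].

Fact autg_closed : group_closed autg_pred.
Proof.
split; first by apply/asboolP; split=> // x; exact: cvg_id.
move=> p q /asboolP [pM cp cpV] /asboolP [qM cq cqV]; apply/asboolP; split.
- move=> x y /=; rewrite -pM; congr (p _); apply: (can_inj (@bij_funK _ q)).
  by rewrite qM !bij_invfunK.
- by move=> x; apply: continuous_comp; [exact: cqV|exact: cp].
- by move=> x; apply: continuous_comp; [exact: cpV|exact: cq].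
Qed.

Record autg := Autg { autg_bij :> bij M; autg_bijP : autg_bij \in autg_pred }.

HB.instance Definition _ := [isSub for autg_bij].
HB.instance Definition _ := [Choice of autg by <:].
HB.instance Definition _ :=
  SubChoice_isSubGroup.Build (bij M) autg_pred autg autg_closed.

End ContinuousAutomorphisms.

Section Autc.
Variables (l : nat) (G : topGroupType).
Local Notation A := (autg (Ga G l)).

Lemma autgP (p : A) : is_autg p.
Proof. by apply/asboolP; exact: (autg_bijP p). Qed.

Definition autg_hom (p : A) : cont_hom (Ga G l) (Ga G l) :=
  @ContHom (Ga G l) (Ga G l) p
    (let: And3 h _ _ := autgP p in h) (let: And3 _ h _ := autgP p in h).

(* The continuous homomorphism induced by (s, t) |-> [~ s~, t~]; it is unique,  *)
(* as the span of the s /\ t is dense, and its values lie in G^(2)/G^(3).      *)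
Definition is_commutator_map (beta : ext2hat l (Ga G l) -> Gc G l) : Prop :=
  [/\ forall u v, beta (u + v)%R = beta u * beta v,
      continuous beta &
      forall s t : G, beta (hat_wedge l (to_a l s) (to_a l t)) =
                      [~ to_c l s, to_c l t]].

Definition commutator_kernel : set (ext2hat l (Ga G l)) :=
  [set w | exists2 beta, is_commutator_map beta & beta w = 1].

Definition is_autc (p : A) : Prop :=
  let stable q := forall w, commutator_kernel w ->
    commutator_kernel (ext2hat_map (autg_hom q) w) in
  stable p /\ stable p^-1.

Variable HH : set (set (Ga G l)).

(* automorphisms in Aut^c that moreover stabilize each member of HH *)
Definition is_autc_fix (p : A) : Prop :=
  is_autc p /\ forall H, HH H -> p @` H = H.

Definition autc_fix_pred : {pred A} := fun p => `[< is_autc_fix p >].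

Lemma autc_1 : is_autc 1.
Proof.
by split=> w Rw; rewrite ext2hat_map_id // => x; rewrite invg1.
Qed.

Lemma autc_M p q : is_autc p -> is_autc q -> is_autc (p * q).
Proof.
move=> [Rp RpV] [Rq RqV]; split=> w Rw.
  by rewrite -(@ext2hat_map_comp l _ _ _ (autg_hom q) (autg_hom p)) //; exact/Rp/Rq.
rewrite -(@ext2hat_map_comp l _ _ _ (autg_hom p^-1) (autg_hom q^-1)).
  exact/RqV/RpV.
by [].  
Qed.

Lemma autc_V p : is_autc p -> is_autc p^-1.
Proof. by case=> Rp RpV; split; rewrite ?invgK. Qed.

Fact autc_fix_closed : group_closed autc_fix_pred.
Proof.
split.
  apply/asboolP; split; first exact: autc_1.
  by move=> H _; rewrite image_id.
move=> p q /asboolP [Rp Hp] /asboolP [Rq Hq]; apply/asboolP; split.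
  exact/autc_M/autc_V.
move=> H HH_H; have qVH : bij_invfun q @` H = H.
  rewrite eqEsubset; split=> [_ [x Hx <-]|x Hx].
    by move: Hx; rewrite -{1}(Hq _ HH_H) => -[y Hy <-]; rewrite bij_funK.
  by exists (q x); rewrite ?bij_funK // -(Hq _ HH_H); exists x.
by rewrite -[in RHS](Hp _ HH_H) -[in RHS]qVH image_comp.
Qed.

Record autc_fix := AutcFix { acf_aut :> A; acf_autP : acf_aut \in autc_fix_pred }.

HB.instance Definition _ := [isSub for acf_aut].
HB.instance Definition _ := [Choice of autc_fix by <:].
HB.instance Definition _ :=
  SubChoice_isSubGroup.Build A autc_fix_pred autc_fix autc_fix_closed.

Definition scalars_set : set autc_fix :=
  [set p | exists m : nat, coprime m l /\ forall x, p x = x ^+ m].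

Lemma Ga_expl (u : Ga G l) : u ^+ l = 1.
Proof.
have [x ->] := qclass_surj u.
have qX n : qclass (G2 G l) x ^+ n = qclass (G2 G l) (x ^+ n).
  by elim: n => [|n IH]; rewrite ?expg0 // !expgS IH qclassM.
rewrite qX; apply/qclassP; rewrite mulg1.
have [_ _ GV] := nsub_subgroup (G2 G l); apply: GV.
by apply: sub_closed_gen; right; exists x.
Qed.

Lemma autc_fix_morph (p : autc_fix) : {morph p : x y / x * y}.
Proof. by have [] := autgP p. Qed.

Lemma autc_fixX (p : autc_fix) n (x : Ga G l) : p (x ^+ n) = p x ^+ n.
Proof.
elim: n => [|n IH]; first exact: morph1 (@autc_fix_morph p).
by rewrite !expgS autc_fix_morph IH.
Qed.

Lemma autc_fixP (p q : autc_fix) : p =1 q -> p = q.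
Proof. by move=> pq; apply/val_inj/val_inj/bijP. Qed.

Fact scalars_subgroup : is_subgroup scalars_set.
Proof.
split.
- by exists 1%N; rewrite coprime1n; split=> // x; rewrite expg1.
- move=> p q [m [ml pE]] [n [nl qE]]; exists (n * m)%N.
  by rewrite coprimeMl nl ml; split=> // x; rewrite expgnA /= qE pE.
move=> p [m [ml pE]]; have ml' : coprime (m + l) l by rewrite coprime_sym /coprime gcdnDr -/(coprime _ _) coprime_sym.
have [m0|m0] := posnP (m + l)%N; first by rewrite m0 in ml'; move: m0 ml' => /eqP; rewrite addn_eq0 => /andP[_ /eqP ->].
case: (egcdnP l m0) => u v uv _; exists u.
have uv1 : (u * (m + l) = v * l + 1)%N by rewrite uv (eqP ml').
split.
  apply: (@coprime_dvdl _ (u * (m + l))); first exact: dvdn_mulr.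
  by rewrite uv1 coprime_sym /coprime gcdnMDl gcdn1.
have xl (x : Ga G l) n : x ^+ (n * l)%N = 1 by rewrite mulnC expgnA Ga_expl expg1n.
have pV x : x = p (x ^+ u).
  have -> : p (x ^+ u) = x ^+ (u * (m + l))%N.
    by rewrite pE -expgnA mulnDr expgnDr xl mulg1.
  by rewrite uv1 expgnDr xl mul1g.
by move=> x /=; rewrite {1}[x]pV bij_funK.
Qed.

Fact scalars_normal p q : scalars_set p -> scalars_set (p ^ q).
Proof.
move=> [m [ml pE]]; exists m; split=> // x; rewrite /conjg /= pE.
by have := autc_fixX q^-1 m (q x); rewrite /= bij_funK.
Qed.

Definition scalars : nsubgroup autc_fix := NSubgroup scalars_subgroup scalars_normal.

Definition autc_fix_mod : groupType := quotgrp scalars.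

End Autc.

(** * Fields and Galois groups *)

Section GeneratedSubobjects.

Definition fld_gen (F : fieldType) (S : set F) : {pred F} :=
  fun x => `[< forall E : divringClosed F, (forall y, S y -> y \in E) -> x \in E >].

Fact fld_gen_closed (F : fieldType) (S : set F) : GRing.divring_closed (fld_gen S).
Proof.
split=> [|x y /asboolP Ex /asboolP Ey|x y /asboolP Ex /asboolP Ey];
  apply/asboolP => E SE; first exact: rpred1.
  by rewrite rpredB ?Ex ?Ey.
by rewrite rpred_div ?Ex ?Ey.
Qed.

HB.instance Definition _ (F : fieldType) (S : set F) :=
  GRing.isDivringClosed.Build F (@fld_gen F S) (fld_gen_closed S).

Definition ring_gen (R : comNzRingType) (S : set R) : {pred R} :=
  fun x => `[< forall E : subringClosed R, (forall y, S y -> y \in E) -> x \in E >].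

Fact ring_gen_closed (R : comNzRingType) (S : set R) :
  GRing.subring_closed (ring_gen S).
Proof.
split=> [|x y /asboolP Ex /asboolP Ey|x y /asboolP Ex /asboolP Ey];
  apply/asboolP => E SE; first exact: rpred1.
  by rewrite rpredB ?Ex ?Ey.
by rewrite rpredM ?Ex ?Ey.
Qed.

HB.instance Definition _ (R : comNzRingType) (S : set R) :=
  GRing.isSubringClosed.Build R (@ring_gen R S) (ring_gen_closed S).

End GeneratedSubobjects.

Record sfield (F : fieldType) (L : divringClosed F) :=
  SField { sf_val :> F; sf_valP : sf_val \in L }.

HB.instance Definition _ (F : fieldType) (L : divringClosed F) := [isSub for @sf_val F L].
HB.instance Definition _ (F : fieldType) (L : divringClosed F) := [Choice of @sfield F L by <:].
HB.instance Definition _ (F : fieldType) (L : divringClosed F) := [SubChoice_isSubIntegralDomain of @sfield F L by <:].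
HB.instance Definition _ (F : fieldType) (L : divringClosed F) := [SubIntegralDomain_isSubField of @sfield F L by <:].

Record sring (R : comNzRingType) (A : subringClosed R) :=
  SRing { sr_val :> R; sr_valP : sr_val \in A }.

HB.instance Definition _ (R : comNzRingType) (A : subringClosed R) := [isSub for @sr_val R A].
HB.instance Definition _ (R : comNzRingType) (A : subringClosed R) := [Choice of @sring R A by <:].
HB.instance Definition _ (R : comNzRingType) (A : subringClosed R) := [SubChoice_isSubComNzRing of @sring R A by <:].

(* [gal F] is Gal(E|F), with its Krull topology *)
Section GaloisGroup.
Variables (E : fieldType) (F : set E).

Definition is_gal (s : bij E) : Prop :=
  [/\ {morph s : x y / (x + y)%R}, {morph s : x y / (x * y)%R} &
      forall x, F x -> s x = x].

Definition gal_pred : {pred bij E} := fun s => `[< is_gal s >].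

Fact gal_closed : group_closed gal_pred.
Proof.
split; first exact/asboolP.
move=> s t /asboolP [sD sM sF] /asboolP [tD tM tF]; apply/asboolP; split.
- move=> x y /=; rewrite -sD; congr (s _); apply: (can_inj (@bij_funK _ t)).
  by rewrite tD !bij_invfunK.
- move=> x y /=; rewrite -sM; congr (s _); apply: (can_inj (@bij_funK _ t)).
  by rewrite tM !bij_invfunK.
- by move=> x Fx /=; rewrite -{1}(tF x Fx) bij_funK sF.
Qed.

Record gal := Gal { gal_bij :> bij E; gal_bijP : gal_bij \in gal_pred }.

HB.instance Definition _ := [isSub for gal_bij].
HB.instance Definition _ := [Choice of gal by <:].
HB.instance Definition _ :=
  SubChoice_isSubGroup.Build (bij E) gal_pred gal gal_closed.

Let gal_act (_ : unit) (s : gal) (x : E) := s x.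
Let gal_act1 i x : gal_act i 1 x = x. Proof. by []. Qed.
Let gal_actM i s t x : gal_act i (s * t) x = gal_act i s (gal_act i t x).
Proof. by []. Qed.

HB.instance Definition _ :=
  Group_isPermTop.Build gal (pt_act := gal_act) gal_act1 gal_actM.

Lemma galP (s : gal) : is_gal s.
Proof. by apply/asboolP; exact: (gal_bijP s). Qed.

Fact gal_zmod (s : gal) : zmod_morphism s.
Proof.
have [sD _ _] := galP s => x y.
by apply: (addIr (s y)); rewrite -sD !subrK.
Qed.

Fact gal_monoid (s : gal) : monoid_morphism s.
Proof.
have [_ sM _] := galP s; split=> //.
have := sM (bij_invfun s 1%R) 1%R.
by rewrite mulr1 bij_invfunK mul1r.
Qed.

HB.instance Definition _ (s : gal) := GRing.isZmodMorphism.Build E E s (gal_zmod s).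
HB.instance Definition _ (s : gal) := GRing.isMonoidMorphism.Build E E s (gal_monoid s).

End GaloisGroup.

Lemma rmorphism_ext (R S : pzSemiRingType) (f g : {rmorphism R -> S}) :
  f =1 g -> f = g.
Proof.
case: f g => [f [[f1] [f2]]] [g [[g1] [g2]]] /= fg.
have {}fg : f = g by apply/funext.
by subst g; rewrite (Prop_irrelevance f1 g1) (Prop_irrelevance f2 g2).
Qed.

(** * The etale fundamental group of an affine scheme *)

Section Etale.
Variables (A B : comNzRingType) (s : {rmorphism A -> B}).

Definition module_finite : Prop :=
  exists n, exists b : 'I_n -> B,
    forall y, exists c : 'I_n -> A, y = (\sum_i s (c i) * b i)%R.

(* infinitesimal lifting along surjections with square-zero kernel *)
Definition formally_etale : Prop :=
  forall (C C' : comNzRingType) (u : {rmorphism A -> C}) (q : {rmorphism C -> C'}),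
    (forall c', exists c, q c = c') ->
    (forall c d, q c = 0%R -> q d = 0%R -> (c * d)%R = 0%R) ->
    forall f : {rmorphism B -> C'}, (forall a, f (s a) = q (u a)) ->
      exists g : {rmorphism B -> C},
        let lifts (h : B -> C) :=
          (forall b, q (h b) = f b) /\ (forall a, h (s a) = u a) in
        lifts g /\ forall h : {rmorphism B -> C}, lifts h -> h =1 g.

End Etale.

(* Finite etale A-algebras.  Every finitely presented A-algebra is isomorphic   *)
(* to some A[X_1, ..., X_n] / I with I finitely generated; restricting to these *)
(* presented algebras gives a small skeleton of the category, so that its fibre *)
(* functors have automorphism groups in the same universe as A.  (The zero      *)
(* algebra is excluded; every fibre functor sends it to the empty set.)         *)
Section FiniteEtaleAlgebras.
Variable A : comNzRingType.

Definition pres_str n (I : idealr (mpoly n A)) (a : A) : {ideal_quot I} :=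
  \pi_{ideal_quot I} (mpolyC n a).

Fact pres_str_zmod n (I : idealr (mpoly n A)) : zmod_morphism (@pres_str n I).
Proof.
move=> a b; rewrite /pres_str mpolyCB.
by apply/eqP; rewrite eq_sym subr_eq -pi_addr subrK.
Qed.

Fact pres_str_monoid n (I : idealr (mpoly n A)) : monoid_morphism (@pres_str n I).
Proof.
split; first by rewrite /pres_str mpolyC1 pi_oner.
by move=> a b; rewrite /pres_str mpolyCM pi_mulr.
Qed.

HB.instance Definition _ n (I : idealr (mpoly n A)) :=
  GRing.isZmodMorphism.Build A {ideal_quot I} (@pres_str n I) (@pres_str_zmod n I).
HB.instance Definition _ n (I : idealr (mpoly n A)) :=
  GRing.isMonoidMorphism.Build A {ideal_quot I} (@pres_str n I) (@pres_str_monoid n I).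

Record fet_alg := FetAlg {
  fet_n : nat;
  fet_ideal : idealr (mpoly fet_n A);
  fet_fg : exists r, exists g : 'I_r -> mpoly fet_n A, forall w,
    w \in fet_ideal <-> exists c : 'I_r -> mpoly fet_n A, w = (\sum_i c i * g i)%R;
  fet_finite : module_finite (@pres_str fet_n fet_ideal);
  fet_etale : formally_etale (@pres_str fet_n fet_ideal)
}.

Definition fet_sort (B : fet_alg) : comNzRingType := {ideal_quot (fet_ideal B)}.
Definition fet_str (B : fet_alg) : {rmorphism A -> fet_sort B} := @pres_str _ (fet_ideal B).

End FiniteEtaleAlgebras.

Coercion fet_sort : fet_alg >-> GRing.ComNzRing.type.

(* [pi1 x] is the etale fundamental group of Spec A with respect to the        *)
(* geometric point x : A -> Om, the automorphism group of the fibre functor.   *)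
Section EtaleFundamentalGroup.
Variables (A : comNzRingType) (Om : closedFieldType) (x : {rmorphism A -> Om}).

Definition fibre (B : fet_alg A) : Type :=
  {f : {rmorphism B -> Om} | forall a, f (fet_str B a) = x a}.

Definition fibre_natural (s : forall B, fibre B -> fibre B) : Prop :=
  forall (B B' : fet_alg A) (h : {rmorphism B -> B'}),
    (forall a, h (fet_str B a) = fet_str B' a) ->
    forall (f : fibre B) (f' : fibre B'), (forall b, sval f b = sval f' (h b)) ->
      forall b, sval (s B f) b = sval (s B' f') (h b).

Record pi1 := Pi1 {
  pi1_fun : forall B, fibre B -> fibre B;
  pi1_inv : forall B, fibre B -> fibre B;
  pi1_funK : forall B, cancel (@pi1_fun B) (@pi1_inv B);
  pi1_invK : forall B, cancel (@pi1_inv B) (@pi1_fun B);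
  pi1_natural : fibre_natural pi1_fun
}.

HB.instance Definition _ := gen_eqMixin pi1.
HB.instance Definition _ := gen_choiceMixin pi1.

Lemma fibreP (B : fet_alg A) (f g : fibre B) : (forall b, sval f b = sval g b) -> f = g.
Proof.
case: f g => [f fx] [g gx] /= fg; have E := rmorphism_ext fg.
by subst g; congr exist; exact: Prop_irrelevance.
Qed.

Lemma pi1P (s t : pi1) : (forall B f, @pi1_fun s B f = @pi1_fun t B f) <-> s = t.
Proof.
split=> [|->//]; case: s t => [s s' sK s'K sN] [t t' tK t'K tN] /= st.
have {}st : s = t.
  by apply: functional_extensionality_dep => B; apply/funext => f.
subst t; have E : s' = t'.
  apply: functional_extensionality_dep => B; apply/funext => f.
  by rewrite -{1}(t'K B f) sK.
by subst t'; congr Pi1; exact: Prop_irrelevance.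
Qed.

Fact pi1_inv_natural (s : pi1) : fibre_natural (pi1_inv s).
Proof.
move=> B B' h hA f f' ff'; set g' := pi1_inv s f'.
have gx a : (sval g' \o h) (fet_str B a) = x a by rewrite /= hA (svalP g').
pose g : fibre B :=
  exist (fun f : {rmorphism B -> Om} => forall a, f (fet_str B a) = x a)
    (sval g' \o h : {rmorphism B -> Om}) gx.
have sg : pi1_fun s g = f.
  apply: fibreP => b; rewrite ff' -[f' in RHS](@pi1_invK s B').
  exact: pi1_natural.
by move=> b; rewrite -sg pi1_funK.
Qed.

Fact pi1_mul_natural (s t : pi1) : fibre_natural (fun B f => pi1_fun s (pi1_fun t f)).
Proof. by move=> B B' h hA f f' ff'; do 2!apply: pi1_natural => //. Qed.

Definition pi1_one : pi1 :=
  @Pi1 (fun B => idfun) (fun B => idfun) (fun B => frefl _) (fun B => frefl _)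
    (fun B B' h _ f f' ff' => ff').
Definition pi1_opp (s : pi1) : pi1 := Pi1 (@pi1_invK s) (@pi1_funK s) (@pi1_inv_natural s).
Definition pi1_mul (s t : pi1) : pi1 :=
  @Pi1 _ (fun B f => pi1_inv t (pi1_inv s f))
    (fun B => can_comp (@pi1_funK s B) (@pi1_funK t B))
    (fun B => can_comp (@pi1_invK t B) (@pi1_invK s B)) (@pi1_mul_natural s t).

Fact pi1_mulA : associative pi1_mul.
Proof. by move=> s t u; apply/pi1P. Qed.
Fact pi1_mul1 : left_id pi1_one pi1_mul.
Proof. by move=> s; apply/pi1P. Qed.
Fact pi1_mulr1 : right_id pi1_one pi1_mul.
Proof. by move=> s; apply/pi1P. Qed.
Fact pi1_mulV : left_inverse pi1_one pi1_opp pi1_mul.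
Proof. by move=> s; apply/pi1P => B f /=; rewrite pi1_funK. Qed.
Fact pi1_mulrV : right_inverse pi1_one pi1_opp pi1_mul.
Proof. by move=> s; apply/pi1P => B f /=; rewrite pi1_invK. Qed.

HB.instance Definition _ := isGroup.Build pi1
  pi1_mulA pi1_mul1 pi1_mulr1 pi1_mulV pi1_mulrV.

Let pi1_act (B : fet_alg A) (s : pi1) (f : fibre B) := pi1_fun s f.
Let pi1_act1 B (f : fibre B) : pi1_act 1 f = f. Proof. by []. Qed.
Let pi1_actM B (s t : pi1) (f : fibre B) :
  pi1_act (s * t) f = pi1_act s (pi1_act t f).
Proof. by []. Qed.

HB.instance Definition _ :=
  Group_isPermTop.Build pi1 (pt_act := pi1_act) pi1_act1 pi1_actM.

(* If the field F contains the image of A, then Gal(Om|F) acts on the fibres    *)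
(* by composition; this is the map induced by Spec F -> Spec A.                *)
Section FromGalois.
Variables (F : set Om) (xF : forall a, F (x a)).

Fact gal_fibreP (s : gal F) (B : fet_alg A) (f : fibre B) a :
  (s \o sval f) (fet_str B a) = x a.
Proof. by have [_ _ sF] := galP s; rewrite /= (svalP f) sF. Qed.

Definition gal_fibre (s : gal F) (B : fet_alg A) (f : fibre B) : fibre B :=
  exist (fun f : {rmorphism B -> Om} => forall a, f (fet_str B a) = x a)
    (s \o sval f : {rmorphism B -> Om}) (gal_fibreP s f).

Fact gal_fibreK (s t : gal F) (B : fet_alg A) : cancel s t ->
  cancel (@gal_fibre s B) (@gal_fibre t B).
Proof. by move=> st f; apply: fibreP => b /=. Qed.

Fact gal_fibre_natural (s : gal F) : fibre_natural (@gal_fibre s).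
Proof. by move=> B B' h hA f f' ff' b /=; rewrite ff'. Qed.

Definition pi1_of_gal (s : gal F) : pi1 :=
  @Pi1 (@gal_fibre s) (@gal_fibre s^-1)
    (fun B => @gal_fibreK s s^-1 B (@bij_funK _ s))
    (fun B => @gal_fibreK s^-1 s B (@bij_invfunK _ s))
    (@gal_fibre_natural s).

End FromGalois.

End EtaleFundamentalGroup.

(** * Regular function fields *)

Definition perfect_field (k0 : fieldType) : Prop :=
  forall p : {poly k0}, irreducible_poly p -> separable_poly p.

Section FunctionFields.
Local Open Scope ring_scope.
Variables (k0 K0 : fieldType) (i : {rmorphism k0 -> K0}).

Definition alg_independent n (x : 'I_n -> K0) : Prop :=
  forall p : mpoly n k0, mmap i x p = 0 -> p = 0.

Definition gen_over n (x : 'I_n -> K0) : divringClosed K0 :=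
  fld_gen (range i `|` range x).

Definition transcendence_base n (x : 'I_n -> K0) : Prop :=
  alg_independent x /\
  forall y, exists p, [/\ p \is a polyOver (gen_over x), p != 0 & root p y].

Definition separating_base n (x : 'I_n -> K0) : Prop :=
  alg_independent x /\
  forall y, exists p, [/\ p \is a polyOver (gen_over x), separable_poly p & root p y].

Definition has_trdeg n : Prop := exists x : 'I_n -> K0, transcendence_base x.

Definition regular_function_field : Prop :=
  [/\ exists n, exists x : 'I_n -> K0, forall y, y \in gen_over x,
      exists n, exists x : 'I_n -> K0, separating_base x &
      forall y, algebraicOver i y -> range i y].

End FunctionFields.

(** * The maximal pro-l extension *)

Section MaximalProl.
Local Open Scope ring_scope.
Variables (l : nat) (Om : fieldType) (K : divringClosed Om).

Definition galois_over (L : divringClosed Om) : Prop :=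
  {subset K <= L} /\ forall x, x \in L -> exists s : seq Om,
    [/\ uniq s, {subset s <= L}, x \in s &
        \prod_(y <- s) ('X - y%:P) \is a polyOver K].

Definition has_degree (L : divringClosed Om) (n : nat) : Prop :=
  exists b : 'I_n -> Om, (forall m, b m \in L) /\
    forall x, x \in L ->
      exists! c : {ffun 'I_n -> Om},
        (forall m, c m \in K) /\ x = \sum_m c m * b m.

(* the compositum in Om of the finite Galois extensions of K of l-power degree *)
Definition max_prol : divringClosed Om :=
  fld_gen [set x | exists L : divringClosed Om,
    [/\ galois_over L, exists n, has_degree L (l ^ n) & x \in L]].

End MaximalProl.

(** * The Galois action *)

(* Everything takes place in an algebraic closure Om of K_0, embedded by j.    *)
Section GaloisAction.
Variables (l : nat) (k0 K0 : fieldType) (i : {rmorphism k0 -> K0}).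
Variables (Om : closedFieldType) (j : {rmorphism K0 -> Om}).

Definition kbar_pred : {pred Om} := fun x => `[< algebraicOver (j \o i) x >].

Fact kbar_closed : GRing.divring_closed kbar_pred.
Proof.
split=> [|x y /asboolP kx /asboolP ky|x y /asboolP kx /asboolP ky]; apply/asboolP.
- exact: algebraic1.
- exact: algebraic_sub.
- exact: algebraic_div.
Qed.

HB.instance Definition _ := GRing.isDivringClosed.Build Om kbar_pred kbar_closed.

Definition kbar : divringClosed Om := kbar_pred.

Definition Kbar : divringClosed Om := fld_gen (range j `|` [set x | x \in kbar]).

Definition Kl : divringClosed Om := max_prol l Kbar.

Definition Gal_k0 : topGroupType := gal [set x : sfield kbar | range (j \o i) (sf_val x)].

Definition GK : topGroupType := gal [set x : sfield Kl | sf_val x \in Kbar].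

Definition GKa : topGroupType := Ga GK l.

(* Spec of [Ua_ring a t] is U_a x k, its coordinate being identified with t,   *)
(* which is transcendental over k when t is non-constant.                      *)
Definition Ua_ring (a : seq k0) (t : K0) : subringClosed Om :=
  ring_gen ([set x | x \in kbar] `|` [set j t; (j t)^-1%R] `|`
            [set x | exists2 b, b \in a & x = (j t - j (i b))^-1%R]).

Definition Ua_point (a : seq k0) (t : K0) : {rmorphism sring (Ua_ring a t) -> Om} :=
  (\val : sring (Ua_ring a t) -> Om).

Lemma Ua_ring_sub a t (x : sring (Ua_ring a t)) : [set y | y \in Kbar] (Ua_point a t x).
Proof.
have jK u : j u \in Kbar by apply/asboolP => E; apply; left; exists u.
case: x => x /= /asboolP; apply=> y [[|]|].
- by move=> ky; apply/asboolP => E; apply; right.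
- by move=> [|] ->; rewrite ?rpredV jK.
- by move=> [b _ ->]; rewrite rpredV rpredB ?jK.
Qed.

Definition pia_Ua (a : seq k0) (t : K0) : topGroupType := Ga (pi1 (Ua_point a t)) l.

Definition GOm : topGroupType := gal [set x : Om | x \in Kbar].

Definition extends (s : GOm) (u : GK) : Prop :=
  forall y : sfield Kl, s (sf_val y) = sf_val (u y).

(* The composite G_K^a -> pi^a(U) -> pi^a(U_a) is induced by the composite     *)
(* Spec K -> U x k -> U_a x k, which does not depend on U.  On the class of u  *)
(* in G_K it is computed through any extension of u to Om; the image does not  *)
(* depend on choices since pi^a(U_a) is a pro-l group.                         *)
Definition pi_t (a : seq k0) (t : K0) (g : GKa) : pia_Ua a t :=
  let lift : GOm := xget 1 [set s | exists2 u, extends s u & to_a l u = g] in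
  to_a l (pi1_of_gal (@Ua_ring_sub a t) lift).

Definition Ht (a : seq k0) (t : K0) : set GKa := [set g | pi_t a t g = 1].

Definition nonconstant (t : K0) : Prop := ~ range i t.

Definition Ht_family (a : seq k0) : set (set GKa) :=
  [set H | exists2 t, nonconstant t & H = Ht a t].

Definition Autca_mod (a : seq k0) : groupType := autc_fix_mod (Ht_family a).

(* phi is the automorphism of G_K^a induced by tau in Gal_k0 = Gal(K|K_0):     *)
(* conjugation by an extension T of tau to K(l) that fixes K_0.                *)
Definition induces (tau : Gal_k0) (phi : GKa -> GKa) : Prop :=
  exists T : gal [set x : sfield Kl | range j (sf_val x)],
    (forall (x : sfield kbar) (y : sfield Kl),
       sf_val y = sf_val x -> sf_val (T y) = sf_val (tau x)) /\
    forall u : GK, exists2 u' : GK,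
      gal_bij u' = gal_bij T * gal_bij u * (gal_bij T)^-1 &
      phi (to_a l u) = to_a l u'.

Definition is_canonical_map (a : seq k0) (rho : Gal_k0 -> Autca_mod a) : Prop :=
  forall tau c, rho tau = c <->
    exists2 phi : autc_fix (Ht_family a),
      induces tau phi & c = qclass (scalars (Ht_family a)) phi.

End GaloisAction.

(* Main.v *)
Require Import Defs.
From HB Require Import structures.
From mathcomp Require Import all_boot all_order all_algebra mxpoly.
From mathcomp Require Import generic_quotient ring_quotient separable cyclic ssrAC.
From mathcomp Require Import all_classical topology.
From mathcomp Require Import freeg.
From mathcomp Require mpoly.

Set Implicit Arguments.
Unset Strict Implicit.
Unset Printing Implicit Defensive.
Import GRing.Theory.
Local Open Scope classical_set_scope.
Local Open Scope ring_scope.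

(* By Kummer theory an automorphism of G_K^a gives a map Psi on K^*/l, and stability of the kernel R turns   *)
(* Steinberg relations z + z' = 1 into relations between Psi(z) and Psi(z').  The kernels H_t determine Psi  *)
(* on K_0^* up to a scalar.  For a constant a, a Bertini argument gives u in K_0 and a place with u - a = 0  *)
(* that has an inertia element and a decomposition group large enough to separate finitely many classes, and *)
(* inertia commutes with decomposition modulo G^(3).  The Steinberg relations (x - c) + (c - y) = x - y at   *)
(* such places force Psi(x - c') = x - c for a permutation c |-> c' of the constants; linear relations make  *)
(* it a field automorphism over k_0, which extends to K over K_0.  After composing with it, Psi is the       *)
(* identity on K, by induction on the length of z as a sum of products of elements of K_0 and k.             *)

(** By Kummer theory the group G_K^a is dual to the group of l-th power classes of K: its continuous
    characters are the [chi z] ([character_kummer], [to_a_eq]), and G^(2) consists of the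
    automorphisms fixing all l-th roots of elements of K ([G2_kummer]). An automorphism phi of G_K^a
    therefore amounts to a map Psi sending z to the character [chi z] composed with phi.
    Surjectivity means that Psi is, up to a scalar, induced by an automorphism of K over K_0 as soon
    as phi lies in Aut^c and preserves every H_t. The kernel R enters through commuting pairs. If s
    and t commute modulo G^(3), their wedge lies in R ([commute_kernel], based on
    [commutator_map_ex]), so their images under phi commute modulo G^(3) too. For z + z' = 1 an
    explicit Heisenberg extension containing l-th roots of z and z' shows that such pairs satisfy
    chi_z(s) chi_z'(t) = chi_z(t) chi_z'(s) ([gamma_G3], [steinberg_commute]), hence so does Psi
    ([autc_steinberg]). Commuting pairs come from places: inertia commutes with decomposition modulo
    G^(3) ([comm_G3]). Consequently, if A + B = C, if s is an inertia element with Psi(A) nonzero at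
    s, and if Psi(B) and Psi(C) are unramified, then Psi(B) and Psi(C) agree on the decomposition
    group ([use_place]). For this to be informative the decomposition group must be large.
    [core_place] provides, for each constant a, an element u of K_0 and a place where u - a
    vanishes, with an inertia element on which the character of u - a is 1, and a decomposition
    group realising every value on finitely many prescribed characters. This is a Bertini theorem:
    Om is algebraic over F(y, t), and a suitable line t = b + e y stays irreducible in a given
    finite Galois cover ([bertini], from [bertini_noether] and [two_pencils]), so that the place
    does not split there ([decomposition]). The groups H_t are common kernels of the characters of t
    - b with b = 0 or b in the tuple ([Ht_char]): Kummer algebras are etale, and etale covers are
    unramified at the remaining points ([notbad_inertia], [etale_kernel]). Invariance of H_t puts
    Psi(t) in the span of these characters; applied to e t for infinitely many e in k_0 it leaves
    only multiples of chi_t ([Psi_line]), with a factor independent of t ([Psi_scalar]). After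
    scaling, Psi is the identity on K_0. For a constant c a norm of u - c lies in K_0, so some
    conjugate c' of c makes Psi(u - c') ramified where u = c, and Steinberg relations give Psi(y -
    c') = chi_(y - c) for all y in K_0 ([point_rel_ex]). Further relations make c |-> c' additive
    and multiplicative ([point_relD], [point_relM]), and it extends to an automorphism over K_0
    ([lift_constants]). Once this is divided out, induction on the number of terms of a sum of
    products u c, with u in K_0 and c constant, shows that Psi is the identity ([known_comb],
    [rigidity]). Injectivity is [scalar_trivial]: an automorphism acting on G_K^a through a power
    map preserves the character of each y - c, and inertia recovers c from these
    ([distinct_points]). *)

Section FieldGraphs.
Variables (E Q : fieldType).
Notation EQ := (E * Q)%type.
Implicit Types (G S : set EQ) (P M : {poly EQ}).

(** The condition on zeros makes the relation single-valued and injective, so that it is the graph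
    of an isomorphism between a subring of E and a subring of Q. *)
Definition ring_graph S : Prop :=
 [/\ S 1, forall x y, S x -> S y -> S (x - y), forall x y, S x -> S y -> S (x * y) &
 forall x, S x -> (x.1 == 0) = (x.2 == 0)].

Definition field_graph G : Prop :=
 ring_graph G /\ forall x, G x -> G (x.1^-1, x.2^-1).

Lemma rg0 S : ring_graph S -> S 0.
by case=> S1 SB _ _; rewrite -(subrr 1); apply: SB. Qed.

Lemma rgN S x : ring_graph S -> S x -> S (- x).
by move=> rS Sx; rewrite -sub0r; have [_ SB _ _] := rS; apply: SB => //; exact: rg0. Qed.

Lemma rgD S x y : ring_graph S -> S x -> S y -> S (x + y).
move=> rS Sx Sy; rewrite -[y]opprK; have [_ SB _ _] := rS.
by apply: SB => //; apply: rgN.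
Qed.

Lemma rg_sum S I (r : seq I) (p : pred I) (F : I -> EQ) :
 ring_graph S -> (forall i, p i -> S (F i)) -> S (\sum_(i <- r | p i) F i).
move=> rS SF; apply: big_ind => //; first exact: rg0.
by move=> x y; apply: rgD.
Qed.

Lemma rgX S x n : ring_graph S -> S x -> S (x ^+ n).
move=> rS Sx; have [S1 _ SM _] := rS.
by elim: n => [|n IH]; rewrite ?expr0 // exprS; apply: SM.
Qed.

Lemma rg_fun S a b b' : ring_graph S -> S (a, b) -> S (a, b') -> b = b'.
move=> [_ SB _ Sz] Sb Sb'; have /= := Sz _ (SB _ _ Sb Sb').
by rewrite subrr eqxx => /esym; rewrite subr_eq0 => /eqP.
Qed.

Lemma rg_inj S a a' b : ring_graph S -> S (a, b) -> S (a', b) -> a = a'.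
move=> [_ SB _ Sz] Sb Sb'; have /= := Sz _ (SB _ _ Sb Sb').
by rewrite subrr eqxx subr_eq0 => /eqP.
Qed.

Definition frac_graph S : set EQ :=
 [set z | exists x y, [/\ S x, S y, y.1 != 0 & z = (x.1 / y.1, x.2 / y.2)]].

Lemma sub_frac S : ring_graph S -> S `<=` frac_graph S.
move=> rS [a b] Sx; have [S1 _ _ _] := rS; exists (a, b), 1.
by split; rewrite //= ?oner_eq0 // !divr1.
Qed.

Lemma frac_field_graph S : ring_graph S -> field_graph (frac_graph S).
move=> rS; have [S1 SB SM Sz] := rS; split; first split.
- exact: sub_frac.
- move=> _ _ [x [y [Sx Sy y0 ->]]] [x' [y' [Sx' Sy' y0' ->]]].
 have y2 : y.2 != 0 by rewrite -Sz.
 have y2' : y'.2 != 0 by rewrite -Sz.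
 exists (x * y' - x' * y), (y * y'); split; [by apply: SB; apply: SM|exact: SM| |].
 by rewrite /= mulf_neq0.
 by congr pair => /=; rewrite -mulNr addf_div // mulNr.
- move=> _ _ [x [y [Sx Sy y0 ->]]] [x' [y' [Sx' Sy' y0' ->]]].
 exists (x * x'), (y * y'); split; [exact: SM|exact: SM|by rewrite /= mulf_neq0|].
 by congr pair => /=; rewrite mulf_div.
- move=> _ [x [y [Sx Sy y0 ->]]] /=.
 by rewrite !mulf_eq0 !invr_eq0 (negbTE y0) -(Sz _ Sy) (negbTE y0) !orbF Sz.
- move=> _ [x [y [Sx Sy y0 ->]]] /=; have [x0|x0] := eqVneq x.1 0.
 have := Sz _ Sx; rewrite x0 eqxx => /esym/eqP ->.
 by rewrite !mul0r !invr0; apply: sub_frac => //; exact: (rg0 rS).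
 by exists y, x; split=> //; rewrite !invf_div.
Qed.

Definition coefs_in G P := forall n, G P`_n.

Lemma overC G c : ring_graph G -> G c -> coefs_in G c%:P.
by move=> rG Gc n; rewrite coefC; case: ifP => // _; exact: rg0. Qed.

Lemma overX G : ring_graph G -> coefs_in G 'X.
by move=> rG n; rewrite coefX; have [G1 _ _ _] := rG; case: (n == 1)%N => //; exact: rg0. Qed.

Lemma overB G P P' : ring_graph G -> coefs_in G P -> coefs_in G P' -> coefs_in G (P - P').
by move=> [_ GB _ _] oP oP' n; rewrite coefB; apply: GB. Qed.

Lemma overM G P P' : ring_graph G -> coefs_in G P -> coefs_in G P' -> coefs_in G (P * P').
move=> rG oP oP' n; have [_ _ GM _] := rG; rewrite coefM.
by apply: rg_sum => // k _; apply: GM.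
Qed.

(** The product ring E * Q is not a domain; over a field graph a nonzero leading coefficient is
    nevertheless invertible in both components, which is what makes Euclidean division work. *)
Lemma over_nz G (P : {poly EQ}) : field_graph G -> coefs_in G P -> P != 0 ->
 (lead_coef P).1 != 0 /\ (lead_coef P).2 != 0.
move=> [[_ _ _ Gz] _] oP P0; rewrite -Gz ?lead_coefE //.
suff : (P`_(size P).-1).1 != 0 by [].
have : P`_(size P).-1 != 0 by rewrite -lead_coefE lead_coef_eq0.
apply: contraNneq => c1; have := Gz _ (oP (size P).-1); rewrite c1 eqxx => /esym/eqP c2.
by rewrite [_`__]surjective_pairing c1 c2.
Qed.

Lemma over_monic G P : field_graph G -> coefs_in G P -> P != 0 ->
 exists c : EQ, [/\ G c, c.1 != 0 & c%:P * P \is monic].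
move=> fG oP P0; have [c1 c2] := over_nz fG oP P0; have [rG GV] := fG.
exists ((lead_coef P).1^-1, (lead_coef P).2^-1); split=> /=.
- by apply: GV; rewrite lead_coefE.
- by rewrite invr_eq0.
rewrite monicE mul_polyC lead_coefE.
have e : ((lead_coef P).1^-1, (lead_coef P).2^-1) * lead_coef P = 1 :> EQ by rewrite [lead_coef P in X in _ * X]surjective_pairing; congr pair; rewrite /= mulVf.
have sz : size (((lead_coef P).1^-1, (lead_coef P).2^-1) *: P) = size P.
 apply/eqP; rewrite eqn_leq size_scale_leq /=.
 rewrite polySpred // ltnNge; apply/negP => /leq_sizeP /(_ _ (leqnn _)) /eqP.
 by rewrite coefZ -lead_coefE e oner_eq0.
by rewrite sz coefZ -lead_coefE e.
Qed.

Lemma over_divp G P M : field_graph G -> coefs_in G P -> coefs_in G M -> M \is monic ->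
 exists D R, [/\ coefs_in G D, coefs_in G R, P = D * M + R & (size R < size M)%N].
move=> fG + oM mM; have [rG _] := fG.
have [n] := ubnP (size P); elim: n P => // n IH P /ltnSE szP oP.
have [lt|le] := ltnP (size P) (size M).
 exists 0, P; split=> //; last by rewrite mul0r add0r.
 by move=> k; rewrite coef0; exact: rg0.
pose D0 := lead_coef P *: 'X^(size P - size M).
have oD0 : coefs_in G D0.
 move=> k; rewrite coefZ coefXn; have [_ _ GM _] := rG; apply: GM.
 by rewrite lead_coefE.
 by have [G1 _ _ _] := rG; case: eqP => _ //; exact: rg0.
have M0 : (0 < size M)%N by rewrite size_poly_gt0 monic_neq0.
have szD : (size (P - D0 * M)%R < size P)%N.
 have P0 : (0 < size P)%N := leq_trans M0 le.
 rewrite -(prednK P0) ltnS; apply/leq_sizeP => k; rewrite leq_eqVlt => /predU1P [<-|lt].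
 rewrite coefB -lead_coefE /D0 -scalerAl coefZ coefXnM.
 have -> : ((size P).-1 < size P - size M)%N = false by apply/negbTE; rewrite -leqNgt -ltnS (prednK P0) ltn_subrL M0 P0.
 have -> : ((size P).-1 - (size P - size M) = (size M).-1)%N by rewrite -!subn1 subnAC subKn.
 by rewrite -lead_coefE (monicP mM) mulr1 subrr.
 rewrite coefB nth_default; last by rewrite (leq_trans _ lt) // (prednK P0).
 rewrite /D0 -scalerAl coefZ coefXnM; case: ifP => _; first by rewrite mulr0 subrr.
 rewrite [M`__]nth_default ?mulr0 ?subrr //.
 by rewrite leq_subRL ?leq_subr // ?subnK // (leq_trans _ lt) ?(prednK P0) // leq_subLR leq_addl.
have [|D [R [oD oR e szR]]] := IH _ (leq_trans szD szP).
 by apply: overB => //; apply: overM.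
exists (D0 + D), R; split=> //; first by move=> k; rewrite coefD; apply: rgD.
by rewrite mulrDl -addrA -e addrC subrK.
Qed.
End FieldGraphs.

(** * Adjoining a pair of elements to a graph *)

Section Adjoin.
Variables (E Q : fieldType).
Notation EQ := (E * Q)%type.
Implicit Types (G S : set EQ) (P M : {poly EQ}).

Definition eval_graph G (z : EQ) : set EQ := [set w | exists2 P, coefs_in G P & w = P.[z]].
Definition adjoin G z := frac_graph (eval_graph G z).

Lemma horner1 P z : P.[z].1 = (map_poly fst P).[z.1].
by rewrite -horner_map. Qed.

Lemma horner2 P z : P.[z].2 = (map_poly snd P).[z.2].
by rewrite -horner_map. Qed.

Lemma eval_ring_graph G z : ring_graph G ->
 (forall P, coefs_in G P -> (P.[z].1 == 0) = (P.[z].2 == 0)) -> ring_graph (eval_graph G z).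
move=> rG Hz; have [G1 _ _ _] := rG; split.
- by exists 1; rewrite ?hornerC // -[1]/(1%:P); exact: overC.
- by move=> _ _ [P oP ->] [P' oP' ->]; exists (P - P'); rewrite ?hornerD ?hornerN //; exact: overB.
- by move=> _ _ [P oP ->] [P' oP' ->]; exists (P * P'); rewrite ?hornerM //; exact: overM.
- by move=> _ [P oP ->]; exact: Hz.
Qed.

Lemma adjoin_sub G z : field_graph G ->
 (forall P, coefs_in G P -> (P.[z].1 == 0) = (P.[z].2 == 0)) ->
 [/\ field_graph (adjoin G z), G `<=` adjoin G z & adjoin G z z].
move=> [rG GV] Hz; have rS := eval_ring_graph rG Hz; split.
- exact: frac_field_graph.
- move=> x Gx; apply: sub_frac => //; exists x%:P; rewrite ?hornerC //; exact: overC.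
- by apply: sub_frac => //; exists 'X; rewrite ?hornerX //; exact: overX.
Qed.

Lemma size_CM (c : EQ) P : (size (c%:P * P)%R <= size P)%N.
by rewrite mul_polyC size_scale_leq. Qed.

Section Algebraic.
Variables (G : set EQ) (M : {poly EQ}) (z : EQ).
Hypotheses (fG : field_graph G) (oM : coefs_in G M) (mM : M \is monic) (Mz : M.[z] = 0).
Hypothesis Mmin : forall P, coefs_in G P -> P != 0 -> (size P < size M)%N -> P.[z].1 != 0.

(** Euclid's algorithm against [M]: with [M = D * P1 + R], a nonzero remainder is inverted by
    induction; a zero remainder contradicts the minimality of [M] unless [P1] is constant. *)
Lemma alg_inv P : coefs_in G P -> P != 0 -> (size P < size M)%N ->
 exists2 P', coefs_in G P' & (P * P').[z] = 1.
have [rG _] := fG.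
have [n] := ubnP (size P); elim: n P => // n IH P /ltnSE szP oP P0 ltP.
have [c [Gc c0 mP1]] := over_monic fG oP P0; set P1 := c%:P * P in mP1.
have oP1 : coefs_in G P1 by apply: overM => //; exact: overC.
have szP1 : (size P1 <= size P)%N := size_CM c P.
have [D [R [oD oR e szR]]] := over_divp fG oM oP1 mP1.
have ez : D.[z] * P1.[z] = - R.[z] by have := Mz; rewrite e hornerD hornerM => /eqP; rewrite addr_eq0 => /eqP.
have [R0|R0] := eqVneq R 0; last first.
 have ltRP : (size R < size P)%N := leq_trans szR szP1.
 have [R' oR' RR'] := IH R (leq_trans ltRP szP) oR R0 (ltn_trans ltRP ltP).
 exists (c%:P * D * - R').
 apply: overM => //; first by apply: overM => //; exact: overC.
 by move=> k; rewrite coefN; apply: rgN.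
 have e1 : (R * R').[z] = - (D.[z] * P1.[z]) * R'.[z] by rewrite hornerM ez opprK.
 rewrite -RR' e1 /P1 !hornerM hornerN hornerC !mulrN !mulNr !mulrA; congr (- (_ * _)).
 by rewrite mulrC -!mulrA; congr (_ * _); rewrite mulrC.
have [sz1|sz1] := leqP (size P1) 1.
 exists c%:P; first exact: overC.
 rewrite mulrC -/P1 (size1_polyC sz1) hornerC.
 have := mP1; rewrite monicE lead_coefE -subn1.
 by have := size_poly_eq0 P1; rewrite (negbTE (monic_neq0 mP1)); case: (size P1) sz1 => [|[|]] //= _ _ /eqP.
have D0 : D != 0 by apply: contraNneq (monic_neq0 mM) => D0; rewrite e D0 R0 mul0r addr0.
have szD : (size D < size M)%N.
 rewrite e R0 addr0 size_Mmonic // -subn1 -addnBA ?(ltnW sz1) //.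
 by rewrite -[X in (X < _)%N]addn0 ltn_add2l subn_gt0.
have := Mmin oD D0 szD; have := Mmin oP1 (monic_neq0 mP1) (leq_ltn_trans szP1 ltP).
move=> h1 h2; have := congr1 fst ez; rewrite R0 horner0 oppr0 /= => /eqP.
by rewrite mulf_eq0 (negbTE h1) (negbTE h2).
Qed.

Lemma alg_eval P : coefs_in G P -> (P.[z].1 == 0) = (P.[z].2 == 0).
move=> oP; have [D [R [oD oR -> szR]]] := over_divp fG oP oM mM.
rewrite hornerD hornerM Mz mulr0 add0r; have [->|R0] := eqVneq R 0.
 by rewrite horner0 /= !eqxx.
have [R' oR'] := alg_inv oR R0 szR; rewrite hornerM => e.
have [e1 e2] := (congr1 fst e, congr1 snd e); rewrite /= in e1 e2.
apply/idP/idP => /eqP h; exfalso.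
 by move/eqP: e1; rewrite h mul0r eq_sym oner_eq0.
by move/eqP: e2; rewrite h mul0r eq_sym oner_eq0.
Qed.
End Algebraic.

Definition gdom G : set E := [set a | exists b, G (a, b)].
Definition gcod G : set Q := [set b | exists a, G (a, b)].
End Adjoin.

Definition alg_over (E : fieldType) (F : set E) (a : E) : Prop :=
 exists p : {poly E}, [/\ forall n, F p`_n, p != 0 & root p a].

(** * Algebraic and transcendental extension steps; maximal graphs *)

Section AlgGraph.
Variables (E Q : fieldType).
Notation EQ := (E * Q)%type.
Implicit Types (G S : set EQ) (P M : {poly EQ}).

Lemma lift_poly1 G (p : {poly E}) : ring_graph G -> (forall n, gdom G p`_n) ->
 exists P, coefs_in G P /\ map_poly fst P = p.
move=> rG /choice [g Gg].
exists (\poly_(n < size p) (p`_n, g n)); split=> [n|].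
 by rewrite coef_poly; case: ifP => _ //; exact: rg0.
apply/polyP => n; rewrite coef_map coef_poly; case: ltnP => //= h.
by rewrite nth_default.
Qed.

Lemma over_eq0 G P : ring_graph G -> coefs_in G P ->
 (map_poly fst P == 0) = (P == 0) /\ (map_poly snd P == 0) = (P == 0).
move=> [_ _ _ Gz] oP; have key n : (P`_n == 0) = ((P`_n).1 == 0).
 apply/eqP/eqP => [->//|h1]; have := Gz _ (oP n); rewrite h1 eqxx => /esym/eqP h2.
 by rewrite [_`__]surjective_pairing h1 h2.
split; apply/eqP/eqP => [/polyP h|->]; rewrite ?map_poly0 //; apply/polyP => n.
 by have := h n; rewrite coef_map !coef0 /= => /eqP; rewrite -key => /eqP.
by have := h n; rewrite coef_map !coef0 /= => /eqP; rewrite -Gz // -key => /eqP.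
Qed.

Lemma alg_min G a : field_graph G -> alg_over (gdom G) a ->
 exists M, [/\ coefs_in G M, M \is monic, root (map_poly fst M) a &
 forall P, coefs_in G P -> P != 0 -> root (map_poly fst P) a -> (size M <= size P)%N].
move=> fG [p [pG p0 pa]]; have [rG _] := fG; have [P0 [oP0 e0]] := lift_poly1 rG pG.
pose good n := `[< exists P, [/\ coefs_in G P, P != 0, root (map_poly fst P) a & size P = n] >].
have exg : exists n, good n.
 exists (size P0); apply/asboolP; exists P0; split; rewrite ?e0 //.
 by have [<- _] := over_eq0 rG oP0; rewrite e0.
case: (ex_minnP exg) => n /asboolP [P [oP Pn0 Pa szP]] minn.
have [c [Gc c0 mM]] := over_monic fG oP Pn0; exists (c%:P * P); split=> //.
- by apply: overM => //; exact: overC.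
- by rewrite rmorphM rootM Pa orbT.
move=> P' oP' P'0 P'a; apply: leq_trans (size_CM c P) _; rewrite szP; apply: minn.
by apply/asboolP; exists P'.
Qed.

(** [M] carries the minimal polynomial of a in its first component and the transported polynomial in
    the second; a may be sent to any root of the latter. *)
Lemma adjoin_alg G a b M : field_graph G -> coefs_in G M -> M \is monic ->
 root (map_poly fst M) a ->
 (forall P, coefs_in G P -> P != 0 -> root (map_poly fst P) a -> (size M <= size P)%N) ->
 root (map_poly snd M) b ->
 [/\ field_graph (adjoin G (a, b)), G `<=` adjoin G (a, b) & adjoin G (a, b) (a, b)].
move=> fG oM mM Ma Mmin Mb; apply: adjoin_sub => // P oP.
apply: (@alg_eval _ _ G M) => //.
 by rewrite [_.[_]]surjective_pairing horner1 horner2 (rootP Ma) (rootP Mb).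
move=> P' oP' P'0 lt; rewrite horner1; apply: contraTN lt => h.
by rewrite -leqNgt; apply: Mmin.
Qed.

Lemma adjoin_transc G a b : field_graph G -> ~ alg_over (gdom G) a -> ~ alg_over (gcod G) b ->
 [/\ field_graph (adjoin G (a, b)), G `<=` adjoin G (a, b) & adjoin G (a, b) (a, b)].
move=> fG na nb; have [rG _] := fG; apply: adjoin_sub => // P oP.
have [->|P0] := eqVneq P 0; first by rewrite horner0 !eqxx.
have [h1 h2] := over_eq0 rG oP; rewrite horner1 horner2 /=.
have -> : ((map_poly fst P).[a] == 0) = false.
 apply/negP => h; apply: na; exists (map_poly fst P); split=> //; last by rewrite h1.
 by move=> n; rewrite coef_map; exists (P`_n).2; rewrite -surjective_pairing.
apply/esym/negP => h; apply: nb; exists (map_poly snd P); split=> //; last by rewrite h2.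
by move=> n; rewrite coef_map; exists (P`_n).1; rewrite -surjective_pairing.
Qed.

(** Zorn's lemma for field graphs subject to a pointwise condition [Psi], which may depend on the
    graph monotonically, such as algebraicity over its fixed field or compatibility with places. *)
Lemma graph_zorn (Psi : set EQ -> EQ -> Prop) G0 :
 (forall G G' z, G `<=` G' -> Psi G z -> Psi G' z) ->
 field_graph G0 -> (forall z, G0 z -> Psi G0 z) ->
 exists G, [/\ field_graph G, G0 `<=` G, forall z, G z -> Psi G z &
 forall G', field_graph G' -> G `<=` G' -> (forall z, G' z -> Psi G' z) -> G' = G].
move=> Pmono f0 P0.
pose PP (X : set EQ) := field_graph (X `|` G0) /\ forall z, (X `|` G0) z -> Psi (X `|` G0) z.
have [F FP Ftot|A [[fA PA] Amax]] := @Zorn_bigcup EQ PP; last first.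
 exists (A `|` G0); split=> //.
 move=> G' f' sub P'.
 apply/seteqP; split=> //; apply: contrapT => nsub.
 have G0G' : G0 `<=` G' by move=> z Gz; apply: sub; right.
 have e : G' `|` G0 = G' by apply/setUidl.
 apply: (Amax G'); last by rewrite /PP e.
 split=> [z Az|G'A]; first by apply: sub; left.
 by apply: nsub => z /G'A Az; left.
pose F' X := F X \/ X = set0.
have F'P X : F' X -> PP X by move=> [/FP//|->]; rewrite /PP set0U.
set U := \bigcup_(X in F) X.
have sub X : F' X -> X `|` G0 `<=` U `|` G0 by move=> [FX|->] z [Xz|G0z]; [left; exists X|right| |right].
have two z z' : (U `|` G0) z -> (U `|` G0) z' ->
 exists X, [/\ F' X, (X `|` G0) z & (X `|` G0) z'].
 move=> [[X FX Xz]|Gz] [[X' FX' Xz']|Gz'].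
 - have [XX'|X'X] := Ftot _ _ FX FX'.
 by exists X'; split; [left|left; apply: XX'|left].
 by exists X; split; [left|left|left; apply: X'X].
 - by exists X; split; [left|left|right].
 - by exists X'; split; [left|right|left].
 - by exists set0; split; [right|right|right].
have one z : (U `|` G0) z -> exists2 X, F' X & (X `|` G0) z by move=> Uz; have [X [FX Xz _]] := two _ _ Uz Uz; exists X.
split; first split; first split.
- by right; have [[]] := f0.
- move=> x y Ux Uy; have [X [FX Xx Xy]] := two _ _ Ux Uy; apply: (sub X FX).
 by have [[[_ XB _ _] _] _] := F'P X FX; exact: XB.
- move=> x y Ux Uy; have [X [FX Xx Xy]] := two _ _ Ux Uy; apply: (sub X FX).
 by have [[[_ _ XM _] _] _] := F'P X FX; exact: XM.
- by move=> x /one [X FX Xx]; have [[[_ _ _ Xz] _] _] := F'P X FX; exact: Xz.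
- move=> x /one [X FX Xx]; apply: (sub X FX).
 by have [[_ XV] _] := F'P X FX; exact: XV.
move=> z /one [X FX Xz]; apply: Pmono (sub X FX) _.
by have [_ XP] := F'P X FX; apply: XP.
Qed.
End AlgGraph.

(** * Subfields as sets, and algebraic elements over them *)

Section Subfields.
Variable E : fieldType.
Implicit Types F : set E.

Definition subfield F : Prop :=
 [/\ F 1, forall x y, F x -> F y -> F (x - y) & forall x y, F x -> F y -> F (x / y)].

Definition set_pred F : {pred E} := fun x => `[< F x >].

Lemma subfield_divring F : subfield F -> GRing.divring_closed (set_pred F).
move=> [F1 FB FD]; split; first exact/asboolP.
 by move=> x y /asboolP Fx /asboolP Fy; apply/asboolP; exact: FB.
by move=> x y /asboolP Fx /asboolP Fy; apply/asboolP; exact: FD.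
Qed.

Definition fld F (hF : subfield F) : divringClosed E :=
 HB.pack (set_pred F) (GRing.isDivringClosed.Build E (set_pred F) (subfield_divring hF)).

Lemma fldP F (hF : subfield F) x : (x \in fld hF) <-> F x.
by split=> [/asboolP|h]; [|exact/asboolP]. Qed.

Lemma div_subfield (L : divringClosed E) : subfield [set x | x \in L].
by split=> [|x y|x y] /=; [exact: rpred1|exact: rpredB|exact: rpred_div]. Qed.

Section Closure.
Variables (F : set E) (hF : subfield F).

Lemma sub1 : F 1. by case: hF. Qed.
Lemma subB x y : F x -> F y -> F (x - y). by case: hF => _ h _; exact: h. Qed.
Lemma sub_div x y : F x -> F y -> F (x / y). by case: hF => _ _; apply. Qed.
Lemma sub0 : F 0. by rewrite -(subrr 1); apply: subB; exact: sub1. Qed.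
Lemma subN x : F x -> F (- x). by rewrite -sub0r; apply: subB; exact: sub0. Qed.
Lemma subD x y : F x -> F y -> F (x + y).
by move=> Fx Fy; rewrite -[y]opprK; apply: subB => //; exact: subN. Qed.
Lemma subV x : F x -> F x^-1. by rewrite -div1r; apply: sub_div; exact: sub1. Qed.
Lemma subM x y : F x -> F y -> F (x * y).
by move=> Fx Fy; rewrite -[y]invrK; apply: sub_div => //; exact: subV. Qed.
Lemma subX x n : F x -> F (x ^+ n).
by move=> Fx; elim: n => [|n IH]; rewrite ?expr0 ?exprS; [exact: sub1|exact: subM]. Qed.
Lemma sub_sum I (r : seq I) (p : pred I) (f : I -> E) :
 (forall i, p i -> F (f i)) -> F (\sum_(i <- r | p i) f i).
by move=> Ff; apply: big_ind => //; [exact: sub0|exact: subD]. Qed.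
Lemma sub_prod I (r : seq I) (p : pred I) (f : I -> E) :
 (forall i, p i -> F (f i)) -> F (\prod_(i <- r | p i) f i).
by move=> Ff; apply: big_ind => //; [exact: sub1|exact: subM]. Qed.
Lemma sub_horner (p : {poly E}) x : (forall n, F p`_n) -> F x -> F p.[x].
by move=> Fp Fx; rewrite horner_coef; apply: sub_sum => i _; apply/subM/subX. Qed.
Lemma sub_nat n : F n%:R.
by elim: n => [|n IH]; rewrite ?mulr0n ?mulrSr; [exact: sub0|apply: subD => //; exact: sub1]. Qed.

Lemma alg_overP a : alg_over F a <-> algebraicOver (\val : sfield (fld hF) -> E) a.
split=> [[p [pF p0 pa]]|[p p0 pa]].
 have cF n : p`_n \in fld hF by apply/fldP.
 pose q : {poly sfield (fld hF)} := \poly_(n < size p) SField (cF n).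
 have e : map_poly (\val : sfield (fld hF) -> E) q = p.
 apply/polyP => n; rewrite coef_map coef_poly; case: ltnP => //= h.
 by rewrite nth_default.
 by exists q; rewrite ?e //; apply: contraNneq p0 => q0; rewrite -e q0 map_poly0.
exists (map_poly (\val : sfield (fld hF) -> E) p); split=> //.
 by move=> n; rewrite coef_map; apply/(fldP hF)/(valP (p`_n)).
by rewrite map_poly_eq0.
Qed.

Lemma alg_id a : F a -> alg_over F a.
move=> Fa; exists ('X - a%:P); split; rewrite ?polyXsubC_eq0 ?root_XsubC //.
by move=> n; rewrite coefB coefX coefC; apply: subB; [exact: sub_nat|case: eqP => _ //; exact: sub0].
Qed.

Lemma alg_subfield : subfield (alg_over F).
split=> [|x y /alg_overP hx /alg_overP hy|x y /alg_overP hx /alg_overP hy].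
- by apply: alg_id; exact: sub1.
- by apply/alg_overP; exact: algebraic_sub.
- by apply/alg_overP; exact: algebraic_div.
Qed.

Lemma alg_trans (F' : set E) a : (forall x, F' x -> alg_over F x) ->
 alg_over F' a -> alg_over F a.
move=> F'F [p [pF' p0 pa]]; apply/alg_overP/integral_algebraic.
apply: (@integral_root _ _ _ p) => // c /(nthP 0) [n _ <-].
by apply/integral_algebraic/alg_overP/F'F.
Qed.
End Closure.

Lemma alg_mono F F' a : F `<=` F' -> alg_over F a -> alg_over F' a.
by move=> FF' [p [pF p0 pa]]; exists p; split=> // n; apply: FF'. Qed.
End Subfields.

Section GraphSubfields.
Variables (E Q : fieldType).
Implicit Types G : set (E * Q).

Lemma fgM G x y : field_graph G -> G x -> G y -> G (x * y).
by case=> [[_ _ h _] _]; exact: h. Qed.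
Lemma fgB G x y : field_graph G -> G x -> G y -> G (x - y).
by case=> [[_ h _ _] _]; exact: h. Qed.
Lemma fg1 G : field_graph G -> G 1.
by case=> [[h _ _ _] _]. Qed.
Lemma fg_div G x y : field_graph G -> G x -> G y -> G (x.1 / y.1, x.2 / y.2).
by move=> fG Gx Gy; have [_ GV] := fG; have := fgM fG Gx (GV _ Gy). Qed.

Lemma dom_subfield G : field_graph G -> subfield (gdom G).
move=> fG; split; first by exists 1; exact: (fg1 fG).
 by move=> x y [x' Gx] [y' Gy]; exists (x' - y'); exact: (fgB fG Gx Gy).
by move=> x y [x' Gx] [y' Gy]; exists (x' / y'); exact: (fg_div fG Gx Gy).
Qed.

Lemma adjoin_in1 G z (A : set E) w : subfield A -> gdom G `<=` A -> A z.1 ->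
 adjoin G z w -> A w.1.
move=> hA GA Az [_ [_ [[P oP ->] [P' oP' ->] _ ->]]] /=; rewrite !horner1.
by apply: (sub_div hA); apply: (sub_horner hA) => // n; rewrite coef_map; apply: GA;
 [exists (P`_n).2|exists (P'`_n).2]; rewrite -surjective_pairing.
Qed.

Lemma adjoin_in2 G z (A : set Q) w : subfield A -> gcod G `<=` A -> A z.2 ->
 adjoin G z w -> A w.2.
move=> hA GA Az [_ [_ [[P oP ->] [P' oP' ->] _ ->]]] /=; rewrite !horner2.
by apply: (sub_div hA); apply: (sub_horner hA) => // n; rewrite coef_map; apply: GA;
 [exists (P`_n).1|exists (P'`_n).1]; rewrite -surjective_pairing.
Qed.

(* One step of extension per element of D suffices. *)
End GraphSubfields.

Lemma frac_subfield (E : fieldType) (R : set E) : R 1 -> (forall x y, R x -> R y -> R (x - y)) ->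
 (forall x y, R x -> R y -> R (x * y)) -> subfield [set z | exists u v, [/\ R u, R v & z = u / v]].
move=> R1 RB RM; have R0 : R 0 by rewrite -(subrr 1); exact: RB.
split; first by exists 1, 1; rewrite divr1.
 move=> _ _ [u [v [Ru Rv ->]]] [u' [v' [Ru' Rv' ->]]].
 have [->|v0] := eqVneq v 0.
 exists (0 - u'), v'; split; [exact: RB|by []|].
 by rewrite invr0 mulr0 !sub0r mulNr.
 have [->|v'0] := eqVneq v' 0.
 by exists u, v; rewrite invr0 mulr0 subr0.
 exists (u * v' - u' * v), (v * v'); split; [by apply: RB; exact: RM|exact: RM|].
 by rewrite -mulNr addf_div // mulNr.
move=> _ _ [u [v [Ru Rv ->]]] [u' [v' [Ru' Rv' ->]]].
exists (u * v'), (v * u'); split; [exact: RM|exact: RM|].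
by rewrite invf_div mulf_div.
Qed.

Lemma range_subfield (E E' : fieldType) (f : {rmorphism E -> E'}) : subfield (range f).
split; first by exists 1; rewrite ?rmorph1.
 by move=> _ _ [a _ <-] [b _ <-]; exists (a - b); rewrite ?rmorphB.
by move=> _ _ [a _ <-] [b _ <-]; exists (a / b); rewrite ?fmorph_div.
Qed.

Lemma map_monic_size (R S : nzRingType) (f : {rmorphism R -> S}) (p : {poly R}) :
 p \is monic -> size (map_poly f p) = size p.
by move=> /monicP mp; apply: size_poly_eq; rewrite -lead_coefE mp rmorph1 oner_neq0. Qed.

(** * Extending partial isomorphisms to automorphisms of an algebraically closed field *)

Section Automorphisms.
Variable Om : closedFieldType.
Implicit Types (F : set Om) (G : set (Om * Om)).

Definition diag G : set Om := [set a | G (a, a)].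

Lemma diag_subfield G : field_graph G -> subfield (diag G).
move=> fG; split; first exact: (fg1 fG).
 by move=> x y Gx Gy; exact: (fgB fG Gx Gy).
by move=> x y Gx Gy; exact: (fg_div fG Gx Gy).
Qed.

Lemma gal_of_graph G : field_graph G -> (forall a, gdom G a) -> (forall b, gcod G b) ->
 exists s : gal (diag G), forall a b, G (a, b) -> s a = b.
move=> fG /choice [f Gf] /choice [g Gg]; have [rG _] := fG.
have fE a b : G (a, b) -> f a = b by move=> Gab; exact: rg_fun rG (Gf a) Gab.
have gE a b : G (a, b) -> g b = a by move=> Gab; exact: rg_inj rG (Gg b) Gab.
have fK : cancel f g by move=> a; apply: gE; exact: Gf.
have gK : cancel g f by move=> a; apply: fE; exact: Gg.
have sP : Defs.Bij fK gK \in gal_pred (diag G).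
 apply/asboolP; split=> [x y|x y|x Gx] /=; apply: fE => //.
 by rewrite -[(_, _)]/((x, f x) + (y, f y)); apply: rgD.
 by rewrite -[(_, _)]/((x, f x) * (y, f y)); apply: fgM.
by exists (Gal sP) => a b /fE.
Qed.

Lemma closed_root_ex (p : {poly Om}) : (1 < size p)%N -> exists x, root p x.
by move=> sp; apply/closed_rootP; rewrite neq_ltn sp orbT. Qed.

Lemma graph_horner G (p : {poly Om}) x y : field_graph G -> (forall n, diag G p`_n) ->
 G (x, y) -> G (p.[x], p.[y]).
move=> fG pG Gxy; have [rG _] := fG; rewrite !horner_coef.
have -> : (\sum_(i < size p) p`_i * x ^+ i, \sum_(i < size p) p`_i * y ^+ i) =
 \sum_(i < size p) (p`_i, p`_i) * (x, y) ^+ i :> Om * Om.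
 have eX n : (x, y) ^+ n = (x ^+ n, y ^+ n) :> Om * Om by elim: n => // n IH; rewrite !exprS IH.
 rewrite [RHS]surjective_pairing !raddf_sum /=.
 by congr pair; apply: eq_bigr => i _; rewrite eX.
by apply: rg_sum => // i _; apply: fgM => //; [exact: pG|exact: rgX].
Qed.

Lemma perm_roots (p : {poly Om}) (f : Om -> Om) : p != 0 -> injective f ->
 (forall x, root p x -> root p (f x)) -> forall y, root p y -> exists2 x, root p x & f x = y.
move=> p0 finj fp y py; have [r Dp] := closed_field_poly_normal p.
have rP x : root p x = (x \in undup r) by rewrite mem_undup Dp rootZ ?lead_coef_eq0 // root_prod_XsubC.
have sub : {subset map f (undup r) <= undup r} by move=> _ /mapP [x xr ->]; rewrite -rP; apply: fp; rewrite rP.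
have um : uniq (map f (undup r)) by rewrite map_inj_uniq // undup_uniq.
have [|_ e] := uniq_min_size um sub; first by rewrite size_map.
have : y \in undup r by rewrite -rP.
by rewrite -e => /mapP [x xr ->]; exists x; rewrite ?rP.
Qed.

(** An everywhere defined graph maps the finitely many roots of a polynomial over its fixed field
    injectively to themselves, hence onto. *)
Lemma alg_graph_total G : field_graph G -> (forall a, alg_over (diag G) a) ->
 (forall a, gdom G a) -> forall b, gcod G b.
move=> fG Galg /choice [f Gf] b; have [rG _] := fG.
have [p [pG p0 pb]] := Galg b.
have finj : injective f by move=> x y e; apply: (rg_inj rG (Gf x)); rewrite e; exact: Gf.
have fp x : root p x -> root p (f x).
 move=> /rootP px; apply/rootP; have := graph_horner fG pG (Gf x); rewrite px => h.
 by apply/esym; exact: (rg_fun rG (rg0 rG) h).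
have [x _ <-] := perm_roots p0 finj fp pb; by exists x; exact: Gf.
Qed.

(** A maximal graph whose elements are algebraic over its fixed field is an automorphism: all of Om
    is algebraic over that fixed field, and an element outside the domain could be sent to a root of
    its transported minimal polynomial. *)
Lemma aut_extension G0 : field_graph G0 ->
 (forall a b, G0 (a, b) -> alg_over (diag G0) a /\ alg_over (diag G0) b) ->
 exists s : gal (diag G0), forall a b, G0 (a, b) -> s a = b.
move=> f0 P0; pose Psi G (z : Om * Om) := alg_over (diag G) z.1 /\ alg_over (diag G) z.2.
have mono G G' z : G `<=` G' -> Psi G z -> Psi G' z by move=> GG' [h1 h2]; split; [apply: alg_mono h1|apply: alg_mono h2] => a; exact: GG'.
have [|G [fG G0G PG Gmax]] := graph_zorn mono f0; first by case=> a b; exact: P0.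
have hG := diag_subfield fG.
have domA a : gdom G a -> alg_over (diag G) a by move=> [b /PG[]].
have codA b : gcod G b -> alg_over (diag G) b by move=> [a /PG[]].
have Galg a : alg_over (diag G) a.
 (* An element transcendental over the fixed field could be adjoined as a further fixed element. *)
 apply: contrapT => na.
 have nd : ~ alg_over (gdom G) a by move=> /(alg_trans hG domA).
 have nc : ~ alg_over (gcod G) a by move=> /(alg_trans hG codA).
 have [fG' GG' G'a] := adjoin_transc fG nd nc.
 have hA := alg_subfield (diag_subfield fG').
 have Gdiag : diag G `<=` diag (adjoin G (a, a)) by move=> x; exact: GG'.
 have e : adjoin G (a, a) = G.
 apply: Gmax => // z G'z; split.
 apply: (adjoin_in1 hA) G'z => [x /domA|]; first exact: alg_mono.
 exact: (alg_id (diag_subfield fG')).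
 apply: (adjoin_in2 hA) G'z => [x /codA|]; first exact: alg_mono.
 exact: (alg_id (diag_subfield fG')).
 by apply/na/(alg_id hG); move: G'a; rewrite e.
have Gdom a : gdom G a.
 have [|M [oM mM Ma Mmin]] := alg_min (a := a) fG.
 by apply: alg_mono (Galg a) => x Gx; exists x.
 have [m1 m2] := over_eq0 (proj1 fG) oM.
 have sz : size (map_poly snd M) = size (map_poly fst M) by rewrite !(map_monic_size _ mM).
 have [|b Mb] := @closed_root_ex (map_poly snd M).
 by rewrite sz; apply: root_size_gt1 Ma; rewrite m1 monic_neq0.
 have [fG' GG' G'ab] := adjoin_alg fG oM mM Ma Mmin Mb.
 have hA := alg_subfield (diag_subfield fG').
 have Gdiag : diag G `<=` diag (adjoin G (a, b)) by move=> x; exact: GG'.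
 suff e : adjoin G (a, b) = G by exists b; rewrite -e.
 apply: Gmax => // z G'z; split.
 by apply: (adjoin_in1 hA) G'z => [x _|]; apply: alg_mono (Galg _).
 by apply: (adjoin_in2 hA) G'z => [x _|]; apply: alg_mono (Galg _).
have [s sG] := gal_of_graph fG Gdom (alg_graph_total fG Galg Gdom).
have sP : gal_bij s \in gal_pred (diag G0) by have [sD sM sF] := galP s; apply/asboolP; split=> // x h; apply: sF; exact: G0G.
by exists (Gal sP) => a b /G0G /sG.
Qed.
End Automorphisms.

(** * Minimal polynomials, conjugates and fixed elements *)

Section Conjugates.
Variable Om : closedFieldType.
Implicit Types (F : set Om) (p : {poly Om}).

Definition coefs (E : fieldType) (F : set E) (p : {poly E}) := forall n, F p`_n.

Lemma diagonal_graph F : subfield F -> field_graph [set z : Om * Om | F z.1 /\ z.1 = z.2].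
move=> hF; split; first split.
- by split; [exact: (sub1 hF)|].
- by move=> [a b] [a' b'] /= [Fa <-] [Fa' <-]; split=> //; exact: (subB hF).
- by move=> [a b] [a' b'] /= [Fa <-] [Fa' <-]; split=> //; exact: (subM hF).
- by move=> [a b] /= [_ <-].
- by move=> [a b] /= [Fa <-]; split=> //; exact: (subV hF).
Qed.

Lemma gal_weaken (E : fieldType) (F F' : set E) (s : gal F') : F `<=` F' ->
 exists t : gal F, t =1 s.
move=> FF'; have sP : gal_bij s \in gal_pred F.
 by have [sD sM sF] := galP s; apply/asboolP; split=> // x h; apply: sF; exact: FF'.
by exists (Gal sP).
Qed.

Lemma gal_horner (E : fieldType) (F : set E) (s : gal F) (p : {poly E}) x :
 coefs F p -> s p.[x] = p.[s x].
move=> pF; have [_ _ sF] := galP s.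
rewrite -[in RHS](_ : map_poly s p = p) ?horner_map //.
by apply/polyP => n; rewrite coef_map /= sF //; exact: pF.
Qed.

Lemma gal_root (E : fieldType) (F : set E) (s : gal F) (p : {poly E}) x :
 coefs F p -> root p x -> root p (s x).
by move=> pF /rootP px; apply/rootP; rewrite -gal_horner // px rmorph0. Qed.

(** The graph construction applied to the identity of F: sending x to another root y of its minimal
    polynomial is a partial isomorphism, which extends to an automorphism. *)
Lemma minpol_ex F x : subfield F -> alg_over F x -> exists m : {poly Om},
 [/\ coefs F m, m \is monic, root m x,
 forall p, coefs F p -> root p x -> m %| p &
 forall y, root m y -> exists s : gal F, s x = y].
move=> hF Fx; set D := [set z : Om * Om | F z.1 /\ z.1 = z.2].
have fD : field_graph D := diagonal_graph hF.
have domD : gdom D = F by apply/seteqP; split=> a => [[b [Fa _]]|Fa]; last exists a.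
have codD : gcod D = F by apply/seteqP; split=> a => [[b [Fa /= <-]]|Fa]; last exists a.
have [|M [oM mM Mx Mmin]] := alg_min (a := x) fD; first by rewrite domD.
have e12 (P : {poly Om * Om}) : coefs_in D P -> map_poly snd P = map_poly fst P by move=> oP; apply/polyP => n; rewrite !coef_map; have [_ /=] := oP n.
have overF (P : {poly Om * Om}) : coefs_in D P -> coefs F (map_poly fst P) by move=> oP n; rewrite coef_map; have [] := oP n.
exists (map_poly fst M); split=> //; first exact: overF.
- by rewrite monicE lead_coefE map_monic_size // coef_map -lead_coefE (monicP mM).
- move=> p pF px; have [|P [oP eP]] := @lift_poly1 _ _ D p (proj1 fD); first by rewrite domD.
 move: px; rewrite -eP => px.
 have [C [R [oC oR e szR]]] := over_divp fD oP oM mM.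
 have [R0|R0] := eqVneq R 0; first by rewrite e R0 addr0 rmorphM dvdp_mull.
 have : root (map_poly fst R) x by move: px; rewrite e rmorphD rmorphM rootE hornerD hornerM (rootP Mx) mulr0 add0r.
 by move=> /(Mmin _ oR R0); rewrite leqNgt szR.
move=> y My; have [|fG DG Gxy] := adjoin_alg (b := y) fD oM mM Mx Mmin; first by rewrite e12.
have FG : F `<=` diag (adjoin D (x, y)) by move=> a Fa; apply: DG.
have Fy : alg_over F y.
 exists (map_poly fst M); split=> //; first exact: overF.
 by have [-> _] := over_eq0 (proj1 fD) oM; exact: monic_neq0.
have [a b Gab|s sG] := aut_extension fG.
 have hA := alg_subfield hF; split; apply: alg_mono FG _.
 by apply: (adjoin_in1 hA _ _ Gab); rewrite ?domD //; exact: (alg_id hF).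
 by apply: (adjoin_in2 hA _ _ Gab); rewrite ?codD //; exact: (alg_id hF).
have [t ts] := gal_weaken s FG; exists t; rewrite ts; exact: sG.
Qed.

Definition separable_over F x := exists p, [/\ coefs F p, separable_poly p & root p x].

Lemma separable_alg F x : separable_over F x -> alg_over F x.
by move=> [p [pF sp px]]; exists p; split=> //; exact: separable_poly_neq0. Qed.

(** Every root of the minimal polynomial is a conjugate of x, hence x itself; separability leaves
    degree one. *)
Lemma separable_fixed F x : subfield F -> separable_over F x ->
 (forall s : gal F, s x = x) -> F x.
move=> hF sx fx; have [m [mF mm mx mdvd mconj]] := minpol_ex hF (separable_alg sx).
have [p [pF sp px]] := sx; have sm := dvdp_separable (mdvd p pF px) sp.
have [r Dm] := closed_field_poly_normal m; rewrite (monicP mm) scale1r in Dm.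
have ur : uniq r by rewrite -(separable_prod_XsubC r) -Dm.
have rx y : y \in r -> y = x by move=> yr; have [|s <-] := mconj y; rewrite ?fx // Dm root_prod_XsubC.
have xr : x \in r by rewrite -root_prod_XsubC -Dm.
have Dm1 : m = 'X - x%:P.
 case: r ur rx xr Dm => [|y [|z r]] //= ur rx _ ->; first by rewrite big_seq1 (rx y) ?mem_head.
 by move: ur; rewrite (rx y) ?mem_head // (rx z) ?inE ?eqxx ?orbT.
by have := subN hF (mF 0%N); rewrite Dm1 coefB coefX coefC sub0r opprK.
Qed.

Lemma finite_orbit F x : alg_over F x -> exists r : seq Om, forall s : gal F, s x \in r.
move=> [p [pF p0 px]]; have [r Dp] := closed_field_poly_normal p; exists r => s.
have := gal_root s pF px.
by rewrite {1}Dp rootZ ?lead_coef_eq0 // root_prod_XsubC.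
Qed.
End Conjugates.

(** * Finite orbits and a finitary Galois correspondence *)

Section Krull.
Variables (E : fieldType) (F : set E).
Implicit Types (H : set (gal F)) (D : seq E).

Lemma pigeonhole_seq (T U : eqType) (f : T -> U) n (L : seq U) (cs : seq T) :
 {in cs, forall c, f c \in L} -> (n * size L < size cs)%N ->
 exists2 l, l \in L & (n < count (fun c => f c == l) cs)%N.
elim: L cs => [|l L IH] cs fL; first by case: cs fL => // c cs /(_ c (mem_head _ _)).
rewrite /= mulnS => lt; have [le|gt] := leqP (count (fun c => f c == l) cs) n; last first.
 by exists l; rewrite ?mem_head.
have [|| l' l'L gt] := IH [seq c <- cs | f c != l].
- by move=> c; rewrite mem_filter => /andP[h /fL]; rewrite inE (negbTE h).
- rewrite size_filter -(ltn_add2l (count (fun c => f c == l) cs)).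
 rewrite (count_predC (fun c => f c == l) cs); apply: leq_ltn_trans lt.
 by rewrite leq_add2r.
exists l'; first by rewrite inE l'L orbT.
apply: leq_trans gt _; rewrite count_filter; apply: sub_count => c /= /andP[].
by [].
Qed.

Lemma infinite_seq (T : choiceType) (C : set T) n : infinite_set C ->
 exists s : seq T, [/\ uniq s, size s = n & forall c, c \in s -> C c].
elim: n => [|n IH] infC; first by exists [::].
have [s [us ss sC]] := IH infC.
have [c [Cc cs]] : exists c, C c /\ c \notin s.
 apply: contrapT => h; apply: infC; apply: (@sub_finite_set _ _ [set` s]).
 by move=> c Cc; apply: contrapT => /negP cs; apply: h; exists c.
 exact: finite_seq.
exists (c :: s); split; rewrite /= ?cs ?us ?ss // => x.
by rewrite inE => /predU1P[->|/sC].
Qed.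

Lemma infinite_nonempty (T : Type) (A : set T) : infinite_set A -> exists e, A e.
move=> infA; apply: contrapT => none; apply: infA.
by have -> : A = set0; [apply/seteqP; split=> // e Ae; case: none; exists e|exact: finite_set0].
Qed.

Lemma infinite_nonroot (C : set E) (p : {poly E}) : infinite_set C -> p != 0 -> exists2 c, C c & ~~ root p c.
move=> infC p0; have [cs [ucs szc csC]] := infinite_seq (size p) infC.
apply: contrapT => none; have rts : all (root p) cs.
 by apply/allP => c /csC Cc; apply: contraT => nr; case: none; exists c.
by have := max_poly_roots p0 rts ucs; rewrite szc ltnn.
Qed.

(** Evaluation at a suitable point distinguishes [Poly T] from finitely many polynomials: the point
    avoids the roots of the product of the nonzero differences. *)
Lemma separating_point (C : set E) (L : seq (seq E)) (T : seq E) : infinite_set C ->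
 exists2 c, C c & forall r, r \in L -> (Poly r).[c] = (Poly T).[c] -> Poly r = Poly T.
move=> infC; pose B := \prod_(r <- L | Poly r != Poly T) (Poly r - Poly T).
have B0 : B != 0 by rewrite prodf_seq_neq0; apply/allP => r _; rewrite subr_eq0; exact/implyP.
have [c Cc nr] := infinite_nonroot infC B0; exists c => // r rL e.
apply/eqP; apply: contraT => ne; move/negP: nr; case.
by rewrite /B (big_rem r) //= ne rootM rootE hornerD hornerN e subrr eqxx.
Qed.

Lemma orbit_seqs H D : (forall x, x \in D -> exists r : seq E, forall h, H h -> h x \in r) ->
 exists L : seq (seq E), forall h, H h -> [seq h x | x <- D] \in L.
elim: D => [|x D IH] fin; first by exists [:: [::]].
have [|r rP] := fin x; first exact: mem_head.
have [|L LP] := IH; first by move=> y yD; apply: fin; rewrite inE yD orbT.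
exists [seq y :: l | y <- r, l <- L] => h Hh /=.
by apply/allpairsP; exists (h x, [seq h y | y <- D]); split=> //=; [exact: rP|exact: LP].
Qed.

Lemma orbit_poly H x (r : seq E) : is_subgroup H -> (forall h, H h -> h x \in r) ->
 exists q : {poly E}, [/\ q != 0, root q x, forall h, H h -> map_poly h q = q,
 (forall y, root q y -> exists2 h, H h & y = h x) &
 separable_poly q /\ exists s : seq E, q = \prod_(y <- s) ('X - y%:P)].
move=> [H1 HM HV] rP; pose O := [seq y <- undup r | `[< exists2 h, H h & y = h x >]].
have OP y : y \in O <-> exists2 h, H h & y = h x.
 rewrite mem_filter mem_undup; split=> [/andP[/asboolP] //|[h Hh yE]].
 by apply/andP; split; [apply/asboolP; exists h|rewrite yE; exact: rP].
have uO : uniq O by rewrite filter_uniq // undup_uniq.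
exists (\prod_(y <- O) ('X - y%:P)); split.
- by rewrite monic_neq0 // monic_prod_XsubC.
- by rewrite root_prod_XsubC; apply/OP; exists 1%g.
- move=> h Hh; rewrite rmorph_prod /=.
 under eq_bigr do rewrite map_polyXsubC.
 rewrite -(big_map h predT (fun y => 'X - y%:P)); apply: perm_big.
 have uhO : uniq (map h O) by rewrite map_inj_uniq //; exact: can_inj (@bij_funK _ h).
 have sub : {subset map h O <= O} by move=> _ /mapP [y /OP [g Hg ->] ->]; apply/OP; exists (h * g)%g => //; exact: HM.
 have [|_ e] := uniq_min_size uhO sub; first by rewrite size_map.
 exact: uniq_perm.
- by move=> y; rewrite root_prod_XsubC => /OP.
- by split; [rewrite separable_prod_XsubC|exists O].
Qed.

Lemma subring_prod_coefs (P : set E) (s : seq E) : P 1 -> (forall x y, P x -> P y -> P (x - y)) ->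
 (forall x y, P x -> P y -> P (x * y)) -> (forall v, v \in s -> P v) -> coefs P (\prod_(v <- s) ('X - v%:P)).
move=> P1 PB PM; have P0 : P 0 by rewrite -(subrr 1); exact: PB.
elim: s => [|v s IH] sP k.
 by rewrite big_nil coef1; case: eqP.
have IH' : coefs P (\prod_(w <- s) ('X - w%:P)) by apply: IH => w ws; apply: sP; rewrite inE ws orbT.
rewrite big_cons mulrBl coefB coefXM coefCM; apply: PB.
 by case: k => [|k] /=; [exact: P0|exact: IH'].
by apply: PM; [apply: sP; exact: mem_head|exact: IH'].
Qed.

(** The Galois correspondence in finite form: finitely many H-fixed elements [D'] suffice to force
    an endomorphism fixing them to agree with an element of H on the finite set D. The last clause
    locates [D'] in any subring containing C and the orbits of D. *)
Lemma krull_density H D (C : set E) : is_subgroup H -> infinite_set C ->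
 (forall c h, C c -> H h -> h c = c) ->
 (forall x, x \in D -> exists r : seq E, forall h, H h -> h x \in r) ->
 exists D' : seq E, [/\ forall z h, z \in D' -> H h -> h z = z,
 forall u : {rmorphism E -> E}, {in D', forall z, u z = z} ->
 exists2 h, H h & {in D, forall x, h x = u x} &
 forall P : set E, P 1 -> (forall x y, P x -> P y -> P (x - y)) -> (forall x y, P x -> P y -> P (x * y)) ->
 C `<=` P -> (forall x h, x \in D -> H h -> P (h x)) -> forall z, z \in D' -> P z].
move=> sH infC HC fin; have [H1 HM HV] := sH; have [L LP] := orbit_seqs fin.
(* With more than [n * size L] points c, one image of D serves more than n of them, and two
   polynomials of size at most n that agree there are equal. *)
pose n := size D; have [cs [ucs scs csC]] := infinite_seq (n * size L).+1 infC.
pose x c := (Poly D).[c].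
have hx (h : {rmorphism E -> E}) c : h c = c -> h (x c) = (Poly [seq h y | y <- D]).[c].
 move=> hc; rewrite /x -[in RHS]hc -map_Poly_id0 ?rmorph0 // horner_map //=.
have orbq c : c \in cs -> exists q : {poly E}, [/\ q != 0, root q (x c),
 forall h, H h -> map_poly h q = q,
 (forall y, root q y -> exists2 h, H h & y = h (x c)) & separable_poly q /\ exists s : seq E, q = \prod_(y <- s) ('X - y%:P)].
 move=> /csC Cc; apply: (@orbit_poly H (x c) [seq (Poly l).[c] | l <- L]) => // h Hh.
 rewrite (hx h); first by apply: (map_f (fun l => (Poly l).[c])); exact: LP.
 exact: HC.
have [q qP] : exists q : E -> {poly E}, forall c, c \in cs -> [/\ q c != 0, root (q c) (x c),
 forall h, H h -> map_poly h (q c) = q c,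
 (forall y, root (q c) y -> exists2 h, H h & y = h (x c)) & separable_poly (q c) /\ exists s : seq E, q c = \prod_(y <- s) ('X - y%:P)].
 have /choice [q qP] : forall c, exists q : {poly E}, c \in cs -> [/\ q != 0, root q (x c),
 forall h, H h -> map_poly h q = q,
 (forall y, root q y -> exists2 h, H h & y = h (x c)) & separable_poly q /\ exists s : seq E, q = \prod_(y <- s) ('X - y%:P)].
 move=> c0; case: (boolP (c0 \in cs)) => [/(orbq c0) [q qP]|]; first by exists q.
 by exists 0.
 by exists q.
(* [D'] consists of the points c and of the coefficients of the orbit polynomials of the elements
   [x c]. *)
exists (cs ++ flatten [seq polyseq (q c) | c <- cs]); split=> [z h|u uD'|P P1 PB PM CP DP z].
- rewrite mem_cat => /orP[/csC|/flattenP [_ /mapP [c ccs ->] zq]] Hh; first by move/HC; apply.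
 have [_ _ /(_ h Hh) e _ _] := qP c ccs; move: zq => /(nthP 0) [i _ <-].
 by rewrite -[in RHS]e coef_map.
have uc c : c \in cs -> u c = c by move=> ccs; apply: uD'; rewrite mem_cat ccs.
have uq c : c \in cs -> map_poly u (q c) = q c.
 move=> ccs; apply/polyP => i; rewrite coef_map /=; have [lt|le] := ltnP i (size (q c)).
 apply: uD'; rewrite mem_cat; apply/orP; right; apply/flattenP.
 by exists (polyseq (q c)); [exact: map_f|exact: mem_nth].
 by rewrite nth_default // rmorph0.
have hc c : exists h, c \in cs -> H h /\ u (x c) = h (x c).
 case: (boolP (c \in cs)) => [ccs|]; last by exists 1%g.
 have [_ qx _ qconj _] := qP c ccs; have [|h Hh e] := qconj (u (x c)); last by exists h.
 by rewrite rootE -(uq c ccs) horner_map (rootP qx) rmorph0.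
have {hc} /choice [h hP] := hc.
pose f c := [seq h c y | y <- D].
have [||l lL lt] := @pigeonhole_seq _ _ f n L cs; last 1 first.
- have : has (fun c => f c == l) cs by rewrite has_count (leq_trans _ lt).
 move=> /hasP [c0 c0cs /eqP fc0]; exists (h c0); first by have [] := hP c0 c0cs.
 suff : map u D = l.
 by rewrite -fc0 => /eq_in_map e y yD; rewrite e.
 have szl : size l = n by rewrite -fc0 size_map.
 have e0 : Poly (map u D) = Poly l.
 apply/eqP; rewrite -subr_eq0; apply: contraTT (lt) => nz; rewrite -leqNgt -size_filter.
 have rts : all (root (Poly (map u D) - Poly l)) [seq c <- cs | f c == l].
 apply/allP => c; rewrite mem_filter => /andP[/eqP fc ccs]; have [Hh e] := hP c ccs.
 have e1 := hx u c (uc c ccs).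
 have e2 := hx (h c) c (HC c (h c) (csC c ccs) Hh).
 by rewrite rootE hornerD hornerN subr_eq0 -fc /f -e1 -e2 e.
 rewrite ltnW // (leq_trans (max_poly_roots nz rts (filter_uniq _ ucs))) //.
 rewrite (leq_trans (size_polyD _ _)) // size_polyN geq_max.
 by rewrite !(leq_trans (size_Poly _)) ?size_map ?szl.
 apply: (@eq_from_nth _ 0); first by rewrite size_map szl.
 by move=> i _; have := congr1 (fun p : {poly E} => p`_i) e0; rewrite !coef_Poly.
- by move=> c ccs; apply: LP; have [] := hP c ccs.
by rewrite scs.
move=> zD'; have P0 : P 0 by rewrite -(subrr 1); exact: PB.
have PD a b : P a -> P b -> P (a + b) by move=> Pa Pb; rewrite -[b]opprK -[- b]sub0r; apply: (PB) => //; exact: PB.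
move: zD'; rewrite mem_cat => /orP[/csC/CP //|/flattenP [_ /mapP [c ccs ->] /(nthP 0) [k _ <-]]].
have [_ _ _ qconj [_ [s qE]]] := qP c ccs; rewrite qE; apply: subring_prod_coefs => // v vs.
have [|h Hh ->] := qconj v; first by rewrite qE root_prod_XsubC.
rewrite (hx h c (HC c h (csC c ccs) Hh)) horner_coef; apply: (big_ind P) => // m _; apply: (PM).
 rewrite coef_Poly; have [lt|le] := ltnP m (size [seq h y | y <- D]); last by rewrite nth_default.
 by have /mapP [y yD ->] := mem_nth 0 lt; exact: DP.
have Pc : P c by apply: CP; exact: csC.
by elim: (m : nat) => [|n' IH]; rewrite ?expr0 ?exprS //; apply: (PM).
Qed.
End Krull.

(** * Eigenvector decomposition for an abelian action of exponent l *)

Section KummerDecomposition.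
Variables (E : fieldType) (F : set E) (S : set (gal F)) (l : nat) (zeta : E) (A : set E).
Hypotheses (sS : is_subgroup S) (l_gt0 : (0 < l)%N) (l_nz : l%:R != 0 :> E).
Hypotheses (zeta_prim : l.-primitive_root zeta) (zetaS : forall s, S s -> s zeta = zeta).
Hypotheses (AD : forall a b, A a -> A b -> A (a + b)) (A0 : A 0)
 (Azeta : forall a, A a -> A (zeta * a)) (Al : forall a, A a -> A (l%:R^-1 * a))
 (AS : forall s a, S s -> A a -> A (s a)).
Hypotheses (comm : forall s s' a, S s -> S s' -> A a -> s (s' a) = s' (s a))
 (exp_l : forall s a, S s -> A a -> (s ^+ l)%g a = a).

Let SX s n : S s -> S (s ^+ n)%g.
by move=> Ss; have [S1 SM _] := sS; elim: n => [|n IH]; rewrite ?expg0 ?expgS //; exact: SM.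
Qed.

Let AzetaX a n : A a -> A (zeta ^+ n * a).
by move=> Aa; elim: n => [|n IH]; rewrite ?expr0 ?mul1r // exprS -mulrA; exact: Azeta. Qed.

Lemma galX1 (s : gal F) n x : (s ^+ n.+1)%g x = s ((s ^+ n)%g x).
by rewrite expgS. Qed.

(** The Lagrange resolvent, projecting onto the eigenspace of s for the eigenvalue [zeta ^+ k]; the
    exponent [l - k] stands for -k. *)
Let res (s : gal F) k z := l%:R^-1 * \sum_(r < l) zeta ^+ ((l - k) * r) * (s ^+ r)%g z.

Let zl : zeta ^+ l = 1. exact: prim_expr_order. Qed.

Let A_sum I (r : seq I) (f : I -> E) : (forall i, A (f i)) -> A (\sum_(i <- r) f i).
by move=> Af; apply: big_ind. Qed.

Let res_A s k z : S s -> A z -> A (res s k z).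
by move=> Ss Az; apply/Al/A_sum => r; apply/AzetaX/AS => //; exact: SX.
Qed.

Let galZ (s : gal F) n a : S s -> s (zeta ^+ n * a) = zeta ^+ n * s a.
by move=> Ss; rewrite rmorphM rmorphXn /= zetaS. Qed.

Let res_eigen s k z : S s -> A z -> (k < l)%N -> s (res s k z) = zeta ^+ k * res s k z.
move=> Ss Az kl; rewrite /res rmorphM fmorphV rmorph_nat mulrCA; congr (_ * _).
rewrite rmorph_sum mulr_sumr /=.
pose f r := zeta ^+ ((l - k) * r) * (s ^+ r)%g z.
have zk : zeta ^+ k * zeta ^+ (l - k) = 1 by rewrite -exprD subnKC ?zl // ltnW.
have e r : zeta ^+ k * f r.+1 = s (zeta ^+ ((l - k) * r) * (s ^+ r)%g z) by rewrite galZ // /f mulnS exprD galX1 !mulrA zk mul1r.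
rewrite (eq_bigr (fun r : 'I_l => zeta ^+ k * f r.+1)); last by move=> r _; rewrite e.
rewrite -!mulr_sumr; congr (_ * _).
have fl : f l = f 0%N by rewrite /f exp_l // expg0 muln0 mulnC exprM zl expr1n.
have e2 n : \sum_(r < n) f r.+1 + f 0%N = \sum_(r < n) f r + f n.
 elim: n => [|n IH]; first by rewrite !big_ord0.
 by rewrite !big_ord_recr /= -IH addrAC.
by apply: (addIr (f 0%N)); rewrite e2 fl.
Qed.

Let res_sum s z : S s -> A z -> \sum_(k < l) res s k z = z.
move=> Ss Az; rewrite -mulr_sumr exchange_big /=.
pose f r := \sum_(k < l) zeta ^+ ((l - k) * r) * (s ^+ r)%g z.
rewrite -(big_mkord xpredT f) big_ltn //= big1_seq ?addr0 => [|r]; last first.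
 rewrite mem_index_iota => /andP[_ /andP[r0 rl]]; rewrite /f -mulr_suml.
 set w := zeta ^+ r.
 have w1 : w != 1 by rewrite -(prim_order_dvd zeta_prim) gtnNdvd.
 have wl : w ^+ l = 1 by rewrite /w -exprM mulnC exprM zl expr1n.
 rewrite (reindex_inj rev_ord_inj) /= (eq_bigr (fun k : 'I_l => w * w ^+ k)); last first.
 by move=> k _; rewrite -exprS /w -exprM subKn // mulnC.
 rewrite -mulr_sumr (_ : \sum_(k < l) w ^+ k = 0) ?mulr0 ?mul0r //.
 apply/eqP; have : (w - 1) * (\sum_(k < l) w ^+ k) = 0 by rewrite -subrX1 wl subrr.
 by move/eqP; rewrite mulf_eq0 subr_eq0 (negbTE w1).
rewrite /f (eq_bigr (fun=> z)); last by move=> k _; rewrite muln0 expr0 mul1r.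
by rewrite sumr_const card_ord -[z *+ _]mulr_natl mulKf.
Qed.

(** The component a behaves under S as z does. This passes the eigenvector property from a finite
    list of elements to every element with the same value on z. *)
Let transfer z a := forall s s' k, S s -> S s' -> s z = zeta ^+ k * s' z -> s a = zeta ^+ k * s' a.

Let res_transfer s k z : S s -> A z -> transfer z (res s k z).
move=> Ss Az g g' n Sg Sg' e.
have gres h : S h -> h (res s k z) = l%:R^-1 * \sum_(r < l) zeta ^+ ((l - k) * r) * (s ^+ r)%g (h z).
 move=> Sh; rewrite /res rmorphM fmorphV rmorph_nat; congr (_ * _).
 rewrite rmorph_sum; apply: eq_bigr => r _ /=; rewrite galZ //; congr (_ * _).
 by apply: comm => //; exact: SX.
rewrite !gres // e mulrCA; congr (_ * _); rewrite mulr_sumr; apply: eq_bigr => r _.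
by rewrite galZ; [rewrite mulrCA|exact: SX].
Qed.

Lemma kummer_decomp_seq (Ls : seq (gal F)) z : {in Ls, forall s, S s} -> A z ->
 exists L : seq E, z = \sum_(a <- L) a /\ forall a, a \in L ->
 [/\ A a, transfer z a & {in Ls, forall s : gal F, exists k, s a = zeta ^+ k * a}].
elim: Ls z => [|s Ls IH] z SL Az.
 exists [:: z]; rewrite big_seq1; split=> // a; rewrite inE => /eqP ->.
 by split=> // s s' k _ _ ->.
have Ss : S s by apply: SL; exact: mem_head.
have SLs : {in Ls, forall s, S s} by move=> t tL; apply: SL; rewrite inE tL orbT.
have /choice [L LP] : forall k : 'I_l, exists L : seq E, res s k z = \sum_(a <- L) a /\
 forall a, a \in L -> [/\ A a, transfer (res s k z) a & {in Ls, forall s : gal F, exists k, s a = zeta ^+ k * a}].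
 by move=> k; apply: IH => //; exact: res_A.
exists (flatten [seq L k | k <- enum 'I_l]); split.
 rewrite big_flatten big_map big_enum /= -(res_sum Ss Az).
 by apply: eq_bigr => k _; have [] := LP k.
move=> a /flattenP [_ /mapP [k _ ->] aL]; have [_ /(_ a aL) [Aa ta ka]] := LP k.
have ta' : transfer z a by move=> g g' n Sg Sg' e; apply: ta => //; exact: (@res_transfer s k z).
split=> // t; rewrite inE => /predU1P[->|]; last exact: ka.
exists k; have [S1 _ _] := sS; rewrite (ta s 1%g k) //.
exact: res_eigen.
Qed.

(** Since x takes finitely many values under S, finitely many elements represent all of them; x is
    decomposed for these, and [transfer] handles the others. *)
Lemma kummer_decomp x : A x -> (exists r : seq E, forall s, S s -> s x \in r) ->
 exists L : seq E, x = \sum_(a <- L) a /\ forall a, a \in L ->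
 A a /\ forall s, S s -> exists k, s a = zeta ^+ k * a.
move=> Ax [r rP].
have [Ls [SLs cov]] : exists Ls : seq (gal F), {in Ls, forall s, S s} /\
 forall s, S s -> exists2 t, t \in Ls & s x = t x.
 have : forall y, exists t, (exists2 s, S s & s x = y) -> S t /\ t x = y.
 move=> y; have [[s Ss e]|h] := pselect (exists2 s, S s & s x = y); first by exists s.
 by exists 1%g => /h.
 move=> /choice [t tP].
 exists [seq t y | y <- r & `[< exists2 s, S s & s x = y >]]; split.
 by move=> u /mapP [y]; rewrite mem_filter => /andP[/asboolP h _] ->; have [] := tP y h.
 move=> s Ss; have [|St ts] := tP (s x); first by exists s.
 exists (t (s x)); last by rewrite ts.
 by apply: map_f; rewrite mem_filter rP // andbT; apply/asboolP; exists s.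
have [L [xL LP]] := kummer_decomp_seq SLs Ax; exists L; split=> // a aL.
have [Aa ta ka] := LP a aL; split=> // s Ss; have [t tL e] := cov s Ss.
have [k tk] := ka t tL; exists k; rewrite -tk -[RHS]mul1r -[1](expr0 zeta).
by apply: ta => //; [exact: SLs|rewrite expr0 mul1r].
Qed.
End KummerDecomposition.

(** * Roots of unity, and elements fixed by all automorphisms *)

Section RootsOfUnity.
Variable Om : closedFieldType.

Lemma separable_XnsubC (R : fieldType) n (a : R) : n%:R != 0 :> R -> a != 0 ->
 separable_poly ('X^n - a%:P).
move=> n0 a0; have n_gt0 : (0 < n)%N by case: n n0; rewrite ?eqxx.
rewrite unlock; apply/Bezout_coprimepP.
exists (- a^-1%:P, (a^-1 / n%:R)%:P * 'X) => /=.
have e : (a^-1 / n%:R)%:P * 'X * ('X^(n.-1) *+ n) = a^-1%:P * 'X^n by rewrite mulrnAr -mulrA -exprS prednK // -mulrnAl -polyCMn -[_ *+ n]mulr_natr mulfVK.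
by rewrite derivB derivXn derivC subr0 e mulNr mulrBr opprB -polyCM mulVf // subrK eqpxx.
Qed.

Lemma closed_prim_root n : n%:R != 0 :> Om -> exists z : Om, n.-primitive_root z.
move=> n0; have n_gt0 : (0 < n)%N by case: n n0; rewrite ?eqxx.
have sep := separable_XnsubC n0 (oner_neq0 Om).
have [r Dp] := closed_field_poly_normal ('X^n - 1%:P : {poly Om}).
have lc : lead_coef ('X^n - 1%:P : {poly Om}) = 1 by rewrite lead_coefXnsubC.
rewrite lc scale1r in Dp.
have /hasP [z _ zp] : has n.-primitive_root r.
 apply: has_prim_root => //.
 - apply/allP => z zr; rewrite /root_of_unity -[1]/(1%:P).
 by rewrite Dp root_prod_XsubC.
 - by rewrite -(separable_prod_XsubC r) -Dp.
 - have := congr1 (fun p : {poly Om} => size p) Dp.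
 by rewrite size_XnsubC // size_prod_XsubC => -[->].
by exists z.
Qed.

Lemma closed_nth_root n (a : Om) : (0 < n)%N -> exists b, b ^+ n = a.
move=> n0; have [|b] := @closed_root_ex _ ('X^n - a%:P); first by rewrite size_XnsubC.
by rewrite rootE !hornerE subr_eq0 => /eqP h; exists b.
Qed.

(** A fixed element is the only root of its minimal polynomial, so it is purely inseparable: a power
    with exponent composed of the characteristic lies in F. *)
Lemma fixed_ppower (F : set Om) x : subfield F -> alg_over F x ->
 (forall s : gal F, s x = x) -> exists2 q, [pchar Om].-nat q & F (x ^+ q).
move=> hF Fx fx; have [m [mF mm mx mdvd mconj]] := minpol_ex hF Fx.
have [r Dm] := closed_field_poly_normal m; rewrite (monicP mm) scale1r in Dm.
have rx y : y \in r -> y = x by move=> yr; have [|s <-] := mconj y; rewrite ?fx // Dm root_prod_XsubC.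
have {}Dm : m = ('X - x%:P) ^+ (size r).
 rewrite Dm big_seq (eq_bigr (fun=> 'X - x%:P)) => [|y /rx -> //].
 by rewrite -big_seq big_const_seq count_predT iter_mulr_1.
have n0 : (0 < size r)%N by rewrite lt0n; apply: contraTneq mx => r0; rewrite Dm r0 expr0 root1.
pose pi := [pchar Om]; pose n := size r; pose q := (n`_pi)%N; pose n' := (n`_pi^')%N.
have eqn : n = (q * n')%N by rewrite partnC.
have n'0 : n'%:R != 0 :> Om by rewrite natf_neq0_pchar part_pnat.
have n'_gt0 : (0 < n')%N by exact: part_gt0.
have Fq : ('X - x%:P) ^+ q = 'X^q - (x ^+ q)%:P.
 rewrite exprDn_pchar; last by rewrite (eq_pnat _ (pchar_poly Om)) part_pnat.
 by rewrite exprNn_pchar ?rmorphXn //= (eq_pnat _ (pchar_poly Om)) part_pnat.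
exists q; first exact: part_pnat.
have em : m = (\prod_(y <- nseq n' (x ^+ q)) ('X - y%:P)) \Po 'X^q.
 rewrite big_nseq iter_mulr_1 Dm -/n eqn exprM Fq.
 by rewrite [RHS](rmorphXn (comp_poly 'X^q)) /= comp_polyB comp_polyX comp_polyC.
(* The polynomial is [(Y - x ^+ q) ^+ n'] at [Y = 'X^q]; its second coefficient is [- n' * x ^+ q],
   and n' is invertible. *)
have := mF (q * n'.-1)%N; rewrite em coef_comp_poly_Xn ?part_gt0 // dvdn_mulr // mulKn ?part_gt0 //.
rewrite -[in n'.-1](size_nseq n' (x ^+ q)) coefPn_prod_XsubC ?size_nseq -?lt0n //.
rewrite big_nseq => /(subN hF); rewrite opprK => h.
have e : iter n' (+%R (x ^+ q)) 0 = n'%:R * x ^+ q by rewrite mulr_natl iter_addr_0.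
by rewrite -[x ^+ q](mulKf n'0) mulrC -e; apply: (sub_div hF) => //; exact: (sub_nat hF).
Qed.

Lemma fixed_power (F : set Om) x l : subfield F -> prime l -> l%:R != 0 :> Om ->
 alg_over F x -> (forall s : gal F, s x = x) -> exists q, [/\ (0 < q)%N, coprime q l & F (x ^+ q)].
move=> hF pl l0 Fx fx; have [q qp Fq] := fixed_ppower hF Fx fx.
exists q; split=> //; first by case/andP: qp.
by apply: (@pnat_coprime [pchar Om]); rewrite // -natf_neq0_pchar.
Qed.
End RootsOfUnity.

(** * Cyclic extensions generated by an l-th root *)

Section KummerExtension.
Variables (Om : closedFieldType) (l : nat) (zeta : Om) (Kb : divringClosed Om).
Notation K := [set x : Om | x \in Kb].
Hypotheses (zeta_prim : l.-primitive_root zeta) (zetaK : zeta \in Kb).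

Lemma prim_gt0 : (0 < l)%N. exact: prim_order_gt0 zeta_prim. Qed.

Lemma root_of_unityE (w : Om) : w ^+ l = 1 -> exists2 k, (k < l)%N & w = zeta ^+ k.
move=> wl; have [k ->] := prim_rootP zeta_prim wl; by exists k.
Qed.

Lemma kummer_conj (F : set Om) (s : gal F) a : F (a ^+ l) -> exists2 k, (k < l)%N & s a = zeta ^+ k * a.
have [-> _|a0 Fa] := eqVneq a 0; first by exists 0%N; rewrite ?prim_gt0 // rmorph0 mulr0.
have [|k kl e] := @root_of_unityE (s a / a).
 by have [_ _ sF] := galP s; rewrite expr_div_n -rmorphXn /= sF // divff // expf_neq0.
by exists k => //; rewrite -e divfK.
Qed.

Section Gen.
Variables (a : Om) (s0 : gal K).
Hypotheses (aK : a ^+ l \in Kb) (s0a : s0 a = zeta * a) (a0 : a != 0).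

Definition kummer_field : set Om := [set z | exists2 p, coefs K p & z = p.[a]].
Notation L := kummer_field.

Let s0K x : x \in Kb -> s0 x = x. by have [_ _ h] := galP s0; exact: h. Qed.
Let s0z n : s0 (zeta ^+ n * a) = zeta ^+ n.+1 * a.
by rewrite rmorphM /= s0K ?rpredX // s0a exprSr mulrA. Qed.

Lemma kummer_root_inj k k' : (k < l)%N -> (k' < l)%N -> zeta ^+ k * a = zeta ^+ k' * a -> k = k'.
move=> kl k'l /(mulIf a0)/eqP; rewrite (eq_prim_root_expr zeta_prim) !modn_small //.
by move/eqP.
Qed.

Lemma kummer_indep (c : 'I_l -> Om) : (forall k, c k \in Kb) ->
 \sum_(k < l) c k * a ^+ k = 0 -> forall k, c k = 0.
move=> cK e; pose cc n := if insub n is Some k then c k else 0.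
have ccE (k : 'I_l) : cc k = c k by rewrite /cc valK.
pose p := \poly_(k < l) cc k; have pE x : p.[x] = \sum_(k < l) c k * x ^+ k.
 by rewrite horner_poly; apply: eq_bigr => k _; rewrite ccE.
have pK : coefs K p.
 move=> n; rewrite coef_poly; case: ifP => _ /=; last exact: rpred0.
 by rewrite /cc; case: insubP => [k _ _|_]; [exact: cK|exact: rpred0].
have rts n : root p (zeta ^+ n * a).
 elim: n => [|n IH]; first by rewrite expr0 mul1r rootE pE e.
 by rewrite -s0z; exact: gal_root.
suff p0 : p = 0 by move=> k; rewrite -ccE; have := coef0 Om k; rewrite -p0 coef_poly ltn_ord.
apply: contraTeq isT => p0 /=; apply/negP.
have all_r : all (root p) [seq zeta ^+ k * a | k <- iota 0 l] by apply/allP => _ /mapP [k _ ->].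
have ur : uniq [seq zeta ^+ k * a | k <- iota 0 l].
 rewrite map_inj_in_uniq ?iota_uniq // => k k'; rewrite !mem_iota /= add0n.
 exact: kummer_root_inj.
have := max_poly_roots p0 all_r ur; rewrite size_map size_iota ltnNge.
by rewrite size_poly.
Qed.

Lemma kummer_coord z : L z -> exists c : 'I_l -> Om, (forall k, c k \in Kb) /\ z = \sum_k c k * a ^+ k.
move=> [p pK ->]; rewrite horner_coef.
apply: (big_ind (fun z => exists c : 'I_l -> Om, (forall k, c k \in Kb) /\ z = \sum_k c k * a ^+ k)).
- by exists (fun=> 0); split=> [k|]; rewrite ?rpred0 // big1 // => k _; rewrite mul0r.
- move=> _ _ [c [cK ->]] [c' [cK' ->]]; exists (fun k => c k + c' k); split=> [k|].
 exact: rpredD.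
 by rewrite -big_split /=; apply: eq_bigr => k _; rewrite mulrDl.
move=> n _; pose r := Ordinal (ltn_pmod n prim_gt0).
exists (fun k => if k == r then p`_n * (a ^+ l) ^+ (n %/ l) else 0); split=> [k|].
 case: ifP => _; rewrite ?rpred0 // rpredM //; last exact: rpredX.
 exact: (pK n).
rewrite (bigD1 r) //= eqxx big1 ?addr0 => [|k /negbTE ->]; last by rewrite mul0r.
by rewrite -mulrA -exprM -exprD mulnC -divn_eq.
Qed.

Lemma kummer_fixed z : L z -> s0 z = z -> z \in Kb.
move=> /kummer_coord [c [cK zE]] sz.
have e : \sum_(k < l) (zeta ^+ k - 1) * c k * a ^+ k = 0.
 under eq_bigr do rewrite -mulrA mulrBl mul1r.
 rewrite sumrB -zE -[X in _ - X]sz zE rmorph_sum -sumrB big1 // => k _.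
 by rewrite rmorphM rmorphXn /= s0K // s0a exprMn mulrCA subrr.
have h := kummer_indep _ e.
rewrite zE rpred_sum // => k _; have [k0|k0] := eqVneq (k : nat) 0%N.
 by rewrite k0 expr0 mulr1.
have /eqP := h (fun k => rpredM (rpredB (rpredX _ zetaK) (rpred1 _)) (cK k)) k.
rewrite mulf_eq0 subr_eq0 -(prim_order_dvd zeta_prim) gtnNdvd ?lt0n //=.
by move=> /eqP ->; rewrite mul0r rpred0.
Qed.

Let twist (p : {poly Om}) n := p \Po (zeta ^+ n *: 'X).
Let twistK p n : coefs K p -> coefs K (twist p n).
move=> pK; suff : twist p n \is a polyOver Kb by move/polyOverP.
by rewrite polyOver_comp ?polyOverZ ?polyOverX ?rpredX //; apply/polyOverP.
Qed.
Let twistE p n : (twist p n).[a] = p.[zeta ^+ n * a].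
by rewrite horner_comp !hornerE. Qed.

(** Inverses come from the norm: the product of the conjugates [p.[zeta ^+ n * a]] is fixed by [s0],
    hence lies in K. *)
Lemma kummer_field_sub : subfield L.
have LM x y : L x -> L y -> L (x * y).
 move=> [p /polyOverP pK ->] [q /polyOverP qK ->]; exists (p * q); rewrite ?hornerM //.
 by apply/polyOverP; rewrite rpredM.
split.
- by exists 1; rewrite ?hornerC //; apply/polyOverP; rewrite rpred1.
- move=> x y [p /polyOverP pK ->] [q /polyOverP qK ->]; exists (p - q); rewrite ?hornerE //.
 by apply/polyOverP; rewrite rpredB.
move=> x y Lx Ly; apply: (LM) => //; move: Ly => [p pK ->].
have [->|pa0] := eqVneq p.[a] 0.
 by rewrite invr0; exists 0; rewrite ?horner0 // => n; rewrite coef0 /= rpred0.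
pose N := \prod_(n < l) p.[zeta ^+ n * a]; pose M := \prod_(n < l.-1) p.[zeta ^+ n.+1 * a].
have NM : N = p.[a] * M.
 rewrite /N /M -[in LHS](prednK prim_gt0) big_ord_recl /= expr0 mul1r; congr (_ * _).
have LM' : L M.
 exists (\prod_(n < l.-1) twist p n.+1); last by rewrite horner_prod; apply: eq_bigr => n _; rewrite twistE.
 by apply/polyOverP/rpred_prod => n _; apply/polyOverP/twistK.
have LN : L N by rewrite NM; apply: LM => //; exists p.
have sN : s0 N = N.
 rewrite /N rmorph_prod /=.
 pose f n := p.[zeta ^+ n * a].
 rewrite (eq_bigr (fun n : 'I_l => f n.+1)); last by move=> n _; rewrite gal_horner ?s0z.
 have fl : f l = f 0%N by rewrite /f (prim_expr_order zeta_prim) expr0.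
 rewrite -[l](prednK prim_gt0) in fl *; rewrite big_ord_recr big_ord_recl /= mulrC.
 by rewrite fl.
have N0 : N != 0.
 apply/prodf_neq0 => n _; have [q qs0] : exists q : gal K, q a = zeta ^+ n * a.
 elim: (val n) => [|m [q qa]]; first by exists 1%g; rewrite expr0 mul1r.
 by exists (s0 * q)%g; rewrite -s0z -qa.
 by rewrite -qs0 -gal_horner // fmorph_eq0.
have NK := kummer_fixed LN sN; exists (N^-1 *: \prod_(n < l.-1) twist p n.+1).
 apply/polyOverP; rewrite polyOverZ ?rpredV //; apply: rpred_prod => n _.
 by apply/polyOverP/twistK.
rewrite hornerZ horner_prod (eq_bigr (fun n : 'I_l.-1 => p.[zeta ^+ n.+1 * a])).
 by rewrite -/M NM invfM -mulrA mulVf ?mulr1 //; apply: contraNneq N0 => M0; rewrite NM M0 mulr0.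
by move=> n _; rewrite twistE.
Qed.

(** K(a) has the basis of powers of a, so its degree is l; it is Galois because K contains
    [zeta]. *)
Lemma kummer_in_max_prol : prime l -> a \in max_prol l Kb.
move=> pl; pose Lf := fld kummer_field_sub.
have KL x : x \in Kb -> x \in Lf.
 move=> xK; apply/fldP; exists x%:P; rewrite ?hornerC // => n; rewrite coefC /=.
 by case: ifP => _; rewrite ?rpred0.
have aL : a \in Lf by apply/fldP; exists 'X; rewrite ?hornerX //; apply/polyOverP; rewrite polyOverX.
apply/asboolP => E; apply; exists Lf; split=> //; last first.
 exists 1%N; rewrite expn1; exists (fun m => a ^+ m); split=> [m|x /fldP Lx].
 exact: rpredX.
 have [c [cK xE]] := kummer_coord Lx; exists [ffun k => c k]; split.
 split=> [m|]; first by rewrite ffunE.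
 by rewrite xE; apply: eq_bigr => m _; rewrite ffunE.
 move=> c' [c'K xE']; apply/ffunP => m; rewrite ffunE; apply/eqP; rewrite -subr_eq0; apply/eqP.
 apply: (kummer_indep (c := fun k => c k - c' k)) => [k|]; first exact: rpredB.
 by under eq_bigr do rewrite mulrBl; rewrite sumrB -xE -xE' subrr.
split=> // x /fldP [p pK xE].
pose s := undup [seq p.[zeta ^+ n * a] | n <- iota 0 l].
have sL : {subset s <= Lf}.
 move=> y; rewrite mem_undup => /mapP [n _ ->]; apply/fldP.
 by exists (twist p n); [exact: twistK|rewrite twistE].
exists s; split=> //; first exact: undup_uniq.
 rewrite mem_undup xE; apply/mapP; exists 0%N; rewrite ?expr0 ?mul1r //.
 by rewrite mem_iota prim_gt0.
have s0s : {subset map s0 s <= s}.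
 move=> w /mapP [y ys ->]; move: ys; rewrite mem_undup => /mapP [n nl ->].
 rewrite mem_iota /= in nl.
 rewrite gal_horner // s0z mem_undup; have [lt|ge] := ltnP n.+1 l.
 by apply: map_f; rewrite mem_iota.
 have -> : n.+1 = l by apply/eqP; rewrite eqn_leq ge nl.
 apply/mapP; exists 0%N; first by rewrite mem_iota prim_gt0.
 by rewrite (prim_expr_order zeta_prim) expr0.
have us : uniq (map s0 s) by rewrite map_inj_uniq ?undup_uniq //; exact: can_inj (@bij_funK _ s0).
have [|_ es] := uniq_min_size us s0s; first by rewrite size_map.
have fixp : map_poly s0 (\prod_(y <- s) ('X - y%:P)) = \prod_(y <- s) ('X - y%:P).
 rewrite rmorph_prod /=; under eq_bigr do rewrite map_polyXsubC.
 rewrite -(big_map s0 predT (fun y => 'X - y%:P)); apply: perm_big.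
 by apply: uniq_perm => //; exact: undup_uniq.
have PL : \prod_(y <- s) ('X - y%:P) \is a polyOver Lf.
 rewrite big_seq; apply: rpred_prod => y /sL yL.
 by rewrite polyOverXsubC.
apply/polyOverP => n; apply: kummer_fixed; first by apply/(fldP kummer_field_sub)/(polyOverP PL).
by rewrite -[in RHS]fixp coef_map.
Qed.
End Gen.
End KummerExtension.

(** * The Krull topology in terms of finite sets *)

Section GaloisTopology.
Variables (E : fieldType) (F : set E).

Lemma open_galP (U : set (gal F)) : open U <->
 forall g, U g -> exists D : seq E, forall h : gal F, {in D, h =1 g} -> U h.
split=> [oU g Ug|h].
 have [D fD DU] := (oU : pw_open _ U) g Ug.
 have /finite_seqP [r rD] := fD.
 exists (map (fun p : {_ : unit & E} => tagged p) r) => h hg; apply: DU => p Dp.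
 by apply: hg; apply/mapP; exists p => //; move: Dp; rewrite rD.
suff : pw_open (fun (p : {_ : unit & E}) (g : gal F) => g (tagged p)) U by [].
move=> g Ug; have [D DU] := h g Ug.
exists [set` (map (fun x : E => existT (fun _ : unit => (E : Type)) tt x) D)] ; first exact: finite_seq.
move=> t tg; apply: DU => x xD.
by apply: (tg (existT (fun _ : unit => (E : Type)) tt x)); apply/mapP; exists x.
Qed.

Lemma closed_galP (H : set (gal F)) (u : gal F) : closed H ->
 (forall D : seq E, exists2 h, H h & {in D, h =1 u}) -> H u.
move=> cH happ; apply: contrapT => nHu.
have /open_galP /(_ u nHu) [D DU] : open (~` H) by rewrite openC.
by have [h Hh hu] := happ D; apply: (DU h).
Qed.

Lemma closed_gal_fix (x : E) : closed [set u : gal F | u x = x].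
rewrite -openC; apply/open_galP => g gx; exists [:: x] => h /(_ x (mem_head _ _)) /= e.
by rewrite /setC /= e.
Qed.

Lemma gal_fix_subgroup (A : set E) : is_subgroup [set u : gal F | forall x, A x -> u x = x].
split=> [|u v hu hv|u hu] x Ax //=; first by rewrite hv ?hu.
by rewrite -{1}(hu x Ax) bij_funK.
Qed.
End GaloisTopology.

Lemma expf_nz (E : fieldType) (l : nat) (a z : E) : prime l -> a ^+ l = z -> z != 0 -> a != 0.
by move=> pl <-; apply: contraNneq => ->; rewrite expr0n gtn_eqF ?prime_gt0. Qed.

(** * Commutators and powers modulo G^(3) *)

Section CentralSeries.
Variables (G : topGroupType) (l : nat).
Local Open Scope group_scope.
Implicit Types x y z : G.

Lemma closed_gen_closed (S : set G) : closed (closed_gen S).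
by apply: closed_bigI => H [_ cH _]. Qed.

Lemma closed_gen_min (S H : set G) : is_subgroup H -> closed H -> S `<=` H -> closed_gen S `<=` H.
by move=> sH cH SH x; apply. Qed.

Lemma G2_comm x y : G2 G l [~ x, y].
by apply: sub_closed_gen; left; exists x, y. Qed.
Lemma G2_exp x : G2 G l (x ^+ l).
by apply: sub_closed_gen; right; exists x. Qed.
Lemma G3_comm x y : G2 G l y -> G3 G l [~ x, y].
by move=> Gy; apply: sub_closed_gen; left; exists x, y. Qed.
Lemma G3_exp x : G3 G l (x ^+ ((if l == 2%N then 2%N else 1%N) * l)%N).
by apply: sub_closed_gen; right; exists x. Qed.

Lemma nsub1 (N : nsubgroup G) : N 1. by case: (nsub_subgroup N). Qed.
Lemma nsubM (N : nsubgroup G) x y : N x -> N y -> N (x * y).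
by case: (nsub_subgroup N) => _ h _; exact: h. Qed.
Lemma nsubV (N : nsubgroup G) x : N x -> N x^-1.
by case: (nsub_subgroup N) => _ _ h; exact: h. Qed.
Lemma qclass_eq1 (N : nsubgroup G) x : qclass N x = 1 <-> N x.
split=> [/(qclassP N x 1)|h]; first by rewrite mulg1 => /nsubV; rewrite invgK.
by apply/(qclassP N x 1); rewrite mulg1; exact: nsubV.
Qed.
Lemma qclassX (N : nsubgroup G) x n : qclass N (x ^+ n) = qclass N x ^+ n.
by elim: n => [|n IH]; rewrite ?expg0 ?expgS // qclassM IH. Qed.
Lemma qclassR (N : nsubgroup G) x y : qclass N [~ x, y] = [~ qclass N x, qclass N y].
by rewrite /commg /conjg !qclassM !qclassV. Qed.

Lemma G3_comm' x y : G2 G l y -> G3 G l [~ y, x].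
move=> /(G3_comm x) h; have -> : [~ y, x] = [~ x, y]^-1 by rewrite /commg /conjg !invgM !invgK !mulgA.
exact: nsubV.
Qed.

Lemma commMgJ (H : groupType) (x y z : H) : [~ x * y, z] = [~ x, z] ^ y * [~ y, z].
by rewrite /commg /conjg !invgM !mulgA mulgK mulgK. Qed.

Lemma commgMJ (H : groupType) (x y z : H) : [~ x, y * z] = [~ x, z] * [~ x, y] ^ z.
by rewrite /commg /conjg !invgM !mulgA mulgK mulgK. Qed.

Notation c := (to_c l).

Lemma to_cM x y : c (x * y) = c x * c y. exact: qclassM. Qed.
Lemma to_aM x y : to_a l (x * y) = to_a l x * to_a l y. exact: qclassM. Qed.

Lemma G2_central x y : G2 G l x -> commute (c x) (c y).
by move=> Gx; apply/commgP/eqP; rewrite -qclassR; apply/qclass_eq1; exact: G3_comm'.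
Qed.

Lemma commg_central (u : Gc G l) x y : commute [~ c x, c y] u.
have [z ->] := qclass_surj u; rewrite -qclassR; apply: G2_central; exact: G2_comm.
Qed.

Lemma comm_c_mull x y z : [~ c (x * y), c z] = [~ c x, c z] * [~ c y, c z].
by rewrite to_cM commMgJ; congr (_ * _); apply/conjg_fixP/commgP/commg_central. Qed.

Lemma comm_c_mulr x y z : [~ c x, c (y * z)] = [~ c x, c y] * [~ c x, c z].
rewrite to_cM commgMJ (_ : _ ^ _ = [~ c x, c y]); first exact: commg_central.
by apply/conjg_fixP/commgP/commg_central.
Qed.

Lemma mulg_continuous2 (f g : G -> G) : continuous f -> continuous g ->
 continuous (fun x => f x * g x).
move=> cf cg x W /(@mulg_continuous G (f x, g x)) [[A B] /= [nA nB] AB].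
have h1 : nbhs x (f @^-1` A) := cf x A nA.
have h2 : nbhs x (g @^-1` B) := cg x B nB.
by apply: filterS (filterI h1 h2) => y [Ay By]; apply: (AB (f y, g y)).
Qed.

(** For odd l this is immediate. For l = 2 the elements central modulo G^(3) whose square lies in
    G^(3) form a closed subgroup; it contains commutators, since [a, b]^2 = [a^2, b] modulo G^(3),
    and squares, since fourth powers lie in G^(3). *)
Lemma G2_expG3 x : G2 G l x -> G3 G l (x ^+ l).
have cid : continuous (@idfun G) by move=> y; exact: cvg_id.
have cc (a : G) : continuous (fun _ : G => a) by move=> y; apply: cst_continuous.
have [l2|l2] := eqVneq l 2%N; last first.
 by move=> _; have := G3_exp x; rewrite (negbTE l2) mul1n.
pose X : set G := [set s | (forall g, G3 G l [~ s, g]) /\ G3 G l (s ^+ l)].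
suff : closed_gen ([set z | exists x y, z = [~ x, y]] `|` [set z | exists x, z = x ^+ l]) `<=` X.
 move=> h Gx; have [_ hx] := h x Gx; exact: hx.
have cent s : (forall g, G3 G l [~ s, g]) <-> forall u : Gc G l, commute (c s) u.
 split=> h u; last by apply/qclass_eq1; rewrite qclassR; apply/eqP/commgP.
 by have [z ->] := qclass_surj u; apply/commgP/eqP; rewrite -qclassR; apply/qclass_eq1.
apply: closed_gen_min.
- split=> [|s t [/cent sc slope] [/cent tc tl]|s [/cent sc slope]].
 + by split=> [g|]; rewrite ?comm1g ?expg1n; exact: nsub1.
 + split; first by apply/cent => u; rewrite to_cM; apply/commute_sym/commuteM; apply/commute_sym.
 apply/qclass_eq1; rewrite qclassX qclassM expgMn; last exact: sc.
 by rewrite -!qclassX (proj2 (qclass_eq1 _ _) slope) (proj2 (qclass_eq1 _ _) tl) mulg1.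
 + split; first by apply/cent => u; rewrite /to_c qclassV; apply/commute_sym/commuteV/commute_sym.
 by rewrite expVgn; apply: nsubV.
- have -> : X = (\bigcap_g ((fun s => [~ s, g]) @^-1` (nsub_set (G3 G l)))) `&`
 ((fun s => s ^+ l) @^-1` (nsub_set (G3 G l))).
 apply/seteqP; split=> s [h1 h2]; split=> //; first by move=> g _; exact: h1.
 by move=> g; exact: h1.
 apply: closedI; last first.
 apply: closed_comp; last exact: closed_gen_closed.
 move=> s _; rewrite l2; exact: (mulg_continuous2 cid cid).
 apply: closed_bigI => g _; apply: closed_comp; last exact: closed_gen_closed.
 move=> s _; apply: mulg_continuous2; first exact: invg_continuous.
 by apply: mulg_continuous2 => //; apply: mulg_continuous2.
move=> _ [[a [b ->]]|[a ->]]; split.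
- by move=> g; apply: G3_comm'; exact: G2_comm.
- apply/qclass_eq1; rewrite qclassX qclassR.
 have -> : [~ c a, c b] ^+ l = [~ c a, c b] ^+ 2 by congr (_ ^+ _).
 rewrite expg2 -comm_c_mull -qclassR; apply/qclass_eq1; apply: G3_comm'.
 have -> : a * a = a ^+ l by rewrite -[a * a]/(a ^+ 2); congr (_ ^+ _).
 exact: G2_exp.
- by move=> g; apply: G3_comm'; exact: G2_exp.
have := G3_exp a; have -> : ((if l == 2 then 2 else 1) * l = l * l)%N by rewrite l2.
by rewrite expgnA.
Qed.
End CentralSeries.

(** * Alternating forms and functionals on the completed exterior square *)

Section WedgeForms.
Variable l : nat.
Hypothesis pl : prime l.

Section OneGroup.
Variable M : groupType.

Lemma to_wedge2B (u v : free2 l M) : to_wedge2 (u - v) = to_wedge2 u - to_wedge2 v.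
by apply/esym/eqP; rewrite subr_eq -pi_addr subrK. Qed.

Lemma to_wedge2_0 : to_wedge2 (0 : free2 l M) = 0.
by rewrite -(subrr 0) to_wedge2B subrr. Qed.

Lemma to_wedge2D (u v : free2 l M) : to_wedge2 (u + v) = to_wedge2 u + to_wedge2 v.
have -> : u + v = u - (0 - v) by rewrite sub0r opprK.
by rewrite !to_wedge2B to_wedge2_0 sub0r opprK.
Qed.

Lemma wedge_span (u : wedge2 l M) : exists L : seq (M * M), u = \sum_(p <- L) wedge l p.1 p.2.
rewrite -[u]to_wedge2_repr; set D := repr u; rewrite -[D]freeg_sumE.
have add (x y : free2 l M) : (exists L : seq (M * M), to_wedge2 x = \sum_(p <- L) wedge l p.1 p.2) ->
 (exists L : seq (M * M), to_wedge2 y = \sum_(p <- L) wedge l p.1 p.2) ->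
 exists L : seq (M * M), to_wedge2 (x + y) = \sum_(p <- L) wedge l p.1 p.2.
 by move=> [L e] [L' e']; exists (L ++ L'); rewrite to_wedge2D e e' big_cat.
have zero : exists L : seq (M * M), to_wedge2 (0 : free2 l M) = \sum_(p <- L) wedge l p.1 p.2 by exists [::]; rewrite big_nil to_wedge2_0.
elim: (dom D) => [|p s IH]; first by rewrite big_nil.
rewrite big_cons; apply: (add _ _ _ IH); set c := coeff _ _.
have -> : Freeg [:: (c, p)] = fgbasis 'F_l p *+ (c : nat).
 apply/eqP/freeg_eqP => q; rewrite coeffMn !coeffU mul1r -[RHS]mulr_natl.
 by congr (_ * _); rewrite -[LHS]natr_Zp.
elim: (c : nat) => [|n IHn]; first by rewrite mulr0n.
rewrite mulrS; apply: (add (fgbasis 'F_l p) (fgbasis 'F_l p *+ n) _ IHn).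
by exists [:: p]; rewrite big_seq1 /wedge /pairg -surjective_pairing.
Qed.

Lemma wedge_form (w : M -> M -> 'F_l) :
 (forall x y z, w (x * y)%g z = w x z + w y z) ->
 (forall x y z, w x (y * z)%g = w x y + w x z) -> (forall x, w x x = 0) ->
 exists Phi : wedge2 l M -> 'F_l, [/\ forall u v, Phi (u + v) = Phi u + Phi v, Phi 0 = 0 &
 forall x y, Phi (wedge l x y) = w x y].
move=> wl wr wa; pose f (p : M * M) : ('F_l)^o := w p.1 p.2.
pose P0 : {freeg (M * M)%type / 'F_l} -> ('F_l)^o := fglift f.
have P0B : {morph P0 : u v / u - v} by move=> u v; exact: (@lift_is_additive 'F_l (M * M)%type ('F_l)^o f u v).
have P0p x y : P0 (pairg l x y) = w x y by rewrite /P0 /pairg /fgbasis liftU /GRing.scale /= mul1r.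
have Pnull u : u \in wedge_null l M -> P0 u = 0.
 move=> /zspanP h; apply: (h [set u | P0 u = 0]) => /=.
 - by rewrite -(subrr 0) P0B subrr.
 - by move=> x y hx hy; rewrite P0B hx hy subrr.
 - move=> _ [[x [x' [y ->]]]|[x [y [y' ->]]]|[x ->]] /=; rewrite ?P0B !P0p.
 + by rewrite wl addrAC addrK subrr.
 + by rewrite wr addrAC addrK subrr.
 + exact: wa.
have Peq (u v : free2 l M) : to_wedge2 u = to_wedge2 v -> P0 u = P0 v by move=> /to_wedge2P /Pnull; rewrite P0B => /eqP; rewrite subr_eq0 => /eqP.
have PE (u : free2 l M) : P0 (repr (to_wedge2 u)) = P0 u by apply: Peq; exact: to_wedge2_repr.
have PB (u v : wedge2 l M) : P0 (repr (u - v)) = P0 (repr u) - P0 (repr v) by rewrite -P0B -[in RHS]PE to_wedge2B !to_wedge2_repr.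
have P00 : P0 (repr (0 : wedge2 l M)) = 0 by rewrite -(subrr 0) PB subrr.
exists (fun u => P0 (repr u)); split=> // [u v|x y]; last by rewrite PE.
by rewrite -[v in LHS]opprK PB -[- v]sub0r PB P00 sub0r opprK.
Qed.
End OneGroup.

Lemma eh_addE' (M : topGroupType) (u v : ext2hat l M) (H : open_nsub M) : (u + v) H = u H + v H.
exact: eh_addE. Qed.

Lemma eh_sumE (M : topGroupType) I (r : seq I) (f : I -> ext2hat l M) (H : open_nsub M) :
 (\sum_(i <- r) f i) H = \sum_(i <- r) (f i) H.
elim: r => [|x r IH]; first by rewrite !big_nil.
by rewrite !big_cons eh_addE' IH.
Qed.

Section Sub.
Variable M : topGroupType.

Lemma open_nsubI (H H' : open_nsub M) : exists I : open_nsub M,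
 (forall x, I x -> H x) /\ (forall x, I x -> H' x).
have sI : is_subgroup (nsub_set H `&` nsub_set H').
 split; first by split; exact: nsub1.
 by move=> x y [h1 h2] [h3 h4]; split; apply: nsubM.
 by move=> x [h1 h2]; split; apply: nsubV.
have nI x y : (nsub_set H `&` nsub_set H') x -> (nsub_set H `&` nsub_set H') (x ^ y)%g by move=> [h1 h2]; split; apply: nsub_normal.
have oI : open (nsub_set (NSubgroup sI nI)) by apply: openI; exact: on_open.
by exists (OpenNSub oI); split=> x [].
Qed.

Lemma eh_agree (w w' : ext2hat l M) (H J : open_nsub M) : (forall x, J x -> H x) ->
 w J = w' J -> w H = w' H.
by move=> JH e; rewrite -(eh_compat w JH) -(eh_compat w' JH) e. Qed.
End Sub.

Variable G : topGroupType.
Notation A := (Ga G l).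

Definition hsum (L : seq (G * G)) : ext2hat l A :=
 \sum_(p <- L) hat_wedge l (to_a l p.1) (to_a l p.2).

Lemma hsum_cat L L' : hsum (L ++ L') = hsum L + hsum L'.
exact: big_cat. Qed.

Lemma hsum_approx (w : ext2hat l A) (H : open_nsub A) : exists L, (hsum L) H = w H.
have [L wE] := wedge_span (w H).
have /choice [f fP] : forall u : quotgrp H, exists s : G, u = qclass H (to_a l s).
 move=> u; have [a ->] := qclass_surj u; have [s ->] := qclass_surj a; by exists s.
exists [seq (f p.1, f p.2) | p <- L]; rewrite wE /hsum eh_sumE big_map.
by apply: eq_bigr => p _ /=; rewrite -!fP.
Qed.

(** The last two clauses say that the form factors through G^a and is locally constant, which is
    what a functional on the completed square needs. *)
Definition alt_form (W : G -> G -> 'F_l) : Prop :=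
 [/\ forall s t r, W (s * t)%g r = W s r + W t r, forall s t r, W s (t * r)%g = W s t + W s r,
 forall s, W s s = 0, forall s t, G2 G l s -> W s t = 0 &
 exists2 U : set G, open U & U 1%g /\ forall s t, U s -> W s t = 0].

Lemma alt_formN W s t : alt_form W -> W s t = - W t s.
move=> [Wl Wr Wa _ _]; have := Wa (s * t)%g; rewrite Wl !Wr !Wa add0r addr0.
by move/eqP; rewrite addr_eq0 => /eqP.
Qed.

(** The radical of the form is open, so the form lives on the finite level [H], its image in G^a. *)
Lemma alt_form_functional W : alt_form W ->
 exists (H : open_nsub A) (Om : ext2hat l A -> 'F_l),
 [/\ forall u v, Om (u + v) = Om u + Om v,
 forall s t, Om (hat_wedge l (to_a l s) (to_a l t)) = W s t &
 forall u v : ext2hat l A, u H = v H -> Om u = Om v].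
move=> aW; have [Wl Wr Wa W2 [U oU [U1 UW]]] := aW.
have W1 r : W 1%g r = 0 by apply: UW.
have WV s r : W s^-1%g r = - W s r by apply/eqP; rewrite -addr_eq0 -Wl mulVg W1.
have sN : is_subgroup [set s | forall t, W s t = 0] by split=> [t|s s' hs hs' t|s hs t] /=; rewrite ?W1 ?Wl ?WV ?hs ?hs' ?addr0 ?oppr0.
have oN : open [set s | forall t, W s t = 0].
 have -> : [set s | forall t, W s t = 0] =
 \bigcup_(n in [set s | forall t, W s t = 0]) (fun x => n^-1 * x)%g @^-1` U.
 apply/seteqP; split=> s /=; first by move=> hs; exists s => //=; rewrite mulVg.
 move=> [n hn /= Us] t; have -> : s = (n * (n^-1 * s))%g by rewrite mulgA mulgV mul1g.
 by rewrite Wl hn UW ?addr0.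
 apply: bigcup_open => n _; apply: open_comp => // x _.
 apply: mulg_continuous2; last by move=> y; exact: cvg_id.
 by move=> y; apply: cst_continuous.
pose HA : set A := to_a l @` [set s | forall t, W s t = 0].
have sH : is_subgroup HA.
 split; first by exists 1%g => //= t.
 move=> _ _ [s hs <-] [s' hs' <-]; exists (s * s')%g; last exact: to_aM.
 by move=> t; rewrite Wl hs hs' addr0.
 move=> _ [s hs <-]; exists s^-1%g; last by rewrite /to_a qclassV.
 by move=> t; rewrite WV hs oppr0.
have nH x y : HA x -> HA (x ^ y)%g.
 move=> [s hs <-]; have [t ->] := qclass_surj y; exists (s ^ t)%g.
 by move=> r; rewrite /conjg !Wl WV hs add0r addNr.
 by rewrite /conjg /to_a !qclassM qclassV.
have oH : open (nsub_set (NSubgroup sH nH)) by exact: qclass_open.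
pose H := OpenNSub oH; exists H.
have inH s : H (to_a l s) -> forall t, W s t = 0.
 move=> [s' hs' /esym/(qclassP (G2 G l) s s') e] t.
 have -> : s = (s' * (s^-1 * s')^-1)%g by rewrite invgM invgK mulgA mulgV mul1g.
 by rewrite Wl hs' WV W2 // oppr0 addr0.
have /choice [f fP] : forall u : quotgrp H, exists s : G, u = qclass H (to_a l s) by move=> u; have [a ->] := qclass_surj u; have [s ->] := qclass_surj a; exists s.
have fW s t : W (f (qclass H (to_a l s))) t = W s t.
 have /(qclassP H) := fP (qclass H (to_a l s)); rewrite -/(to_a l _) -qclassV -qclassM => h.
 by have := inH _ h t; rewrite Wl WV => /eqP; rewrite addrC subr_eq0 => /eqP.
have fW' s t : W t (f (qclass H (to_a l s))) = W t s by rewrite alt_formN // fW -alt_formN.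
have fM u v t : W (f (u * v)%g) t = W (f u) t + W (f v) t by rewrite {1}[u]fP {1}[v]fP -qclassM -to_aM fW Wl.
have [||//|Phi [PD P0 PW]] := @wedge_form (quotgrp H) (fun u v => W (f u) (f v)).
- by move=> x y z; exact: fM.
- by move=> x y z; rewrite alt_formN // fM opprD -!alt_formN.
exists (fun u => Phi (u H)); split=> [u v|s t|u v ->] //.
 by rewrite eh_addE' PD.
by rewrite /= PW fW fW'.
Qed.
End WedgeForms.

Section CommClass.
Local Open Scope group_scope.
Variables (G : topGroupType) (l : nat).

Lemma to_cR (s t : G) : to_c l [~ s, t] = [~ to_c l s, to_c l t].
exact: qclassR. Qed.

Lemma to_cR_mull (s t r : G) : to_c l [~ s * t, r] = to_c l ([~ s, r] * [~ t, r]).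
by rewrite [RHS]to_cM !to_cR comm_c_mull. Qed.

Lemma to_cR_mulr (s t r : G) : to_c l [~ s, t * r] = to_c l ([~ s, t] * [~ s, r]).
by rewrite [RHS]to_cM !to_cR comm_c_mulr. Qed.
End CommClass.

(** * Places of a field and their existence *)

Section Places.
Variables (E : fieldType) (Q : closedFieldType).
Implicit Types (S P : set (E * Q)) (x y : E) (p : {poly E}) (q : {poly Q}).

(** The graph of a ring homomorphism from a subring of E to Q; the last clause makes it
    single-valued. *)
Definition hom_graph S : Prop :=
 [/\ S (1, 1), forall x y a b, S (x, a) -> S (y, b) -> S (x - y, a - b),
 forall x y a b, S (x, a) -> S (y, b) -> S (x * y, a * b) &
 forall b, S (0, b) -> b = 0].

(** The graph of the residue map of a valuation ring, with residues taken in the algebraically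
    closed field Q. *)
Definition place P : Prop :=
 [/\ hom_graph P, forall x a, P (x, a) -> a != 0 -> P (x^-1, a^-1) &
 forall x, (exists a, P (x, a)) \/ P (x^-1, 0)].

Section HomGraph.
Variable S : set (E * Q).
Hypothesis hS : hom_graph S.

Lemma hg1 : S (1, 1). by case: hS. Qed.
Lemma hgB x y a b : S (x, a) -> S (y, b) -> S (x - y, a - b).
by case: hS => _ h _ _; exact: h. Qed.
Lemma hgM x y a b : S (x, a) -> S (y, b) -> S (x * y, a * b).
by case: hS => _ _ h _; exact: h. Qed.
Lemma hg0 : S (0, 0). by have := hgB hg1 hg1; rewrite !subrr. Qed.
Lemma hgN x a : S (x, a) -> S (- x, - a).
by move=> h; have := hgB hg0 h; rewrite !sub0r. Qed.
Lemma hgD x y a b : S (x, a) -> S (y, b) -> S (x + y, a + b).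
by move=> h h'; have := hgB h (hgN h'); rewrite !opprK. Qed.
Lemma hg_fun x a b : S (x, a) -> S (x, b) -> a = b.
move=> h h'; have := hgB h h'; rewrite subrr; have [_ _ _ h0] := hS.
by move/h0/eqP; rewrite subr_eq0 => /eqP.
Qed.
Lemma hgX x a n : S (x, a) -> S (x ^+ n, a ^+ n).
by move=> h; elim: n => [|n IH]; rewrite ?expr0 ?exprS; [exact: hg1|exact: hgM]. Qed.
Lemma hg_sum I (r : seq I) (f : I -> E) (g : I -> Q) : (forall i, S (f i, g i)) ->
 S (\sum_(i <- r) f i, \sum_(i <- r) g i).
by move=> h; elim: r => [|i r IH]; rewrite ?big_nil ?big_cons; [exact: hg0|exact: hgD].
Qed.
Lemma hg_prod I (r : seq I) (f : I -> E) (g : I -> Q) : (forall i, S (f i, g i)) ->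
 S (\prod_(i <- r) f i, \prod_(i <- r) g i).
by move=> h; elim: r => [|i r IH]; rewrite ?big_nil ?big_cons; [exact: hg1|exact: hgM].
Qed.

Definition coefs_graph p q := forall n, S (p`_n, q`_n).

Lemma cg_B p p' q q' : coefs_graph p q -> coefs_graph p' q' -> coefs_graph (p - p') (q - q').
by move=> h h' n; rewrite !coefB; apply: hgB. Qed.
Lemma cg_M p p' q q' : coefs_graph p q -> coefs_graph p' q' -> coefs_graph (p * p') (q * q').
move=> h h' n; rewrite !coefM.
by apply: (hg_sum _ (f := fun k : 'I_n.+1 => p`_k * p'`_(n - k)) (g := fun k : 'I_n.+1 => q`_k * q'`_(n - k))) => k; exact: hgM.
Qed.
Lemma cg_C x a : S (x, a) -> coefs_graph x%:P a%:P.
by move=> h n; rewrite !coefC; case: eqP => _ //; exact: hg0. Qed.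
Lemma cg_X n : coefs_graph 'X^n 'X^n.
by move=> m; rewrite !coefXn; case: eqP => _; [exact: hg1|exact: hg0]. Qed.

Lemma hg_horner p q x a : coefs_graph p q -> S (x, a) -> S (p.[x], q.[a]).
move=> h hx; have [lt1 lt2] : (size p <= maxn (size p) (size q) /\ size q <= maxn (size p) (size q))%N.
 by rewrite leq_maxl leq_maxr.
rewrite (horner_coef_wide _ lt1) (horner_coef_wide _ lt2); apply: hg_sum => i.
by apply: hgM => //; exact: hgX.
Qed.

(** The obstruction to extending the homomorphism to x: the maximal ideal generates the unit ideal
    in S[x]. *)
Definition bad p x := (forall n, S (p`_n, 0)) /\ p.[x] = 1.

Hypothesis loc : forall x a, S (x, a) -> a != 0 -> S (x^-1, a^-1).

(** Chevalley's descent: relations 1 = p(x) and 1 = p'(1/x) with coefficients of residue 0 cannot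
    coexist, since the shorter one lowers the degree of the longer one. *)
Lemma bad_pair_le p p' x : x != 0 -> (size p' <= size p)%N ->
 bad p x -> bad p' x^-1 -> (forall r r' : {poly E}, (size r + size r' < size p + size p')%N -> bad r x -> bad r' x^-1 -> False) -> False.
move=> x0 le [pm px] [pm' px'] IH.
pose N := (size p).-1; pose u := 1 - p'`_0.
have Su : S (u, 1) by have := hgB hg1 (pm' 0%N); rewrite subr0.
have u0 : u != 0.
 apply: contraTneq (oner_neq0 Q) => u0; rewrite negbK; move: Su; rewrite u0.
 by have [_ _ _ h] := hS => /h ->.
have Su' : S (u^-1, 1) by have := loc Su (oner_neq0 _); rewrite invr1.
have sp : (0 < size p)%N.
 rewrite lt0n size_poly_eq0; apply: contraTneq (oner_neq0 E) => p0.
 by rewrite -px p0 horner0 eqxx.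
have sN : size p = N.+1 by rewrite prednK.
have sp' : (size p' <= N.+1)%N by rewrite -sN.
(* The relation p'(1/x) = 1, multiplied by x^N, reads [r.[x] = u * x ^+ N], and u is a unit; it
   eliminates the leading term of p. *)
pose r := \sum_(k < N) p'`_k.+1 *: 'X^(N - k.+1).
have rx : r.[x] = u * x ^+ N.
 rewrite /u mulrBl mul1r -[X in X - _](mul1r (x ^+ N)) -px' (horner_coef_wide _ sp').
 rewrite big_ord_recl expr0 mulr1 mulrDl addrAC subrr add0r mulr_suml /r horner_sum.
 apply: eq_bigr => k _; rewrite !hornerE -mulrA; congr (_ * _).
 have kN : (k.+1 <= N)%N := ltn_ord k.
 have -> : x ^+ N = x ^+ (N - k.+1) * x ^+ k.+1 by rewrite -exprD subnK.
 by rewrite mulrCA -exprMn mulVf // expr1n mulr1.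
have rm n : S (r`_n, 0).
 rewrite /r coef_sum; have := hg_sum (index_enum 'I_N) (f := fun k => (p'`_k.+1 *: 'X^(N - k.+1))`_n) (g := fun=> 0).
 rewrite big1_eq => h; apply: h => k; rewrite coefZ coefXn; case: eqP => _; rewrite ?mulr1 ?mulr0 //.
 exact: hg0.
pose p2 := p - lead_coef p *: 'X^N + (lead_coef p / u) *: r.
have lm : S (lead_coef p, 0) by exact: pm.
apply: (IH p2 p') => //.
- rewrite ltn_add2r sN ltnS.
 have szr : (size r <= N)%N.
 apply: (leq_trans (size_sum _ _ _)); apply/bigmax_leqP => k _.
 apply: (leq_trans (size_scale_leq _ _)); rewrite size_polyXn.
 by rewrite -subSn ?subSS ?leq_subr //; exact: ltn_ord.
 apply: (leq_trans (size_polyD _ _)); rewrite geq_max (leq_trans (size_scale_leq _ _)) // andbT.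
 apply/leq_sizeP => k; rewrite leq_eqVlt => /orP[/eqP <-|Nk].
 by rewrite coefB coefZ coefXn eqxx mulr1 lead_coefE subrr.
 rewrite coefB coefZ coefXn gtn_eqF // mulr0 subr0.
 by apply/leq_sizeP: Nk; rewrite sN.
- split=> [n|].
 have h1 : S ((lead_coef p *: 'X^N)`_n, 0) by rewrite coefZ coefXn; case: eqP => _; rewrite ?mulr1 ?mulr0 //; exact: hg0.
 have h2 : S (((lead_coef p / u) *: r)`_n, 0) by rewrite coefZ; have := hgM (hgM lm Su') (rm n); rewrite !mul0r.
 have -> : p2`_n = p`_n - (lead_coef p *: 'X^N)`_n + ((lead_coef p / u) *: r)`_n by rewrite /p2 coefD coefB.
 by have := hgD (hgB (pm n) h1) h2; rewrite subrr addr0.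
 by rewrite !hornerE rx mulrA divfK // subrK px.
Qed.
End HomGraph.

Lemma bad_pair S p p' x : hom_graph S -> (forall x a, S (x, a) -> a != 0 -> S (x^-1, a^-1)) ->
 x != 0 -> bad S p x -> bad S p' x^-1 -> False.
move=> hS loc; have [n] := ubnP (size p + size p').
elim: n p p' x => // n IH p p' x lt x0 b b'.
have [le|/ltnW le] := leqP (size p') (size p).
 apply: (bad_pair_le hS loc x0 le b b') => r r' lt' br br'.
 by apply: (IH r r' x) => //; exact: leq_trans lt' lt.
apply: (bad_pair_le hS loc (x := x^-1) _ le b'); rewrite ?invr_eq0 ?invrK // => r r' lt' br br'.
apply: (IH r' r x) => //; rewrite addnC; apply: leq_trans lt' _.
by rewrite addnC.
Qed.

Lemma size_sub_lead (R : nzRingType) (p q : {poly R}) : p != 0 -> size q = size p ->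
 lead_coef q = lead_coef p -> (size (p - q)%R < size p)%N.
move=> p0 sq lq; have sp : (0 < size p)%N by rewrite size_poly_gt0.
rewrite -(prednK sp) ltnS; apply/leq_sizeP => k; rewrite leq_eqVlt => /orP[/eqP <-|lt].
 by rewrite coefB -[in q`_ _]sq -!lead_coefE lq subrr.
by rewrite (prednK sp) in lt; rewrite coefB !nth_default ?sq // subrr.
Qed.

Lemma hom_graph_zorn S0 : hom_graph S0 -> exists S, [/\ hom_graph S, S0 `<=` S &
 forall S', hom_graph S' -> S `<=` S' -> S' `<=` S].
move=> h0; pose PP X := hom_graph (X `|` S0).
have [F FP Ftot|A [hA Amax]] := @Zorn_bigcup (E * Q) PP; last first.
 exists (A `|` S0); split=> // S' hS' sub.
 apply: contrapT => nsub.
 have e : S' `|` S0 = S' by apply/setUidl => z Sz; apply: sub; right.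
 apply: (Amax S'); last by rewrite /PP e.
 split=> [z Az|S'A]; first by apply: sub; left.
 by apply: nsub => z /S'A Az; left.
pose F' X := F X \/ X = set0.
have F'P X : F' X -> PP X by move=> [/FP//|->]; rewrite /PP set0U.
set U := \bigcup_(X in F) X.
have sub X : F' X -> X `|` S0 `<=` U `|` S0 by move=> [FX|->] z [Xz|G0z]; [left; exists X|right| |right].
have two z z' : (U `|` S0) z -> (U `|` S0) z' ->
 exists X, [/\ F' X, (X `|` S0) z & (X `|` S0) z'].
 move=> [[X FX Xz]|Gz] [[X' FX' Xz']|Gz'].
 - have [XX'|X'X] := Ftot _ _ FX FX'.
 by exists X'; split; [left|left; apply: XX'|left].
 by exists X; split; [left|left|left; apply: X'X].
 - by exists X; split; [left|left|right].
 - by exists X'; split; [left|right|left].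
 - by exists set0; split; [right|right|right].
split.
- by right; exact: hg1.
- move=> x y a b hx hy; have [X [FX Xx Xy]] := two _ _ hx hy.
 by apply: (sub X FX); apply: (hgB (F'P X FX)).
- move=> x y a b hx hy; have [X [FX Xx Xy]] := two _ _ hx hy.
 by apply: (sub X FX); apply: (hgM (F'P X FX)).
move=> b hb; have [X [FX Xx _]] := two _ _ hb hb.
by have [_ _ _] := F'P X FX; apply.
Qed.

Theorem chevalley S0 : hom_graph S0 -> exists P, place P /\ S0 `<=` P.
move=> /hom_graph_zorn [S [hS S0S Smax]]; exists S; split=> //.
have nz x a : S (x, a) -> a != 0 -> x != 0.
 move=> h; apply: contraNneq => x0; move: h; rewrite x0; have [_ _ _ h0] := hS.
 by move=> /h0 ->.
have loc x a : S (x, a) -> a != 0 -> S (x^-1, a^-1).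
 (* The extension of S to the localisation at the elements of nonzero residue. *)
 pose S' : set (E * Q) := [set z | exists x a s t, [/\ S (x, a), S (s, t), t != 0 & z = (x / s, a / t)]].
 have hS' : hom_graph S'.
 split.
 - by exists 1, 1, 1, 1; split; [exact: hg1|exact: hg1|exact: oner_neq0|rewrite !divr1].
 - move=> _ _ _ _ [x1 [a1 [s1 [t1 [h1 k1 n1 [-> ->]]]]]] [x2 [a2 [s2 [t2 [h2 k2 n2 [-> ->]]]]]].
 exists (x1 * s2 - x2 * s1), (a1 * t2 - a2 * t1), (s1 * s2), (t1 * t2); split.
 + by apply: hgB => //; apply: hgM.
 + exact: hgM.
 + exact: mulf_neq0.
 + by rewrite -!mulNr !addf_div ?(nz _ _ k1) ?(nz _ _ k2).
 - move=> _ _ _ _ [x1 [a1 [s1 [t1 [h1 k1 n1 [-> ->]]]]]] [x2 [a2 [s2 [t2 [h2 k2 n2 [-> ->]]]]]].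
 exists (x1 * x2), (a1 * a2), (s1 * s2), (t1 * t2); split; [exact: hgM|exact: hgM|exact: mulf_neq0|].
 by rewrite !mulf_div.
 - move=> _ [x1 [a1 [s1 [t1 [h1 k1 n1 [e ->]]]]]].
 move/esym/eqP: e; rewrite mulf_eq0 invr_eq0 (negbTE (nz _ _ k1 n1)) orbF => /eqP e.
 by move: h1; rewrite e; have [_ _ _ h0] := hS => /h0 ->; rewrite mul0r.
 have sub : S `<=` S'.
 move=> [x1 a1] h; exists x1, a1, 1, 1; split=> //; [exact: hg1|exact: oner_neq0|by rewrite !divr1].
 move=> h a0; apply: (Smax S' hS' sub); exists 1, 1, x, a.
 by split=> //; [exact: hg1|rewrite !div1r].
split=> // x.
have [->|x0] := eqVneq x 0; first by left; exists 0; exact: hg0.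
have ext y : y != 0 -> ~ (exists p, bad S p y) -> exists a, S (y, a).
 move=> y0 nb.
 (* [J] is the ideal of reductions of the polynomial relations of y; a common root of it is an
    admissible residue for y. *)
 pose J q := exists2 p, coefs_graph S p q & p.[y] = 0.
 have JB q q' : J q -> J q' -> J (q - q') by move=> [p h e] [p' h' e']; exists (p - p'); [exact: cg_B|rewrite hornerD hornerN e e' subrr].
 have Jlead q q' d : J q -> J q' -> q != 0 -> J ((lead_coef q' / lead_coef q) *: ('X^d * q)).
 move=> [p h e] [p' h' e'] q0; have l0 : lead_coef q != 0 by rewrite lead_coef_eq0.
 exists ((p'`_(size q').-1 / p`_(size q).-1)%:P * ('X^d * p)); last by rewrite hornerCM hornerM e !mulr0.
 rewrite -mul_polyC; apply: cg_M => //; last by apply: cg_M => //; exact: cg_X.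
 by apply: cg_C => //; apply: hgM => //; apply: loc.
 have [a aJ] : exists a, forall q, J q -> q.[a] = 0.
 have [[q [Jq q0 qmin]]|none] := pselect (exists q, [/\ J q, q != 0 & forall q', J q' -> q' != 0 -> (size q <= size q')%N]); last first.
 exists 0 => q Jq; suff -> : q = 0 by rewrite horner0.
 apply: contrapT => /eqP q0; apply: none.
 have ex : exists n, `[< exists q, [/\ J q, q != 0 & size q = n] >] by exists (size q); apply/asboolP; exists q.
 case: (ex_minnP ex) => n /asboolP [q1 [J1 n1 s1]] minn; exists q1; split=> // q' J' n'.
 by rewrite s1; apply: minn; apply/asboolP; exists q'.
 (* A nonzero constant in [J] would produce an obstructing polynomial for y. *)
 have sq : (1 < size q)%N.
 rewrite ltn_neqAle lt0n size_poly_eq0 q0 andbT eq_sym; apply/eqP => /eqP sq.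
 have [p h e] := Jq; move/size_poly1P: sq => [c c0 qE].
 have hp0 : S (p`_0, c) by have := h 0%N; rewrite qE coefC.
 apply: nb; exists (1 - (p`_0)^-1 *: p); split; last by rewrite hornerD hornerN hornerZ e mulr0 subr0 hornerC.
 move=> n; have := hgB hS (cg_C hS (hg1 hS) n) (hgM hS (loc _ _ hp0 c0) (h n)).
 rewrite coefB coefZ qE !coefC; case: eqP => _; first by rewrite mulVf // subrr.
 by rewrite mulr0 subrr.
 have [a qa] := closed_root_ex sq; exists a.
 move=> q'; have [n] := ubnP (size q'); elim: n q' => // n IH q' lt J'.
 have [->|q'0] := eqVneq q' 0; first by rewrite horner0.
 have le := qmin q' J' q'0; pose d := (size q' - size q)%N.
 pose q2 := q' - (lead_coef q' / lead_coef q) *: ('X^d * q).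
 have J2 : J q2 by apply: JB => //; exact: Jlead.
 have -> : q'.[a] = q2.[a] by rewrite /q2 hornerD hornerN hornerZ hornerM (rootP qa) !mulr0 subr0.
 apply: IH => //; apply: (@leq_trans (size q')); last by rewrite -ltnS.
 have l0 : lead_coef q != 0 by rewrite lead_coef_eq0.
 have szX : size ('X^d * q) = size q' by rewrite size_monicM ?monicXn // size_polyXn addSn /= subnK.
 have lX : lead_coef ('X^d * q) = lead_coef q by rewrite lead_coefM lead_coefXn mul1r.
 apply: size_sub_lead => //; last by rewrite lead_coefZ lX divfK.
 by rewrite size_scale ?szX // mulf_neq0 ?invr_eq0 ?lead_coef_eq0.
 pose S' : set (E * Q) := [set z | exists p q, coefs_graph S p q /\ z = (p.[y], q.[a])].
 have hS' : hom_graph S'.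
 split.
 - by exists 1, 1; rewrite !hornerC; split=> //; exact: cg_C (hg1 hS).
 - move=> _ _ _ _ [p [q [h [-> ->]]]] [p' [q' [h' [-> ->]]]]; exists (p - p'), (q - q').
 by rewrite !hornerD !hornerN; split=> //; exact: cg_B.
 - move=> _ _ _ _ [p [q [h [-> ->]]]] [p' [q' [h' [-> ->]]]]; exists (p * p'), (q * q').
 by rewrite !hornerM; split=> //; exact: cg_M.
 - by move=> _ [p [q [h [e ->]]]]; apply: aJ; exists p.
 have sub : S `<=` S'.
 move=> [u v] h; exists u%:P, v%:P; rewrite !hornerC; split=> //; exact: cg_C.
 exists a; apply: (Smax S' hS' sub); exists 'X, 'X; rewrite !hornerX; split=> //.
 by have := cg_X hS 1; rewrite !expr1.
have [[a h]|nx] := pselect (exists a, S (x, a)); [by left; exists a|right].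
have [[p b]|nb] := pselect (exists p, bad S p x); last first.
 by case: nx; apply: ext.
have [a h] : exists a, S (x^-1, a).
 apply: ext; rewrite ?invr_eq0 // => -[p' b'].
 exact: bad_pair hS loc x0 b b'.
have [a0|a0] := eqVneq a 0; first by rewrite -a0.
by case: nx; exists a^-1; rewrite -[x]invrK; exact: loc.
Qed.
End Places.

(** * Elementary properties of places *)

Section PlaceTheory.
Variables (E : fieldType) (Q : closedFieldType) (P : set (E * Q)).
Hypothesis plP : place P.

Lemma pl_hg : hom_graph P. by case: plP. Qed.
Lemma plV x a : P (x, a) -> a != 0 -> P (x^-1, a^-1).
by case: plP => _ h _; exact: h. Qed.
Lemma pl_total x : (exists a, P (x, a)) \/ P (x^-1, 0).
by case: plP => _ _; apply. Qed.

Lemma pl_nz x a : P (x, a) -> a != 0 -> x != 0.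
move=> h; apply: contraNneq => x0; move: h; rewrite x0; have [_ _ _ h0] := pl_hg.
by move=> /h0 ->.
Qed.

Lemma pl_div x y a b : P (x, a) -> P (y, b) -> b != 0 -> P (x / y, a / b).
by move=> h h' b0; apply: (hgM pl_hg) => //; exact: plV. Qed.

Lemma pl_nonunit x a : x != 0 -> P (x, 0) -> ~ P (x^-1, a).
move=> x0 h h'; have := hgM pl_hg h h'; rewrite divff // mul0r => h1.
by have := hg_fun pl_hg h1 (hg1 pl_hg) => /esym/eqP; rewrite oner_eq0.
Qed.

Lemma pl_scale (s : seq E) : (forall x, x \in s -> x = 0) \/
 exists k, [/\ k \in s, k != 0 & forall x, x \in s -> exists a, P (x / k, a)].
elim: s => [|x s [s0|[k [ks k0 kP]]]]; first by left.
 have [x0|x0] := eqVneq x 0; [left|right].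
 by move=> y; rewrite inE => /orP[/eqP ->|/s0].
 exists x; split=> //; rewrite ?mem_head // => y; rewrite inE => /orP[/eqP ->|/s0 ->].
 by exists 1; rewrite divff //; exact: hg1 pl_hg.
 by exists 0; rewrite mul0r; exact: hg0 pl_hg.
right; have [[a ha]|h] := pl_total (x / k).
 exists k; split=> //; first by rewrite inE ks orbT.
 by move=> y; rewrite inE => /orP[/eqP ->|/kP //]; exists a.
have [x0|x0] := eqVneq x 0.
 exists k; split=> //; first by rewrite inE ks orbT.
 move=> y; rewrite inE => /orP[/eqP ->|/kP //]; exists 0; rewrite x0 mul0r; exact: hg0 pl_hg.
exists x; split=> //; rewrite ?mem_head // => y; rewrite inE => /orP[/eqP ->|ys].
 by exists 1; rewrite divff //; exact: hg1 pl_hg.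
have [b hb] := kP y ys; exists (b * 0); have -> : y / x = (y / k) * (x / k)^-1.
 by rewrite invf_div mulrA divfK.
exact: hgM pl_hg _ _ _ _ hb h.
Qed.

Lemma pl_comp (E' : fieldType) (f : {rmorphism E' -> E}) : place [set z : E' * Q | P (f z.1, z.2)].
have hP := pl_hg; split=> /=.
- split=> [|x y a b|x y a b|b] /=; rewrite ?rmorph1 ?rmorphB ?rmorphM ?rmorph0.
 + exact: hg1.
 + exact: hgB.
 + exact: hgM.
 + by have [_ _ _ h] := hP; exact: h.
- by move=> x a h a0; rewrite fmorphV; exact: plV.
- by move=> x; rewrite fmorphV; exact: pl_total.
Qed.
End PlaceTheory.

Lemma pchar_expr_inj (F : fieldType) q (a b : F) : [pchar F].-nat q -> a ^+ q = b ^+ q -> a = b.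
move=> qp e; apply/eqP; rewrite -subr_eq0; have q0 : (0 < q)%N by case/andP: qp.
have := exprDn_pchar (a - b) b qp; rewrite subrK e -[X in X = _]add0r => /addIr/esym/eqP.
by rewrite expf_eq0 q0.
Qed.

(** * Conjugacy of the places extending a given place *)

Section PlaceConj.
Variable Om : closedFieldType.
Implicit Types (P : set (Om * Om)) (M : set Om).

Definition over_place M P P' := forall x q, M x -> P (x, q) -> P' (x, q).

(** The valuation ring of P is a localisation of the integral closure of its trace on M: z is a
    fraction with unit denominator, whose two terms are finite at every place extending the same
    place of M. *)
Lemma integral_fraction M P z q : subfield M -> place P -> alg_over M z -> P (z, q) ->
 exists b c, [/\ z = c / b, exists2 t, P (b, t) & t != 0 &
 forall P', place P' -> over_place M P P' -> exists t u, P' (b, t) /\ P' (c, u)].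
move=> hM pP Mz Pz; have hP := pl_hg pP.
have [->|z0] := eqVneq z 0.
 exists 1, 0; split; first by rewrite mul0r.
 by exists 1; [exact: hg1|exact: oner_neq0].
 by move=> P' pP' _; exists 1, 0; split; [exact: hg1 (pl_hg pP')|exact: hg0 (pl_hg pP')].
have [p [pM p0 pz]] := Mz.
have [s0|[k [ks k0 kP]]] := pl_scale pP (polyseq p).
 case/eqP: p0; apply/polyP => n; rewrite coef0; have [lt|le] := ltnP n (size p).
 by apply: s0; exact: mem_nth.
 by rewrite nth_default.
have kM : M k by move: ks => /(nthP 0) [n _ <-].
pose r := k^-1 *: p; have rM n : M r`_n by rewrite coefZ mulrC; exact: (sub_div hM).
have rz : r.[z] = 0 by rewrite hornerZ (rootP pz) mulr0.
have rP n : exists t, P (r`_n, t).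
 rewrite coefZ mulrC; have [lt|le] := ltnP n (size p); first by apply: kP; exact: mem_nth.
 by exists 0; rewrite nth_default // mul0r; exact: hg0.
have szr : size r = size p by rewrite size_scale ?invr_eq0.
have exj : exists n, `[< ~ P (r`_n, 0) >].
 have [n ln kE] := nthP 0 ks; exists n; apply/asboolP; rewrite coefZ kE mulVf // => h.
 by have := hg_fun hP h (hg1 hP) => /esym/eqP; rewrite oner_eq0.
have bj n : `[< ~ P (r`_n, 0) >] -> (n <= size p)%N.
 move=> /asboolP h; rewrite leqNgt; apply/negP => lt; apply: h.
 by rewrite nth_default ?szr 1?ltnW //; exact: hg0.
case: (ex_maxnP exj bj) => j /asboolP nj maxj.
have hi n : (j < n)%N -> P (r`_n, 0).
 move=> lt; apply: contrapT => h; have := maxj n; rewrite leqNgt lt => /(_ (introT (asboolP _) h)).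
 by [].
pose N := (size p).+1; have jN : (j <= size p)%N by apply: bj; apply/asboolP.
(* The relation r(z) = 0 is cut at j, the last index whose coefficient has nonzero residue. Then b
   is a polynomial in z and b z one in 1/z, so both are finite wherever z or 1/z is. *)
pose b := \sum_(i < N - j) r`_(i + j) * z ^+ i; pose cc := \sum_(i < j) r`_i * z^-1 ^+ (j.-1 - i).
have eN : (j + (N - j) = N)%N by rewrite subnKC // leqW.
have sum0 : \sum_(i < j) r`_i * z ^+ i + z ^+ j * b = 0.
 rewrite -[RHS]rz (horner_coef_wide _ (n := N)); last by rewrite szr.
 rewrite -[in RHS]eN big_split_ord /=; congr (_ + _); rewrite /b mulr_sumr.
 by apply: eq_bigr => i _; rewrite exprD mulrCA [(i + j)%N]addnC.
have bz : (0 < j)%N -> b * z = - cc.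
 move=> j0; apply: (mulfI (expf_neq0 j.-1 z0)); rewrite mulrCA -exprSr prednK //.
 rewrite [b * _]mulrC; apply/eqP; rewrite mulrN -addr_eq0 addrC -[X in _ == X]sum0; apply/eqP.
 congr (_ + _); rewrite /cc mulr_sumr; apply: eq_bigr => i _.
 have ij : (i <= j.-1)%N by rewrite -ltnS prednK //; exact: ltn_ord.
 rewrite mulrCA; congr (_ * _); rewrite -[in z ^+ j.-1](subnK ij) exprD exprVn mulrAC divff ?mul1r //.
 by rewrite expf_neq0.
have [tj htj] := rP j; have tj0 : tj != 0 by apply/eqP => e; apply: nj; move: htj; rewrite e.
have Pb : P (b, tj).
 have -> : tj = \sum_(i < N - j) (if i == 0%N :> nat then tj else 0) * q ^+ i.
 have Nj : (0 < N - j)%N by rewrite subn_gt0.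
 rewrite (bigD1 (Ordinal Nj)) //= expr0 mulr1 big1 ?addr0 // => i ni.
 by rewrite ifN ?mul0r.
 apply: (hg_sum hP) => i; apply: (hgM hP); last exact: (hgX hP).
 by case: eqP => [->|/eqP i0]; [rewrite add0n|apply: hi; rewrite -addn1 addnC leq_add2r lt0n].
exists b, (b * z); split.
- by rewrite mulrAC divff ?mul1r // (pl_nz pP Pb).
- by exists tj.
move=> P' pP' PP'; have hP' := pl_hg pP'.
have rP' n : exists t, P' (r`_n, t) by have [t h] := rP n; exists t; apply: PP'.
have /choice [t tP] := rP'.
have [[u hu]|hz] := pl_total pP' z.
 have hb : P' (b, \sum_(i < N - j) t (i + j)%N * u ^+ i) by apply: (hg_sum hP') => i; apply: (hgM hP') => //; exact: (hgX hP').
 exists (\sum_(i < N - j) t (i + j)%N * u ^+ i), ((\sum_(i < N - j) t (i + j)%N * u ^+ i) * u).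
 by split=> //; apply: (hgM hP').
have [w hw] : exists w, P' (b * z, w).
 have [j0|j0] := posnP j.
 have b0 : b = 0 by have := sum0; rewrite j0 big_ord0 add0r expr0 mul1r.
 by exists 0; rewrite b0 mul0r; exact: hg0.
 exists (- \sum_(i < j) t i * 0 ^+ (j.-1 - i)); rewrite bz //; apply: (hgN hP').
 by apply: (hg_sum hP') => i; apply: (hgM hP') => //; exact: (hgX hP').
exists (w * 0), w; split=> //; have -> : b = b * z * z^-1 by rewrite mulfK.
exact: (hgM hP').
Qed.

(** For the combinations [x c] of D, the orbit polynomial reduces in the same way at both places, so
    the residue of [x c] at P is the residue at P' of a conjugate. A pigeonhole over many constants
    c makes one automorphism work for all of D. *)
Lemma place_conj_fin M P P' (C : set Om) (D : seq Om) : subfield M -> place P -> place P' ->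
 (forall x, alg_over M x) -> over_place M P P' ->
 infinite_set C -> (forall c, C c -> M c /\ P (c, c)) ->
 (forall d (h : gal M), d \in D -> exists t u, P (h d, t) /\ P' (h d, u)) ->
 exists h : gal M, forall d q, d \in D -> P (d, q) -> P' (h d, q).
move=> hM pP pP' algM PP' infC CP DP; have hP := pl_hg pP; have hP' := pl_hg pP'.
pose th x := xget 0 [set q | P (x, q)]; pose th' x := xget 0 [set q | P' (x, q)].
have thE x q : P (x, q) -> P (x, th x) by move=> h; rewrite /th; case: xgetP => [y _ //|/(_ q)/(_ h)].
have th'E x q : P' (x, q) -> P' (x, th' x) by move=> h; rewrite /th'; case: xgetP => [y _ //|/(_ q)/(_ h)].
have thu x q : P (x, q) -> th x = q by move=> h; exact: (hg_fun hP (thE _ _ h) h).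
have th'u x q : P' (x, q) -> th' x = q by move=> h; exact: (hg_fun hP' (th'E _ _ h) h).
have dP d (h : gal M) : d \in D -> P (h d, th (h d)) by move=> /(DP _ h) [t [u [ht _]]]; exact: thE ht.
have dP' d (h : gal M) : d \in D -> P' (h d, th' (h d)) by move=> /(DP _ h) [t [u [_ hu]]]; exact: th'E hu.
have [L LP] := @orbit_seqs Om M setT D (fun x _ => let: ex_intro r rP := finite_orbit (algM x) in ex_intro _ r (fun h _ => rP h)).
pose n := size D; have [cs [ucs scs csC]] := infinite_seq (n * size L).+1 infC.
pose x c := (Poly D).[c].
have hc (h : gal M) c : c \in cs -> h c = c by move=> /csC /CP [Mc _]; have [_ _ ->] := galP h.
have Pc c : c \in cs -> P (c, c) by move=> /csC /CP [].
have P'c c : c \in cs -> P' (c, c) by move=> /csC /CP [Mc]; exact: PP'.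
have hx (h : gal M) c : c \in cs -> h (x c) = (Poly [seq h y | y <- D]).[c].
 move=> ccs; rewrite /x -[in RHS](hc h c ccs) -map_Poly_id0 ?rmorph0 // horner_map //=.
have Polyg (R : set (Om * Om)) (f : Om -> Om) c (s : seq Om) : hom_graph R -> R (c, c) ->
 {in s, forall y, R (y, f y)} -> R ((Poly s).[c], (Poly (map f s)).[c]).
 move=> hR Rc; elim: s => [|y s IH] Rs; first by rewrite /= !horner0; exact: hg0.
 rewrite /= !horner_cons; apply: (hgD hR); last by apply: Rs; exact: mem_head.
 by apply: (hgM hR) => //; apply: IH => w ws; apply: Rs; rewrite inE ws orbT.
have Ph c (h : gal M) : c \in cs -> P (h (x c), (Poly [seq th (h y) | y <- D]).[c]).
 move=> ccs; rewrite hx // [X in P (_, (Poly X).[_])](map_comp th h) .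
 by apply: Polyg => //; [exact: Pc|move=> _ /mapP [y yD ->]; exact: dP].
have P'h c (h : gal M) : c \in cs -> P' (h (x c), (Poly [seq th' (h y) | y <- D]).[c]).
 move=> ccs; rewrite hx // [X in P' (_, (Poly X).[_])](map_comp th' h).
 by apply: Polyg => //; [exact: P'c|move=> _ /mapP [y yD ->]; exact: dP'].
have key c : c \in cs -> exists h : gal M, th (x c) = th' (h (x c)).
 move=> ccs; have [r rP] := finite_orbit (algM (x c)).
 have [||f [_ fx ffix fO [_ [O fE]]]] := @orbit_poly _ _ [set: gal M] (x c) r; [by []|by move=> h _; exact: rP|].
 have OP y : y \in O -> exists h : gal M, y = h (x c) by move=> yO; have [|h _ ->] := fO y; [rewrite fE root_prod_XsubC|exists h].
 have cg (R : set (Om * Om)) (g : Om -> Om) : hom_graph R -> {in O, forall y, R (y, g y)} ->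
 coefs_graph R f (\prod_(y <- O) ('X - (g y)%:P)).
 move=> hR Rg; rewrite fE; elim: (O) Rg => [|y s IH] Rg; rewrite ?big_nil ?big_cons.
 exact: cg_C (hg1 hR).
 apply: cg_M => //; last by apply: IH => w ws; apply: Rg; rewrite inE ws orbT.
 apply: cg_B => //; first by have := cg_X hR 1; rewrite !expr1.
 by apply: cg_C => //; apply: Rg; exact: mem_head.
 have fP : coefs_graph P f (\prod_(y <- O) ('X - (th y)%:P)) by apply: cg => // y /OP [h ->]; exact: thE (Ph c h ccs).
 have fP' : coefs_graph P' f (\prod_(y <- O) ('X - (th' y)%:P)) by apply: cg => // y /OP [h ->]; exact: th'E (P'h c h ccs).
 have e : \prod_(y <- O) ('X - (th y)%:P) = \prod_(y <- O) ('X - (th' y)%:P).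
 (* The coefficient is Galois-invariant, so a power of it lies in M, where both places agree;
    raising residues to this power is injective. *)
 apply/polyP => m; have [s|q qp Mq] := @fixed_ppower Om M f`_m hM (algM _).
 by rewrite -[in RHS](ffix s) // coef_map.
 apply: (pchar_expr_inj qp); apply: (hg_fun hP' (x := f`_m ^+ q)).
 by apply: PP' => //; exact: hgX (fP m).
 exact: hgX (fP' m).
 have : root (\prod_(y <- O) ('X - (th y)%:P)) (th (x c)).
 rewrite -(big_map th predT (fun y => 'X - y%:P)) root_prod_XsubC; apply: map_f.
 by rewrite -root_prod_XsubC -fE.
 rewrite e -(big_map th' predT (fun y => 'X - y%:P)) root_prod_XsubC => /mapP [y /OP [h ->] eh].
 by exists h.
have /choice [h hP0] : forall c, exists h : gal M, c \in cs -> th (x c) = th' (h (x c)) by move=> c; have [/key [h e]|_] := boolP (c \in cs); [exists h|exists 1%g].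
pose f c := [seq h c y | y <- D].
have [||k kL lt] := @pigeonhole_seq _ _ f n L cs; last 1 first.
- have : has (fun c => f c == k) cs by rewrite has_count (leq_trans _ lt).
 move=> /hasP [c0 c0cs /eqP fc0]; exists (h c0) => d q dD Pd.
 suff : map th D = map th' k.
 rewrite -fc0 -map_comp => /eq_in_map /(_ d dD) /= e.
 by rewrite -(thu _ _ Pd) e; exact: dP'.
 have szk : size k = n by rewrite -fc0 size_map.
 have e0 : Poly (map th D) = Poly (map th' k).
 apply/eqP; rewrite -subr_eq0; apply: contraTT (lt) => nz; rewrite -leqNgt -size_filter.
 have rts : all (root (Poly (map th D) - Poly (map th' k))) [seq c <- cs | f c == k].
 apply/allP => c; rewrite mem_filter => /andP[/eqP fc ccs].
 rewrite rootE hornerD hornerN subr_eq0 -fc /f -map_comp.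
 rewrite -(th'u _ _ (P'h c (h c) ccs)) -hP0 //; apply/eqP/esym/thu.
 by have := Ph c 1%g ccs; rewrite (_ : [seq th _ | y <- D] = map th D).
 rewrite ltnW // (leq_trans (max_poly_roots nz rts (filter_uniq _ ucs))) //.
 rewrite (leq_trans (size_polyD _ _)) // size_polyN geq_max.
 by rewrite !(leq_trans (size_Poly _)) ?size_map ?szk.
 apply: (@eq_from_nth _ 0); first by rewrite !size_map szk.
 by move=> i _; have := congr1 (fun p : {poly Om} => p`_i) e0; rewrite !coef_Poly.
- by move=> c ccs; apply: LP.
by rewrite scs.
Qed.
End PlaceConj.

Section SimpleExtension.
Variable E : fieldType.
Implicit Types F : set E.

Definition fadj F a : set E := [set z | exists p q, [/\ coefs F p, coefs F q & z = p.[a] / q.[a]]].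

Section Closure.
Variables (F : set E) (a : E).
Hypothesis hF : subfield F.

Lemma coefsC x : F x -> coefs F x%:P.
by move=> Fx n; rewrite coefC; case: eqP => _ //; exact: sub0. Qed.
Lemma coefsX : coefs F 'X.
by move=> n; rewrite coefX; exact: sub_nat. Qed.
Lemma coefsB p q : coefs F p -> coefs F q -> coefs F (p - q).
by move=> h h' n; rewrite coefB; exact: subB. Qed.
Lemma coefsD p q : coefs F p -> coefs F q -> coefs F (p + q).
by move=> h h' n; rewrite coefD; exact: subD. Qed.
Lemma coefsM p q : coefs F p -> coefs F q -> coefs F (p * q).
by move=> h h' n; rewrite coefM; apply: sub_sum => // k _; exact: subM. Qed.

Lemma fadj_poly p : coefs F p -> fadj F a p.[a].
by move=> h; exists p, 1; rewrite hornerC divr1; split=> //; exact: coefsC (sub1 hF).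
Qed.

Lemma fadj_incl x : F x -> fadj F a x.
by move=> Fx; have := fadj_poly (coefsC Fx); rewrite hornerC. Qed.

Lemma fadj_gen : fadj F a a.
by have := fadj_poly coefsX; rewrite hornerX. Qed.

Lemma fadj_sub : subfield (fadj F a).
split=> [|_ _ [p [q [h k ->]]] [p' [q' [h' k' ->]]]|_ _ [p [q [h k ->]]] [p' [q' [h' k' ->]]]].
- exact: fadj_incl (sub1 hF).
- have [q0|q0] := eqVneq q.[a] 0.
 by exists (- p'), q'; rewrite q0 invr0 mulr0 sub0r hornerN mulNr; split=> // n; rewrite coefN; exact: subN.
 have [q0'|q0'] := eqVneq q'.[a] 0.
 by exists p, q; rewrite q0' invr0 mulr0 subr0.
 exists (p * q' - p' * q), (q * q'); split; [|exact: coefsM|].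
 by apply: coefsB; exact: coefsM.
 by rewrite hornerD hornerN !hornerM -mulNr addf_div // mulNr.
- exists (p * q'), (q * p'); split; [exact: coefsM|exact: coefsM|].
 by rewrite !hornerM invf_div mulf_div.
Qed.

Lemma fadj_min F' : subfield F' -> F `<=` F' -> F' a -> fadj F a `<=` F'.
move=> hF' FF' Fa _ [p [q [h k ->]]]; apply: (sub_div hF'); apply: (sub_horner hF') => // n.
 exact/FF'/h.
exact/FF'/k.
Qed.

Lemma gal_fadj (s t : gal F) x : s a = t a -> fadj F a x -> s x = t x.
move=> e [p [q [h k ->]]]; rewrite !fmorph_div /=.
by rewrite !gal_horner // e.
Qed.
End Closure.
End SimpleExtension.

Section PlaceExtension.
Variable Om : closedFieldType.
Implicit Types (P : set (Om * Om)) (M : set Om).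

(** The conjugates of a give finitely many candidates on M(a). If each failed at some element, these
    elements, written as integral fractions, would form a finite set contradicting
    [place_conj_fin]. *)
Lemma place_conj_simple M P P' (C : set Om) a : subfield M -> place P -> place P' ->
 (forall x, alg_over M x) -> over_place M P P' ->
 infinite_set C -> (forall c, C c -> M c /\ P (c, c)) ->
 exists g : gal M, forall z q, fadj M a z -> P (z, q) -> P' (g z, q).
move=> hM pP pP' algM PP' infC CP; have hP := pl_hg pP; have hP' := pl_hg pP'.
apply: contrapT => none.
have /choice [W WP] : forall g : gal M, exists z, exists q, [/\ fadj M a z, P (z, q) & ~ P' (g z, q)].
 move=> g; apply: contrapT => h; apply: none; exists g => z q az Pz.
 by apply: contrapT => n; apply: h; exists z, q.
have [r rP] := finite_orbit (algM a).
have /choice [hb hbP] : forall b, exists h : gal M, (exists g : gal M, g a = b) -> h a = b.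
 by move=> b; have [[g e]|n] := pselect (exists g : gal M, g a = b); [exists g|exists 1%g].
pose D0 := [seq W (hb b) | b <- r].
have D0P z : z \in D0 -> exists q, P (z, q) by move=> /mapP [b _ ->]; have [q [_ h _]] := WP (hb b); exists q.
have /choice [bc bcP] : forall z, exists bc : Om * Om, z \in D0 -> [/\ z = bc.2 / bc.1, exists2 t, P (bc.1, t) & t != 0 &
 forall P1, place P1 -> over_place M P P1 -> exists t u, P1 (bc.1, t) /\ P1 (bc.2, u)].
 move=> z; have [/D0P [q Pq]|_] := boolP (z \in D0); last by exists (0, 0).
 by have [b [c h]] := integral_fraction hM pP (algM z) Pq; exists (b, c).
pose D := flatten [seq [:: (bc z).1; (bc z).2] | z <- D0].
have overg (g : gal M) R : over_place M P R -> over_place M P [set z : Om * Om | R (g z.1, z.2)] by move=> h x q Mx Px /=; have [_ _ ->] := galP g => //; apply: h.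
have [d h dD|h hP1] := place_conj_fin hM pP pP' algM PP' infC CP (D := D).
 have [z zD zd] : exists2 z, z \in D0 & (d = (bc z).1 \/ d = (bc z).2).
 move: dD => /flattenP [_ /mapP [z zD ->]]; rewrite !inE => e; exists z => //.
 by case/orP: e => /eqP; [left|right].
 have [_ _ all] := bcP z zD.
 have [t [u [h1 h2]]] := all _ (pl_comp pP h) (overg h P (fun x q _ => id)).
 have [t' [u' [h1' h2']]] := all _ (pl_comp pP' h) (overg h P' PP').
 by case: zd => ->; [exists t, t'|exists u, u'].
have har : h a \in r by exact: rP.
have e : hb (h a) a = h a by apply: hbP; exists h.
set z := W (hb (h a)); have zD : z \in D0 by apply/mapP; exists (h a).
have [q [az Pz nP]] := WP (hb (h a)); apply: nP; rewrite (gal_fadj e az) -/z.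
have [zE [t Pt t0] all] := bcP z zD.
have [t1 [u [Pt1 Pu]]] := all _ pP (fun x q _ => id).
have b1 : (bc z).1 \in D by apply/flattenP; exists [:: (bc z).1; (bc z).2]; rewrite ?mem_head //; apply/mapP; exists z.
have b2 : (bc z).2 \in D by apply/flattenP; exists [:: (bc z).1; (bc z).2]; rewrite ?inE ?eqxx ?orbT //; apply/mapP; exists z.
have Pq : P (z, u / t) by rewrite zE; exact: (pl_div pP).
rewrite (hg_fun hP Pz Pq) zE fmorph_div; apply: (pl_div pP') => //; exact: hP1.
Qed.

(** Among the partial isomorphisms compatible with both places a maximal one is total: otherwise
    [place_conj_simple] extends it to one more element. *)
Theorem place_extension P P' G0 (C : set Om) : place P -> place P' -> field_graph G0 ->
 (forall a b, G0 (a, b) -> forall q, P (a, q) -> P' (b, q)) ->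
 (forall x, alg_over (diag G0) x) ->
 infinite_set C -> (forall c, C c -> diag G0 c /\ P (c, c)) ->
 exists s : gal (diag G0), (forall a b, G0 (a, b) -> s a = b) /\
 forall a q, P (a, q) -> P' (s a, q).
move=> pP pP' f0 G0P Galg0 infC CP.
pose Psi (G : set (Om * Om)) (z : Om * Om) := forall q, P (z.1, q) -> P' (z.2, q).
have mono G G' z : G `<=` G' -> Psi G z -> Psi G' z by [].
have [|G [fG G0G PG Gmax]] := graph_zorn mono f0; first by case=> a b; exact: G0P.
have dd : diag G0 `<=` diag G by move=> x; exact: G0G.
have Galg a : alg_over (diag G) a by exact: alg_mono dd (Galg0 a).
have [a b _|s1 s1G] := aut_extension fG; first by split; exact: Galg.
pose P2 : set (Om * Om) := [set z | P' (s1 z.1, z.2)].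
have pP2 : place P2 by exact: (pl_comp pP' s1).
pose M : set Om := [set a | exists b, G (a, b)]; have hM : subfield M := dom_subfield fG.
have dM : diag G `<=` M by move=> x; exists x.
have PP2 : over_place M P P2 by move=> x q [y Gxy] Px; rewrite /P2 /= (s1G _ _ Gxy); exact: (PG _ Gxy).
have Gdom a : M a.
 have [|g gP] := place_conj_simple a hM pP pP2 (fun x => alg_mono dM (Galg x)) PP2 infC.
 by move=> c /CP [Gc Pc]; split=> //; exact/dM/dd.
 pose G' : set (Om * Om) := [set z | fadj M a z.1 /\ z.2 = s1 (g z.1)].
 have hA := fadj_sub a hM.
 have fG' : field_graph G'.
 split; first split.
 - by split; [exact: sub1|rewrite /= !rmorph1].
 - by move=> [x y] [x' y'] [/= h ->] [/= h' ->]; split; [exact: subB|rewrite /= !rmorphB].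
 - by move=> [x y] [x' y'] [/= h ->] [/= h' ->]; split; [exact: subM|rewrite /= !rmorphM].
 - by move=> [x y] [/= h ->]; rewrite !fmorph_eq0.
 - by move=> [x y] [/= h ->]; split; [exact: subV|rewrite /= !fmorphV].
 have GG' : G `<=` G'.
 move=> [x y] Gxy; split; first by apply: fadj_incl => //; exists y.
 by have [_ _ ->] := galP g; [rewrite (s1G _ _ Gxy)|exists y].
 have e : G' = G.
 apply: Gmax => // -[x y] [/= h ->] q Px; exact: gP.
 have h : G' (a, s1 (g a)) by split=> //=; exact: fadj_gen.
 by exists (s1 (g a)); move: h; rewrite e.
have [s sG] := gal_of_graph fG Gdom (alg_graph_total fG Galg Gdom).
have sP : gal_bij s \in gal_pred (diag G0) by have [sD sM sF] := galP s; apply/asboolP; split=> // x h; apply: sF; exact: G0G.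
exists (Gal sP); split=> [a b /G0G /sG //|a q Pa].
have [b Gab] := Gdom a; have := sG _ _ Gab; rewrite /= => ->.
exact: (PG _ Gab).
Qed.
End PlaceExtension.

(** * The field K, its pro-l extension and its Galois group *)

Section Setting.
Variables (l : nat) (k0 K0 : fieldType) (i : {rmorphism k0 -> K0}).
Variables (Om : closedFieldType) (j : {rmorphism K0 -> Om}).
Hypotheses (pl : prime l) (l0 : l%:R != 0 :> Om).
Hypothesis Omalg : forall x : Om, algebraicOver j x.
Hypothesis inf0 : infinite_set [set: k0].
Notation Kb := (Kbar i j).
Notation kb := (kbar i j).
Notation GO := (GOm i j).
Notation KL := (sfield (Kl l i j)).
Notation GKn := (GK l i j).
Notation G2n := (G2 GKn l).
Notation G3n := (G3 GKn l).

Section Setting.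
Notation K := [set x : Om | x \in Kb].
Notation k := [set x : Om | x \in kb].

Definition zeta : Om := xget 0 [set z : Om | l.-primitive_root z].

Lemma zeta_prim : l.-primitive_root zeta.
by have [z zp] := closed_prim_root l0; rewrite /zeta; case: xgetP => [y _ //|/(_ z)]. Qed.

Lemma fld_gen_incl (F : fieldType) (S : set F) x : S x -> x \in fld_gen S.
by move=> Sx; apply/asboolP => E; apply. Qed.

Lemma j_Kb u : j u \in Kb.
by apply: fld_gen_incl; left; exists u. Qed.

Lemma kb_Kb x : x \in kb -> x \in Kb.
by move=> kx; apply: fld_gen_incl; right. Qed.

Lemma i_kb c : j (i c) \in kb.
by apply/asboolP; exact: (algebraic_id (j \o i)). Qed.

Lemma Om_alg x : alg_over K x.
have [p p0 px] := Omalg x; exists (map_poly j p); split=> //.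
 by move=> n; rewrite coef_map; exact: j_Kb.
by rewrite map_poly_eq0.
Qed.

Lemma kb_closed x : alg_over k x -> x \in kb.
move=> [p [pk p0 px]]; apply/asboolP/integral_algebraic.
apply: (@integral_root _ _ _ p) => // c /(nthP 0) [n _ <-].
by apply/integral_algebraic; have /asboolP := pk n.
Qed.

Lemma root_kb n x : (0 < n)%N -> x ^+ n \in kb -> x \in kb.
move=> n0 xn; apply: kb_closed; exists ('X^n - (x ^+ n)%:P); split.
- move=> m; rewrite coefB coefXn coefC /=; apply: rpredB; first by case: eqP; rewrite ?rpred0 ?rpred1.
 by case: eqP => _; rewrite ?rpred0.
- by rewrite -size_poly_gt0 size_XnsubC.
- by rewrite rootE !hornerE subrr.
Qed.

Lemma zeta_kb : zeta \in kb.
by apply: (@root_kb l); rewrite ?prime_gt0 // (prim_expr_order zeta_prim) rpred1. Qed.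

Lemma zeta_Kb : zeta \in Kb. exact/kb_Kb/zeta_kb. Qed.

Lemma inf_const : infinite_set (range (j \o i)).
move=> fin; apply: inf0; rewrite -(@eq_finite_set _ _ (range (j \o i))) //.
by apply: inj_card_eq => x y _ _ e; apply: (fmorph_inj i); exact: (fmorph_inj j).
Qed.

Lemma inv_mod (n : nat) : (0 < n < l)%N -> exists m, n * m = 1 %[mod l].
move=> /andP[n0 nl]; have cp : coprime l n by rewrite prime_coprime // gtnNdvd.
case: (egcdnP l n0) => u v e _; exists u.
by rewrite mulnC e gcdnC (eqP cp) modnMDl.
Qed.

(** An l-th root outside K is separable over K, hence moved by some automorphism; a power of the
    latter multiplies it by exactly [zeta]. *)
Lemma kummer_move a : a ^+ l \in Kb -> a \notin Kb -> exists s : GO, s a = zeta * a.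
move=> aK na; have hK := div_subfield Kb.
have a0 : a != 0 by apply: contraNneq na => ->; rewrite rpred0.
have [s sa] : exists s : GO, s a != a.
 apply: contrapT => h; move/negP: na; apply; apply: (separable_fixed hK) => [|s]; last first.
 by apply: contrapT => /eqP sa; apply: h; exists s.
 exists ('X^l - (a ^+ l)%:P); split.
 - move=> m; rewrite coefB coefXn coefC /=; apply: rpredB; first by case: eqP; rewrite ?rpred0 ?rpred1.
 by case: eqP => _; rewrite ?rpred0.
 - by apply: separable_XnsubC => //; rewrite expf_neq0.
 - by rewrite rootE !hornerE subrr.
have [n nl e] := kummer_conj zeta_prim s aK.
have n0 : (0 < n)%N by rewrite lt0n; apply: contra sa => /eqP n0; rewrite e n0 mul1r.
have [m nm] : exists m, n * m = 1 %[mod l] by apply: inv_mod; rewrite n0.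
exists (s ^+ m)%g.
have -> : (s ^+ m)%g a = zeta ^+ (n * m) * a.
 elim: (m) => [|r IH]; first by rewrite muln0 mul1r.
 rewrite galX1 IH rmorphM rmorphXn /= e mulnS exprD.
 have [_ _ sK] := galP s; rewrite (sK zeta zeta_Kb) mulrCA mulrA.
 by [].
by rewrite -[zeta in RHS]expr1; congr (_ * _); apply/eqP; rewrite (eq_prim_root_expr zeta_prim) nm.
Qed.

Lemma Kb_Kl x : x \in Kb -> x \in Kl l i j.
move=> xK; apply: fld_gen_incl; exists Kb; split=> //.
 split=> // y yK; exists [:: y]; rewrite inE eqxx; split=> //.
 by move=> z; rewrite inE => /eqP ->.
 by rewrite big_seq1 polyOverXsubC.
exists 0%N; rewrite expn0; exists (fun=> 1); split=> [_|y yK]; first exact: rpred1.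
exists [ffun=> y]; split.
 by split=> [m|]; rewrite ?ffunE // big_ord1 ffunE mulr1.
move=> c [_ ->]; apply/ffunP => m.
by rewrite ffunE big_ord1 mulr1 (ord1 m).
Qed.

Lemma root_Kl a : a ^+ l \in Kb -> a \in Kl l i j.
move=> aK; have [aKb|na] := boolP (a \in Kb); last first.
 have [s sa] := kummer_move aK na.
 apply: (kummer_in_max_prol zeta_prim zeta_Kb aK sa) => //.
 by apply: contraNneq na => ->; rewrite rpred0.
exact: Kb_Kl.
Qed.

Lemma Kl_stable (s : GO) x : x \in Kl l i j -> s x \in Kl l i j.
move=> /asboolP xKl.
pose P : set Om := [set y | s y \in Kl l i j].
have hP : subfield P.
 split=> [|y z|y z]; rewrite /P /=; first by rewrite rmorph1 rpred1.
 by rewrite rmorphB; exact: rpredB.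
 by rewrite fmorph_div; exact: rpred_div.
apply/(fldP hP)/xKl => y [L [Lgal Ldeg yL]]; apply/fldP; rewrite /P /=.
apply: fld_gen_incl; exists L; split=> //; have [KL /(_ y yL) [r [ur rL yr rK]]] := Lgal.
apply: rL; rewrite -root_prod_XsubC; apply: gal_root; last by rewrite root_prod_XsubC.
by move=> n; apply: (polyOverP rK).
Qed.

Definition res_fun (s : GO) (u : sfield (Kl l i j)) : sfield (Kl l i j) :=
 SField (Kl_stable s (sf_valP u)).

Lemma res_funK (s : GO) : cancel (res_fun s) (res_fun s^-1%g).
by move=> u; apply: val_inj; rewrite /= bij_funK. Qed.

Lemma res_funVK (s : GO) : cancel (res_fun s^-1%g) (res_fun s).
by move=> u; apply: val_inj; rewrite /= bij_invfunK. Qed.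

Lemma res_gal (s : GO) : Defs.Bij (res_funK s) (res_funVK s) \in
 gal_pred [set x : sfield (Kl l i j) | sf_val x \in Kb].
have [sD sM sF] := galP s; apply/asboolP; split=> [x y|x y|x xK]; apply: val_inj => /=.
- exact: sD.
- exact: sM.
- exact: sF.
Qed.

Definition res (s : GO) : GK l i j := Gal (res_gal s).

Lemma gal_eq (E : fieldType) (F : set E) (s t : gal F) : s =1 t -> s = t.
by move=> st; apply/val_inj/bijP. Qed.

Lemma resM s t : res (s * t)%g = (res s * res t)%g.
by apply: gal_eq => u; apply: val_inj. Qed.

Lemma extends_res s u : extends s u <-> res s = u.
split=> [h|<- //]; apply: gal_eq => y; apply: val_inj; exact: h.
Qed.

(** An automorphism of K(l) is a field graph over K, which extends to Om. Elements of G_K can thus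
    be handled as automorphisms of Om. *)
Lemma res_surj u : exists s, res s = u.
pose G : set (Om * Om) := [set z | exists y : sfield (Kl l i j), z = (sf_val y, sf_val (u y))].
have KKl : K `<=` diag G.
 move=> x xK; have xKl := Kb_Kl xK.
 exists (SField xKl); have [_ _ /(_ (SField xKl) xK) ->] := galP u.
 by [].
have fG : field_graph G.
 split; first split.
 - by exists 1; rewrite rmorph1.
 - by move=> _ _ [y ->] [z ->]; exists (y - z); rewrite rmorphB.
 - by move=> _ _ [y ->] [z ->]; exists (y * z); rewrite rmorphM.
 - move=> _ [y ->] /=.
 by rewrite -[sf_val y]/(val y) -[sf_val (u y)]/(val (u y)) !fmorph_eq0.
 - by move=> _ [y ->]; exists y^-1; rewrite fmorphV.
have [a b _|s sG] := aut_extension fG.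
 by split; apply: alg_mono KKl (Om_alg _).
have [t ts] := gal_weaken s KKl; exists t; apply: gal_eq => y; apply: val_inj.
by rewrite /= ts; apply: sG; exists y.
Qed.
End Setting.

Notation z_ := zeta.

(** * Kummer characters *)

Section KummerCharacters.
Notation K := [set x : Om | x \in Kb].

Definition zpow (a : 'F_l) : Om := z_ ^+ a.

Lemma zpow_nat n : zpow n%:R = z_ ^+ n.
by rewrite /zpow val_Fp_nat // (prim_expr_mod zeta_prim). Qed.

Lemma Fl_nat (a : 'F_l) : a = (a : nat)%:R.
by rewrite natr_Zp. Qed.

Lemma zpowD a b : zpow (a + b) = zpow a * zpow b.
by rewrite [a in LHS]Fl_nat [b in LHS]Fl_nat -natrD zpow_nat exprD. Qed.

Lemma zpow0 : zpow 0 = 1. by rewrite -[0]/(0%:R) zpow_nat. Qed.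

Lemma zpow_inj : injective zpow.
move=> a b /eqP; rewrite /zpow (eq_prim_root_expr zeta_prim) => /eqP e.
by rewrite [a]Fl_nat [b]Fl_nat -(Fp_nat_mod pl) e Fp_nat_mod.
Qed.

Lemma zpowX a n : zpow a ^+ n = zpow (a *+ n).
by elim: n => [|n IH]; rewrite ?mulr0n ?zpow0 // exprS mulrS zpowD IH. Qed.

Lemma zpow_fix (s : GO) a : s (zpow a) = zpow a.
by have [_ _ sK] := galP s; apply: sK; rewrite /= rpredX ?zeta_Kb. Qed.

Definition lroot (z : Om) : Om := xget 0 [set a | a ^+ l = z].

Lemma lrootP z : lroot z ^+ l = z.
have [b bz] := closed_nth_root z (prime_gt0 pl).
by rewrite /lroot; case: xgetP => // /(_ b).
Qed.

Lemma lroot_nz z : z != 0 -> lroot z != 0.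
exact: expf_nz pl (lrootP z).
Qed.

(** The Kummer character of z, with values in the prime field by means of the fixed root of unity
    [zeta]; it does not depend on the choice of the l-th root ([chiE]). *)
Definition chi z (s : GO) : 'F_l := xget 0 [set a | s (lroot z) = zpow a * lroot z].

Lemma chiE z a (s : GO) : z \in Kb -> a ^+ l = z -> s a = zpow (chi z s) * a.
move=> zK az; have [z0|z0] := eqVneq z 0.
 by move: az; rewrite z0 => /eqP; rewrite expf_eq0 => /andP[_ /eqP ->]; rewrite rmorph0 mulr0.
have b0 := lroot_nz z0.
have sb : s (lroot z) = zpow (chi z s) * lroot z.
 have [|n nl e] := kummer_conj zeta_prim s (a := lroot z) (F := K); first by rewrite lrootP.
 by rewrite /chi; case: xgetP => // /(_ n%:R) /=; rewrite zpow_nat e.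
have [|n nl e] := @root_of_unityE _ _ _ zeta_prim (a / lroot z).
 by rewrite expr_div_n az lrootP divff.
have -> : a = z_ ^+ n * lroot z by rewrite -e divfK.
by rewrite rmorphM /= sb -zpow_nat zpow_fix mulrCA.
Qed.

Lemma chi_uniq z a (s : GO) c : z \in Kb -> a ^+ l = z -> a != 0 -> s a = zpow c * a -> chi z s = c.
move=> zK az a0 e; have := chiE s zK az; rewrite e => /(mulIf a0)/zpow_inj.
by [].
Qed.

Lemma chi_mul z (s t : GO) : z \in Kb -> z != 0 -> chi z (s * t)%g = chi z s + chi z t.
move=> zK z0; have b0 := lroot_nz z0.
apply: (chi_uniq zK (lrootP z) b0).
have -> : (s * t)%g (lroot z) = s (t (lroot z)) by [].
rewrite (chiE t zK (lrootP z)) rmorphM /= zpow_fix (chiE s zK (lrootP z)) zpowD.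
by rewrite mulrA [zpow _ * zpow _]mulrC.
Qed.

Lemma chiM z z' (s : GO) : z \in Kb -> z' \in Kb -> z != 0 -> z' != 0 ->
 chi (z * z') s = chi z s + chi z' s.
move=> zK zK' z0 z0'; apply: (@chi_uniq _ (lroot z * lroot z')); rewrite ?rpredM //.
- by rewrite exprMn !lrootP.
- by rewrite mulf_neq0 ?lroot_nz.
rewrite rmorphM /= (chiE s zK (lrootP z)) (chiE s zK' (lrootP z')) zpowD.
by rewrite mulrACA.
Qed.
End KummerCharacters.

(** * Nondegeneracy of the Kummer pairing; closed subgroups of G_K *)

Section Duality.
Notation K := [set x : Om | x \in Kb].

Lemma chi_fix z a (s : GO) : z \in Kb -> z != 0 -> a ^+ l = z -> chi z s = 0 <-> s a = a.
move=> zK z0 az; have a0 : a != 0.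
 exact: expf_nz pl az z0.
split=> [h|h]; first by rewrite (chiE s zK az) h zpow0 // mul1r.
by apply: (chi_uniq zK az a0); rewrite zpow0 // mul1r.
Qed.

Lemma chi_power b (s : GO) : b \in Kb -> b != 0 -> chi (b ^+ l) s = 0.
move=> bK b0; apply/(@chi_fix _ b); rewrite ?rpredX ?expf_neq0 //.
by have [_ _ sK] := galP s; exact: sK.
Qed.

Lemma chi_trivial z : z \in Kb -> z != 0 -> (forall s : GO, chi z s = 0) ->
 exists2 b, b \in Kb & b ^+ l = z.
move=> zK z0 h; exists (lroot z); last exact: lrootP.
apply: contrapT => /negP nb; have [|s e] := kummer_move (a := lroot z) _ nb.
 by rewrite lrootP.
have /(@chi_fix _ (lroot z)) := h s; rewrite lrootP // => /(_ zK z0 erefl)/eqP.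
rewrite e -subr_eq0 -{2}[lroot z]mul1r -mulrBl mulf_eq0 (negbTE (lroot_nz z0)) orbF subr_eq0.
by rewrite -[zeta]expr1 -(prim_order_dvd zeta_prim) gtnNdvd ?prime_gt1.
Qed.

Lemma chi1 (s : GO) : chi 1 s = 0.
by rewrite -(expr1n _ l) chi_power ?rpred1 ?oner_neq0. Qed.

Lemma chiX z n (s : GO) : z \in Kb -> z != 0 -> chi (z ^+ n) s = chi z s *+ n.
move=> zK z0; elim: n => [|n IH]; first by rewrite mulr0n chi1.
by rewrite exprS chiM ?rpredX ?expf_neq0 // IH mulrS.
Qed.

Lemma chiV z (s : GO) : z \in Kb -> z != 0 -> chi z^-1 s = - chi z s.
move=> zK z0; apply/eqP; rewrite -addr_eq0 -chiM ?rpredV ?invr_neq0 // mulVf //.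
by rewrite chi1.
Qed.

Lemma chi_grp1 z : z \in Kb -> z != 0 -> chi z (1%g : GO) = 0.
by move=> zK z0; apply/(@chi_fix _ (lroot z)) => //; exact: lrootP. Qed.

Lemma chi_grpV z (s : GO) : z \in Kb -> z != 0 -> chi z s^-1%g = - chi z s.
by move=> zK z0; apply/eqP; rewrite -addr_eq0 -chi_mul // mulVg chi_grp1.
Qed.

Lemma GK_orbit (x : KL) : exists r : seq KL, forall u : GKn, u x \in r.
have [r rP] := finite_orbit (Om_alg (sf_val x)).
exists (pmap insub r) => u; have [s <-] := res_surj u.
rewrite mem_pmap_sub /=; apply: rP.
Qed.

Definition constKL : set KL := [set x | range (j \o i) (sf_val x)].

Lemma infinite_constKL : infinite_set constKL.
move=> fin; have := @inf_const; apply.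
apply: (@sub_finite_set _ _ ((@sf_val _ _) @` constKL)); last exact: finite_image.
move=> x [c _ cx]; have xK : x \in Kl l i j.
 by apply: Kb_Kl; rewrite -cx; exact: j_Kb.
by exists (SField xK) => //; exists c.
Qed.

Lemma GK_const (u : GKn) x : sf_val x \in Kb -> u x = x.
by have [_ _ h] := galP u; exact: h. Qed.

(** A closed subgroup contains every automorphism fixing its fixed field; this is [krull_density] on
    each basic neighbourhood. *)
Lemma krull_GK (H : set GKn) (u : GKn) : is_subgroup H -> closed H ->
 (forall z, (forall h, H h -> h z = z) -> u z = z) -> H u.
move=> sH cH hu; apply: (closed_galP cH) => D.
have [||D' [D'H D'P _]] := krull_density (D := D) sH infinite_constKL.
- by move=> c h [c0 _ e] _; apply: GK_const; rewrite -e; exact: j_Kb.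
- by move=> x _; have [r rP] := GK_orbit x; exists r.
have [|h Hh e] := D'P u; first by move=> z zD'; apply: hu => h Hh; exact: D'H.
by exists h.
Qed.

Lemma GK_fixed x : (forall u : GKn, u x = x) -> exists q, [/\ (0 < q)%N, coprime q l & sf_val x ^+ q \in Kb].
move=> fx; apply: (fixed_power (F := K) (div_subfield _) pl l0 (Om_alg _)) => s.
by have := congr1 (@sf_val _ _) (fx (res s)).
Qed.

Lemma sf_valX n (x : KL) : sf_val (x ^+ n) = sf_val x ^+ n.
exact: (rmorphXn (\val : KL -> Om)). Qed.

(** If a is an eigenvector of G_K, then a power a^(l q) with q prime to l lies in K. So u fixes a^q,
    and its eigenvalue, an l-th root of unity killed by q, is 1. *)
Lemma eigen_fixed (u : GKn) (a : KL) : (forall x : KL, sf_val x ^+ l \in Kb -> u x = x) ->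
 (forall s : GKn, exists k, sf_val (s a) = z_ ^+ k * sf_val a) -> u a = a.
move=> uK aS; have zl := prim_expr_order zeta_prim.
have [|q [q0 cq aq]] := @GK_fixed (a ^+ l).
 move=> s; have [k e] := aS s; apply: val_inj; rewrite rmorphXn [LHS]sf_valX e.
 by rewrite exprMn -exprM mulnC exprM zl expr1n mul1r -sf_valX.
have [k e] := aS u; have [->|a0] := eqVneq a 0; first by rewrite rmorph0.
have a0' : sf_val a != 0 by [].
have : sf_val (u (a ^+ q)) = sf_val (a ^+ q) by rewrite uK // sf_valX; move: aq; rewrite sf_valX -!exprM mulnC.
rewrite rmorphXn [LHS]sf_valX e [RHS]sf_valX exprMn -exprM => /eqP.
rewrite -subr_eq0 -{2}[sf_val a ^+ q]mul1r -mulrBl mulf_eq0 expf_eq0 (negbTE a0') andbF orbF.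
rewrite subr_eq0 -(prim_order_dvd zeta_prim) Gauss_dvdl ?(coprime_sym _ q) // => /dvdnP [m km].
by apply: val_inj; rewrite /= e km mulnC exprM zl expr1n mul1r.
Qed.
End Duality.

(** * G^(2), and the duality between G_K^a and the l-th power classes of K *)

Section KummerDuality.
Definition zetaK : KL := SField (Kb_Kl zeta_Kb).

Lemma zetaK_prim : l.-primitive_root zetaK.
rewrite -(fmorph_primitive_root (\val : KL -> Om)) /=; exact: zeta_prim.
Qed.

Lemma zetaK_fix (u : GKn) : u zetaK = zetaK.
by apply: GK_const; exact: zeta_Kb. Qed.

Lemma lK_nz : l%:R != 0 :> KL.
by rewrite -(fmorph_eq0 (\val : KL -> Om)) rmorph_nat. Qed.

(** The hypotheses say that S acts on the fixed field of N through an abelian group of exponent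
    l. *)
Lemma GK_decomp (S N : nsubgroup GKn) : (forall s t, S s -> S t -> N [~ s, t]%g) ->
 (forall s, S s -> N (s ^+ l)%g) ->
 forall x : KL, (forall h, N h -> h x = x) ->
 exists L : seq KL, x = \sum_(a <- L) a /\ forall a, a \in L ->
 (forall h, N h -> h a = a) /\ forall s, S s -> exists k, s a = zetaK ^+ k * a.
move=> NR NX x Nx.
have fixl (h : GKn) : h l%:R^-1 = l%:R^-1 by rewrite fmorphV rmorph_nat.
apply: (@kummer_decomp _ _ (nsub_set S) l zetaK [set a | forall h, N h -> h a = a]) => //.
- exact: nsub_subgroup.
- exact: prime_gt0.
- exact: lK_nz.
- exact: zetaK_prim.
- by move=> s _; exact: zetaK_fix.
- by move=> a b ha hb h Nh; rewrite rmorphD /= ha ?hb.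
- by move=> h _; rewrite rmorph0.
- by move=> a ha h Nh; rewrite rmorphM /= zetaK_fix ha.
- by move=> a ha h Nh; rewrite rmorphM /= fixl ha.
- move=> s a Ss ha h Nh.
 have -> : h (s a) = s ((h ^ s)%g a) by rewrite -[RHS]/((s * (s^-1 * (h * s)))%g a) !mulgA mulgV mul1g.
 by rewrite ha //; exact: nsub_normal.
- move=> s s' a Ss Ss' ha.
 have -> : s (s' a) = s' (s ([~ s, s']%g a)) by rewrite -[LHS]/((s * s')%g a) commgC.
 by rewrite ha //; exact: NR.
- by move=> s a Ss ha; apply/ha/NX.
by have [r rP] := GK_orbit x; exists r.
Qed.

Lemma sf_valZ n a : sf_val (zetaK ^+ n * a) = z_ ^+ n * sf_val a.
by rewrite -[LHS]/(sf_val (zetaK ^+ n) * sf_val a) sf_valX. Qed.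

Definition whole : nsubgroup GKn.
by exists setT. Defined.

Lemma eigenK (u : GKn) (a : KL) : (forall x : KL, sf_val x ^+ l \in Kb -> u x = x) ->
 (forall s : GKn, exists k, s a = zetaK ^+ k * a) -> u a = a.
move=> uK aS; apply: eigen_fixed => // s; have [k ->] := aS s; exists k.
exact: sf_valZ.
Qed.

Lemma kummer_fix_root (s : GKn) (x : KL) : sf_val x ^+ l \in Kb -> exists k, s x = zetaK ^+ k * x.
move=> xl; have [g <-] := res_surj s.
have [k _ e] := kummer_conj zeta_prim g xl.
by exists k; apply: val_inj; rewrite /= e; exact/esym/sf_valZ.
Qed.

(** An element fixed by G^(2) is a sum of eigenvectors of G_K, and these are fixed by whatever fixes
    the l-th roots of elements of K. *)
Lemma G2_kummer (u : GKn) : G2n u <-> forall x : KL, sf_val x ^+ l \in Kb -> u x = x.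
split=> [|uK].
 apply: (closed_gen_min (H := [set u : GKn | forall x : KL, sf_val x ^+ l \in Kb -> u x = x])).
 - exact: gal_fix_subgroup.
 - have -> : [set u : GKn | forall x : KL, sf_val x ^+ l \in Kb -> u x = x] =
 \bigcap_(x in [set x : KL | sf_val x ^+ l \in Kb]) [set u : GKn | u x = x] by [].
 by apply: closed_bigI => x _; exact: closed_gal_fix.
 move=> _ [[s [t ->]]|[s ->]] x xl.
 have [a sx] := kummer_fix_root s xl; have [b tx] := kummer_fix_root t xl.
 have e : (s * t)%g x = (t * s)%g x.
 rewrite -[LHS]/(s (t x)) -[RHS]/(t (s x)) sx tx !rmorphM !rmorphXn /= !zetaK_fix sx tx.
 by rewrite mulrCA.
 have -> : [~ s, t]%g = ((t * s)^-1 * (s * t))%g by rewrite /commg /conjg !invgM !mulgA.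
 by rewrite -[LHS]/((t * s)^-1%g ((s * t)%g x)) e -[LHS]/(((t * s)^-1 * (t * s))%g x) mulVg.
 have [a sx] := kummer_fix_root s xl.
 have e n : (s ^+ n)%g x = zetaK ^+ (a * n) * x.
 elim: n => [|n IH]; first by rewrite muln0 mul1r.
 by rewrite galX1 IH rmorphM rmorphXn /= zetaK_fix sx mulnS exprD mulrCA mulrA.
 by rewrite e mulnC exprM (prim_expr_order zetaK_prim) expr1n mul1r.
apply: krull_GK; [exact: nsub_subgroup|exact: closed_gen_closed|].
move=> x Nx; have [||L [-> LP]] := @GK_decomp whole G2n _ _ x Nx.
- by move=> s t _ _; exact: G2_comm.
- by move=> s _; exact: G2_exp.
rewrite raddf_sum big_seq [RHS]big_seq; apply: eq_bigr => a aL.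
have [_ aS] := LP a aL; apply: eigenK => // s; exact: aS.
Qed.

Definition inE3 (x : KL) : Prop := forall h, G3n h -> h x = x.

Lemma E3_decomp x : inE3 x -> exists L : seq KL, x = \sum_(a <- L) a /\ forall a, a \in L ->
 inE3 a /\ forall s, G2n s -> exists k, s a = zetaK ^+ k * a.
apply: GK_decomp => [s t Gs Gt|s]; first exact: G3_comm.
exact: G2_expG3.
Qed.

Lemma to_a_eq (s t : GO) : to_a l (res s) = to_a l (res t) <->
 forall z, z \in Kb -> z != 0 -> chi z s = chi z t.
rewrite qclassP; split=> [/G2_kummer h z zK z0|h].
 have xKl : lroot z \in Kl l i j by apply: root_Kl; rewrite // lrootP.
 have xl : sf_val (SField xKl) ^+ l \in Kb by rewrite /= lrootP.
 have e : (s^-1 * t)%g (lroot z) = lroot z := congr1 (@sf_val _ _) (h (SField xKl) xl).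
 move/(chi_fix _ zK z0 (lrootP z)): e.
 by rewrite chi_mul // chi_grpV // addrC => /eqP; rewrite subr_eq0 => /eqP.
apply/G2_kummer => x xl; apply: val_inj; rewrite -[LHS]/((s^-1 * t)%g (sf_val x)) -[RHS]/(sf_val x).
have [x0|x0] := eqVneq (sf_val x) 0; first by rewrite x0 rmorph0.
have z0 : sf_val x ^+ l != 0 by rewrite expf_neq0.
apply/(chi_fix _ xl z0 erefl).
by rewrite chi_mul // chi_grpV // (h _ xl z0) addNr.
Qed.

(** Surjectivity of Kummer duality: the kernel of f fixes an eigenvector a on which f acts
    faithfully, and a suitable power of a is an l-th root with character f. *)
Lemma character_kummer (f : GKn -> 'F_l) : (forall u v, f (u * v)%g = f u + f v) ->
 (exists D : seq KL, forall u : GKn, {in D, u =1 id} -> f u = 0) ->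
 exists z, [/\ z \in Kb, z != 0 & forall s, f (res s) = chi z s].
move=> fM [D fD].
have f1 : f 1%g = 0 by have := fM 1%g 1%g; rewrite mulg1 => /eqP; rewrite -subr_eq0 opprD addNKr oppr_eq0 => /eqP.
have fV u : f u^-1%g = - f u by apply/eqP; rewrite -addr_eq0 -fM mulVg f1.
have fX u n : f (u ^+ n)%g = f u *+ n by elim: n => [|n IH]; rewrite ?expg0 ?f1 // expgS fM IH mulrS.
have sN : is_subgroup [set u | f u = 0] by split=> [|u v /= hu hv|u /= hu]; rewrite /= ?f1 ?fM ?fV ?hu ?hv ?addr0 ?oppr0.
have nN x y : [set u | f u = 0] x -> [set u | f u = 0] (x ^ y)%g by rewrite /conjg /= !fM fV => ->; rewrite add0r addNr.
pose N := NSubgroup sN nN.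
have cN : closed (nsub_set N).
 rewrite -openC; apply/open_galP => g /= fg; exists D => h hg fh; apply: fg.
 have -> : g = (h * (h^-1 * g))%g by rewrite mulgA mulgV mul1g.
 rewrite fM fh add0r; apply: fD => x xD.
 by rewrite /= -(hg x xD) bij_funK.
have lF : l%:R = 0 :> 'F_l by apply/eqP; rewrite -(dvdn_pcharf (pchar_Fp pl)).
have [[u0 fu0]|nf] := pselect (exists u, f u <> 0); last first.
 exists 1; rewrite rpred1 oner_neq0; split=> // s; rewrite chi1 //.
 by apply: contrapT => h; apply: nf; exists (res s).
have [y [Ny uy]] : exists y : KL, (forall h, N h -> h y = y) /\ u0 y <> y.
 apply: contrapT => h; apply: fu0; apply: (krull_GK sN cN) => y Ny.
 by apply: contrapT => uy; apply: h; exists y.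
have [||L [yL LP]] := @GK_decomp whole N _ _ y Ny.
- by move=> s t _ _; rewrite /= /commg /conjg !fM !fV [f s + f t]addrC addKr addNr.
- move=> s _; rewrite /= fX -mulr_natr.
 by rewrite lF mulr0.
have [a aL ua] : exists2 a, a \in L & u0 a <> a.
 apply: contrapT => h; apply: uy; rewrite yL raddf_sum big_seq [RHS]big_seq.
 apply: eq_bigr => a aL; apply: contrapT => ua; apply: h; by exists a.
have [Na aS] := LP a aL.
have {}aS (u : GKn) : exists k : 'F_l, sf_val (u a) = zpow k * sf_val a.
 have [k ->] := aS u I; exists k%:R; rewrite zpow_nat //; exact: sf_valZ.
have a0 : sf_val a != 0.
 apply/eqP => a0; apply: ua; have -> : a = 0 by apply: val_inj.
 exact: rmorph0.
have {aS} /choice [e eP] := aS.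
have eM u v : e (u * v)%g = e u + e v.
 apply: zpow_inj; apply: (mulIf a0); rewrite -eP zpowD //.
 have -> : (u * v)%g a = u (v a) by [].
 have -> : v a = zetaK ^+ (e v) * a by apply: val_inj; rewrite [LHS]eP; exact/esym/sf_valZ.
 by rewrite rmorphM rmorphXn /= zetaK_fix [LHS]sf_valZ eP mulrA [zpow _ * zpow _]mulrC.
have eN u : f u = 0 -> e u = 0.
 move=> fu; apply: zpow_inj; apply: (mulIf a0).
 by rewrite -eP zpow0 // mul1r Na.
have eX u n : e (u ^+ n)%g = e u *+ n.
 elim: n => [|n IH]; first by rewrite expg0 mulr0n eN.
 by rewrite expgS eM IH mulrS.
have fu0' : f u0 != 0 by apply/eqP.
have e0 : e u0 != 0.
 apply: contra_notN ua => /eqP h; apply: val_inj; rewrite [LHS]eP h zpow0 // mul1r.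
 by [].
have ef u : e u * f u0 = f u * e u0.
 pose n := nat_of_ord (f u / f u0).
 have nE : n%:R = f u / f u0 by rewrite natr_Zp.
 have /eN : f (u * (u0 ^+ n)^-1)%g = 0 by rewrite fM fV fX -mulr_natl nE divfK // subrr.
 have eV v : e v^-1%g = - e v by apply/eqP; rewrite -addr_eq0 -eM mulVg eN.
 rewrite eM eV eX -mulr_natl nE => /eqP; rewrite subr_eq0 => /eqP ->.
 by rewrite mulrAC divfK.
have [q [q0 cq aq]] : exists q, [/\ (0 < q)%N, coprime q l & sf_val (a ^+ l) ^+ q \in Kb].
 apply: GK_fixed => // u; apply: val_inj; rewrite rmorphXn [LHS]sf_valX [sf_val _]eP.
 by rewrite exprMn zpowX // -mulr_natr lF mulr0 zpow0 // mul1r [RHS]sf_valX.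
have q0' : q%:R != 0 :> 'F_l by rewrite -(dvdn_pcharf (pchar_Fp pl)) -prime_coprime // coprime_sym.
(* The exponent corrects both the ratio of f to the character e of a and the factor q needed to
   bring a^l into K. *)
pose m := nat_of_ord (f u0 / e u0 / q%:R).
have mE : m%:R = f u0 / e u0 / q%:R by rewrite natr_Zp.
pose b := sf_val a ^+ (q * m).
have bK : b ^+ l \in Kb.
 have -> : b ^+ l = sf_val a ^+ l ^+ q ^+ m by rewrite /b -!exprM mulnC mulnA.
 by rewrite rpredX //; move: aq; rewrite sf_valX.
have b0 : b != 0 by rewrite expf_neq0.
exists (b ^+ l); split=> //; first by rewrite expf_neq0.
move=> s; apply/esym/(chi_uniq bK erefl b0).
rewrite /b rmorphXn /= (_ : s (sf_val a) = zpow (e (res s)) * sf_val a); last by rewrite -eP.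
rewrite exprMn zpowX //; congr (zpow _ * _).
have -> : f (res s) = e (res s) * (f u0 / e u0) by rewrite mulrA ef mulfK.
by rewrite -mulr_natr natrM mE [q%:R * _]mulrC divfK.
Qed.
End KummerDuality.

(** * Existence of the commutator map on the completed exterior square *)

Section CommutatorMap.
Notation K := [set x : Om | x \in Kb].
Notation A := (Ga GKn l).
Notation zK := zetaK.
Notation E3 := (@inE3).

Lemma E3_stable (g : GKn) x : E3 x -> E3 (g x).
move=> hx h h3; have : G3n (h ^ g)%g by exact: nsub_normal.
move=> /hx; rewrite /conjg => e.
have : g ((g^-1 * (h * g))%g x) = g x by rewrite e.
by rewrite /= (@bij_invfunK _ g).
Qed.

Lemma to_c_E3 (g h : GKn) x : E3 x -> to_c l g = to_c l h -> g x = h x.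
move=> hx /(qclassP G3n) /hx e; rewrite -[in LHS]e /=.
exact: (@bij_invfunK _ g).
Qed.

Lemma E3_to_c (g h : GKn) : (forall x, E3 x -> g x = h x) -> to_c l g = to_c l h.
move=> e; apply/(qclassP G3n); apply: krull_GK.
- exact: nsub_subgroup.
- exact: closed_gen_closed.
by move=> x hx /=; rewrite -(e x) // (@bij_funK _ g).
Qed.

Lemma comm_val (s t : GKn) (x : KL) : ([~ s, t]%g : GKn) x = s^-1%g (t^-1%g (s (t x))).
by []. Qed.

Section Eigen.
Variable a : KL.
Hypotheses (a0 : a != 0) (a3 : E3 a) (aG : forall g, G2n g -> exists k, g a = zK ^+ k * a).

Let e (g : GKn) : 'F_l := xget 0 [set c | sf_val (g a) = zpow c * sf_val a].

Let va0 : sf_val a != 0. by apply: contraNneq a0 => h; apply/eqP/val_inj. Qed.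

Let eP g : G2n g -> sf_val (g a) = zpow (e g) * sf_val a.
move=> /aG [k ga]; rewrite /e; case: xgetP => [c _ //|/(_ k%:R) []].
by rewrite /= ga sf_valZ zpow_nat.
Qed.

Let eU g c : G2n g -> sf_val (g a) = zpow c * sf_val a -> e g = c.
by move=> /eP ->; move/(mulIf va0)/(zpow_inj). Qed.

Let eM g h : G2n g -> G2n h -> e (g * h)%g = e g + e h.
move=> Gg Gh; apply: eU; first exact: nsubM.
have [k hk] := aG Gh; have ->: (g * h)%g a = g (h a) by [].
have := eP Gh; rewrite {1}hk sf_valZ => /(mulIf va0) e1.
have -> : g (h a) = zK ^+ k * g a by rewrite hk rmorphM rmorphXn /= zetaK_fix.
by rewrite sf_valZ e1 (eP Gg) zpowD mulrCA mulrA.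
Qed.

Let eC g h : G2n g -> G2n h -> to_c l g = to_c l h -> e g = e h.
by move=> Gg Gh c; apply: eU => //; rewrite (to_c_E3 a3 c); exact: eP. Qed.

(** The exponent by which [s, t] acts on the G^(2)-eigenvector a. It is bilinear because commutators
    are central modulo G^(3). *)
Definition commW (s t : GKn) : 'F_l := e [~ s, t]%g.

Lemma commW_form : alt_form commW.
have c1 : e 1%g = 0 by apply: eU; [exact: nsub1|rewrite zpow0 mul1r].
split.
- move=> s t r; rewrite /commW -eM; try exact: G2_comm.
 by apply: eC; [exact: G2_comm|apply: nsubM; exact: G2_comm|exact: to_cR_mull].
- move=> s t r; rewrite /commW -eM; try exact: G2_comm.
 by apply: eC; [exact: G2_comm|apply: nsubM; exact: G2_comm|exact: to_cR_mulr].
- move=> s; rewrite /commW (_ : [~ s, s]%g = 1%g) //; exact: commgg.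
- move=> s t Gs; rewrite /commW -c1; apply: eC; [exact: G2_comm|exact: nsub1|].
 by apply/(qclassP G3n); rewrite mulg1; apply: nsubV; exact: G3_comm'.
have [r rP] := GK_orbit a.
exists [set s : GKn | forall x, x \in r -> s x = x].
 apply/open_galP => g gr; exists r => h hg x xr /=; rewrite hg //; exact: gr.
split=> // s t sr; apply: eU; first exact: G2_comm.
rewrite zpow0 mul1r; congr sf_val; rewrite comm_val (sr (t a)) ?rP //.
rewrite [t^-1%g _](@bij_funK _ t) -[in LHS](sr a (rP 1%g)); exact: (@bij_funK _ s).
Qed.

Definition cprod (L : seq (GKn * GKn)) : GKn := (\prod_(p <- L) [~ p.1, p.2])%g.

Lemma cprod_W L : sf_val (cprod L a) = zpow (\sum_(p <- L) commW p.1 p.2) * sf_val a.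
have GL : G2n (cprod L).
 rewrite /cprod; elim: L => [|p L IH]; first by rewrite big_nil; exact: nsub1.
 by rewrite big_cons; apply: nsubM => //; exact: G2_comm.
rewrite eP //; congr (zpow _ * _); move: GL; rewrite /cprod.
elim: L => [|p L IH]; first by rewrite !big_nil => _; apply: eU; [exact: nsub1|rewrite zpow0 mul1r].
rewrite !big_cons => GL; have Gp : G2n [~ p.1, p.2]%g by exact: G2_comm.
have GL' : G2n (\prod_(p <- L) [~ p.1, p.2])%g by have := nsubM (nsubV Gp) GL; rewrite mulgA mulVg mul1g.
by rewrite eM // IH.
Qed.

(** The functional attached to [commW] computes the action of a product of commutators on a, and
    that functional depends on one finite level only. *)
Lemma cprod_eigen : exists H : open_nsub A, forall L L',
 (hsum l L : ext2hat l A) H = (hsum l L' : ext2hat l A) H -> cprod L a = cprod L' a.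
have [H [Ph [PD PW PH]]] := alt_form_functional commW_form.
have P0 : Ph 0 = 0 by apply: (addrI (Ph 0)); rewrite -PD !addr0.
have PL L : Ph (hsum l L) = \sum_(p <- L) commW p.1 p.2.
 rewrite /hsum; elim: L => [|p L IH]; first by rewrite !big_nil P0.
 by rewrite !big_cons PD PW IH.
exists H => L L' /PH; rewrite !PL => e'.
by apply: val_inj; rewrite /= !cprod_W e'.
Qed.
End Eigen.

Lemma cprod_local x : E3 x -> exists H : open_nsub A, forall L L',
 (hsum l L : ext2hat l A) H = (hsum l L' : ext2hat l A) H -> cprod L x = cprod L' x.
move=> /(E3_decomp) [S [-> SP]].
elim: S SP => [|a S IH] SP.
 have oT : open (nsub_set (@NSubgroup A setT (And3 Logic.I (fun _ _ _ _ => Logic.I) (fun _ _ => Logic.I)) (fun _ _ _ => Logic.I))).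
 exact: openT.
 by exists (OpenNSub oT) => L L' _; rewrite !big_nil !rmorph0.
have [|H HP] := IH; first by move=> b bS; apply: SP; rewrite inE bS orbT.
have [a3 aG] := SP a (mem_head _ _).
have [->|a0] := eqVneq a 0.
 by exists H => L L' /HP e; rewrite big_cons add0r.
have [H' H'P] := cprod_eigen a0 a3 aG.
have [J [JH JH']] := open_nsubI H H'.
exists J => L L' e; rewrite !big_cons !rmorphD /=; congr (_ + _).
 by apply: H'P; apply: eh_agree e; exact: JH'.
by apply: HP; apply: eh_agree e; exact: JH.
Qed.

Lemma cprod_cat L L' : cprod (L ++ L') = (cprod L * cprod L')%g.
exact: big_cat. Qed.

Lemma cprod_fix L x : sf_val x \in Kb -> cprod L x = x.
exact: GK_const. Qed.

(** The value at x of the still to be constructed commutator of w: products of commutators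
    approximating w well enough all send x to y. *)
Definition acts_as (w : ext2hat l A) (x y : KL) : Prop :=
 exists H : open_nsub A, forall L, (hsum l L : ext2hat l A) H = w H -> cprod L x = y.

Lemma acts_as_total w x : E3 x -> exists y, acts_as w x y.
move=> /cprod_local [H HP]; have [L LH] := hsum_approx w H.
by exists (cprod L x), H => L' e; apply: HP; rewrite e LH.
Qed.

Lemma acts_as2 w x y x' y' : acts_as w x y -> acts_as w x' y' ->
 exists L, cprod L x = y /\ cprod L x' = y'.
move=> [H HP] [H' H'P]; have [J [JH JH']] := open_nsubI H H'.
have [L LJ] := hsum_approx w J; exists L; split.
 by apply: HP; exact: eh_agree LJ.
by apply: H'P; exact: eh_agree LJ.
Qed.

(** The relation [acts_as w] is the graph of an embedding of the fixed field of G^(3) fixing K, and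
    therefore comes from an element of G_K. *)
Lemma acts_as_lift w : exists g : GKn, forall x, E3 x -> acts_as w x (g x).
pose G : set (Om * Om) := [set z | exists x y, [/\ E3 x, acts_as w x y & z = (sf_val x, sf_val y)]].
have agree x y x' y' (f : KL -> KL -> KL) : (forall g : GKn, g (f x x') = f (g x) (g x')) ->
 acts_as w x y -> acts_as w x' y' -> acts_as w (f x x') (f y y').
 move=> fg [H HP] [H' H'P]; have [J [JH JH']] := open_nsubI H H'.
 by exists J => L LJ; rewrite fg (HP L) ?(H'P L) //; exact: eh_agree LJ.
have E3B x x' : E3 x -> E3 x' -> E3 (x - x') by move=> hx hx' h h3; rewrite rmorphB /= hx ?hx'.
have E3M x x' : E3 x -> E3 x' -> E3 (x * x') by move=> hx hx' h h3; rewrite rmorphM /= hx ?hx'.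
have KG x : x \in Kb -> G (x, x).
 move=> xK; pose u : KL := SField (Kb_Kl xK).
 exists u, u; split=> //; first by move=> h _; exact: GK_const.
 have [H _] := @cprod_local u (fun h _ => GK_const h (xK : sf_val u \in Kb)).
 by exists H => L _; exact: cprod_fix.
have fG : field_graph G.
 split; first split.
 - by apply: KG; rewrite rpred1.
 - move=> _ _ [x [y [hx xy ->]]] [x' [y' [hx' xy' ->]]]; exists (x - x'), (y - y').
 split=> //; first exact: E3B.
 by apply: (agree x y x' y' (fun u v => u - v)) => // g; rewrite rmorphB.
 - move=> _ _ [x [y [hx xy ->]]] [x' [y' [hx' xy' ->]]]; exists (x * x'), (y * y').
 split=> //; first exact: E3M.
 by apply: (agree x y x' y' (fun u v => u * v)) => // g; rewrite rmorphM.
 - move=> _ [x [y [hx xy ->]]] /=; have [L [<- _]] := acts_as2 xy xy.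
 by rewrite -[sf_val x]/(val x) -[sf_val (cprod L x)]/(val (cprod L x)) !fmorph_eq0.
 - move=> _ [x [y [hx xy ->]]]; exists x^-1, y^-1; split=> //.
 by move=> h h3; rewrite fmorphV /= hx.
 by have [H HP] := xy; exists H => L LH; rewrite fmorphV /= (HP L).
have [a b _|s sG] := aut_extension fG.
 by split; apply: alg_mono (Om_alg _).
have [t ts] := gal_weaken s KG.
exists (res t) => x hx; have [y xy] := acts_as_total w hx.
have -> : res t x = y by apply: val_inj; rewrite /= ts; apply: sG; exists x, y.
exact: xy.
Qed.

(** Modulo G^(3) an element of G_K is determined by its action on the fixed field of G^(3), so the
    lifts of [acts_as_lift] define the map; additivity and continuity are checked on finitely many
    elements of that field. *)
Lemma commutator_map_ex : exists beta : ext2hat l A -> Gc GKn l, is_commutator_map beta.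
have /choice [S SP] := acts_as_lift.
exists (fun w => to_c l (S w)); split.
- move=> u v; rewrite -to_cM; apply: E3_to_c => x hx.
 have [H HP] := SP (u + v) x hx; have [H1 HP1] := SP v x hx.
 have [H2 HP2] := SP u _ (E3_stable (S v) hx).
 have [J1 [J1H J1H1]] := open_nsubI H H1; have [J [JJ1 JH2]] := open_nsubI J1 H2.
 have [L LJ] := hsum_approx u J; have [L' L'J] := hsum_approx v J.
 have e : hsum l (L ++ L') J = (u + v) J by rewrite hsum_cat !eh_addE' LJ L'J.
 rewrite -(HP (L ++ L')); last by apply: (eh_agree _ e) => y /JJ1; exact: J1H.
 rewrite cprod_cat /= (HP1 L'); last by apply: (eh_agree _ L'J) => y /JJ1; exact: J1H1.
 by rewrite (HP2 L) //; apply: (eh_agree _ LJ).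
- move=> w U; rewrite nbhsE => -[V [oV Vw] VU].
 have /open_galP /(_ _ Vw) [D DV] : open (to_c l @^-1` V) by exact: oV.
 have [||D' [D'3 D'P _]] := krull_density (D := D) (nsub_subgroup G3n) (@infinite_constKL).
 + by move=> c h [c0 _ e] _; apply: GK_const; rewrite -e; exact: j_Kb.
 + by move=> x _; have [r rP] := GK_orbit x; exists r => h _.
 have /choice [H HP] : forall x, exists H : open_nsub A, E3 x ->
 forall L, (hsum l L : ext2hat l A) H = w H -> cprod L x = S w x.
 move=> x; have [hx|nx] := pselect (E3 x); last first.
 by have [H _] := cprod_local (x := 0) (fun h _ => rmorph0 h); exists H.
 by have [H HP] := SP w x hx; exists H.
 rewrite nbhsE; exists [set u : ext2hat l A | forall K, (H @` [set` D']) K -> u K = w K].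
 split=> //.
 apply: (@pw_open_basic _ _ _ (fun (K : open_nsub A) (u : ext2hat l A) => u K)).
 exact/finite_image/finite_seq.
 move=> u /= uw; apply: VU.
 have uD' : {in D', forall x, ((S u)^-1 * S w)%g x = x}.
 move=> x xD'; have hx : E3 x by move=> h; exact: D'3.
 have -> : ((S u)^-1 * S w)%g x = (S u)^-1%g (S w x) by [].
 suff -> : S w x = S u x by exact: (@bij_funK _ (S u)).
 have [H' H'P] := SP u x hx; have [J [JH JH']] := open_nsubI (H x) H'.
 have [L LJ] := hsum_approx u J.
 rewrite -(H'P L); last exact: eh_agree LJ.
 rewrite (HP x hx L) //; rewrite -(uw (H x)); last by exists x.
 exact: eh_agree LJ.
 have [h h3 hD] := D'P ((S u)^-1 * S w)%g uD'.
 have : V (to_c l (S u * h)%g).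
 apply: DV => x xD; have -> : (S u * h)%g x = S u (h x) by [].
 by rewrite hD //= (@bij_invfunK _ (S u)).
 by rewrite to_cM (_ : to_c l h = 1%g) ?mulg1 //; apply/qclass_eq1.
move=> s t; rewrite -to_cR; apply: E3_to_c => x hx.
have [H HP] := SP (hat_wedge l (to_a l s) (to_a l t)) x hx.
by rewrite -(HP [:: (s, t)]) /hsum /cprod ?big_seq1.
Qed.
End CommutatorMap.

(** * Iterated l-th roots inside K(l) *)

Section RootTower.
Notation K := [set x : Om | x \in Kb].

(** A finite Galois layer of l-power degree, together with its stability under all automorphisms of
    Om over K. *)
Definition prol_level (L : divringClosed Om) : Prop :=
 [/\ galois_over Kb L, exists n, has_degree Kb L (l ^ n) & forall (s : GO) x, x \in L -> s x \in L].

Lemma prol_level_Kl L x : prol_level L -> x \in L -> x \in Kl l i j.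
by move=> [gL dL _] xL; apply: fld_gen_incl; exists L. Qed.

Lemma prol_level_base : prol_level Kb.
split.
- split=> // x xK; exists [:: x]; rewrite big_seq1 polyOverXsubC mem_head; split=> // y.
 by rewrite inE => /eqP ->.
- exists 0%N, (fun _ => 1); split=> [m|x xK]; first exact: rpred1.
 exists [ffun=> x]; split=> [|c [cK ->]]; first by rewrite big_ord1 ffunE mulr1; split=> // m; rewrite ffunE.
 by apply/ffunP => m; rewrite ffunE big_ord1 mulr1 [m]ord1.
by move=> s x xK; have [_ _ ->] := galP s.
Qed.

Lemma degree_tower (E : fieldType) (F L M : divringClosed E) (m n : nat) :
 {subset F <= L} -> {subset L <= M} ->
 has_degree F L m -> has_degree L M n -> has_degree F M (m * n).
move=> FL LM [b [bL bP]] [b' [b'M b'P]].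
pose ix (q : 'I_(m * n)) := vec_mx (\row_k k) : 'M['I_(m * n)]_(m, n).
have e (f : 'I_m -> 'I_n -> E) : \sum_(q < m * n) f (enum_val (cast_ord (esym (mxvec_cast m n)) q)).1
 (enum_val (cast_ord (esym (mxvec_cast m n)) q)).2 = \sum_(p < m) \sum_(r < n) f p r.
 rewrite pair_bigA /= (reindex (fun q : 'I_(m * n) => enum_val (cast_ord (esym (mxvec_cast m n)) q))) //=.
 exists (fun pr => cast_ord (mxvec_cast m n) (enum_rank pr)) => x _.
 by rewrite enum_valK cast_ordKV.
 by rewrite cast_ordK enum_rankK.
pose dx (q : 'I_(m * n)) := enum_val (cast_ord (esym (mxvec_cast m n)) q) : 'I_m * 'I_n.
have dx_mx p r : dx (mxvec_index p r) = (p, r) by rewrite /dx /mxvec_index cast_ordK enum_rankK.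
have mx_dx q : mxvec_index (dx q).1 (dx q).2 = q by rewrite /mxvec_index -surjective_pairing /dx enum_valK cast_ordKV.
exists (fun q => b (dx q).1 * b' (dx q).2); split=> [q|x xM].
 by rewrite rpredM // LM.
have [c [[cL xE] cU]] := b'P x xM.
have /choice [d dP] : forall r, exists d : {ffun 'I_m -> E}, ((forall p, d p \in F) /\ c r = \sum_p d p * b p) /\
 forall d' : {ffun 'I_m -> E}, (forall p, d' p \in F) /\ c r = \sum_p d' p * b p -> d = d'.
 by move=> r; have [d [h1 h2]] := bP _ (cL r); exists d; split.
exists [ffun q => d (dx q).2 (dx q).1]; split.
 split=> [q|]; first by rewrite ffunE; exact: (proj1 (proj1 (dP _))).
 rewrite xE (eq_bigr (fun q => d (dx q).2 (dx q).1 * (b (dx q).1 * b' (dx q).2))); last by move=> q _; rewrite ffunE.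
 rewrite (e (fun p r => d r p * (b p * b' r))) exchange_big /=; apply: eq_bigr => r _.
 rewrite (proj2 (proj1 (dP r))) mulr_suml; apply: eq_bigr => p _; by rewrite mulrA.
move=> d' [d'F xE']; apply/ffunP => q; rewrite ffunE.
have ce : c = [ffun r => \sum_p d' (mxvec_index p r) * b p].
 apply: cU; split=> [r|]; first by rewrite ffunE rpred_sum // => p _; rewrite rpredM // FL.
 rewrite xE' (eq_bigr (fun q => d' (mxvec_index (dx q).1 (dx q).2) * (b (dx q).1 * b' (dx q).2))); last by move=> q' _; rewrite mx_dx.
 rewrite (e (fun p r => d' (mxvec_index p r) * (b p * b' r))) exchange_big /=; apply: eq_bigr => r _.
 by rewrite ffunE mulr_suml; apply: eq_bigr => p _; rewrite mulrA.
have -> := proj2 (dP (dx q).2) [ffun p => d' (mxvec_index p (dx q).2)].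
 by rewrite ffunE mx_dx.
split=> [p|]; first by rewrite ffunE.
by rewrite ce ffunE; apply: eq_bigr => p _; rewrite ffunE.
Qed.

Lemma level_fixed L x : prol_level L -> x \in L -> (forall s : GO, s x = x) -> x \in Kb.
move=> [[_ gL] _ _] xL fx; have [s [us _ xs sP]] := gL x xL.
apply: (separable_fixed (F := K) (div_subfield Kb) _ fx).
exists (\prod_(y <- s) ('X - y%:P)); split; first by move/polyOverP: sP.
 by rewrite separable_prod_XsubC.
by rewrite root_prod_XsubC.
Qed.

(** The condition on conjugates makes L(a) stable under automorphisms over K, hence again Galois
    over K; its degree over L is 1 or l. *)
Lemma level_root L a : prol_level L -> a ^+ l \in L -> a != 0 ->
 (forall s : GO, exists2 c, c \in L & s a = c * a) ->
 exists L', [/\ prol_level L', {subset L <= L'} & a \in L'].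
move=> pL aL a0 aS; have [[KL gL] [n dL] sL] := pL.
have [aLL|na] := boolP (a \in L); first by exists L; split.
have hL := div_subfield L.
have zL : z_ \in L by apply: KL; exact: zeta_Kb.
have [s0 s0a] : exists s0 : gal [set x | x \in L], s0 a = z_ * a.
 have [s sa] : exists s : gal [set x | x \in L], s a != a.
 apply: contrapT => h; move/negP: na; apply; apply: (separable_fixed hL) => [|s]; last first.
 by apply/eqP; apply: contra_notT h => h; exists s.
 exists ('X^l - (a ^+ l)%:P); split.
 - move=> m; rewrite coefB coefXn coefC /=; apply: rpredB; first by case: eqP; rewrite ?rpred0 ?rpred1.
 by case: eqP => _; rewrite ?rpred0.
 - by apply: separable_XnsubC; rewrite ?expf_neq0.
 - by rewrite rootE !hornerE subrr.
 have [k kl sk] := kummer_conj zeta_prim s aL.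
 have k0' : (0 < k < l)%N by rewrite kl andbT lt0n; apply: contraNneq sa => k0'; rewrite sk k0' expr0 mul1r.
 have [m km] := inv_mod k0'; exists (s ^+ m)%g.
 have galX q : (s ^+ q)%g a = z_ ^+ (k * q) * a.
 elim: q => [|q IH]; first by rewrite muln0 expr0 mul1r.
 have -> : (s ^+ q.+1)%g a = s ((s ^+ q)%g a) by rewrite expgS.
 have sz : s z_ = z_ by have [_ _ ->] := galP s.
 by rewrite IH rmorphM rmorphXn /= sk sz mulrA -exprD mulnS addnC.
 rewrite galX -[in RHS](expr1 z_); congr (_ * _).
 by apply/eqP; rewrite (eq_prim_root_expr zeta_prim) km.
pose LS := kummer_field_sub zeta_prim zL aL s0a a0.
pose M := fld LS.
have LM : {subset L <= M}.
 move=> x xL; apply/fldP; exists x%:P; rewrite ?hornerC // => m; rewrite coefC /=.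
 by case: ifP => _; rewrite ?rpred0.
have aM : a \in M by apply/fldP; exists 'X; rewrite ?hornerX //; apply/polyOverP; rewrite polyOverX.
have dM : has_degree L M l.
 exists (fun m => a ^+ m); split=> [m|x /fldP Lx]; first exact: rpredX.
 have [c [cK xE]] := kummer_coord zeta_prim aL Lx; exists [ffun k => c k]; split.
 split=> [m|]; first by rewrite ffunE.
 by rewrite xE; apply: eq_bigr => m _; rewrite ffunE.
 move=> c' [c'K xE']; apply/ffunP => m; rewrite ffunE; apply/eqP; rewrite -subr_eq0; apply/eqP.
 have e0 : \sum_(k < l) (c k - c' k) * a ^+ k = 0 by under eq_bigr do rewrite mulrBl; rewrite sumrB -xE -xE' subrr.
 exact: (@kummer_indep _ _ _ L zeta_prim zL a s0 s0a a0 (fun k => c k - c' k) (fun k => rpredB (cK k) (c'K k)) e0 m).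
have sM (s : GO) x : x \in M -> s x \in M.
 move=> /fldP [p pL' ->]; rewrite horner_coef rmorph_sum; apply: (@big_ind _ (fun y => y \in M)) => [|u v|q _].
 - exact: rpred0.
 - exact: rpredD.
 have [c cL sa] := aS s.
 rewrite rmorphM rmorphXn [X in X ^+ q](sa : s a = _); apply: rpredM; first by apply/LM/sL; exact: pL'.
 by apply/rpredX/rpredM => //; exact: LM.
exists M; split=> //; split=> //; last first.
 by exists n.+1; rewrite expnSr; apply: (degree_tower KL LM).
split; first by move=> x /KL /LM.
move=> x xM; have [r rP] := finite_orbit (Om_alg x).
pose s := [seq y <- undup r | `[< exists g : GO, y = g x >]].
have sP y : y \in s <-> exists g : GO, y = g x.
 rewrite mem_filter mem_undup; split=> [/andP[/asboolP//]|[g e]].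
 by apply/andP; split; [apply/asboolP; exists g|rewrite e].
have us : uniq s by rewrite filter_uniq ?undup_uniq.
have fixs (f : {rmorphism Om -> Om}) : {in s, forall y, f y \in s} ->
 map_poly f (\prod_(y <- s) ('X - y%:P)) = \prod_(y <- s) ('X - y%:P).
 move=> fs; rewrite rmorph_prod /=; under eq_bigr do rewrite map_polyXsubC.
 rewrite -(big_map f predT (fun y => 'X - y%:P)); apply: perm_big.
 have um : uniq (map f s) by rewrite map_inj_uniq //; exact: fmorph_inj.
 apply: uniq_perm => //; apply: (uniq_min_size um _ _).2; last by rewrite size_map.
 by move=> _ /mapP [y ys ->]; exact: fs.
exists s; split=> //.
- by move=> y /sP [g ->]; exact: sM.
- by apply/sP; exists 1%g.
have [t0 t0E] := gal_weaken s0 KL.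
apply/polyOverP => q; apply: (level_fixed pL) => [|g]; last first.
 by rewrite -coef_map fixs // => y /sP [h ->]; apply/sP; exists (g * h)%g.
apply: (kummer_fixed zeta_prim zL aL s0a a0).
 apply/(fldP LS); move: q; apply/polyOverP; rewrite big_seq; apply: rpred_prod => y /sP [g ->].
 by rewrite polyOverXsubC sM.
rewrite -coef_map fixs // => y /sP [h ->]; apply/sP; exists (t0 * h)%g.
by rewrite /= t0E.
Qed.
End RootTower.

(** * Steinberg relations and commuting elements *)

Section Steinberg.
Notation A := (Ga GKn l).

Lemma autg_lift (p : autg A) (s : GO) : exists t : GO, p (to_a l (res s)) = to_a l (res t).
have [u ->] := qclass_surj (p (to_a l (res s))).
by have [t <-] := res_surj u; exists t.
Qed.

Section OneRelation.
Variables (z z' : Om).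
Hypotheses (zK : z \in Kb) (zK' : z' \in Kb) (z0 : z != 0) (z0' : z' != 0) (zz : z + z' = 1).

Let al := lroot z.
Let al' := lroot z'.
Let g n := 1 - z_ ^+ n * al.
Let P n := \prod_(k < n) g k.
(** An l-th root of the product of the r-th powers of 1 - zeta^r al. The field K(al, al', ga) is the
    Heisenberg extension attached to z + z' = 1. *)
Let ga := \prod_(r < l) lroot (g r) ^+ r.

Let alE : al ^+ l = z. exact: lrootP. Qed.
Let alE' : al' ^+ l = z'. exact: lrootP. Qed.
Let al0 : al != 0. exact: lroot_nz. Qed.
Let al0' : al' != 0. exact: lroot_nz. Qed.
Let zl : l.-primitive_root z_. exact: zeta_prim. Qed.

Let g_per n : g (n + l) = g n.
by rewrite /g exprD (prim_expr_order zl) mulr1. Qed.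

(** The factorisation of X^l - 1 evaluated at 1/al: the conjugates of 1 - al have product 1 - z. *)
Let Pl : P l = z'.
have <- : 1 - z = z' by rewrite -zz addrC addKr.
have := congr1 (fun p => p.[al^-1]) (factor_Xn_sub_1 zl).
rewrite horner_prod big_mkord !hornerE -alE => e.
rewrite /P (eq_bigr (fun k : 'I_l => al * (al^-1 - z_ ^+ k))); last first.
 by move=> k _; rewrite mulrBr divff // [al * _]mulrC.
rewrite big_split /= prodr_const card_ord.
rewrite (eq_bigr (fun k : 'I_l => ('X - (z_ ^+ k)%:P).[al^-1])); last by move=> k _; rewrite !hornerE.
by rewrite e mulrBr mulr1 -exprMn divff // expr1n.
Qed.

Let g_nz n : g n != 0.
have h m : (m < l)%N -> g m != 0.
 move=> ml; apply: contraNneq z0' => e.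
 by rewrite -Pl /P (bigD1 (Ordinal ml)) //= e mul0r.
rewrite (divn_eq n l) addnC; elim: (n %/ l)%N => [|q IH].
 by rewrite mul0n addn0 h // ltn_pmod ?prime_gt0.
by rewrite mulSn addnCA addnC g_per.
Qed.

Let P_nz n : P n != 0.
by apply/prodf_neq0 => k _; exact: g_nz. Qed.

Let P_D m n : P (m + n) = P m * \prod_(k < n) g (k + m).
by rewrite /P big_split_ord /=; congr (_ * _); apply: eq_bigr => k _; rewrite addnC. Qed.

Let P_shift m : \prod_(k < l) g (k + m) = z'.
apply: (mulfI (P_nz m)); rewrite -P_D addnC P_D Pl mulrC; congr (_ * _).
by apply: eq_bigr => k _; rewrite g_per.
Qed.

Let P_mull n : P (l * n) = z' ^+ n.
elim: n => [|n IH]; first by rewrite muln0 /P big_ord0.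
by rewrite mulnS addnC P_D IH P_shift exprSr.
Qed.

Let f m := \prod_(r < l) g (r + m) ^+ r.

Let f_step m : f m.+1 * z' = f m * g m ^+ l.
rewrite -(P_shift m.+1) /f -big_split /=.
rewrite (eq_bigr (fun r : 'I_l => g (r.+1 + m) ^+ r.+1)); last first.
 by move=> r _; rewrite -exprSr addnS addSn.
have := big_ord_recl l (fun r : 'I_l.+1 => g (r + m) ^+ r) : \prod_(r < l.+1) _ = _.
rewrite big_ord_recr /= expr0 mul1r [(l + m)%N]addnC g_per => e.
by rewrite e; apply: eq_bigr.
Qed.

Let f_P m : f m * al' ^+ (l * m) = f 0%N * P m ^+ l.
elim: m => [|m IH]; first by rewrite muln0 expr0 /P big_ord0 expr1n.
rewrite mulnS exprD mulrA alE' f_step mulrAC IH /P big_ord_recr /= exprMn.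
by rewrite mulrA.
Qed.

Let gaE : ga ^+ l = f 0%N.
rewrite /ga -prodrXl; apply: eq_bigr => r _.
by rewrite exprAC lrootP // addn0.
Qed.

Let ga0 : ga != 0.
by apply/prodf_neq0 => k _; rewrite expf_neq0 ?lroot_nz. Qed.

(** The coordinates of s in the Heisenberg group: its actions on [al], [al'] and [ga]. The factors
    [al' ^+ m] and [P m] come from the comparison of f m with f 0 in [f_P]. *)
Let data (s : GO) m b e := [/\ s al = z_ ^+ m * al, s al' = z_ ^+ b * al' &
 s ga * al' ^+ m = z_ ^+ e * ga * P m].

Let s_z (s : GO) n : s (z_ ^+ n) = z_ ^+ n.
by have [_ _ ->] := galP s; rewrite //= rpredX ?zeta_Kb. Qed.

Let s_g (s : GO) m n : s al = z_ ^+ m * al -> s (g n) = g (n + m).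
by move=> e; rewrite /g rmorphB rmorphM rmorph1 /= s_z e mulrA -exprD. Qed.

Let data_e (s : GO) m b : s al = z_ ^+ m * al -> s al' = z_ ^+ b * al' -> exists e, data s m b e.
move=> e1 e2; have sf0 : s (f 0%N) = f m.
 rewrite rmorph_prod /=; apply: eq_bigr => r _.
 by rewrite rmorphXn /= (s_g _ e1) addn0.
have am0 : al' ^+ m != 0 by rewrite expf_neq0.
have [|e el ee] := @root_of_unityE Om l z_ zl (s ga * al' ^+ m / (ga * P m)).
 rewrite expr_div_n !exprMn -rmorphXn /= gaE sf0 -exprM mulnC f_P divff //.
 by rewrite mulf_neq0 ?expf_neq0 // -gaE expf_neq0.
by exists e; split=> //; rewrite -mulrA -ee divfK // mulf_neq0.
Qed.

Let data_ex (s : GO) : exists m b e, data s m b e.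
have [m _ e1] := @kummer_conj Om l z_ zl _ s al (etrans (congr1 (fun x => x \in Kb) alE) zK).
have [b _ e2] := @kummer_conj Om l z_ zl _ s al' (etrans (congr1 (fun x => x \in Kb) alE') zK').
by have [e h] := data_e e1 e2; exists m, b, e.
Qed.

(** The multiplication law of the Heisenberg group; the twist [b * n] is the noncommutative part. *)
Let data_comp (s t : GO) m b e n c h : data s m b e -> data t n c h ->
 s (t ga) * al' ^+ (m + n) * z_ ^+ (b * n) = z_ ^+ (e + h) * ga * P (m + n).
move=> [s1 s2 s3] [t1 t2 t3].
have := congr1 s t3; rewrite !rmorphM !rmorphXn /= s2 exprMn -exprM.
have -> : s z_ ^+ h = z_ ^+ h by rewrite -rmorphXn /= s_z.
have -> : s (P n) = \prod_(k < n) g (k + m) by rewrite rmorph_prod; apply: eq_bigr => k _; exact: s_g.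
move=> E; rewrite exprD P_D.
transitivity (s (t ga) * (z_ ^+ (b * n) * al' ^+ n) * al' ^+ m).
 by rewrite [LHS](AC (1*2*1) (1*(4*3)*2)).
rewrite E -!mulrA [_ * al' ^+ m]mulrC !mulrA -[z_ ^+ h * s ga * _]mulrA s3.
by rewrite exprD !mulrA [z_ ^+ h * _]mulrC.
Qed.

Let cancel3 x y u : x * al' ^+ u = y * al' ^+ u -> x = y.
by apply: mulIf; rewrite expf_neq0. Qed.

Lemma gamma_Kl : ga \in Kl l i j.
have [L1 [p1 _ a1]] : exists L', [/\ prol_level L', {subset Kb <= L'} & al \in L'].
 apply: (level_root prol_level_base) => //; first by rewrite alE.
 move=> s; have [m [b [e [-> _ _]]]] := data_ex s; exists (z_ ^+ m) => //.
 by rewrite rpredX ?zeta_Kb.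
have KL (L : divringClosed Om) : prol_level L -> {subset Kb <= L} by case=> [[]].
have zL L : prol_level L -> z_ \in L by move=> /KL; apply; exact: zeta_Kb.
have [L2 [p2 L12 a2]] : exists L', [/\ prol_level L', {subset L1 <= L'} & al' \in L'].
 apply: (level_root p1) => //; first by rewrite alE' (KL _ p1).
 move=> s; have [m [b [e [_ -> _]]]] := data_ex s; exists (z_ ^+ b) => //.
 by rewrite rpredX ?zL.
have gL n : g n \in L2 by rewrite rpredB ?rpred1 ?rpredM ?rpredX ?zL ?L12.
have [|//|s|L3 [p3 _ a3]] := @level_root L2 ga p2.
- by rewrite gaE rpred_prod // => r _; rewrite rpredX.
- have [m [b [e [_ _ sg]]]] := data_ex s; exists (z_ ^+ e * P m / al' ^+ m).
 by rewrite rpred_div ?rpredM ?rpredX ?zL // rpred_prod.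
 by apply: (@cancel3 _ _ m); rewrite sg [RHS]mulrAC divfK ?expf_neq0 // mulrAC.
exact: prol_level_Kl p3 a3.
Qed.

(** It suffices to treat the generators of G^(3): elements fixing [al] and [al'] act on [ga] by
    central scalars, and powers are computed with the multiplication law. *)
Lemma gamma_G3 (u : GKn) : G3n u -> u (SField gamma_Kl) = SField gamma_Kl.
set gk := SField gamma_Kl.
have H (s t : GO) : s (t ga) = t (s ga) -> ([~ res s, res t]%g : GKn) gk = gk.
 move=> e; apply: val_inj.
 suff e' : s^-1%g (t^-1%g (s (t ga))) = ga by exact: e'.
 by rewrite e [t^-1%g _](@bij_funK _ t); exact: (@bij_funK _ s).
apply: (closed_gen_min (H := [set u : GKn | u gk = gk])).
- split=> // [x y hx hy|x hx].
 by have e : x (y gk) = gk; [rewrite (hy : y gk = gk)|exact: e].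
 have e : x^-1%g (x gk) = gk by exact: (@bij_funK _ x).
 by rewrite (hx : x gk = gk) in e.
- exact: closed_gal_fix.
move=> _ [[x [y [Gy ->]]]|[x ->]] /=.
 have [s sx] := res_surj x; have [t ty] := res_surj y; subst x y.
 have ta : t al = al.
 have aK : al \in Kl l i j by apply: root_Kl; rewrite // alE.
 move/(G2_kummer): Gy => /(_ (SField aK)) /=; rewrite alE => /(_ zK).
 by move/(congr1 (@sf_val _ _)).
 have ta' : t al' = al'.
 have aK : al' \in Kl l i j by apply: root_Kl; rewrite // alE'.
 move/(G2_kummer): Gy => /(_ (SField aK)) /=; rewrite alE' => /(_ zK').
 by move/(congr1 (@sf_val _ _)).
 have [h dt] : exists h, data t 0 0 h by apply: data_e; rewrite expr0 mul1r.
 have [m [b [e ds]]] := data_ex s.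
 apply: H; have := data_comp ds dt; have := data_comp dt ds.
 rewrite muln0 mul0n expr0 !mulr1 add0n addn0 [(h + e)%N]addnC => <-.
 exact: cancel3.
have [s sx] := res_surj x; subst x.
have [m [b [e ds]]] := data_ex s; have [s1 s2 s3] := ds.
have pw q : (s ^+ q)%g ga * al' ^+ (q * m) * z_ ^+ (b * m * 'C(q, 2)) = z_ ^+ (q * e) * ga * P (q * m).
 elim: q => [|q IH]; first by rewrite !mul0n muln0 !expr0 /P big_ord0 !mulr1 mul1r.
 have -> : (s ^+ q.+1)%g ga = s ((s ^+ q)%g ga) by rewrite expgS.
 have := congr1 s IH; rewrite !rmorphM !rmorphXn /= s2 exprMn -exprM.
 have sz : s z_ = z_ by have := s_z s 1; rewrite expr1.
 have -> : s (P (q * m)%N) = \prod_(k < q * m) g (k + m) by rewrite rmorph_prod; apply: eq_bigr => k _; exact: s_g.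
 rewrite sz => E; rewrite binS bin1 mulSn exprD P_D.
 transitivity (s ((s ^+ q)%g ga) * (z_ ^+ (b * (q * m)) * al' ^+ (q * m)) * z_ ^+ (b * m * 'C(q, 2)) * al' ^+ m).
 rewrite mulnDr [in z_ ^+ (_ + _)]exprD (_ : (b * m * q)%N = (b * (q * m))%N); last by rewrite mulnAC -mulnA.
 by rewrite [LHS](AC (1*2*2) (1*(5*3)*4*2)).
 rewrite E -!mulrA [_ * al' ^+ m]mulrC !mulrA -[z_ ^+ (q * e) * s ga * _]mulrA s3.
 by rewrite mulSn exprD !mulrA [z_ ^+ (q * e) * _]mulrC.
set d := (_ * l)%N; have [d' dE] : exists d', d = (l * d')%N by exists (if l == 2 then 2 else 1)%N; rewrite mulnC.
(* The power formula has the exponent 'C(d, 2), and this is where the factor delta matters: d = l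
   works for odd l, while l = 2 takes d = 4, with 'C(4, 2) = 6. *)
have ld : (l %| 'C(d, 2))%N.
 rewrite /d; have [->//|l2] := eqVneq l 2%N.
 by rewrite mul1n prime_dvd_bin //= ltn_neqAle eq_sym l2 prime_gt1.
apply: val_inj; rewrite /= -[RHS]mul1r.
have rX n : res (s ^+ n)%g = (res s ^+ n)%g by elim: n => [|n IH]; rewrite ?expgS ?resM ?IH //; apply: gal_eq => y; apply: val_inj.
rewrite -rX /=; have := pw d.
rewrite (eqP (_ : z_ ^+ (b * m * 'C(d, 2)) == 1)); last first.
 by rewrite -(prim_order_dvd zl) dvdn_mull.
rewrite (eqP (_ : z_ ^+ (d * e) == 1)); last by rewrite -(prim_order_dvd zl) dE -mulnA dvdn_mulr.
rewrite dE -mulnA P_mull exprM alE' mulr1.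
by move/(mulIf (expf_neq0 _ z0')).
Qed.

(** If s and t commute on [ga], their Heisenberg twists [b * n] and [c * m] agree modulo l; this
    equality is the determinant relation. *)
Lemma steinberg_commute (s t : GO) : G3n [~ res s, res t]%g ->
 chi z s * chi z' t = chi z t * chi z' s.
move=> /gamma_G3 /(congr1 (@sf_val _ _)) => e.
have {}e : s^-1%g (t^-1%g (s (t ga))) = ga by exact: e.
have {}e : s (t ga) = t (s ga).
 have := congr1 (fun x => t (s x)) e; rewrite /= (@bij_invfunK _ s) (@bij_invfunK _ t) => ->.
 by [].
have [m [b [e1 ds]]] := data_ex s; have [n [c [e2 dt]]] := data_ex t.
have [s1 s2 _] := ds; have [t1 t2 _] := dt.
have h1 := data_comp ds dt; have h2 := data_comp dt ds.
have {}h2 : s (t ga) * al' ^+ (m + n) * z_ ^+ (c * m) = z_ ^+ (e1 + e2) * ga * P (m + n) by rewrite e [(m + n)%N]addnC [(e1 + e2)%N]addnC; exact: h2.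
rewrite -h1 in h2.
have stn : s (t ga) * al' ^+ (m + n) != 0 by rewrite mulf_neq0 ?fmorph_eq0 ?expf_neq0.
move/(mulfI stn)/eqP: h2; rewrite -!(zpow_nat) => /eqP/(zpow_inj); rewrite !natrM => h2.
have cE w a (x : GO) k : w \in Kb -> w != 0 -> a ^+ l = w -> x a = z_ ^+ k * a -> chi w x = k%:R.
 move=> wK w0 aw xa; apply: (chi_uniq wK aw); last by rewrite zpow_nat.
 exact: expf_nz pl aw w0.
rewrite (cE _ _ _ _ zK z0 alE s1) (cE _ _ _ _ zK z0 alE t1).
rewrite (cE _ _ _ _ zK' z0' alE' s2) (cE _ _ _ _ zK' z0' alE' t2).
by rewrite [RHS]mulrC -h2 mulrC.
Qed.
End OneRelation.

(** The character of z composed with p is the character of w. *)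
Definition dual_char (p : autg A) (z w : Om) : Prop :=
 forall s t : GO, p (to_a l (res s)) = to_a l (res t) -> chi z t = chi w s.

Lemma commute_kernel (s t : GKn) : G3n [~ s, t]%g ->
 commutator_kernel (hat_wedge l (to_a l s) (to_a l t)).
move=> h; have [b bP] := commutator_map_ex.
exists b => //; have [_ _ ->] := bP; rewrite -to_cR; exact/(qclass_eq1 G3n).
Qed.

(** The wedge of a commuting pair lies in the kernel R, which p preserves, and the commutator map
    reads off commutation of the images. *)
Lemma autc_commute (p : autg A) (s t s' t' : GKn) : is_autc p ->
 p (to_a l s) = to_a l s' -> p (to_a l t) = to_a l t' ->
 G3n [~ s, t]%g -> G3n [~ s', t']%g.
move=> [pR _] ps pt /commute_kernel /pR.
have -> : ext2hat_map (autg_hom p) (hat_wedge l (to_a l s) (to_a l t)) =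
 hat_wedge l (to_a l s') (to_a l t').
 apply/ext2hatP => H; rewrite /= /ext2hat_fun /= wedge2_map_wedge; last first.
 by apply: qmapM => //; have [] := autgP p.
 by rewrite !qmapE ?ps ?pt //; have [] := autgP p.
move=> [b [_ _ ->]]; rewrite -to_cR => /(qclass_eq1 G3n).
by [].
Qed.

Lemma autc_steinberg (p : autg A) z z' w w' (s t : GO) : is_autc p ->
 z \in Kb -> z' \in Kb -> z != 0 -> z' != 0 -> z + z' = 1 ->
 dual_char p z w -> dual_char p z' w' -> G3n [~ res s, res t]%g ->
 chi w s * chi w' t = chi w t * chi w' s.
move=> pc zK zK' z0 z0' zz zw zw' h.
have [s' ps] := autg_lift p s; have [t' pt] := autg_lift p t.
have := steinberg_commute zK zK' z0 z0' zz (autc_commute pc ps pt h).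
by rewrite (zw _ _ ps) (zw _ _ pt) (zw' _ _ ps) (zw' _ _ pt).
Qed.
End Steinberg.

(** * Inertia and decomposition of a place trivial on the constants *)

Section Inertia.
Variable P : set (Om * Om).
Hypotheses (pP : place P) (kP : forall c, c \in kb -> P (c, c)).

Let hP : hom_graph P := pl_hg pP.

Definition punit (x : Om) := exists2 q, q != 0 & P (x, q).

(** t belongs to the decomposition group of P and induces f on residues; inertia is the case of the
    identity. *)
Definition acts_by (t : GO) (f : Om -> Om) := forall x q, P (x, q) -> P (t x, f q).

Definition inertia (s : GO) := acts_by s idfun.

Lemma punitV x : punit x -> punit x^-1.
by move=> [q q0 h]; exists q^-1; rewrite ?invr_eq0 //; exact: plV. Qed.

Lemma punitM x y : punit x -> punit y -> punit (x * y).
by move=> [q q0 h] [r r0 h']; exists (q * r); rewrite ?mulf_neq0 //; exact: hgM. Qed.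

Lemma punit_nz x : punit x -> x != 0.
by move=> [q q0 h]; exact: (pl_nz pP h q0). Qed.

Lemma punit_cases x : x != 0 -> [\/ punit x, P (x, 0) | P (x^-1, 0)].
move=> x0; have [[q h]|h] := pl_total pP x; last exact: Or33.
by have [q0|q0] := eqVneq q 0; [rewrite q0 in h; exact: Or32|apply: Or31; exists q].
Qed.

Lemma punit_root n x : (0 < n)%N -> x != 0 -> punit (x ^+ n) -> punit x.
move=> n0 x0 [q q0 h]; have [//|h'|h'] := punit_cases x0.
 by have := hg_fun hP h (hgX hP n h'); rewrite expr0n gtn_eqF // => e; rewrite e eqxx in q0.
have := hgX hP n h'; rewrite expr0n gtn_eqF // exprVn => h1.
have := hgM hP h h1; rewrite divff ?expf_neq0 // mulr0 => h2.
by have := hg_fun hP h2 (hg1 hP) => /esym/eqP; rewrite oner_eq0.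
Qed.

Lemma gal_period (g : GO) x : exists2 m, (0 < m)%N & iter m g x = x.
have [r rP] := finite_orbit (Om_alg x).
have itE m : iter m g x = (g ^+ m)%g x by elim: m => [|m IH] //=; rewrite IH expgS.
pose s := [seq iter m g x | m <- iota 0 (size r).+1].
have /(uniqPn 0) [a [b [ab]]] : ~~ uniq s.
 apply/negP => us; have : (size s <= size r)%N.
 by apply: uniq_leq_size => // _ /mapP [m _ ->]; rewrite itE; exact: rP.
 by rewrite size_map size_iota ltnn.
have inj : injective g by exact: fmorph_inj.
have iinj n : injective (iter n g) by elim: n => [|n IH] y z //= /inj /IH.
rewrite size_map size_iota => bs.
have as' := ltn_trans ab bs.
rewrite !(nth_map 0%N) ?size_iota // !nth_iota // !add0n -(subnK (ltnW ab)) addnC iterD => /iinj e.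
by exists (b - a)%N; rewrite ?subn_gt0.
Qed.

Lemma ratio_prod (g : GO) x m : x != 0 -> \prod_(n < m) iter n g (g x / x) = iter m g x / x.
move=> x0; elim: m => [|m IH]; first by rewrite big_ord0 divff.
have itM n y z : iter n g (y / z) = iter n g y / iter n g z by elim: n => [|n IH'] //=; rewrite IH' fmorph_div.
have itn n y : (iter n g y == 0) = (y == 0) by elim: n => [|n IH'] //=; rewrite fmorph_eq0.
rewrite big_ord_recr /= IH itM -iterSr iterS mulrC mulrACA [_ * x^-1]mulrC.
by rewrite -mulrA [X in _ * X]mulrC divfK ?itn // mulrC.
Qed.

(** t has a finite period m on x, and the product of the m translates of t(x)/x telescopes to 1; an
    element of the maximal ideal, or one with such an inverse, cannot satisfy this. *)
Lemma ratio_unit (t : GO) (f : {rmorphism Om -> Om}) x : acts_by t f -> x != 0 -> punit (t x / x).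
move=> tf x0; have [m m0 mx] := gal_period t x.
have no y : P (y, 0) -> \prod_(n < m) iter n t y = 1 -> False.
 move=> Py e; have Pn n : P (iter n t y, 0).
 by elim: n => //= n IH; have := tf _ _ IH; rewrite rmorph0.
 have := hg_prod hP (index_enum _) (fun n : 'I_m => Pn n); rewrite e => h.
 have := hg_fun hP h (hg1 hP); rewrite prodr_const card_ord expr0n gtn_eqF // => /esym/eqP.
 by rewrite oner_eq0.
have e : \prod_(n < m) iter n t (t x / x) = 1 by rewrite ratio_prod // mx divff.
have [|//|h|h] := @punit_cases (t x / x); first by rewrite mulf_neq0 ?invr_eq0 ?fmorph_eq0.
 by case: (no _ h e).
have itV n y : iter n t y^-1 = (iter n t y)^-1 by elim: n => [|n IH] //=; rewrite IH fmorphV.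
have e1 : \prod_(n < m) iter n t (t x / x)^-1 = 1 by rewrite (eq_bigr (fun n : 'I_m => (iter n t (t x / x))^-1)) // prodfV e invr1.
by case: (no _ h e1).
Qed.

(** On an eigenvector the commutator is a scalar zeta^k. Comparing residues of s(t a) and t(s a),
    both divided by a, shows that zeta^k = 1. *)
Lemma comm_G3 (s t : GO) (f : {rmorphism Om -> Om}) : inertia s -> acts_by t f ->
 (forall c, c \in kb -> f c = c) -> G3n [~ res s, res t]%g.
move=> si tf fk; apply: krull_GK; [exact: nsub_subgroup|exact: closed_gen_closed|].
move=> z /(E3_decomp) [L [-> LP]]; rewrite rmorph_sum.
rewrite big_seq [RHS]big_seq; apply: eq_bigr => a /LP [a3 aG].
have [->|a0] := eqVneq a 0; first by rewrite rmorph0.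
have [k ak] : exists k, ([~ res s, res t]%g : GKn) a = zetaK ^+ k * a by apply: aG; exact: G2_comm.
pose al := sf_val a; have al0 : al != 0 by apply: contraNneq a0 => h; apply/eqP/val_inj.
have e : s (t al) = z_ ^+ k * t (s al).
 have : s^-1%g (t^-1%g (s (t al))) = z_ ^+ k * al by have := congr1 (@sf_val _ _) ak; rewrite sf_valZ.
 move/(congr1 s); rewrite (@bij_invfunK _ s) => /(congr1 t); rewrite (@bij_invfunK _ t) => ->.
 have fz (g : GO) : g z_ = z_ by have [_ _ ->] := galP g; rewrite //= zeta_Kb.
 by rewrite !rmorphM !rmorphXn /= !fz.
have [w w0 Pw] := ratio_unit (f := idfun) si al0.
have [u u0 Pu] := ratio_unit tf al0.
have E : s (t al / al) * (s al / al) = z_ ^+ k * (t (s al / al) * (t al / al)).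
 rewrite !fmorph_div /= e; have sa : s al != 0 by rewrite fmorph_eq0.
 have ta : t al != 0 by rewrite fmorph_eq0.
 rewrite mulrA divfK // [t (s al) / _ * _]mulrA divfK //; by rewrite mulrA.
have h1 := hgM hP (si _ _ Pu) Pw; have h2 := hgM hP (tf _ _ Pw) Pu.
have Pz n : P (z_ ^+ n, z_ ^+ n) by apply: (hgX hP); apply: kP; exact: zeta_kb.
have := hgM hP (Pz k) h2; rewrite -E => h3; have := hg_fun hP h1 h3 => /= {h1 h2 h3}.
(* The residue w of s(a)/a is a root of unity, by the same telescoping product, hence a constant
   fixed by f. *)
have wk : f w = w.
 apply: fk; have [m m0 mx] := gal_period s al.
 apply: (@root_kb m) => //; suff -> : w ^+ m = 1 by exact: rpred1.
 have Pn n : P (iter n s (s al / al), w) by elim: n => //= n; exact: si.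
 have := hg_prod hP (index_enum _) (fun n : 'I_m => Pn n).
 rewrite ratio_prod // mx divff // prodr_const card_ord => h.
 exact: (hg_fun hP h (hg1 hP)).
rewrite wk [w * u]mulrC -[LHS]mul1r => /(mulIf (mulf_neq0 u0 w0)) zk.
apply: val_inj; have := congr1 (@sf_val _ _) ak; rewrite sf_valZ -zk mul1r.
exact.
Qed.

Lemma chi_unit (s : GO) e : inertia s -> e \in Kb -> punit e -> chi e s = 0.
move=> si eK ue; have e0 := punit_nz ue.
have [|b b0 Pb] := @punit_root l (lroot e) (prime_gt0 pl) (lroot_nz e0).
 by rewrite lrootP.
have sb := chiE s eK (lrootP e).
have h : P (zpow (chi e s) * lroot e, zpow (chi e s) * b) by apply: (hgM hP) => //; apply: (hgX hP); apply: kP; exact: zeta_kb.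
have := hg_fun hP (si _ _ Pb); rewrite sb => /(_ _ h); rewrite -[LHS]mul1r => /(mulIf b0).
by rewrite -(zpow0) => /(zpow_inj).
Qed.

(** An l-th root of an element of residue 1 has a root of unity as residue, which f fixes. *)
Lemma chi_one (t : GO) (f : {rmorphism Om -> Om}) e : acts_by t f ->
 (forall c, c \in kb -> f c = c) -> e \in Kb -> P (e, 1) -> chi e t = 0.
move=> tf fk eK Pe; have e0 := pl_nz pP Pe (oner_neq0 _).
have [|b b0 Pb] := @punit_root l (lroot e) (prime_gt0 pl) (lroot_nz e0).
 by exists 1; rewrite ?oner_eq0 ?lrootP.
have bl : b ^+ l = 1 by have := hgX hP l Pb; rewrite lrootP // => h; exact: (hg_fun hP h Pe).
have fb : f b = b by apply: fk; apply: (@root_kb l) (prime_gt0 pl) _; rewrite bl rpred1.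
have tb := chiE t eK (lrootP e).
have h : P (zpow (chi e t) * lroot e, zpow (chi e t) * b) by apply: (hgM hP) => //; apply: (hgX hP); apply: kP; exact: zeta_kb.
have := hg_fun hP (tf _ _ Pb); rewrite tb fb => /(_ _ h); rewrite -[LHS]mul1r => /(mulIf b0).
by rewrite -(zpow0) => /(zpow_inj).
Qed.

Section Ramified.
Variable p : Om.
Hypotheses (pK : p \in Kb) (p0 : p != 0) (Pp : P (p, 0)).
Hypothesis disc : forall f, f \in Kb -> f != 0 -> exists q n m, coprime q l /\ punit (f ^+ q * p ^+ n / p ^+ m).

Let a := lroot p.
Let aE : a ^+ l = p. exact: lrootP. Qed.
Let a0 : a != 0. exact: lroot_nz. Qed.

Let Pa : P (a, 0).
have [[q q0 h]|//|h] := punit_cases a0.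
 have := hgX hP l h; rewrite aE => h'; have := hg_fun hP h' Pp => /eqP.
 by rewrite expf_eq0 (negbTE q0) andbF.
have := hgX hP l h; rewrite exprVn aE => h'; by case: (pl_nonunit pP p0 Pp h').
Qed.

Let pow_unit n : punit (a ^+ n) -> n = 0%N.
case: n => // n [q q0 h]; have := hg_fun hP h (hgX hP n.+1 Pa).
by rewrite expr0n /= => e; rewrite e eqxx in q0.
Qed.

(** The hypothesis [disc] gives elements of K values that, up to a factor prime to l, are multiples
    of the value of p; a^n with 0 < n < l has a value not of this kind. *)
Lemma twist_nonunit f n : f \in Kb -> (0 < n < l)%N -> ~ punit (f * a ^+ n).
move=> fK /andP[n0 nl] u; have f0 : f != 0.
 by have := punit_nz u; apply: contraNneq => ->; rewrite mul0r.
have [q [r [m [cq um]]]] := disc fK f0.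
have uq : punit ((f * a ^+ n) ^+ q).
 elim: (q) => [|q' IH]; first by exists 1; [exact: oner_neq0|rewrite expr0; exact: hg1].
 by rewrite exprS; exact: punitM.
have := punitM uq (punitV um).
have -> : (f * a ^+ n) ^+ q * (f ^+ q * p ^+ r / p ^+ m)^-1 = a ^+ (n * q) * p ^+ m / p ^+ r.
 rewrite exprMn -exprM invf_div mulrA -[f ^+ q * _ * _]mulrA -mulf_div divff ?mul1r //.
 exact: expf_neq0.
rewrite -aE -!exprM -exprD => u1.
have [le|lt] := leqP (l * r) (n * q + l * m).
 have : punit (a ^+ (n * q + l * m - l * r)) by move: u1; rewrite -{1}(subnK le) exprD mulfK ?expf_neq0.
 move/pow_unit/eqP; rewrite subn_eq0 => le'.
 have e : (n * q + l * m)%N = (l * r)%N by apply/eqP; rewrite eqn_leq le le'.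
 have : (l %| n * q)%N by rewrite -(@dvdn_addl (l * m) l (n * q)) ?dvdn_mulr // e dvdn_mulr.
 by rewrite Gauss_dvdl 1?coprime_sym // gtnNdvd.
have : punit (a ^+ (l * r - (n * q + l * m))).
 have := punitV u1; rewrite invf_div => u2; rewrite expfB ?u2 //.
by move/pow_unit/eqP; rewrite subn_eq0 leqNgt lt.
Qed.

(** The automorphism a |-> zeta a of K(a) does not change residues, because K(a) is totally
    ramified; [place_extension] extends it to an inertia element. *)
Lemma inertia_ex : exists s : GO, inertia s /\ s a = z_ * a.
have na : a \notin Kb.
 apply/negP => aK; have := @twist_nonunit a^-1 1 _ _; rewrite expr1 mulVf //; apply.
 - by rewrite rpredV.
 - by rewrite /= prime_gt1.
 - by exists 1; [exact: oner_neq0|exact: hg1].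
have [s0 s0a] : exists s : GO, s a = z_ * a by apply: (kummer_move (a := a)); rewrite ?aE.
have zK := zeta_Kb; have aK : a ^+ l \in Kb by rewrite aE.
have LS := kummer_field_sub zeta_prim zK aK s0a a0.
pose G0 : set (Om * Om) := [set z | kummer_field Kb a z.1 /\ z.2 = s0 z.1].
have fG : field_graph G0.
 split; first split.
 - by split; [exact: sub1|rewrite /= rmorph1].
 - by move=> [x y] [x' y'] [/= h ->] [/= h' ->]; split; [exact: subB|rewrite /= rmorphB].
 - by move=> [x y] [x' y'] [/= h ->] [/= h' ->]; split; [exact: subM|rewrite /= rmorphM].
 - by move=> [x y] [/= h ->]; rewrite fmorph_eq0.
 - by move=> [x y] [/= h ->]; split; [exact: subV|rewrite /= fmorphV].
have KG x : x \in Kb -> diag G0 x.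
 move=> xK; split; last by have [_ _ ->] := galP s0.
 exists x%:P; rewrite ?hornerC // => n; rewrite coefC /=.
 by case: ifP => _; rewrite ?rpred0.
have compat x y : G0 (x, y) -> forall q, P (x, q) -> P (y, q).
 move=> [/= Lx ->] q Pxq; have [c [cK xE]] := kummer_coord zeta_prim aK Lx.
 (* No two terms [c k * a ^+ k] have a unit ratio, so at most one of them contributes to the
    residue, and this can only be the term with k = 0. *)
 have terms : exists v : 'I_l -> Om, [/\ forall k, P (c k * a ^+ k, v k), \sum_k v k = q & forall k : 'I_l, k != 0%N :> nat -> v k = 0].
 pose tm (k : 'I_l) := c k * a ^+ k.
 have nonu (k k' : 'I_l) : k != k' -> ~ punit (tm k / tm k').
 have gen (k1 k2 : 'I_l) : (k1 < k2)%N -> ~ punit (tm k2 / tm k1).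
 move=> lt u; apply: (@twist_nonunit (c k2 / c k1) (k2 - k1)%N); first exact: rpred_div.
 by rewrite subn_gt0 lt (leq_ltn_trans (leq_subr _ _)).
 suff -> : c k2 / c k1 * a ^+ (k2 - k1) = tm k2 / tm k1 by [].
 by rewrite expfB // mulf_div.
 rewrite neq_ltn => /orP[lt|lt] u; last exact: (gen _ _ lt u).
 by apply: (gen _ _ lt); rewrite -invf_div; exact: punitV.
 have [z0|[m [/mapP [k _ ->] m0 mP]]] := pl_scale pP [seq tm k | k <- index_enum 'I_l].
 have tz k : tm k = 0 by apply: z0; apply: map_f; rewrite mem_index_enum.
 exists (fun=> 0); split=> // [k|]; first by rewrite -/(tm k) tz; exact: hg0.
 have x0 : x = 0 by rewrite xE big1 // => k _; exact: tz.
 by rewrite big1_eq; move: Pxq; rewrite x0; exact: (hg_fun hP (hg0 hP)).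
 have ratio k' : k' != k -> P (tm k' / tm k, 0).
 move=> nk; have [|r Pr] := mP (tm k'); first by apply: map_f; rewrite mem_index_enum.
 have [r0|r0] := eqVneq r 0; first by rewrite -r0.
 by case: (nonu _ _ nk); exists r.
 have Ptk : P (tm k, q).
 have h : P (x / tm k, 1).
 have -> : x / tm k = \sum_k' tm k' / tm k by rewrite xE mulr_suml.
 have -> : 1 = \sum_(k' < l) (k' == k)%:R :> Om by rewrite (bigD1 k) //= eqxx big1 ?addr0 // => k' /negbTE ->.
 apply: (hg_sum hP) => k'; have [->|nk] := eqVneq k' k; last exact: ratio.
 by rewrite divff //; exact: hg1.
 have x0 : x != 0 by have := pl_nz pP h (oner_neq0 _); apply: contraNneq => ->; rewrite mul0r.
 by have := pl_div pP Pxq h (oner_neq0 _); rewrite divr1 invf_div mulrCA divff ?mulr1.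
 exists (fun k' => if k' == k then q else 0); split.
 - move=> k'; case: eqP => [-> //|/eqP nk]; rewrite -/(tm k').
 have := hgM hP (ratio _ nk) Ptk; by rewrite divfK // mul0r.
 - by rewrite (bigD1 k) //= eqxx big1 ?addr0 // => k' /negbTE ->.
 move=> k' k'0; case: eqP => // kk; apply/eqP; apply: contraT => q0; exfalso.
 apply: (@twist_nonunit (c k) k); rewrite ?cK //; last by exists q.
 by rewrite -kk lt0n k'0 /=; exact: ltn_ord.
 have [v [vP vs v0]] := terms.
 have -> : s0 x = \sum_(k < l) z_ ^+ k * (c k * a ^+ k).
 rewrite xE rmorph_sum; apply: eq_bigr => k _.
 rewrite rmorphM rmorphXn /= s0a exprMn mulrCA; congr (_ * _); congr (_ * _).
 by have [_ _ ->] := galP s0; [|exact: cK].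
 have -> : q = \sum_(k < l) z_ ^+ k * v k by rewrite -vs; apply: eq_bigr => k _; have [->|k1] := eqVneq (k : nat) 0%N; rewrite ?expr0 ?mul1r // v0 // mulr0.
 apply: (hg_sum hP) => k; apply: (hgM hP) => //.
 by apply: (hgX hP); apply: kP; exact: zeta_kb.
have [||x|s [sG sP]] := place_extension (C := range (j \o i)) pP pP fG compat.
- by move=> x; apply: alg_mono (Om_alg x) => y; exact: KG.
- exact: inf_const.
- move=> [c _ <-]; split; first by apply: KG; exact: j_Kb.
 by apply: kP; exact: i_kb.
have [t ts] := gal_weaken s KG; exists t; split=> [x q Px|]; rewrite ts; first exact: sP.
rewrite (sG a (s0 a)) //; split=> //=; exists 'X; rewrite ?hornerX // => n; rewrite coefX /=.
by case: eqP => _; rewrite ?rpred0 ?rpred1.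
Qed.

Lemma inertia_chi : exists s : GO, inertia s /\ chi p s = 1.
have [s [si sa]] := inertia_ex; exists s; split=> //.
by apply: (chi_uniq pK aE a0); rewrite -[1]/(1%:R) zpow_nat expr1.
Qed.
End Ramified.
End Inertia.
End Setting.

(** * Residues in rational function fields and their algebraic extensions *)

Section Residues.
Variable Om : closedFieldType.
Implicit Types (P : set (Om * Om)) (F L M : set Om).

Definition trivial_on F P := forall c, F c -> P (c, c).

Lemma coefs_lift F (hF : subfield F) (p : {poly Om}) : coefs F p ->
 exists p0 : {poly sfield (fld hF)}, map_poly \val p0 = p.
move=> pF; have cF n : p`_n \in fld hF by apply/fldP.
exists (\poly_(n < size p) SField (cF n)); apply/polyP => n.
rewrite coef_map coef_poly; case: ltnP => [//|le]; by rewrite nth_default.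
Qed.

Lemma factor_over F p a : subfield F -> coefs F p -> F a -> root p a ->
 exists2 p', coefs F p' & p = p' * ('X - a%:P).
move=> hF pF Fa pa; have [p0 e] := coefs_lift hF pF.
have aF : a \in fld hF by apply/fldP.
have : root p0 (SField aF) by rewrite -(fmorph_root (\val : sfield (fld hF) -> Om)) e.
move=> /factor_theorem [q qE]; exists (map_poly \val q).
 by move=> n; rewrite coef_map; apply/(fldP hF)/sf_valP.
by rewrite -e qE [LHS]rmorphM; congr (_ * _); exact: map_polyXsubC.
Qed.

Lemma trivial_graph F P p : subfield F -> trivial_on F P -> coefs F p -> coefs_graph P p p.
by move=> hF tP pF n; exact: tP. Qed.

(** Common factors t - a of numerator and denominator are cancelled until the denominator has
    nonzero residue. *)
Lemma res_fadj F t a P x q : subfield F -> place P -> trivial_on F P -> P (t, a) -> F a ->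
 fadj F t x -> P (x, q) -> F q.
move=> hF pP tP Pt Fa [p [r [pF rF ->]]]; have hP := pl_hg pP.
have [n] := ubnP (size r); elim: n p r pF rF => // n IH p r pF rF lt Px.
have Pp := hg_horner hP (trivial_graph hF tP pF) Pt.
have Pr := hg_horner hP (trivial_graph hF tP rF) Pt.
have [rt|rt] := eqVneq r.[t] 0.
 move: Px; rewrite rt invr0 mulr0 => h; rewrite (hg_fun hP h (hg0 hP)); exact: sub0.
have [ra|ra] := eqVneq r.[a] 0; last first.
 have h := pl_div pP Pp Pr ra; rewrite (hg_fun hP Px h).
 by apply: (sub_div hF); apply: sub_horner.
have pa : root p a.
 have := hgM hP Px Pr; rewrite divfK // ra mulr0 => h.
 by rewrite rootE (hg_fun hP Pp h).
have [p' pF' pE] := factor_over hF pF Fa pa.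
have [|r' rF' rE] := factor_over hF rF Fa (_ : root r a); first by rewrite rootE ra.
have ta : t - a != 0 by apply: contraNneq rt => ta; rewrite rE hornerM hornerXsubC ta mulr0.
apply: (IH p' r' pF' rF'); last first.
 by move: Px; rewrite pE rE !hornerM !hornerXsubC -mulf_div divff // mulr1.
have r0 : r' != 0 by apply: contraNneq rt => r0; rewrite rE r0 mul0r horner0.
by rewrite -ltnS (leq_trans _ lt) // rE size_Mmonic ?monicXsubC // size_XsubC addn2.
Qed.

Lemma res_alg F M P w q : subfield F -> subfield M -> place P ->
 (forall x t, M x -> P (x, t) -> F t) -> alg_over M w -> P (w, q) -> alg_over F q.
move=> hF hM pP MF [p [pM p0 pw]] Pw; have hP := pl_hg pP.
have [s0|[k [ks k0 kP]]] := pl_scale pP (polyseq p).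
 case/eqP: p0; apply/polyP => n; rewrite coef0; have [lt|le] := ltnP n (size p).
 by apply: s0; exact: mem_nth.
 by rewrite nth_default.
have kM : M k by move: ks => /(nthP 0) [n _ <-].
pose r := k^-1 *: p; have rM n : M r`_n by rewrite coefZ mulrC; exact: (sub_div hM).
have rz : r.[w] = 0 by rewrite hornerZ (rootP pw) mulr0.
have /choice [t tP] : forall n, exists t, P (r`_n, t).
 move=> n; rewrite coefZ mulrC; have [lt|le] := ltnP n (size p); first by apply: kP; exact: mem_nth.
 by exists 0; rewrite nth_default // mul0r; exact: hg0.
pose T := \poly_(n < size p) t n.
have szr : size r = size p by rewrite size_scale ?invr_eq0.
have gT : coefs_graph P r T.
 move=> n; rewrite coef_poly; case: ltnP => // le.
 by rewrite nth_default ?szr //; exact: hg0.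
exists T; split=> [n||].
- by apply: MF (gT n).
- have [n ln kE] := nthP 0 ks; apply/eqP => T0; have := gT n.
 rewrite T0 coef0 coefZ kE mulVf // => h.
 by have := hg_fun hP h (hg1 hP) => /esym/eqP; rewrite oner_eq0.
- by rewrite rootE; apply/eqP; have := hg_horner hP gT Pw; rewrite rz => h; exact: (hg_fun hP h (hg0 hP)).
Qed.

Lemma alg_const M w : alg_over M w -> w != 0 -> exists p, [/\ coefs M p, p.[w] = 0 & p`_0 != 0].
move=> [p [pM p0 /rootP pw]] w0; have [n] := ubnP (size p); elim: n p pM p0 pw => // n IH p pM p0 pw lt.
have [p00|p00] := eqVneq p`_0 0; last by exists p.
have /factor_theorem [r rE] : root p 0 by rewrite rootE horner_coef0 p00.
rewrite subr0 in rE; have r0 : r != 0 by apply: contraNneq p0 => r0; rewrite rE r0 mul0r.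
apply: (IH r) => //.
- by move=> m; have := pM m.+1; rewrite rE coefMX.
- by move: pw; rewrite rE hornerMX => /eqP; rewrite mulf_eq0 (negbTE w0) orbF => /eqP.
- by rewrite -ltnS (leq_trans _ lt) // rE size_mulX.
Qed.

(** If w had residue 0, a relation over M with nonzero constant term, normalised at that term, would
    reduce to 1 = 0; likewise for 1/w. *)
Lemma res_unit_alg M P w : subfield M -> place P -> (forall x, M x -> x != 0 -> punit P x) ->
 alg_over M w -> w != 0 -> punit P w.
move=> hM pP MU Mw w0; have hP := pl_hg pP.
have no v : alg_over M v -> v != 0 -> P (v, 0) -> False.
 move=> Mv v0 Pv; have [p [pM pv p0]] := alg_const Mv v0.
 have /choice [t tP] : forall n, exists t, P (p`_n / p`_0, t).
 move=> n; have [->|pn] := eqVneq p`_n 0; first by exists 0; rewrite mul0r; exact: hg0.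
 have [|q _ h] := MU (p`_n / p`_0) (sub_div hM (pM n) (pM 0%N)); last by exists q.
 by rewrite mulf_neq0 ?invr_eq0.
 have g : coefs_graph P ((p`_0)^-1 *: p) (\poly_(n < size p) t n).
 move=> n; rewrite coef_poly coefZ mulrC; case: ltnP => // le.
 by rewrite nth_default // mul0r; exact: hg0.
 have := hg_horner hP g Pv; rewrite hornerZ pv mulr0 horner_coef0 => h.
 have := g 0%N; rewrite coefZ mulVf // => h'.
 have e1 := hg_fun hP (hg1 hP) h'; have := hg_fun hP (hg0 hP) h; rewrite -e1 => /esym/eqP.
 by rewrite oner_eq0.
have [//|h|h] := punit_cases pP w0; first by case: (no w Mw w0 h).
case: (no w^-1 _ _ h); rewrite ?invr_eq0 //.
exact: (subV (alg_subfield hM)).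
Qed.

Lemma common_den L t p : subfield L -> coefs (fadj L t) p -> exists d, [/\ coefs L d, d.[t] != 0 &
 forall n, exists2 r, coefs L r & d.[t] * p`_n = r.[t]].
move=> hL; elim/poly_ind: p => [|p c IH] pL.
 exists 1; split=> [||n]; rewrite ?hornerC ?oner_eq0 //; first exact: (coefsC hL (sub1 hL)).
 by exists 0; rewrite ?coef0 ?horner0 ?mulr0 // => m; rewrite coef0; exact: sub0.
have [|d [dL d0 dP]] := IH.
 by move=> n; have := pL n.+1; rewrite coefD coefMX coefC /= addr0.
have := pL 0%N; rewrite coefD coefMX coefC /= add0r => -[u [v [uL vL cE]]].
have [v0|v0] := eqVneq v.[t] 0.
 exists d; split=> // -[|n]; last by rewrite coefD coefMX coefC /= addr0.
 rewrite coefD coefMX coefC /= add0r cE v0 invr0 !mulr0; exists 0; rewrite ?horner0 // => m.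
 by rewrite coef0; exact: sub0.
exists (d * v); split=> [||[|n]]; first exact: coefsM.
- by rewrite hornerM mulf_neq0.
- rewrite coefD coefMX coefC /= add0r cE; exists (d * u); first exact: coefsM.
 by rewrite !hornerM -mulrA [v.[t] * _]mulrC divfK.
have [r rL e] := dP n; rewrite coefD coefMX coefC /= addr0; exists (v * r); first exact: coefsM.
by rewrite !hornerM -e mulrCA mulrA.
Qed.

(** In a relation of z over L[t] with nonzero constant term, a zero of z at t = a forces that
    constant term to vanish at a. *)
Lemma finite_zeros L t z : subfield L -> alg_over (fadj L t) z -> z != 0 -> ~ alg_over L t ->
 exists A : {poly Om}, A != 0 /\ forall P a, place P -> trivial_on L P -> P (t, a) -> P (z, 0) -> root A a.
move=> hL Lz z0 nt; have [p [pM pz p0]] := alg_const Lz z0.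
have [d [dL d0 dP]] := common_den hL pM.
have /choice [r rP] : forall n, exists r, coefs L r /\ d.[t] * p`_n = r.[t] by move=> n; have [r h1 h2] := dP n; exists r.
exists (r 0%N); split.
 apply: contraNneq p0 => r0; have [_] := rP 0%N; rewrite r0 horner0 => /eqP.
 by rewrite mulf_eq0 (negbTE d0).
move=> P a pP tP Pt Pz; have hP := pl_hg pP.
have Pr n : P ((r n).[t], (r n).[a]) by apply: (hg_horner hP) => //; apply: (trivial_graph hL tP); have [] := rP n.
have g : coefs_graph P (d.[t] *: p) (\poly_(n < size p) (r n).[a]).
 move=> n; rewrite coef_poly coefZ (proj2 (rP n)); case: ltnP => // le.
 by rewrite -(proj2 (rP n)) nth_default // mulr0; exact: hg0.
have := hg_horner hP g Pz; rewrite hornerZ pz mulr0 horner_coef0 coef_poly => h.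
have sp : (0 < size p)%N by rewrite size_poly_gt0; apply: contraNneq p0 => ->; rewrite coef0.
by move: h; rewrite sp rootE => h; rewrite -(hg_fun hP (hg0 hP) h).
Qed.

Lemma finite_zeros_seq L t (D : seq Om) : subfield L -> (forall x, alg_over (fadj L t) x) -> ~ alg_over L t ->
 exists2 A : {poly Om}, A != 0 &
 forall w P a, w \in D -> w != 0 -> place P -> trivial_on L P -> P (t, a) -> P (w, 0) -> root A a.
move=> hL algP nt; elim: D => [|w D [A A0 AP]]; first by exists 1; rewrite ?oner_neq0.
have [w0|w0] := eqVneq w 0.
 by exists A => // v P a; rewrite inE w0 => /predU1P[->|]; [rewrite eqxx|exact: AP].
have [B [B0 BP]] := finite_zeros hL (algP w) w0 nt; exists (B * A); first by rewrite mulf_neq0.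
move=> v P a; rewrite inE rootM => /predU1P[->|vD] v0 pP tP Pt Pv; first by rewrite (BP P a).
by rewrite (AP v P a) ?orbT.
Qed.

Lemma place_at L t a : subfield L -> ~ alg_over L t ->
 exists P, [/\ place P, trivial_on L P & P (t, a)].
move=> hL nt; pose S : set (Om * Om) := [set z | exists p, coefs L p /\ z = (p.[t], p.[a])].
have [|P [pP SP]] := @chevalley Om Om S.
 split.
 - by exists 1; rewrite !hornerC; split=> //; exact: (coefsC hL (sub1 hL)).
 - move=> _ _ _ _ [p [pL [-> ->]]] [q [qL [-> ->]]]; exists (p - q).
 by rewrite !hornerD !hornerN; split=> //; exact: coefsB.
 - move=> _ _ _ _ [p [pL [-> ->]]] [q [qL [-> ->]]]; exists (p * q).
 by rewrite !hornerM; split=> //; exact: coefsM.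
 - move=> _ [p [pL [e ->]]]; have [->|p0] := eqVneq p 0; first by rewrite horner0.
 by case: nt; exists p; split=> //; rewrite rootE -e.
exists P; split=> // [c Lc|]; apply: SP.
 by exists c%:P; rewrite !hornerC; split=> //; exact: coefsC.
by exists 'X; rewrite !hornerX; split=> //; exact: coefsX.
Qed.
End Residues.

(** * Lagrange interpolation *)

Section Lagrange.
Variable E : fieldType.
Implicit Types (cs vs : seq E) (p : {poly E}).

Definition lag_basis cs c : {poly E} := \prod_(d <- cs | d != c) ((c - d)^-1 *: ('X - d%:P)).

Definition lag cs vs : {poly E} := \sum_(k < size cs) vs`_k *: lag_basis cs cs`_k.

Lemma lag_basis_eval cs c c' : c \in cs -> c' \in cs -> (lag_basis cs c).[c'] = (c' == c)%:R.
move=> ccs c'cs; rewrite /lag_basis horner_prod; have [->|ne] := eqVneq c' c.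
 rewrite big1 // => d dc; rewrite hornerZ hornerXsubC mulVf // subr_eq0 eq_sym //.
by rewrite (big_rem c') //= ne hornerZ hornerXsubC subrr mulr0 mul0r.
Qed.

Lemma size_lag_basis cs c : c \in cs -> uniq cs -> (size (lag_basis cs c) <= size cs)%N.
move=> ccs ucs; rewrite /lag_basis -big_filter.
have -> : size cs = (size [seq d <- cs | d != c]).+1.
 rewrite size_filter -(count_predC (pred1 c)) -[count (pred1 c) cs]/(count_mem c cs) count_uniq_mem // ccs.
 by rewrite add1n.
elim: [seq d <- cs | d != c] => [|d s IH]; first by rewrite big_nil size_poly1.
rewrite big_cons -scalerAl (leq_trans (size_scale_leq _ _)) //.
apply: (leq_trans (size_polyMleq _ _)); rewrite size_XsubC addSn /=.
by rewrite ltnS.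
Qed.

Lemma lagP cs p : uniq cs -> (size p <= size cs)%N -> p = lag cs [seq p.[c] | c <- cs].
move=> ucs szp; apply/eqP; rewrite -subr_eq0; apply: contraTT isT => nz.
have rts : all (root (p - lag cs [seq p.[c] | c <- cs])) cs.
 apply/allP => c ccs; rewrite rootE hornerD hornerN /lag horner_sum.
 have lt : (index c cs < size cs)%N by rewrite index_mem.
 rewrite (bigD1 (Ordinal lt)) //= hornerZ (nth_map 0) ?index_mem // nth_index // lag_basis_eval // eqxx mulr1.
 rewrite big1 ?addr0 ?subrr // => k kn; rewrite hornerZ lag_basis_eval ?mem_nth //.
 case: eqP => [e|_]; last by rewrite mulr0.
 by case/eqP: kn; apply: val_inj; rewrite /= e index_uniq.
have := max_poly_roots nz rts ucs; rewrite ltnNge; case/negP.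
apply: (leq_trans (size_polyD _ _)); rewrite size_polyN geq_max szp /=.
apply: (leq_trans (size_sum _ _ _)); apply/bigmax_leqP => k _.
by apply: (leq_trans (size_scale_leq _ _)); apply: size_lag_basis; rewrite ?mem_nth.
Qed.
End Lagrange.

Lemma choices (T : eqType) (Rs : seq (seq T)) : exists L : seq (seq T),
 forall s, size s = size Rs -> (forall n, (n < size Rs)%N -> forall x0, nth x0 s n \in nth [::] Rs n) -> s \in L.
elim: Rs => [|R Rs [L LP]]; first by exists [:: [::]] => -[].
exists [seq x :: s | x <- R, s <- L] => -[//|x s] /= [sz] h.
apply/allpairsP; exists (x, s); split=> //=; first exact: (h 0%N isT x).
by apply: LP => // n ln x0; exact: (h n.+1 ln x0).
Qed.

(** * Rational functions integral over a polynomial ring, with a degree bound *)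

Section IntegralClosure.
Variables (Om : closedFieldType) (F : set Om) (y : Om).
Hypotheses (hF : subfield F) (Falg : forall x, alg_over F x -> F x) (Fy : ~ F y).

Lemma transc_poly p : coefs F p -> p.[y] = 0 -> p = 0.
move=> pF py; apply: contrapT => p0; apply/Fy/Falg; exists p; split=> //; first exact/eqP.
by rewrite rootE py.
Qed.

(** F[y] is integrally closed; beyond degree B the leading power of the monic equation would
    dominate all other terms. *)
Lemma integral_poly (H : {poly {poly Om}}) B q : (forall k, coefs F H`_k) -> H \is monic ->
 (forall k, (k < (size H).-1)%N -> (size (H`_k)%R <= B)%N) ->
 fadj F y q -> (map_poly (horner_eval y) H).[q] = 0 ->
 exists p, [/\ coefs F p, (size p <= B)%N, q = p.[y] & H.[p] = 0].
move=> HF mH HB [p [r [pF rF qE]]]; rewrite {}qE.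
pose m := (size H).-1; have szH : size H = m.+1 by rewrite prednK // size_poly_gt0 monic_neq0.
(* The homogenised equation: [T p r] evaluates to r^m H(p/r). *)
pose T p r := \sum_(k < m.+1) H`_k * p ^+ k * r ^+ (m - k).
have Hm : H`_m = 1 by move/eqP: mH.
have TF p' r' : coefs F p' -> coefs F r' -> coefs F (T p' r').
 move=> h h'; have hX (s : {poly Om}) n : coefs F s -> coefs F (s ^+ n).
 move=> hs; elim: n => [|n IH]; first by rewrite expr0; exact: (coefsC hF (sub1 hF)).
 by rewrite exprS; exact: coefsM.
 rewrite /T; apply: (@big_ind _ (coefs F)) => [|u v|k _].
 - by move=> n; rewrite coef0; exact: sub0.
 - exact: coefsD.
 - by apply: coefsM => //; [apply: coefsM => //|]; exact: hX.
have TE p' r' : r'.[y] != 0 -> (T p' r').[y] = r'.[y] ^+ m * (map_poly (horner_eval y) H).[p'.[y] / r'.[y]].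
 move=> r0; rewrite [X in _ = _ * X](@horner_coef_wide _ m.+1) ?(leq_trans (size_poly _ _)) ?szH //.
 rewrite mulr_sumr /T horner_sum; apply: eq_bigr => k _.
 have km : (k <= m)%N by rewrite -ltnS.
 rewrite coef_map /horner_eval !hornerM !horner_exp mulrCA -mulrA; congr (_ * _).
 have -> : r'.[y] ^+ m = r'.[y] ^+ (m - k) * r'.[y] ^+ k by rewrite -exprD subnK.
 by rewrite expr_div_n -[RHS]mulrA [r'.[y] ^+ k * _]mulrCA divff ?expf_neq0 // mulr1 mulrC.
have [n] := ubnP (size r); elim: n p r pF rF => // n IH p r pF rF lt e.
have H0 : H.[0] = 0 -> exists p0, [/\ coefs F p0, (size p0 <= B)%N, 0 = p0.[y] & H.[p0] = 0].
 by exists 0; rewrite size_poly0 horner0; split=> // k; rewrite coef0; exact: sub0.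
have [ry|ry] := eqVneq r.[y] 0.
 rewrite ry invr0 mulr0 in e *; apply: H0.
 move: e; rewrite !horner_coef0 coef_map /horner_eval => e; exact: (transc_poly (HF _)).
have T0 : T p r = 0 by apply: transc_poly; [exact: TF|rewrite TE // e mulr0].
have r0 : r != 0 by apply: contraNneq ry => ->; rewrite horner0.
have [sr|sr] := leqP (size r) 1.
 pose s := r`_0; have rE : r = s%:P by apply: size1_polyC.
 have s0 : s != 0 by apply: contraNneq r0 => s0; rewrite rE s0.
 pose p' := s^-1 *: p; have pF' : coefs F p'.
 by move=> k; rewrite coefZ mulrC; apply: (sub_div hF) => //; exact: rF.
 have qE : p.[y] / r.[y] = p'.[y] by rewrite rE hornerC hornerZ mulrC.
 have Hp : H.[p'] = 0.
 have : T p' 1 = 0.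
 apply: transc_poly; first by apply: TF => //; exact: (coefsC hF (sub1 hF)).
 by rewrite TE hornerC ?oner_eq0 // divr1 -qE e mulr0.
 move=> e1; rewrite -[RHS]e1 /T horner_coef szH.
 by apply: eq_bigr => k _; rewrite expr1n mulr1.
 exists p'; split=> //; rewrite leqNgt; apply/negP => Bp.
 have p0' : p' != 0 by rewrite -size_poly_gt0 (leq_ltn_trans _ Bp).
 have : p' ^+ m = - \sum_(k < m) H`_k * p' ^+ k by apply/eqP; rewrite -addr_eq0 addrC; move: Hp; rewrite horner_coef szH big_ord_recr /= Hm mul1r => ->.
 move/(congr1 (fun x : {poly Om} => size x)); rewrite size_polyN => e1.
 have sX k : size (p' ^+ k) = ((size p').-1 * k).+1 by rewrite -(size_exp p' k) prednK // size_poly_gt0 expf_neq0.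
 have : (size (\sum_(k < m) H`_k * p' ^+ k)%R <= (size p').-1 * m)%N.
 apply: (leq_trans (size_sum _ _ _)); apply/bigmax_leqP => k _.
 apply: (leq_trans (size_polyMleq _ _)); rewrite sX addnS /=.
 apply: (@leq_trans ((size p').-1 * k.+1)); last by rewrite leq_mul2l ltn_ord orbT.
 rewrite mulnS leq_add2r (leq_trans (HB k (ltn_ord k))) //.
 by rewrite -ltnS prednK // size_poly_gt0.
 by rewrite -e1 sX ltnn.
(* At a root c of the denominator the homogenised equation leaves only p(c)^m = 0, so the factor X -
   c cancels. *)
have [c rc] := closed_root_ex sr; have Fc : F c by apply: Falg; exists r.
have pc : root p c.
 have := congr1 (fun x : {poly Om} => x.[c]) T0; rewrite horner0 /T horner_sum big_ord_recr /=.
 rewrite big1 => [|k _]; last first.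
 by rewrite hornerM [(r ^+ _).[c]]horner_exp (rootP rc) expr0n subn_eq0 leqNgt ltn_ord mulr0.
 rewrite add0r subnn expr0 mulr1 Hm mul1r horner_exp => /eqP.
 by rewrite expf_eq0 rootE => /andP[].
have [p' pF' pE] := factor_over hF pF Fc pc; have [r' rF' rE] := factor_over hF rF Fc rc.
have yc : y - c != 0 by apply: contraNneq ry => yc; rewrite rE hornerM hornerXsubC yc mulr0.
have e2 : p.[y] / r.[y] = p'.[y] / r'.[y] by rewrite pE rE !hornerM !hornerXsubC -mulf_div divff // mulr1.
rewrite e2 in e *; apply: (IH p' r') => //.
have r0' : r' != 0 by apply: contraNneq ry => h; rewrite rE h mul0r horner0.
by rewrite -ltnS (leq_trans _ lt) // rE size_Mmonic ?monicXsubC // size_XsubC addn2.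
Qed.
End IntegralClosure.

Lemma place_integral (E : fieldType) (Q : closedFieldType) (P : set (E * Q)) (p : {poly E}) z : place P -> p \is monic ->
 (forall n, exists t, P (p`_n, t)) -> root p z -> exists q, P (z, q).
move=> pP mp pV pz; have hP := pl_hg pP; have [//|h] := pl_total pP z.
have [->|z0] := eqVneq z 0; first by exists 0; exact: hg0.
pose m := (size p).-1; have szp : size p = m.+1 by rewrite prednK // size_poly_gt0 monic_neq0.
have /choice [t tP] := pV.
have e : \sum_(k < m.+1) p`_k * z^-1 ^+ (m - k) = 0.
 apply: (mulfI (expf_neq0 m z0)); rewrite mulr0 -[RHS](rootP pz) horner_coef szp mulr_sumr.
 apply: eq_bigr => k _; have km : (k <= m)%N by rewrite -ltnS.
 rewrite mulrCA; congr (_ * _); rewrite -[in z ^+ m](subnK km) exprD exprVn mulrAC divff ?mul1r //.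
 by rewrite expf_neq0.
have := hg_sum hP (index_enum 'I_m.+1) (f := fun k => p`_k * z^-1 ^+ (m - k)) (g := fun k => t k * 0 ^+ (m - k)).
rewrite e => h'; have {h'} := h' (fun k => hgM hP (tP k) (hgX hP _ h)).
rewrite big_ord_recr /= subnn expr0 mulr1 big1 => [|k _]; last by rewrite expr0n subn_eq0 leqNgt ltn_ord mulr0.
rewrite add0r => h1; have := tP m; have -> : p`_m = 1 by move/eqP: mp.
rewrite -(hg_fun hP (hg0 hP) h1) => /(hg_fun hP (hg1 hP)) /eqP.
by rewrite oner_eq0.
Qed.

Lemma cg_prod (E : fieldType) (Q : closedFieldType) (S : set (E * Q)) (s : seq E) (v : E -> Q) : hom_graph S ->
 {in s, forall x, S (x, v x)} -> coefs_graph S (\prod_(x <- s) ('X - x%:P)) (\prod_(x <- s) ('X - (v x)%:P)).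
move=> hS; elim: s => [|x s IH] sv; rewrite ?big_nil ?big_cons; first exact: cg_C (hg1 hS).
apply: cg_M => //; last by apply: IH => w ws; apply: sv; rewrite inE ws orbT.
apply: cg_B => //; first by have := cg_X hS 1; rewrite !expr1.
by apply: cg_C => //; apply: sv; exact: mem_head.
Qed.

Lemma cg_fun (E : fieldType) (Q : closedFieldType) (S : set (E * Q)) p q q' : hom_graph S ->
 coefs_graph S p q -> coefs_graph S p q' -> q = q'.
by move=> hS h h'; apply/polyP => n; exact: (hg_fun hS (h n) (h' n)). Qed.

Lemma pl_post (Om : closedFieldType) (P : set (Om * Om)) (F : set Om) (r : gal F) : place P ->
 place [set z : Om * Om | P (z.1, r z.2)].
move=> pP; have hP := pl_hg pP; split=> /=.
- split=> [|x y a b|x y a b|b] /=; rewrite ?rmorph1 ?rmorphB ?rmorphM.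
 + exact: hg1.
 + exact: hgB.
 + exact: hgM.
 + by have [_ _ _ h] := hP => /h/eqP; rewrite fmorph_eq0 => /eqP.
- by move=> x a h a0; rewrite fmorphV; apply: plV; rewrite ?fmorph_eq0.
- move=> x; rewrite rmorph0; have [[a h]|h] := pl_total pP x; last by right.
 by left; exists (r^-1%g a); rewrite (@bij_invfunK _ r).
Qed.

Lemma clear_den (E : fieldType) (R : set E) (p : {poly E}) : R 0 -> R 1 -> (forall x y, R x -> R y -> R (x * y)) ->
 (forall n, exists u v, [/\ R u, R v & p`_n = u / v]) -> exists d, [/\ R d, d != 0 & forall n, R (d * p`_n)].
move=> R0 R1 RM; elim/poly_ind: p => [|p c IH] pR.
 by exists 1; split=> // [|n]; rewrite ?oner_eq0 // coef0 mulr0.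
have [|d [dR d0 dP]] := IH; first by move=> n; have := pR n.+1; rewrite coefD coefMX coefC /= addr0.
have := pR 0%N; rewrite coefD coefMX coefC /= add0r => -[u [v [uR vR cE]]].
have [v0|v0] := eqVneq v 0.
 exists d; split=> // -[|n]; rewrite coefD coefMX coefC /= ?addr0 ?add0r //.
 by rewrite cE v0 invr0 !mulr0.
exists (v * d); split=> [||[|n]]; rewrite ?mulf_neq0 //; first exact: RM.
 by rewrite coefD coefMX coefC /= add0r cE mulrC mulrA divfK //; apply: RM.
by rewrite coefD coefMX coefC /= addr0 -mulrA; apply: RM.
Qed.

Lemma map_prod_XsubC (E E' : fieldType) (f : {rmorphism E -> E'}) (s : seq E) :
 map_poly f (\prod_(v <- s) ('X - v%:P)) = \prod_(v <- [seq f v | v <- s]) ('X - v%:P).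
by rewrite rmorph_prod big_map; apply: eq_bigr => v _; exact: map_polyXsubC. Qed.

Section Frobenius.
Variables (E : fieldType) (q : nat).
Hypothesis hq : [pchar E].-nat q.

(** The proof that q is a power of the characteristic exponent is an argument, so that the ring
    morphism structure can be attached to the function. *)
Definition frob of [pchar E].-nat q := fun x : E => x ^+ q.

Fact frob_zmod : zmod_morphism (frob hq).
move=> x y; apply/eqP; rewrite eq_sym subr_eq -[X in _ == X](exprDn_pchar (x - y) y hq); apply/eqP.
by rewrite subrK.
Qed.

Fact frob_monoid : monoid_morphism (frob hq).
by split=> [|x y]; rewrite /frob ?expr1n ?exprMn. Qed.

HB.instance Definition _ := GRing.isZmodMorphism.Build E E (frob hq) frob_zmod.
HB.instance Definition _ := GRing.isMonoidMorphism.Build E E (frob hq) frob_monoid.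
End Frobenius.

(** * Places over a rational point of the t-line *)

Section PointPlaces.
Variables (Om : closedFieldType) (L : set Om) (t a0 : Om).
Hypotheses (hL : subfield L) (nt : ~ alg_over L t) (La0 : L a0).
Notation Phi := (fadj L t).

Definition over_point (P : set (Om * Om)) := [/\ place P, trivial_on L P & P (t, a0)].

Notation tau := (t - a0).

Lemma tau_nz : tau != 0.
by apply/eqP => /eqP; rewrite subr_eq0 => /eqP e; apply: nt; rewrite e; exact: alg_id. Qed.

Lemma over_tau P : over_point P -> P (tau, 0).
by move=> [pP tP Pt]; rewrite -(subrr a0); apply: (hgB (pl_hg pP)) => //; exact: tP. Qed.

Lemma poly_unif (p : {poly Om}) : coefs L p -> p != 0 -> exists p' n, [/\ coefs L p', p'.[a0] != 0 & p.[t] = p'.[t] * tau ^+ n].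
move=> pL p0; have [m] := ubnP (size p); elim: m p pL p0 => // m IH p pL p0 lt.
have [pa|pa] := eqVneq p.[a0] 0; last by exists p, 0%N; rewrite expr0 mulr1.
have [|r rL rE] := factor_over hL pL La0 (_ : root p a0); first by rewrite rootE pa.
have r0 : r != 0 by apply: contraNneq p0 => r0; rewrite rE r0 mul0r.
have [|p' [n [p'L p'a e]]] := IH r rL r0.
 by rewrite -ltnS (leq_trans _ lt) // rE size_Mmonic ?monicXsubC // size_XsubC addn2.
by exists p', n.+1; split=> //; rewrite rE hornerM hornerXsubC e exprSr mulrA.
Qed.

Lemma Phi_unif x : Phi x -> x != 0 -> exists n m r, r != 0 /\ forall P, over_point P -> P (x * tau ^+ n / tau ^+ m, r).
move=> [p [q [pL qL xE]]] x0; have p0 : p != 0 by apply: contraNneq x0 => p0; rewrite xE p0 horner0 mul0r.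
have q0 : q != 0 by apply: contraNneq x0 => q0; rewrite xE q0 horner0 invr0 mulr0.
have [p' [n [p'L p'a pE]]] := poly_unif pL p0; have [q' [m [q'L q'a qE]]] := poly_unif qL q0.
exists m, n, (p'.[a0] / q'.[a0]); split=> [|P [pP tP Pt]]; first by rewrite mulf_neq0 ?invr_eq0.
have -> : x * tau ^+ m / tau ^+ n = p'.[t] / q'.[t].
 rewrite xE pE qE invfM [LHS](AC ((2*2)*1*1) ((1*3)*(2*6)*(5*4))) /=.
 by rewrite !divff ?mulr1 // expf_neq0 // tau_nz.
by apply: (pl_div pP) => //; apply: (hg_horner (pl_hg pP)) => //; apply: (trivial_graph hL).
Qed.

(** On L(t) the place is determined by the point: every element is a power of t - a0 times an
    element with a prescribed nonzero residue. *)
Lemma agree_Phi P P' x q : over_point P -> over_point P' -> Phi x -> P (x, q) -> P' (x, q).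
move=> oP oP' Px xq; have [[pP _ _] [pP' _ _]] := (oP, oP'); have hP := pl_hg pP; have hP' := pl_hg pP'.
have [x0|x0] := eqVneq x 0.
 by move: xq; rewrite x0 => h; rewrite (hg_fun hP h (hg0 hP)); exact: hg0.
have [n [m [r [r0 rP]]]] := Phi_unif Px x0; have t0 := tau_nz.
have ur := rP _ oP; have ur' := rP _ oP'.
have [le|lt] := leqP n m.
 have xE : x * tau ^+ n / tau ^+ m * tau ^+ (m - n) = x by rewrite -[in tau ^+ m](subnKC le) exprD invfM !mulrA mulfK ?expf_neq0 // divfK // expf_neq0.
 have h := hgM hP ur (hgX hP (m - n) (over_tau oP)); rewrite xE in h.
 have h' := hgM hP' ur' (hgX hP' (m - n) (over_tau oP')); rewrite xE in h'.
 by rewrite (hg_fun hP xq h).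
have h := hgM hP (plV pP ur r0) (hgX hP (n - m) (over_tau oP)).
rewrite expr0n subn_eq0 leqNgt lt /= mulr0 in h.
have e : (x * tau ^+ n / tau ^+ m)^-1 * tau ^+ (n - m) = x^-1.
 rewrite -[in tau ^+ n](subnK (ltnW lt)) exprD !invfM invrK.
 by rewrite [LHS](AC ((1*(1*1)*1)*1) (1*((2*5)*(3*4)))) /= mulVf ?mulVf ?mulr1 // expf_neq0.
rewrite e in h; by case: (pl_nonunit pP _ h (_ : P (x^-1^-1, q))); rewrite ?invr_eq0 // invrK.
Qed.
End PointPlaces.

(** * Fields over F(y, t) and specialisation along lines *)

Section TwoVariables.
Variables (Om : closedFieldType) (F : set Om) (y t : Om).
Hypotheses (hF : subfield F) (Falg : forall x, alg_over F x -> F x) (Finf : infinite_set F).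
Hypothesis Fy : ~ F y.
Notation L := (fadj F y).
Hypothesis nt : ~ alg_over L t.
Notation Phi := (fadj L t).
Hypothesis Phialg : forall x, alg_over Phi x.

Section Specialization.
Lemma hL : subfield L. exact: fadj_sub. Qed.
Lemma hPhi : subfield Phi. exact: fadj_sub hL. Qed.
Lemma FL : F `<=` L. by move=> x; exact: fadj_incl. Qed.
Lemma LPhi : L `<=` Phi. by move=> x; apply: fadj_incl; exact: hL. Qed.
Lemma Ly : L y. exact: fadj_gen. Qed.
Lemma Phit : Phi t. exact: (fadj_gen _ hL). Qed.
Lemma y_nz : y != 0. by apply/eqP => y0; apply: Fy; rewrite y0; exact: sub0. Qed.

Lemma infinite_nonroot_line (E : set Om) (A : {poly Om}) b : infinite_set E -> A != 0 ->
 infinite_set [set e | E e /\ ~~ root A (b + e * y)].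
move=> infE A0 fin; apply: infE; apply: (@sub_finite_set _ _ ([set e | E e /\ ~~ root A (b + e * y)] `|` [set e | root A (b + e * y)])).
 by move=> e Ee; have [r|r] := boolP (root A (b + e * y)); [right|left].
rewrite finite_setU; split=> //; have [r Dr] := closed_field_poly_normal A.
apply: (@sub_finite_set _ _ [set` [seq (x - b) / y | x <- r]]); last exact: finite_seq.
move=> e /=; rewrite Dr rootZ ?lead_coef_eq0 // root_prod_XsubC => h.
by apply/mapP; exists (b + e * y) => //; rewrite addrC addKr mulfK // y_nz.
Qed.

(* Every automorphism of the residue field over L comes from the decomposition group. *)
Lemma decomp_lift P a (r : gal L) : place P -> trivial_on L P -> P (t, a) -> L a ->
 exists g : gal Phi, forall x q, P (x, q) -> P (g x, r q).
move=> pP tP Pt La; have hP := pl_hg pP.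
have pP' := pl_post r pP.
have [||x|c|s [_ sP]] := place_extension (C := F) pP pP' (diagonal_graph hPhi).
- move=> a' b' [/= Pa <-] q Pq; have Lq := res_fadj hL pP tP Pt La Pa Pq.
 by have [_ _ h] := galP r; rewrite /= h.
- by move=> x; apply: alg_mono (Phialg x) => z Pz.
- exact: Finf.
- by move=> Fc; split; [split=> //=; exact/LPhi/FL|apply: tP; exact: FL].
have sub : Phi `<=` diag [set z : Om * Om | Phi z.1 /\ z.1 = z.2] by [].
by have [g gs] := gal_weaken s sub; exists g => x q /sP; rewrite gs.
Qed.

(** Polynomials in t and y over F, the outer variable being t. Below, [ev a s] evaluates at t = a, y
    = s, and [sub b e] restricts to the line t = b + e y. *)
Definition poly2 := {poly {poly sfield (fld hF)}}.

Definition inc : {rmorphism {poly sfield (fld hF)} -> {poly Om}} := map_poly \val.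

Definition at_ (s : Om) : {rmorphism {poly sfield (fld hF)} -> Om} := horner_eval s \o inc.

Definition ev (a s : Om) : {rmorphism poly2 -> Om} := horner_eval a \o map_poly (at_ s).

Definition sub (b e : Om) : {rmorphism poly2 -> {poly Om}} :=
 horner_eval (b%:P + e *: 'X) \o map_poly inc.

Lemma evE a s h : ev a s h = (map_poly (at_ s) h).[a]. by []. Qed.
Lemma subE b e h : sub b e h = (map_poly inc h).[b%:P + e *: 'X]. by []. Qed.

Lemma sub_ev b e s h : (sub b e h).[s] = ev (b + e * s) s h.
transitivity ((map_poly (at_ s) h).[horner_eval s (b%:P + e *: 'X)]).
 by rewrite subE -[LHS]/(horner_eval s _) -horner_map -map_poly_comp.
by rewrite evE /horner_eval !hornerE.
Qed.

Lemma val_F (c : sfield (fld hF)) : F (\val c).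
by apply/(fldP hF)/sf_valP. Qed.

Lemma coefs_val p : coefs F (inc p).
by move=> n; rewrite coef_map; exact: val_F. Qed.

Lemma ev_over (M : set Om) a s h : subfield M -> F `<=` M -> M a -> M s -> M (ev a s h).
move=> hM FM Ma Ms; rewrite evE; apply: (sub_horner hM) => // n.
rewrite coef_map; change (M (inc h`_n).[s]); apply: (sub_horner hM) => // k.
exact/FM/coefs_val.
Qed.

Lemma sub_over b e h : F b -> F e -> coefs F (sub b e h).
move=> Fb Fe; have lin : coefs F (b%:P + e *: 'X).
 apply: coefsD => //; first exact: coefsC.
 by move=> n; rewrite coefZ; apply: subM => //; exact: coefsX.
have -> : sub b e h = \sum_(k < size h) inc h`_k * (b%:P + e *: 'X) ^+ k.
 rewrite subE horner_coef size_map_inj_poly ?rmorph0 //; last exact: map_poly_inj.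
 by apply: eq_bigr => k _; rewrite coef_map.
apply: (@big_ind _ (coefs F)) => [|u v|k _].
- by move=> n; rewrite coef0; exact: sub0.
- exact: coefsD.
apply: coefsM => //; first exact: coefs_val.
elim: (k : nat) => [|m IH]; first by rewrite expr0; exact: (coefsC hF (sub1 hF)).
by rewrite exprS; apply: coefsM.
Qed.

Lemma sub_size h : exists B, forall b e, (size (sub b e h) <= B)%N.
exists (\max_(k < size h) (size (h`_k)%R + k))%N => b e.
have -> : sub b e h = \sum_(k < size h) inc h`_k * (b%:P + e *: 'X) ^+ k.
 rewrite subE horner_coef size_map_inj_poly ?rmorph0 //; last exact: map_poly_inj.
 by apply: eq_bigr => k _; rewrite coef_map.
apply: (leq_trans (size_sum _ _ _)); apply/bigmax_leqP => k _.
apply: (@leq_trans (size (h`_k)%R + k)); last first.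
 exact: (@leq_bigmax _ (fun k : 'I_(size h) => (size (h`_k)%R + k)%N)).
apply: (leq_trans (size_polyMleq _ _)); rewrite size_map_poly.
have lin : (size (b%:P + e *: 'X)%R <= 2)%N.
 rewrite (leq_trans (size_polyD _ _)) // geq_max (leq_trans (size_polyC_leq1 _)) //.
 by rewrite (leq_trans (size_scale_leq _ _)) // size_polyX.
have : (size ((b%:P + e *: 'X) ^+ k)%R <= k.+1)%N.
 apply: (leq_trans (size_poly_exp_leq _ _)); rewrite ltnS -[X in (_ <= X)%N]mul1n leq_mul2r.
 by apply/orP; right; case: (size _) lin.
by case: (size ((b%:P + e *: 'X) ^+ k)%R) => [|m] lt; rewrite ?addn0 ?addnS /= ?(leq_trans (leq_pred _)) ?leq_addr // leq_add2l.
Qed.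

Lemma ev_place P a a' s s' h : place P -> trivial_on F P -> P (a, a') -> P (s, s') ->
 P (ev a s h, ev a' s' h).
move=> pP tP Pa Ps; have hP := pl_hg pP; rewrite !evE.
apply: (hg_horner hP) => // n; rewrite !coef_map; change (P ((inc h`_n).[s], (inc h`_n).[s'])).
by apply: (hg_horner hP) => // k; apply: tP; exact: coefs_val.
Qed.

(** Integrality over F[y, t]. *)
Definition int_over (z : Om) := exists2 H : {poly poly2}, H \is monic & root (map_poly (ev t y) H) z.

(** The parameter of the pencil of lines t = b + e y with fixed b: its residue on the line is e. *)
Definition slope b := (t - b) / y.
Notation U b := (alg_over (fadj F (slope b))).

Lemma slope_place P b e : place P -> trivial_on L P -> F b -> P (t, b + e * y) -> F e -> P (slope b, e).
move=> pP tP Fb Pt Fe; have -> : e = (b + e * y - b) / y by rewrite addrC addKr mulfK ?y_nz.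
apply: (pl_div pP); [|by apply: tP; exact: Ly|exact: y_nz].
by apply: (hgB (pl_hg pP)) => //; apply: tP; exact: FL.
Qed.

(** If the integral element z has a residue in F(y) on infinitely many lines of a pencil, then z is
    a polynomial in y over the algebraic closure of F(slope). The residues are polynomials of
    bounded degree, so they are determined by finitely many values, which are specialisations of
    elements algebraic over F(slope). *)
Lemma bertini_noether b (E : set Om) (Pl : Om -> set (Om * Om)) z : F b -> infinite_set E -> E `<=` F ->
 (forall e, E e -> [/\ place (Pl e), trivial_on L (Pl e) & Pl e (t, b + e * y)]) ->
 int_over z -> (forall e, E e -> exists2 q, L q & Pl e (z, q)) ->
 exists2 W, coefs (U b) W & z = W.[y].
move=> Fb infE EF PlP [H mH Hz] zE; set u := slope b.
have hU : subfield (U b) by apply: alg_subfield; exact: fadj_sub.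
have FU : F `<=` U b by move=> x Fx; apply: alg_id; [exact: fadj_sub|exact: fadj_incl].
have Uu : U b u by apply: alg_id; [exact: fadj_sub|exact: fadj_gen].
have [B BP] : exists B, forall k b e, (size (sub b e (H`_k)%R) <= B)%N.
 have /choice [Bf BfP] := sub_size; exists (\max_(k < size H) Bf (H`_k)%R)%N => k b' e.
 have [lt|le] := ltnP k (size H); last by rewrite nth_default // rmorph0 size_poly0.
 by rewrite (leq_trans (BfP _ _ _)) // (@leq_bigmax _ (fun k : 'I_(size H) => Bf (H`_k)%R) (Ordinal lt)).
have subev e s : map_poly (horner_eval s) (map_poly (sub b e) H) = map_poly (ev (b + e * s) s) H by rewrite -map_poly_comp; apply: eq_map_poly => h; exact: sub_ev.
have peP e : E e -> exists p, [/\ coefs F p, (size p <= B)%N, Pl e (z, p.[y]) &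
 (map_poly (sub b e) H).[p] = 0].
 move=> Ee; have [pP tP Pt] := PlP e Ee; have [q Lq Pz] := zE e Ee; have hP := pl_hg pP.
 have tF : trivial_on F (Pl e) by move=> c /FL; exact: tP.
 have [||k _|||p [pF szp qE pH]] := @integral_poly Om F y hF Falg Fy (map_poly (sub b e) H) B q.
 - by move=> k; rewrite coef_map; apply: sub_over => //; exact: EF.
 - exact: monic_map.
 - by rewrite coef_map; exact: BP.
 - exact: Lq.
 - rewrite subev; have g : coefs_graph (Pl e) (map_poly (ev t y) H) (map_poly (ev (b + e * y) y) H).
 by move=> n; rewrite !coef_map; apply: ev_place => //; apply: tP; exact: Ly.
 have := hg_horner hP g Pz; rewrite (rootP Hz) => h.
 by rewrite (hg_fun hP (hg0 hP) h).
 by exists p; split=> //; rewrite -qE.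
have [cs [ucs szcs csE]] := infinite_seq B infE.
(* [R c] lists the roots of the equation of z at the point y = c of the generic line; they are
   algebraic over F(slope). *)
have /choice [R RP] : forall c, exists r : seq Om, map_poly (ev (b + u * c) c) H = \prod_(x <- r) ('X - x%:P).
 move=> c; have [r e] := closed_field_poly_normal (map_poly (ev (b + u * c) c) H); exists r.
 by rewrite e (monicP (monic_map _ mH)) scale1r.
have RU c x : F c -> x \in R c -> U b x.
 move=> Fc xR; apply: (alg_trans (fadj_sub u hF) (F' := U b)) => //.
 exists (map_poly (ev (b + u * c) c) H); split.
 - by move=> n; rewrite coef_map; apply: ev_over => //; [apply: subD => //; [exact: FU|apply: subM => //; exact: FU]|exact: FU].
 - by rewrite monic_neq0 ?monic_map.
 - by rewrite RP root_prod_XsubC.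
(* On the line of slope e the value p(c) is the residue of one of these roots. *)
have rho e c p : E e -> F c -> coefs F p -> (map_poly (sub b e) H).[p] = 0 ->
 exists2 x, x \in R c & Pl e (x, p.[c]).
 move=> Ee Fc pF pH; have [pP tP Pt] := PlP e Ee; have hP := pl_hg pP.
 have tF : trivial_on F (Pl e) by move=> d /FL; exact: tP.
 have Pu := slope_place pP tP Fb Pt (EF _ Ee).
 have g : coefs_graph (Pl e) (map_poly (ev (b + u * c) c) H) (map_poly (ev (b + e * c) c) H).
 move=> n; rewrite !coef_map; apply: ev_place => //; last exact: tF.
 by apply: (hgD hP); [exact: tF|apply: (hgM hP) => //; exact: tF].
 have /choice [v vP] : forall x, exists w, x \in R c -> Pl e (x, w).
 move=> x; have [xR|_] := boolP (x \in R c); last by exists 0.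
 have [||w] := @place_integral _ _ (Pl e) (map_poly (ev (b + u * c) c) H) x pP (monic_map _ mH); last by exists w.
 by move=> n; exists (map_poly (ev (b + e * c) c) H)`_n.
 by rewrite RP root_prod_XsubC.
 have e1 : map_poly (ev (b + e * c) c) H = \prod_(x <- R c) ('X - (v x)%:P) by apply: (cg_fun hP g); rewrite RP; apply: cg_prod.
 have : root (map_poly (ev (b + e * c) c) H) p.[c].
 rewrite -subev rootE -[p.[c]]/(horner_eval c p) horner_map /= pH.
 by rewrite /horner_eval horner0.
 rewrite e1 -(big_map v predT (fun y => 'X - y%:P)) root_prod_XsubC => /mapP [x xR ->].
 by exists x => //; exact: vP.
have [Ls LsP] := choices [seq R c | c <- cs].
pose valid (s : seq Om) := size s = size cs /\ forall n, (n < size cs)%N -> s`_n \in R cs`_n.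
have csF n : (n < size cs)%N -> F cs`_n by move=> ln; apply/EF/csE; exact: mem_nth.
have validL s : valid s -> s \in Ls.
 move=> [sz h]; apply: LsP; rewrite ?size_map // => n ln x0.
 by rewrite (nth_map 0) // (set_nth_default 0) ?sz //; exact: h.
have basisF c : c \in cs -> coefs F (lag_basis cs c).
 move=> ccs; rewrite /lag_basis big_seq_cond; apply: (@big_ind _ (coefs F)) => [|p q|d /andP[dcs _]].
 - exact: (coefsC hF (sub1 hF)).
 - exact: coefsM.
 move=> n; rewrite coefZ; have Fc := EF _ (csE _ ccs); have Fd := EF _ (csE _ dcs).
 apply: subM => //; first by apply: subV => //; exact: subB.
 by rewrite coefB; apply: subB => //; [exact: coefsX|exact: coefsC].
have [[s [vs sz]]|none] := pselect (exists s, valid s /\ z = (lag cs s).[y]).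
 exists (lag cs s) => // n; rewrite /lag coef_sum; apply: (sub_sum hU) => k _.
 rewrite coefZ; apply: (subM hU); last by apply/FU/basisF; exact: mem_nth.
 by apply: (RU cs`_k); [exact: csF|exact: (proj2 vs)].
(* If z differed from every interpolation through these roots, the finitely many differences would
   vanish on finitely many lines only; yet on each line of E one of them vanishes. *)
have [PA PA0 AP] := finite_zeros_seq [seq z - (lag cs s).[y] | s <- Ls] hL Phialg nt.
have [e [Ee nr]] := infinite_nonempty (@infinite_nonroot_line _ _ b infE PA0); have [p [pF szp Pz pH]] := peP e Ee.
case/negP: nr.
have [pP tP Pt] := PlP e Ee; have hP := pl_hg pP.
have /choice [s sP] : forall n, exists x, (n < size cs)%N -> x \in R cs`_n /\ Pl e (x, p.[cs`_n]).
 move=> n; case: (ltnP n (size cs)) => [ln|_]; last by exists 0.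
 by have [x h1 h2] := rho e _ p Ee (csF _ ln) pF pH; exists x.
have vs : valid (mkseq s (size cs)) by split=> [|n ln]; rewrite ?size_mkseq // nth_mkseq //; have [] := sP n ln.
apply: (AP (z - (lag cs (mkseq s (size cs))).[y]) _ _ _ _ pP tP Pt).
 by apply: (map_f (fun s => z - (lag cs s).[y])); exact: validL.
 by rewrite subr_eq0; apply/eqP => e0; apply: none; exists (mkseq s (size cs)).
rewrite -[X in Pl e (_, X)](subrr p.[y]).
apply: (hgB hP) => //; have pE : p = lag cs [seq p.[c] | c <- cs].
 by apply: lagP => //; rewrite szcs.
rewrite [X in Pl e (_, X.[_])]pE; apply: (hg_horner hP); last by apply: tP; exact: Ly.
move=> n; rewrite /lag !coef_sum; apply: (hg_sum hP) => k; rewrite !coefZ; apply: (hgM hP).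
 rewrite nth_mkseq // (nth_map 0) //; exact: (proj2 (sP k (ltn_ord k))).
by apply/tP/FL/basisF; exact: mem_nth.
Qed.
End Specialization.

(** * Comparison of two pencils of lines *)

Section TwoPencils.
Notation U b := (alg_over (fadj F (slope b))).

Let hL : subfield L := hL.
Let hPhi : subfield Phi := hPhi.
Let y0 : y != 0 := y_nz.

Lemma slope_field b : F b -> fadj F (slope b) `<=` Phi.
move=> Fb; apply: (fadj_min hPhi).
 by move=> x Fx; apply: LPhi; exact: FL.
rewrite /slope; apply: (sub_div hPhi); last by apply: LPhi; exact: Ly.
by apply: (subB hPhi); [exact: Phit|apply: LPhi; exact: FL].
Qed.

Lemma U_field b : subfield (U b). by apply: alg_subfield; exact: fadj_sub. Qed.

Lemma U_alg b x : alg_over (U b) x -> U b x.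
by apply: alg_trans; [exact: fadj_sub|]. Qed.

Lemma slope_residue P b e w q : place P -> trivial_on L P -> F b -> P (t, b + e * y) -> F e ->
 U b w -> P (w, q) -> F q.
move=> pP tP Fb Pt Fe Uw Pw; have tF : trivial_on F P by move=> c /(FL); exact: tP.
apply: Falg; apply: (res_alg hF (fadj_sub (slope b) hF) pP _ Uw Pw) => x u Mx Px.
exact: (res_fadj hF pP tF (slope_place pP tP Fb Pt Fe) Fe Mx Px).
Qed.

(** Elements of U b have residues in F along a line of the pencil, whereas the residue of y is y. *)
Lemma U_y b : F b -> ~ U b y.
move=> Fb Uy; have [P [pP tP Pt]] := place_at (b + 0 * y) hL nt.
apply/Fy/(slope_residue pP tP Fb Pt (sub0 hF) Uy); apply: tP; exact: Ly.
Qed.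

Lemma gal_U b (g : gal Phi) w : F b -> U b w -> U b (g w).
move=> Fb [p [pM p0 pw]]; exists p; split=> //; apply: gal_root pw => n.
exact: (slope_field Fb (pM n)).
Qed.

Lemma gal_coefs b (g : gal Phi) (W : {poly Om}) : F b -> coefs (U b) W -> g W.[y] = W.[y] -> forall n, g W`_n = W`_n.
move=> Fb UW gW n; have gy : g y = y.
 by have [_ _ ->] := galP g => //; apply: LPhi; exact: Ly.
have e : map_poly g W - W = 0.
 apply: (transc_poly (F := U b) (y := y)); [exact: U_alg|exact: U_y| |].
 by move=> k; rewrite coefB coef_map; apply: (subB (U_field b)); [exact: gal_U|].
 have e1 : (map_poly g W).[g y] = g W.[y] by rewrite horner_map.
 by rewrite gy in e1; rewrite hornerD hornerN e1 gW subrr.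
by have := congr1 (fun p : {poly Om} => p`_n) e; rewrite coefB coef_map coef0 => /eqP; rewrite subr_eq0 => /eqP.
Qed.

Lemma coefs_gal (g : gal Phi) (W : {poly Om}) : (forall n, g W`_n = W`_n) -> g W.[y] = W.[y].
move=> gW; have gy : g y = y.
 by have [_ _ ->] := galP g => //; apply: LPhi; exact: Ly.
have e : map_poly g W = W by apply/polyP => n; rewrite coef_map; exact: gW.
have e2 : (map_poly g W).[g y] = g W.[y] by rewrite horner_map.
by rewrite gy e in e2; rewrite -e2.
Qed.

Lemma good_specialization b (D : seq Om) : F b -> (forall w, w \in D -> w != 0) ->
 exists P e, [/\ place P, trivial_on L P, P (t, b + e * y), F e & forall w, w \in D -> ~ P (w, 0)].
move=> Fb D0; have [A A0 AP] := finite_zeros_seq D hL Phialg nt.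
have [e [Fe nr]] := infinite_nonempty (@infinite_nonroot_line _ _ b Finf A0).
have [P [pP tP Pt]] := place_at (b + e * y) hL nt; exists P, e; split=> //.
by move=> w wD Pw; move/negP: nr; apply; exact: AP wD (D0 _ wD) pP tP Pt Pw.
Qed.

(** On a general line of the first pencil the decomposition group fixes the coefficients of W, hence
    z, hence those of W'. The same line restricts trivially to the slope field of the second pencil,
    so the coefficients of W' inherit the rationality of their residues. *)
Lemma two_pencils b b' z (W W' : {poly Om}) : F b -> F b' -> b != b' -> coefs (U b) W -> coefs (U b') W' ->
 z = W.[y] -> z = W'.[y] -> forall g : gal Phi, g z = z.
move=> Fb Fb' bb UW UW' zW zW'.
have /choice [r rP] : forall w, exists r : seq Om, forall g : gal Phi, g w \in r by move=> w; exact: finite_orbit (Phialg w).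
(* Nonvanishing of these elements keeps the coefficients of W finite and their conjugates distinct
   after reduction. *)
pose D1 := flatten [seq w^-1 :: [seq v - w | v <- r w] | w <- polyseq W].
pose D := [seq d <- D1 | d != 0].
have [w|P [e [pP tP Pt Fe PD]]] := good_specialization (D := D) Fb; first by rewrite mem_filter => /andP[].
have hP := pl_hg pP.
have WV n : exists2 q, F q & P (W`_n, q).
 have [w0|w0] := eqVneq W`_n 0; first by exists 0; [exact: sub0|rewrite w0; exact: hg0].
 have nW : (n < size W)%N by rewrite ltnNge; apply: contraNN w0 => le; rewrite nth_default.
 have [[q Pq]|h] := pl_total pP W`_n; first by exists q => //; exact: (slope_residue pP tP Fb Pt Fe (UW n) Pq).
 case: (PD (W`_n)^-1) => //; rewrite mem_filter invr_eq0 w0; apply/flattenP.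
 exists ((W`_n)^-1 :: [seq v - W`_n | v <- r W`_n]); last exact: mem_head.
 by apply: (map_f (fun w => w^-1 :: [seq v - w | v <- r w])); exact: mem_nth.
have fixW (g : gal Phi) (rho : gal L) : (forall x q, P (x, q) -> P (g x, rho q)) -> forall n, g W`_n = W`_n.
 move=> gr n; have [q Fq Pq] := WV n; have := gr _ _ Pq.
 have [_ _ ->] := galP rho; last exact: FL; move=> Pgq.
 apply/eqP; rewrite -subr_eq0; apply/eqP; apply: contrapT => /eqP ne.
 have [w0|w0] := eqVneq W`_n 0; first by rewrite w0 rmorph0 subrr eqxx in ne.
 have nW : (n < size W)%N by rewrite ltnNge; apply: contraNN w0 => le; rewrite nth_default.
 case: (PD (g W`_n - W`_n)); last by have h := hgB hP Pgq Pq; rewrite subrr in h.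
 rewrite mem_filter ne; apply/flattenP; exists ((W`_n)^-1 :: [seq v - W`_n | v <- r W`_n]).
 by apply: (map_f (fun w => w^-1 :: [seq v - w | v <- r w])); exact: mem_nth.
 by rewrite inE; apply/orP; right; apply: (map_f (fun v => v - W`_n)); exact: rP.
have fixW' (g : gal Phi) (rho : gal L) : (forall x q, P (x, q) -> P (g x, rho q)) -> forall n, g W'`_n = W'`_n.
 by move=> gr; apply: (gal_coefs Fb' UW'); rewrite -zW' zW; apply: coefs_gal; exact: fixW gr.
(* v is the residue of the second slope; it is transcendental over F and generates F(y) over F. *)
pose v := e + (b - b') / y.
have Pu' : P (slope b', v).
 have -> : v = (b + e * y - b') / y by rewrite [b + _ - _]addrAC [RHS]mulrDl (mulfK y0) [RHS]addrC.
 apply: (pl_div pP); [|by apply: tP; exact: Ly|exact: y0].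
 by apply: hgB => //; apply: tP; exact: FL.
have ve : v - e = (b - b') / y by rewrite /v [e + _]addrC addrK.
have yv : y = (b - b') / (v - e) by rewrite ve invf_div mulrCA divff ?mulr1 // subr_eq0.
have nv : ~ F v by move=> Fv; apply: Fy; rewrite yv; apply: (sub_div hF); exact: subB.
have Lv : L v.
 apply: (subD hL); first exact: FL.
 by apply: (sub_div hL); [apply: FL; exact: subB|exact: Ly].
have tF : trivial_on F P by move=> c /(FL); exact: tP.
have hM' := fadj_sub (slope b') hF.
have Mu x : fadj F (slope b') x -> x != 0 -> punit P x.
 move=> [p [d [pF dF ->]]] x0; have dn : d.[slope b'] != 0.
 by apply: contraNneq x0 => ->; rewrite invr0 mulr0.
 have pn : p.[slope b'] != 0 by apply: contraNneq x0 => ->; rewrite mul0r.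
 have un (s : {poly Om}) : coefs F s -> s.[slope b'] != 0 -> punit P s.[slope b'].
 move=> sF s0; exists s.[v]; last by apply: (hg_horner hP) => //; exact: (trivial_graph hF tF).
 apply: contraNneq s0 => sv; suff -> : s = 0 by rewrite horner0.
 exact: (transc_poly Falg nv).
 by apply: (punitM pP) => //; [exact: un|apply: (punitV pP); exact: un].
have Uu x : U b' x -> x != 0 -> punit P x by move=> Ux; exact: (res_unit_alg hM' pP Mu Ux).
have Mres x q : fadj F (slope b') x -> P (x, q) -> L q.
 move=> Mx Px; have [->|x0] := eqVneq q 0; first exact: sub0 hL.
 move: Mx Px => [p [d [pF dF ->]]] Px.
 have hp : P (p.[slope b'], p.[v]) by apply: (hg_horner hP) => //; exact: (trivial_graph hF tF).
 have hd : P (d.[slope b'], d.[v]) by apply: (hg_horner hP) => //; exact: (trivial_graph hF tF).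
 have dv : d.[v] != 0.
 apply/eqP => dv; have d0 : d = 0 by apply: (transc_poly Falg nv).
 by move: Px; rewrite d0 horner0 invr0 mulr0 => h; rewrite (hg_fun hP h (hg0 hP)) eqxx in x0.
 rewrite (hg_fun hP Px (pl_div pP hp hd dv)).
 by apply: (sub_div hL); apply: (sub_horner hL) => // n; apply: FL.
move=> g; rewrite zW'; apply: coefs_gal => n; set w := W'`_n.
have Uw : U b' w by exact: UW'.
have [->|w0] := eqVneq w 0; first exact: rmorph0.
have [q q0 Pq] := Uu _ Uw w0.
(* Every automorphism of residues over L lifts to the decomposition group, which fixes w; so the
   residue q of w is purely inseparable over L. *)
have [s|m mp Lm] := @fixed_ppower Om L q hL (res_alg hL hM' pP Mres Uw Pq).
 have [h hr] := decomp_lift s pP tP Pt (subD hL (FL Fb) (subM hL (FL Fe) Ly)).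
 have := hr _ _ Pq; rewrite (fixW' h s hr n) => Pq'.
 exact: (hg_fun hP Pq' Pq).
have vL : L `<=` fadj F v.
 apply: (fadj_min (fadj_sub v hF)); first by move=> x; exact: fadj_incl.
 rewrite yv; apply: (sub_div (fadj_sub v hF)); first by apply: fadj_incl => //; exact: subB.
 by apply: (subB (fadj_sub v hF)); [exact: fadj_gen|exact: fadj_incl].
have [p [d [pF dF qE]]] := vL _ Lm.
pose x := p.[slope b'] / d.[slope b'].
have Mx : fadj F (slope b') x by exists p, d.
have dv : d.[v] != 0 by apply: contraNneq q0 => dv; move/eqP: qE; rewrite dv invr0 mulr0 expf_eq0 => /andP[].
have Px : P (x, q ^+ m) by rewrite qE; apply: (pl_div pP) => //; apply: (hg_horner hP) => //; exact: (trivial_graph hF tF).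
have wx : w ^+ m = x.
 apply/eqP; rewrite -subr_eq0; apply: contraT => ne.
 have Ud : U b' (w ^+ m - x) by apply: (subB (U_field b')); [apply: (subX (U_field b'))|apply: alg_id].
 have [u u0 Pu] := Uu _ Ud ne.
 have := hgB hP (hgX hP m Pq) Px; rewrite subrr => /(hg_fun hP Pu) e0.
 by rewrite e0 eqxx in u0.
apply: (pchar_expr_inj mp); rewrite -rmorphXn /= wx.
by have [_ _ ->] := galP g => //; exact: (slope_field Fb').
Qed.
End TwoPencils.

(** * A line staying irreducible in a given cover *)

Section Bertini.
Let hL : subfield L := hL.
Let hPhi : subfield Phi := hPhi.
Let y0 : y != 0 := y_nz.

Lemma int_prod (s : seq Om) : {in s, forall v, int_over v} ->
 forall k, int_over (\prod_(v <- s) ('X - v%:P))`_k.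
elim: s => [|v s IH] sv k.
 rewrite big_nil coef1; case: eqP => _; [exact: integral1|exact: integral0].
have IH' : forall k, int_over (\prod_(v <- s) ('X - v%:P))`_k by apply: IH => w ws; apply: sv; rewrite inE ws orbT.
rewrite big_cons mulrBl coefB coefXM coefCM; apply: integral_sub.
 by case: k => [|k]; [exact: integral0|exact: IH'].
by apply: integral_mul; [apply: sv; exact: mem_head|exact: IH'].
Qed.

Lemma int_residue P a z : place P -> trivial_on L P -> P (t, a) -> int_over z -> exists q, P (z, q).
move=> pP tP Pt [H mH Hz]; apply: (place_integral pP (monic_map _ mH)) Hz => n.
rewrite coef_map; exists (ev a y H`_n); apply: ev_place => //; last by apply: tP; exact: Ly.
by move=> c /(FL); exact: tP.
Qed.

Variables (Z : Om) (rs : seq Om).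
Hypotheses (urs : uniq rs) (rsP : forall v, v \in rs <-> exists g : gal Phi, v = g Z).
Hypothesis fPhi : coefs Phi (\prod_(v <- rs) ('X - v%:P)).
Hypothesis rsint : forall v, v \in rs -> int_over v.

(** The reduced equation of Z remains irreducible: the residues of its conjugates are conjugate over
    L. *)
Definition transitive_residues (P : set (Om * Om)) := forall v v' q q', v \in rs -> v' \in rs ->
 P (v, q) -> P (v', q') -> exists r : gal L, r q = q'.

(** If the reduced equation splits, the conjugates of Z whose residues are roots of a proper factor
    form the required subset; a bit sequence records it. *)
Lemma split_residues P a : place P -> trivial_on L P -> P (t, a) -> L a ->
 (forall v v', v \in rs -> v' \in rs -> v != v' -> ~ P (v - v', 0)) -> ~ transitive_residues P ->
 exists m : bitseq, [/\ size m = size rs, (exists2 v, v \in rs & v \notin mask m rs), (exists v, v \in mask m rs) &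
 forall k, exists2 q, L q & P ((\prod_(v <- mask m rs) ('X - v%:P))`_k, q)].
move=> pP tP Pt La dist ntr; have hP := pl_hg pP.
have [v0 [v1 [q0 [q1 [v0r v1r Pq0 Pq1 nr]]]]] : exists v0 v1 q0 q1, [/\ v0 \in rs, v1 \in rs, P (v0, q0), P (v1, q1) &
 forall r : gal L, r q0 <> q1].
 apply: contrapT => none; apply: ntr => v v' q q' vr v'r Pq Pq'.
 by apply: contrapT => nn; apply: none; exists v, v', q, q'; split=> // r e; apply: nn; exists r.
have /choice [th thP] : forall v, exists q, v \in rs -> P (v, q).
 move=> v; have [vr|_] := boolP (v \in rs); last by exists 0.
 by have [q h] := int_residue pP tP Pt (rsint vr); exists q.
have thinj : {in rs &, injective th}.
 move=> v v' vr v'r e; apply/eqP; apply: contraT => ne; case: (dist _ _ vr v'r ne).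
 by have := hgB hP (thP _ vr) (thP _ v'r); rewrite e subrr.
have fg : coefs_graph P (\prod_(v <- rs) ('X - v%:P)) (\prod_(v <- rs) ('X - (th v)%:P)) by apply: cg_prod.
have fL : coefs L (\prod_(v <- rs) ('X - (th v)%:P)) by move=> k; apply: (res_fadj hL pP tP Pt La (fPhi k) (fg k)).
have fth v : v \in rs -> root (\prod_(v <- rs) ('X - (th v)%:P)) (th v) by move=> vr; rewrite -(big_map th predT (fun x => 'X - x%:P)) root_prod_XsubC map_f.
have Lv0 : alg_over L (th v0).
 exists (\prod_(v <- rs) ('X - (th v)%:P)); split=> //; last exact: fth.
 by rewrite monic_neq0 // monic_prod_XsubC.
have [m [mL mm mx mdvd mconj]] := minpol_ex hL Lv0.
have mf := mdvd _ fL (fth _ v0r).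
have usep : separable_poly (\prod_(v <- rs) ('X - (th v)%:P)) by rewrite -(big_map th predT (fun x => 'X - x%:P)) separable_prod_XsubC map_inj_in_uniq.
have msep := dvdp_separable mf usep.
have [r Dm] := closed_field_poly_normal m; rewrite (monicP mm) scale1r in Dm.
have ur : uniq r by move: msep; rewrite Dm separable_prod_XsubC.
pose mk := [seq root m (th v) | v <- rs].
have mkE : mask mk rs = [seq v <- rs | root m (th v)] by rewrite filter_mask.
have rE : perm_eq r [seq th v | v <- mask mk rs].
 apply: uniq_perm => //.
 by rewrite mkE map_inj_in_uniq ?filter_uniq // => v v'; rewrite !mem_filter => /andP[_ h] /andP[_ h']; exact: thinj.
 move=> z; rewrite -root_prod_XsubC -Dm mkE; apply/idP/mapP => [rz|[v vr ->]]; last first.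
 by move: vr; rewrite mem_filter => /andP[].
 have : root (\prod_(v <- rs) ('X - (th v)%:P)) z by move: rz; rewrite -!dvdp_XsubCl => /dvdp_trans; apply.
 rewrite -(big_map th predT (fun x => 'X - x%:P)) root_prod_XsubC => /mapP [v vr e].
 by exists v => //; rewrite mem_filter vr -e rz.
exists mk; split.
- by rewrite size_map.
- exists v1 => //; rewrite mkE mem_filter v1r andbT; apply/negP => /mconj [s sE].
 apply: (nr s); rewrite (hg_fun hP Pq0 (thP _ v0r)) (hg_fun hP Pq1 (thP _ v1r)); exact: sE.
- by exists v0; rewrite mkE mem_filter v0r mx.
- move=> k; exists m`_k => //; rewrite Dm (perm_big _ rE) /= big_map.
 by apply: cg_prod => // v; rewrite mkE mem_filter => /andP[_]; exact: thP.
Qed.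

Lemma infinite_fiber (T : choiceType) (V : eqType) (E : set T) (Ls : seq V) (R : T -> V -> Prop) :
 infinite_set E -> (forall e, E e -> exists2 v, v \in Ls & R e v) ->
 exists2 v, v \in Ls & infinite_set [set e | E e /\ R e v].
elim: Ls E => [|v Ls IH] E infE ER.
 by have [e /ER []] := infinite_nonempty infE.
have [fin|inf] := pselect (finite_set [set e | E e /\ R e v]); last by exists v; rewrite ?mem_head.
have [||w wL inf] := IH (E `\` [set e | E e /\ R e v]).
- exact: infinite_setD.
- move=> e [Ee ne]; have [w] := ER e Ee; rewrite inE => /orP[/eqP -> h|wL h]; last by exists w.
 by case: ne.
exists w; first by rewrite inE wL orbT.
by apply: sub_infinite_set inf => e [[Ee _] h].
Qed.

(** Otherwise every line off finitely many splits the conjugates of Z. A fixed splitting occurs on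
    infinitely many lines of a pencil, and the same one in two pencils; [bertini_noether] and
    [two_pencils] then make the factor invariant under Gal(Phi), although it contains only part of
    an orbit. *)
Theorem bertini (Cb Ce : set Om) (D : seq Om) : infinite_set Cb -> Cb `<=` F -> infinite_set Ce -> Ce `<=` F ->
 (forall w, w \in D -> w != 0) ->
 exists P b e, [/\ place P, trivial_on L P, P (t, b + e * y), Cb b /\ Ce e &
 (forall w, w \in D -> ~ P (w, 0)) /\ transitive_residues P].
move=> infb bF infe eF D0; apply: contrapT => none.
(* The differences of conjugates keep the residues of the conjugates distinct. *)
pose D' := D ++ [seq v - v' | v <- rs, v' <- [seq v' <- rs | v != v']].
have D'0 w : w \in D' -> w != 0.
 rewrite mem_cat => /orP[/D0 //|/allpairsPdep [v [v' [vr]]]].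
 by rewrite mem_filter => /andP[ne _] ->; rewrite subr_eq0.
have [PA PA0 AP] := finite_zeros_seq D' hL Phialg nt.
have PAP P a w : place P -> trivial_on L P -> P (t, a) -> w \in D' -> P (w, 0) -> root PA a by move=> pP tP Pt wD; apply: AP wD (D'0 _ wD) pP tP Pt.
have [Ms MsP] := choices (nseq (size rs) [:: true; false]).
have MsE (m : bitseq) : size m = size rs -> m \in Ms.
 move=> sz; apply: MsP; rewrite ?size_nseq // => n ln x0; rewrite nth_nseq ln.
 by case: (nth _ _ _).
pose good b (m : bitseq) := [/\ (exists2 v, v \in rs & v \notin mask m rs), (exists v, v \in mask m rs) &
 forall k, exists2 W, coefs (alg_over (fadj F (slope b))) W & (\prod_(v <- mask m rs) ('X - v%:P))`_k = W.[y]].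
have each b : Cb b -> exists2 m, m \in Ms & good b m.
 move=> Cbb; pose E := [set e | Ce e /\ ~~ root PA (b + e * y)].
 have infE : infinite_set E := @infinite_nonroot_line _ _ b infe PA0.
 have /choice [Pl PlP] : forall e, exists P, [/\ place P, trivial_on L P & P (t, b + e * y)] by move=> e; have [P [h1 h2 h3]] := place_at (b + e * y) hL nt; exists P.
 pose R e (m : bitseq) := [/\ (exists2 v, v \in rs & v \notin mask m rs), (exists v, v \in mask m rs) &
 forall k, exists2 q, L q & Pl e ((\prod_(v <- mask m rs) ('X - v%:P))`_k, q)].
 have [e [Cee nr]|m mM infm] := @infinite_fiber _ _ E Ms R infE.
 have [pP tP Pt] := PlP e.
 have [|||m [sz h1 h2 h3]] := split_residues pP tP Pt.
 - by apply: (subD hL); [apply/(FL)/bF|apply: (subM hL); [apply/(FL)/eF|exact: Ly]].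
 - move=> v v' vr v'r ne Pw; move/negP: nr; apply; apply: (PAP _ _ _ pP tP Pt _ Pw).
 rewrite mem_cat; apply/orP; right; apply/allpairsPdep; exists v, v'; split=> //.
 by rewrite mem_filter ne.
 - move=> tr; apply: none; exists (Pl e), b, e; split=> //; split=> // w wD Pw.
 by move/negP: nr; apply; apply: (PAP _ _ _ pP tP Pt _ Pw); rewrite mem_cat wD.
 by exists m; [exact: MsE|split].
 exists m => //; have [e0 [_ [h1 h2 _]]] := infinite_nonempty infm; split=> // k.
 apply: (bertini_noether (bF _ Cbb) infm (Pl := Pl)).
 - by move=> e [[Cee _] _]; exact: eF.
 - by move=> e _; exact: PlP.
 - by apply: int_prod => v /mem_mask; exact: rsint.
 - by move=> e [_ [_ _ h]].
have [bs [ubs szbs bsC]] := infinite_seq (1 * size Ms).+1 infb.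
have /choice [M MP] : forall b, exists m, Cb b -> m \in Ms /\ good b m by move=> b; have [/each [m h1 h2]|nb] := pselect (Cb b); [exists m|exists [::]].
have [||m mM lt] := @pigeonhole_seq _ _ M 1 Ms bs; [by move=> b /bsC /MP []|by rewrite szbs|].
have [b [b' [bb Cbb Cbb' [e e']]]] : exists b b', [/\ b != b', Cb b, Cb b' & M b = m /\ M b' = m].
 move: lt; rewrite -size_filter; set s := [seq b <- bs | _] => lt.
 have us : uniq s by rewrite filter_uniq.
 have sP x : x \in s -> Cb x /\ M x = m by rewrite mem_filter => /andP[/eqP <- /bsC].
 case: s us sP lt => [//|b [//|b' s]] /= /andP[ne _] sP _.
 have [h1 h2] := sP b (mem_head _ _); have [|h3 h4] := sP b'; first by rewrite !inE eqxx orbT.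
 by exists b, b'; split=> //; move: ne; rewrite inE negb_or => /andP[].
have [_ [[w wr nw] [v vs] gb]] := MP _ Cbb; rewrite e in nw vs gb.
have [_ [_ _ gb']] := MP _ Cbb'; rewrite e' in gb'.
(* The two pencils b and b' share the splitting m, so every coefficient lies in the reach of
   [two_pencils]. *)
have fix_ (g : gal Phi) : map_poly g (\prod_(v <- mask m rs) ('X - v%:P)) = \prod_(v <- mask m rs) ('X - v%:P).
 apply/polyP => k; rewrite coef_map; have [W UW zW] := gb k; have [W' UW' zW'] := gb' k.
 exact: (two_pencils (bF _ Cbb) (bF _ Cbb') bb UW UW' zW zW').
have [g0 vE] := (rsP v).1 (mem_mask vs); have [g1 wE] := (rsP w).1 wr.
move/negP: nw; apply; rewrite -root_prod_XsubC -(fix_ (g1 * g0^-1)%g).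
have -> : w = (g1 * g0^-1)%g v by rewrite wE vE /= (@bij_funK _ g0).
by rewrite fmorph_root root_prod_XsubC.
Qed.
End Bertini.

(** * An integral primitive element *)

Section Primitive.
Let hL : subfield L := hL.
Let hPhi : subfield Phi := hPhi.
Notation Ev := (ev t y).

Lemma ev_const c : F c -> exists h, Ev h = c.
move=> Fc; have cF : c \in fld hF by apply/fldP.
exists (SField cF)%:P%:P; rewrite evE map_polyC hornerC; change ((inc (SField cF)%:P).[y] = c).
by rewrite [inc _]map_polyC hornerC.
Qed.

Lemma ev_y : exists h, Ev h = y.
exists 'X%:P; rewrite evE map_polyC hornerC; change ((inc 'X).[y] = y).
by rewrite [inc _]map_polyX hornerX.
Qed.

Lemma ev_t : exists h, Ev h = t.
by exists 'X; rewrite evE map_polyX hornerX. Qed.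

Lemma ev_Phi h : Phi (Ev h).
apply: ev_over => //; [by move=> x Fx; apply: LPhi; exact: (FL)|exact: Phit|].
by apply: LPhi; exact: Ly.
Qed.

Lemma Phi_frac c : Phi c -> exists u v, [/\ range Ev u, range Ev v & c = u / v].
pose S := [set c : Om | exists u v, [/\ range Ev u, range Ev v & c = u / v]].
have emb x : (exists h, Ev h = x) -> S x by move=> [h e]; exists x, 1; rewrite divr1; split=> //; [exists h|exists 1; rewrite ?rmorph1].
have hS : subfield S.
 apply: (frac_subfield (R := range Ev)); first by exists 1; rewrite ?rmorph1.
 by move=> _ _ [u _ <-] [v _ <-]; exists (u - v); rewrite ?rmorphB.
 by move=> _ _ [u _ <-] [v _ <-]; exists (u * v); rewrite ?rmorphM.
apply: (fadj_min hS); last by apply: emb; exact: ev_t.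
apply: (fadj_min hS); last by apply: emb; exact: ev_y.
by move=> x Fx; apply: emb; exact: ev_const.
Qed.

(** Multiplying a root by the common denominator d of a monic equation makes it integral: the
    equation is multiplied by a power of d. *)
Lemma int_scaled (f : {poly Om}) d v : f \is monic -> range Ev d -> (forall n, range Ev (d * f`_n)) ->
 root f v -> int_over (d * v).
move=> mf [dl _ dE] fR fv; have /choice [u uP] : forall n, exists u, Ev u = d * f`_n.
 by move=> n; have [u _ h] := fR n; exists u.
have szf : (0 < size f)%N by rewrite size_poly_gt0 monic_neq0.
pose D := (size f).-1; have szD : size f = D.+1 by rewrite prednK.
pose H : {poly poly2} := 'X^D + \poly_(k < D) (u k * dl ^+ (D.-1 - k)).
exists H.
 rewrite monicE lead_coefDl ?lead_coefXn //.
 by rewrite size_polyXn ltnS size_poly.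
have fE : v ^+ D = - \sum_(k < D) f`_k * v ^+ k.
 move: fv => /rootP; rewrite horner_coef szD big_ord_recr /= => /eqP; rewrite addrC addr_eq0 => /eqP <-.
 by move/monicP: mf; rewrite lead_coefE => ->; rewrite mul1r.
have HE : map_poly Ev H = 'X^D + \poly_(k < D) Ev (u k * dl ^+ (D.-1 - k)).
 have HnE n : H`_n = (n == D)%:R + (if (n < D)%N then u n * dl ^+ (D.-1 - n) else 0) by etransitivity; [exact: coefD|congr (_ + _); [exact: coefXn|exact: coef_poly]].
 apply/polyP => n; rewrite coef_map HnE coefD coefXn coef_poly.
 by etransitivity; [exact: rmorphD|congr (_ + _); [exact: rmorph_nat|case: ifP => // _; exact: rmorph0]].
apply/rootP; rewrite HE hornerD hornerXn.
rewrite horner_poly exprMn fE mulrN mulr_sumr addrC; apply/eqP; rewrite subr_eq0; apply/eqP.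
apply: eq_bigr => k _; rewrite rmorphM rmorphXn uP dE exprMn.
have -> : d ^+ D = d * d ^+ (D.-1 - k) * d ^+ k.
 have D0 : (0 < D)%N by exact: leq_trans (ltn_ord k).
 by rewrite -exprS -exprD addSn subnK ?prednK // -ltnS prednK.
by rewrite [LHS](AC ((2*1)*2) (((1*3)*4)*(2*5))).
Qed.

Lemma primitive_ex (ds : seq Om) : exists Z, forall g : gal Phi, g Z = Z -> {in ds, forall d, g d = d}.
have [L LP] := @orbit_seqs Om Phi setT ds (fun x _ => let: ex_intro r h := finite_orbit (Phialg x) in ex_intro _ r (fun h' _ => h h')).
have [c cF sep] := separating_point L ds Finf.
exists (Poly ds).[c] => g gZ; have gc : g c = c.
 by have [_ _ ->] := galP g => //; apply: LPhi; apply: FL; exact: cF.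
have e : Poly [seq g d | d <- ds] = Poly ds.
 apply: sep; first exact: LP.
 by rewrite -(map_Poly_id0 ds (rmorph0 g)) -{1}gc horner_map.
move=> d /(nthP 0) [n ln <-]; have := congr1 (fun p : {poly Om} => p`_n) e.
by rewrite !coef_Poly (nth_map 0).
Qed.

Lemma common_ppower (s : seq Om) : (forall x, x \in s -> exists2 q, [pchar Om].-nat q & Phi (x ^+ q)) ->
 exists2 q, [pchar Om].-nat q & forall x, x \in s -> Phi (x ^+ q).
elim: s => [|x s IH] sP; first by exists 1%N.
have [q qp qP] := IH (fun z zs => sP z (mem_behead (zs : z \in behead (x :: s)))).
have [r rp rP] := sP x (mem_head _ _).
exists (q * r)%N; first by rewrite pnatM qp.
move=> z; rewrite inE => /orP[/eqP ->|zs]; first by rewrite mulnC exprM; exact: (subX hPhi).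
by rewrite exprM; apply: (subX hPhi); exact: qP.
Qed.

(** A generic combination of [ds] is scaled to be integral and raised to a power that brings the
    orbit polynomial into Phi; none of this affects the fixing property. *)
Lemma primitive_setup (ds : seq Om) : exists Z rs, [/\ uniq rs, (forall v, v \in rs <-> exists g : gal Phi, v = g Z),
 coefs Phi (\prod_(v <- rs) ('X - v%:P)), (forall v, v \in rs -> int_over v) &
 forall g : gal Phi, g Z = Z -> {in ds, forall d, g d = d}].
have [Zc Zfix] := primitive_ex ds.
have [m [mF mm mZ _ _]] := minpol_ex hPhi (Phialg Zc).
have [||x x' [u _ <-] [u' _ <-]|n|d [dR d0 dm]] := @clear_den Om (range Ev) m.
- by exists 0 => //; exact: rmorph0.
- by exists 1 => //; exact: rmorph1.
- by exists (u * u') => //; exact: rmorphM.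
- exact: Phi_frac.
pose Z2 := d * Zc.
have gd (g : gal Phi) : g d = d by have [_ _ h] := galP g; apply: h; have [h0 _ <-] := dR; exact: ev_Phi.
have [r rP] := finite_orbit (Phialg Z2).
pose r2 := [seq v <- undup r | `[< exists g : gal Phi, v = g Z2 >]].
have r2P v : v \in r2 <-> exists g : gal Phi, v = g Z2.
 rewrite mem_filter; split=> [/andP[/asboolP]//|h]; apply/andP; split; first exact/asboolP.
 by have [g ->] := h; rewrite mem_undup.
have ur2 : uniq r2 by rewrite filter_uniq ?undup_uniq.
have int2 v : v \in r2 -> int_over v.
 move=> /r2P [g ->]; rewrite /Z2 rmorphM /= gd; apply: (int_scaled mm dR dm).
 exact: gal_root mZ.
pose f2 := \prod_(v <- r2) ('X - v%:P).
have gf2 (g : gal Phi) : map_poly g f2 = f2.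
 rewrite /f2 map_prod_XsubC; apply: perm_big; apply: uniq_perm => //.
 by rewrite map_inj_uniq //; exact: fmorph_inj.
 move=> v; apply/mapP/idP => [[w /r2P [h ->] ->]|/r2P [h ->]].
 by apply/r2P; exists (g * h)%g.
 exists ((g^-1 * h)%g Z2); first by apply/r2P; exists (g^-1 * h)%g.
 by rewrite /= (@bij_invfunK _ g).
(* The coefficients of the orbit polynomial are invariant, hence in Phi only after raising to a
   power of the characteristic exponent; the roots are raised accordingly. *)
have [|q qp qP] := @common_ppower f2.
 move=> x /(nthP 0) [n _ <-]; apply: (fixed_ppower hPhi (Phialg _)) => g.
 by rewrite -{2}(gf2 g) coef_map.
have q0 : (0 < q)%N by case/andP: qp.
exists (Z2 ^+ q), [seq v ^+ q | v <- r2]; split.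
- by rewrite map_inj_uniq // => v w; exact: pchar_expr_inj.
- move=> v; split=> [/mapP [w /r2P [g ->] ->]|[g ->]]; first by exists g; rewrite rmorphXn.
 by rewrite rmorphXn; apply: map_f; apply/r2P; exists g.
- rewrite -(map_prod_XsubC (frob qp)) => n; rewrite coef_map /= /frob.
 have [lt|le] := ltnP n (size f2); first by apply: qP; exact: mem_nth.
 by rewrite [f2`_n]nth_default // expr0n eqn0Ngt q0; exact: (sub0 hPhi).
- move=> _ /mapP [w /int2 wi ->]; elim: q {qp qP q0} => [|q IH]; first by rewrite expr0; exact: integral1.
 by rewrite exprS; exact: integral_mul.
move=> g; rewrite rmorphXn => /(pchar_expr_inj qp); rewrite /Z2 rmorphM /= gd => /(mulfI d0).
exact: Zfix.
Qed.
End Primitive.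

(** * The decomposition group at an irreducible unramified line *)

Section Decomposition.
Let hL : subfield L := hL.
Let hPhi : subfield Phi := hPhi.

Variable a0 : Om.
Hypothesis La0 : L a0.

Notation over_point := (over_point L t a0).
Notation tau := (t - a0).

Variables (Z : Om) (rs : seq Om).
Hypotheses (urs : uniq rs) (rsP : forall v, v \in rs <-> exists g : gal Phi, v = g Z).
Hypothesis fPhi : coefs Phi (\prod_(v <- rs) ('X - v%:P)).
Hypothesis rsint : forall v, v \in rs -> int_over v.

Variable P : set (Om * Om).
Hypotheses (oP : over_point P) (tr : transitive_residues rs P)
 (dist : forall v v', v \in rs -> v' \in rs -> v != v' -> ~ P (v - v', 0)).

Notation N := (fadj Phi Z).
Let pP : place P. by case: oP. Qed.
Let tP : trivial_on L P. by case: oP. Qed.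
Let Pt : P (t, a0). by case: oP. Qed.
Let hP : hom_graph P := pl_hg pP.

Let Zrs : Z \in rs.
by apply/rsP; exists 1%g. Qed.

(** The residues of the conjugates of Z are distinct and all conjugate over L, so a polynomial over
    L vanishing at one of them vanishes at all. *)
Lemma residue_indep q0 (r : {poly Om}) : P (Z, q0) -> coefs L r -> r != 0 -> (size r <= size rs)%N -> r.[q0] != 0.
move=> PZ rL r0 sz; apply/eqP => rq.
have /choice [th thP] : forall v, exists q, v \in rs -> P (v, q).
 move=> v; have [vr|_] := boolP (v \in rs); last by exists 0.
 by have [q h] := int_residue pP tP Pt (rsint vr); exists q.
have rts : all (root r) [seq th v | v <- rs].
 apply/allP => _ /mapP [v vr ->]; have [s <-] := tr Zrs vr PZ (thP _ vr).
 by apply: gal_root rL _; apply/rootP.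
have := max_poly_roots r0 rts; rewrite map_inj_in_uniq ?urs => [|v v' vr v'r e].
 by rewrite size_map => /(_ isT); rewrite ltnNge sz.
apply/eqP; apply: contraT => ne; case: (dist vr v'r ne).
by have := hgB hP (thP _ vr) (thP _ v'r); rewrite e subrr.
Qed.

Lemma reduce (p : {poly Om}) : coefs Phi p -> exists p', [/\ coefs Phi p', (size p' <= size rs)%N & p'.[Z] = p.[Z]].
pose f := \prod_(v <- rs) ('X - v%:P).
have mf : f \is monic by exact: monic_prod_XsubC.
have szf : size f = (size rs).+1 by rewrite size_prod_XsubC.
have fZ : f.[Z] = 0 by apply/rootP; rewrite root_prod_XsubC.
move=> pPhi; have [m] := ubnP (size p); elim: m p pPhi => // m IH p pPhi lt.
have [le|gt] := leqP (size p) (size rs); first by exists p.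
pose g := lead_coef p *: 'X^(size p - size f) * f.
have p0 : p != 0 by rewrite -size_poly_gt0 (leq_ltn_trans _ gt).
have szg : size g = size p.
 rewrite /g size_Mmonic // ?scaler_eq0 ?lead_coef_eq0 ?(negbTE p0) -?size_poly_eq0 ?size_polyXn //.
 by rewrite size_scale ?lead_coef_eq0 // size_polyXn addSn /= subnK // szf.
have gPhi : coefs Phi g.
 apply: coefsM => // n; rewrite coefZ; apply: (subM hPhi); first by rewrite lead_coefE.
 by rewrite coefXn; exact: sub_nat.
have [||p' [p'Phi sz e]] := IH (p - g).
- exact: coefsB.
- rewrite -ltnS (leq_trans _ lt) // ltnS; apply: size_sub_lead => //.
 by rewrite /g lead_coef_Mmonic // lead_coefZ lead_coefXn mulr1.
by exists p'; split=> //; rewrite e hornerD hornerN /g hornerM fZ mulr0 subr0.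
Qed.

Let good q0 x := exists k r, [/\ Phi k, k != 0, r != 0 & forall P', over_point P' -> P' (Z, q0) -> P' (x / k, r)].

(** No ramification in Phi(Z): up to an element of Phi, x is a unit, and its residue is computed
    from that of Z alone, because 1, Z, Z^2, ... stay independent after reduction. *)
Lemma unif q0 x : P (Z, q0) -> N x -> x != 0 -> good q0 x.
move=> PZ; have pol (p : {poly Om}) : coefs Phi p -> p.[Z] != 0 -> good q0 p.[Z].
 move=> pPhi pZ; have [p' [p'Phi sz e]] := reduce pPhi; rewrite -e in pZ *.
 have [s0|[k [ks k0 kP]]] := pl_scale pP (polyseq p').
 move: pZ; rewrite horner_coef big1 ?eqxx // => n _; rewrite (s0 p'`_n) ?mul0r //; exact: mem_nth.
 have kPhi : Phi k by move: ks => /(nthP 0) [n _ <-].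
 have p'n n : Phi (p'`_n / k) by exact: (sub_div hPhi).
 have /choice [r rP] : forall n, exists r, P (p'`_n / k, r).
 move=> n; have [lt|le] := ltnP n (size p'); first by apply: kP; exact: mem_nth.
 by exists 0; rewrite nth_default // mul0r; exact: hg0.
 pose T := \poly_(n < size p') r n.
 have TL : coefs L T.
 move=> n; rewrite coef_poly; case: ifP => _; last exact: (sub0 hL).
 exact: (res_fadj hL pP tP Pt La0 (p'n n) (rP n)).
 have T0 : T != 0.
 have [n ln kE] := nthP 0 ks; apply/eqP => T0; have := congr1 (fun p : {poly Om} => p`_n) T0.
 rewrite coef_poly ln coef0 => rn; have := rP n; rewrite rn kE divff // => h.
 by have := hg_fun hP h (hg1 hP) => /esym/eqP; rewrite oner_eq0.
 exists k, T.[q0]; split=> //.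
 by apply: (residue_indep PZ) => //; apply: leq_trans sz; exact: size_poly.
 move=> P' oP' PZ'; have [pP' _ _] := oP'; have hP' := pl_hg pP'.
 have -> : p'.[Z] / k = (k^-1 *: p').[Z] by rewrite hornerZ mulrC.
 apply: (hg_horner hP') PZ' => n; rewrite coefZ mulrC coef_poly; case: ltnP => le.
 exact: (agree_Phi hL nt La0 oP oP').
 by rewrite nth_default // mul0r; exact: hg0.
move=> [p [q [pPhi qPhi ->]]] x0.
have p0 : p.[Z] != 0 by apply: contraNneq x0 => ->; rewrite mul0r.
have q0' : q.[Z] != 0 by apply: contraNneq x0 => ->; rewrite invr0 mulr0.
have [k [r [kPhi k0 r0 kr]]] := pol _ pPhi p0; have [k' [r' [kPhi' k0' r0' kr']]] := pol _ qPhi q0'.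
exists (k / k'), (r / r'); split; [exact: (sub_div hPhi)|by rewrite mulf_neq0 ?invr_eq0|by rewrite mulf_neq0 ?invr_eq0|].
move=> P' oP' PZ'; have [pP' _ _] := oP'.
have -> : p.[Z] / q.[Z] / (k / k') = p.[Z] / k / (q.[Z] / k') by rewrite !invf_div [LHS](AC ((1*1)*(1*1)) ((1*4)*(3*2))).
by apply: (pl_div pP'); [exact: kr|exact: kr'|].
Qed.

Lemma agree_N q0 P' x q : P (Z, q0) -> over_point P' -> P' (Z, q0) -> N x -> P (x, q) -> P' (x, q).
move=> PZ oP' PZ' Nx Px; have [pP' _ _] := oP'; have hP' := pl_hg pP'.
have [x0|x0] := eqVneq x 0.
 by move: Px; rewrite x0 => h; rewrite (hg_fun hP h (hg0 hP)); exact: hg0.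
have [k [r [kPhi k0 r0 kr]]] := unif PZ Nx x0.
have Pk : P (k, q / r).
 have := pl_div pP Px (kr P oP PZ) r0; by rewrite invf_div mulrCA divff ?mulr1.
have := hgM hP' (kr P' oP' PZ') (agree_Phi hL nt La0 oP oP' kPhi Pk).
by rewrite divfK // mulrCA divff ?mulr1.
Qed.

Lemma disc_N x : N x -> x != 0 -> exists n m, punit P (x * tau ^+ n / tau ^+ m).
move=> Nx x0; have [q0 PZ] := int_residue pP tP Pt (rsint Zrs).
have [k [r [kPhi k0 r0 kr]]] := unif PZ Nx x0.
have [n [m [r' [r'0 rP]]]] := Phi_unif hL nt La0 kPhi k0.
exists n, m, (r * r'); first by rewrite mulf_neq0.
have := hgM hP (kr P oP PZ) (rP P oP).
by rewrite !mulrA divfK.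
Qed.

(** The place P composed with g lies over the same point. By transitivity of residues, after a
    change s of the residue field it agrees with P on N, so the two are conjugate over N by some h;
    then g h lies in the decomposition group. *)
Lemma decomposition (g : {rmorphism Om -> Om}) : bijective g -> (forall x, F x -> F (g x)) ->
 g y = y -> g t = t -> g a0 = a0 ->
 exists (h : gal N) (s : gal L), forall x q, P (x, q) -> P (g (h x), g (s q)).
move=> [g' gK g'K] gF gy gt ga.
have gL x : L x -> L (g x).
 move=> [p [r [pF rF ->]]]; exists (map_poly g p), (map_poly g r); split.
 - by move=> n; rewrite coef_map; exact: gF.
 - by move=> n; rewrite coef_map; exact: gF.
 have gh (f : {poly Om}) : (map_poly g f).[y] = g f.[y] by rewrite -{1}gy horner_map.
 by rewrite !gh fmorph_div.
pose P1 := [set z : Om * Om | P (g z.1, g z.2)].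
have pl1 (r : {rmorphism Om -> Om}) : bijective r -> place [set z : Om * Om | P (g z.1, r z.2)].
 move=> [r' rK r'K]; split=> /=.
 - split=> [|x z u v|x z u v|v] /=; rewrite ?rmorph1 ?rmorphB ?rmorphM.
 + exact: hg1.
 + exact: hgB.
 + exact: hgM.
 + by have [_ _ _ h] := hP; rewrite rmorph0 => /h/eqP; rewrite fmorph_eq0 => /eqP.
 - by move=> x u h u0; rewrite !fmorphV; apply: plV; rewrite ?fmorph_eq0.
 - move=> x; rewrite fmorphV rmorph0; have [[u h]|h] := pl_total pP (g x); last by right.
 by left; exists (r' u); rewrite r'K.
have o1 : over_point P1.
 split; [exact: (pl1 g (Bijective gK g'K))|by move=> c Lc; apply: tP; exact: gL|].
 by rewrite /P1 /= gt ga.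
have [||x|c|ga1 [_ gaP]] := place_extension (C := F) pP (let: And3 h _ _ := o1 in h) (diagonal_graph hPhi).
- by move=> u v [/= Pu <-] q; exact: (agree_Phi hL nt La0).
- by move=> x; apply: alg_mono (Phialg x) => z Pz.
- exact: Finf.
- by move=> Fc; split; [split=> //=; apply: LPhi; exact: (FL)|apply: tP; exact: FL].
have [gam gamE] := @gal_weaken Om Phi _ ga1 (fun z Pz => conj Pz erefl).
have [q0 PZ] := int_residue pP tP Pt (rsint Zrs).
have gZ : gam^-1%g Z \in rs by apply/rsP; exists gam^-1%g.
have [q1 Pq1] := int_residue pP tP Pt (rsint gZ).
have P1Z : P1 (Z, q1) by have := gaP _ _ Pq1; rewrite -gamE (@bij_invfunK _ gam).
have [s sq] := tr Zrs gZ PZ Pq1.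
pose P2 := [set z : Om * Om | P (g z.1, (g \o s : {rmorphism Om -> Om}) z.2)].
have sL (c : Om) : L c -> s c = c by have [_ _ h] := galP s; exact: h.
have o2 : over_point P2.
 split.
 - apply: pl1; exists (s^-1%g \o g') => u /=; first by rewrite gK (@bij_funK _ s).
 by rewrite (@bij_invfunK _ s) g'K.
 - by move=> c Lc; rewrite /P2 /= sL //; apply: tP; exact: gL.
 by rewrite /P2 /= sL // gt ga.
have P2Z : P2 (Z, q0) by rewrite /P2 /= sq.
have hN : subfield N := fadj_sub Z hPhi.
have [||x|c|h1 [_ hP1]] := place_extension (C := F) pP (let: And3 h _ _ := o2 in h) (diagonal_graph hN).
- by move=> u v [/= Nu <-] q; exact: (agree_N PZ o2 P2Z).
- by move=> x; apply: alg_mono (Phialg x) => z Pz; split=> //; exact: (fadj_incl Z hPhi).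
- exact: Finf.
- move=> Fc; split; last by apply: tP; exact: FL.
 by split=> //=; apply: (fadj_incl Z hPhi); apply: LPhi; exact: FL.
have [h hE] := @gal_weaken Om N _ h1 (fun z Pz => conj Pz erefl).
by exists h, s => x q /hP1; rewrite -hE.
Qed.
End Decomposition.
End TwoVariables.

Lemma fld_gen_sub (E : fieldType) (S M : set E) x : subfield M -> S `<=` M -> x \in fld_gen S -> M x.
by move=> hM SM /asboolP h; apply/(fldP hM); apply: h => z Sz; apply/(fldP hM)/SM. Qed.

Lemma preim_subfield (E E' : fieldType) (f : {rmorphism E -> E'}) (M : set E') : subfield M -> subfield [set x | M (f x)].
move=> hM; split=> /= [|x y Mx My|x y Mx My].
- by rewrite rmorph1; exact: sub1.
- by rewrite rmorphB; exact: subB.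
- by rewrite fmorph_div; exact: sub_div.
Qed.

(** * Separating one variable of an algebraically independent family *)

Section AlgebraicIndependence.
Import -(notations) mpoly.
Variables (k0 K0 : fieldType) (i : {rmorphism k0 -> K0}) (n : nat) (x : 'I_n -> K0) (m : 'I_n).
Hypothesis hx : alg_independent i x.
Notation A := (mpoly.mpoly n k0).
Notation var r := (mpoly.mpolyX k0 (mpoly.mnm1 r)).

(* The polynomials as univariate polynomials in the variable m. *)
Definition split_var : {rmorphism A -> {poly A}} :=
 mpoly.mmap (polyC \o mpoly.mpolyC n (R := k0) : {rmorphism k0 -> {poly A}}) (fun r => if r == m then 'X else (var r)%:P).

Definition eval_at : {rmorphism A -> K0} := mpoly.mmap i x.

Definition without : set A := [set q | split_var q = q%:P].

Lemma without0 : without 0. by rewrite /without /= !rmorph0. Qed.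
Lemma without1 : without 1. by rewrite /without /= !rmorph1. Qed.

Lemma withoutB u v : without u -> without v -> without (u - v).
move=> Su Sv; rewrite /without /=; transitivity (split_var u - split_var v); first exact: rmorphB.
by rewrite [split_var u]Su [split_var v]Sv; symmetry; exact: polyCB.
Qed.

Lemma withoutM u v : without u -> without v -> without (u * v).
move=> Su Sv; rewrite /without /=; transitivity (split_var u * split_var v); first exact: rmorphM.
by rewrite [split_var u]Su [split_var v]Sv; symmetry; exact: polyCM.
Qed.

Lemma split_varX r : split_var (var r) = if r == m then 'X else (var r)%:P.
by rewrite [LHS]mpoly.mmapX mpoly.mmap1U. Qed.

Lemma split_varC c : split_var (mpoly.mpolyC n c) = (mpoly.mpolyC n c)%:P.
exact: mpoly.mmapC. Qed.

Lemma eval_atX r : eval_at (var r) = x r.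
by rewrite [LHS]mpoly.mmapX mpoly.mmap1U. Qed.

Lemma eval_atC c : eval_at (mpoly.mpolyC n c) = i c.
exact: mpoly.mmapC. Qed.

Variables (E : fieldType) (j : {rmorphism K0 -> E}).

(** The field generated by the constants and the members of the family other than x m. *)
Definition frac_without : set E := [set z | exists u v, [/\ without u, without v & z = j (eval_at u) / j (eval_at v)]].

Lemma frac_without_subfield : subfield frac_without.
pose R := (j \o eval_at) @` without.
have -> : frac_without = [set z | exists u v, [/\ R u, R v & z = u / v]].
 apply/seteqP; split=> [_ [u [v [Su Sv ->]]]|_ [_ [_ [[u Su <-] [v Sv <-] ->]]]]; last by exists u, v.
 by exists (j (eval_at u)), (j (eval_at v)); split; [exists u|exists v|].
apply: frac_subfield.
- by exists 1; [exact: without1|rewrite /= !rmorph1].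
- by move=> _ _ [u Su <-] [v Sv <-]; exists (u - v); [exact: withoutB|rewrite /= !rmorphB].
- by move=> _ _ [u Su <-] [v Sv <-]; exists (u * v); [exact: withoutM|rewrite /= !rmorphM].
Qed.

Lemma frac_withoutC c : frac_without (j (i c)).
exists (mpoly.mpolyC n c), 1; split; [exact: split_varC|exact: rmorph1|].
by rewrite eval_atC !rmorph1 divr1.
Qed.

Lemma frac_withoutX r : r != m -> frac_without (j (x r)).
move=> rm; exists (var r), 1; split; [by rewrite /without /= split_varX (negbTE rm)|exact: rmorph1|].
by rewrite eval_atX !rmorph1 divr1.
Qed.

(** A relation cleared of denominators is a polynomial in the x's, hence zero, and [split_var] reads
    off its coefficients with respect to the variable m. *)
Lemma not_alg_without : ~ alg_over frac_without (j (x m)).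
move=> [p [pM p0 px]].
have [||_ _ [u Su <-] [v Sv <-]|k|_ [[w Sw <-] d0 dP]] := @clear_den E ((j \o eval_at) @` without) p.
- by exists 0; rewrite /= ?rmorph0 //; exact: without0.
- by exists 1; rewrite /= ?rmorph1 //; exact: without1.
- by exists (u * v); [exact: withoutM|rewrite !rmorphM].
- by have [u [v [Su Sv ->]]] := pM k; exists (j (eval_at u)), (j (eval_at v)); split=> //; [exists u|exists v].
have /choice [q qP] : forall k, exists q, without q /\ j (eval_at q) = j (eval_at w) * p`_k by move=> k; have [q Sq e] := dP k; exists q.
pose Q := \sum_(k < size p) q k * var m ^+ k.
have Q0 : Q = 0.
 apply: hx; apply: (fmorph_inj j); change (j (eval_at Q) = j 0); rewrite rmorph0.
 transitivity (j (eval_at w) * p.[j (x m)]); last by rewrite (rootP px) mulr0.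
 have e : eval_at Q = \sum_(k < size p) eval_at (q k) * x m ^+ k.
 etransitivity; first exact: (rmorph_sum eval_at).
 apply: eq_bigr => k _; etransitivity; first exact: (rmorphM eval_at).
 by congr (_ * _); etransitivity; [exact: (rmorphXn eval_at)|rewrite eval_atX].
 rewrite e horner_coef mulr_sumr rmorph_sum; apply: eq_bigr => k _.
 by rewrite rmorphM rmorphXn /= mulrA; congr (_ * _); exact: (qP k).2.
have sQ : split_var Q = \poly_(k < size p) q k.
 rewrite poly_def /Q rmorph_sum; apply: eq_bigr => k _.
 rewrite rmorphM rmorphXn /= split_varX eqxx [split_var (q k)](qP k).1; exact: mul_polyC.
have sz : (0 < size p)%N by rewrite size_poly_gt0.
have := congr1 (fun r : {poly A} => r`_(size p).-1) sQ.
rewrite Q0 rmorph0 coef0 coef_poly prednK // leqnn => q0.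
have := (qP (size p).-1).2; rewrite -q0 !rmorph0 => /esym/eqP.
by rewrite mulf_eq0 (negbTE d0) /= -[_`_ _]/(lead_coef p) lead_coef_eq0 (negbTE p0).
Qed.
End AlgebraicIndependence.

Lemma gal_refix (E : fieldType) (F F' : set E) (s : gal F') : (forall x, F x -> s x = x) -> exists t : gal F, t =1 s.
move=> sF; have sP : gal_bij s \in gal_pred F.
 by have [sD sM _] := galP s; apply/asboolP; split.
by exists (Gal sP).
Qed.

(** A homomorphism vanishing on the common kernel of finitely many others is a combination of them.
    The step uses an element killed by all others but not by [g b] to determine the coefficient of
    [g b]. *)
Lemma hom_span (G : groupType) (l : nat) (I : eqType) (bs : seq I) (g : I -> G -> 'F_l) (f : G -> 'F_l) : prime l -> uniq bs ->
 (forall s t, f (s * t)%g = f s + f t) -> (forall b s t, g b (s * t)%g = g b s + g b t) ->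
 (forall s, (forall b, b \in bs -> g b s = 0) -> f s = 0) ->
 exists c : I -> 'F_l, forall s, f s = \sum_(b <- bs) c b * g b s.
move=> pl; elim: bs f => [|b bs IH] f; first by move=> _ fM gM h; exists (fun=> 0) => s; rewrite big_nil; exact: h.
move=> /= /andP[nb ubs] fM gM h.
have ext (c : I -> 'F_l) (m : 'F_l) s : \sum_(b' <- b :: bs) (if b' == b then m else c b') * g b' s =
 m * g b s + \sum_(b' <- bs) c b' * g b' s.
 rewrite big_cons eqxx; congr (_ + _); rewrite !big_seq; apply: eq_bigr => b' b's.
 by case: eqP => // e; rewrite -e b's in nb.
have [[s0 [s0bs s0b]]|none] := pselect (exists s0, (forall b', b' \in bs -> g b' s0 = 0) /\ g b s0 != 0); last first.
 have [s hs|c cP] := IH f ubs fM gM.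
 apply: h => b'; rewrite inE => /orP[/eqP ->|/hs //]; apply/eqP; apply: contraT => ne.
 by case: none; exists s.
 by exists (fun b' => if b' == b then 0 else c b') => s; rewrite ext mul0r add0r.
pose m := f s0 / g b s0; pose f' s := f s - m * g b s.
have fX (F : G -> 'F_l) : (forall s t, F (s * t)%g = F s + F t) -> forall s n, F (s ^+ n)%g = F s *+ n.
 move=> FM s; have F1 : F 1%g = 0 by have := FM 1%g 1%g; rewrite mulg1 -[X in X = _]addr0 => /addrI.
 by elim=> [|n IHn]; rewrite ?expg0 // expgS FM IHn mulrS.
have [s t|//|s hs|c cP] := IH f' ubs.
- by rewrite /f' fM gM mulrDr opprD addrACA.
- rewrite /f'; pose k := - (g b s / g b s0).
 have e b' : b' \in b :: bs -> g b' (s * s0 ^+ (k : nat))%g = 0.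
 rewrite gM (fX _ (gM b')) inE => /orP[/eqP ->|b'b]; last by rewrite hs // s0bs // mul0rn addr0.
 by rewrite -mulr_natl -(Fl_nat k) /k mulNr divfK // subrr.
 have := h _ e; rewrite fM (fX _ fM) -mulr_natl -(Fl_nat k) /k => <-.
 by rewrite /m mulNr [f s0 / _ * _]mulrAC [f s0 * _]mulrC mulrAC [RHS]addrC addrC.
exists (fun b' => if b' == b then m else c b') => s; rewrite ext -cP /f'.
by rewrite addrC subrK.
Qed.

(** Steinitz exchange: the relation of t over F(x), cleared of denominators, is reread as a relation
    of x over F(t); it is not zero because t is transcendental. *)
Lemma exchange (Om : closedFieldType) (F : set Om) (x t : Om) : subfield F -> ~ alg_over F t -> alg_over (fadj F x) t -> alg_over (fadj F t) x.
move=> hF nt [p [pM p0 pt]]; have [d [dF d0 dP]] := common_den hF pM.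
have /choice [r rP] : forall n, exists r, coefs F r /\ d.[x] * p`_n = r.[x] by move=> n; have [r h1 h2] := dP n; exists r.
pose B := \max_(n < size p) size (r n).
pose c m := \poly_(n < size p) (r n)`_m.
have cF m : coefs F (c m).
 move=> n; rewrite coef_poly; case: ifP => _; [exact: (rP n).1|exact: sub0].
pose Q := \poly_(m < B) (c m).[t].
have Qx : Q.[x] = 0.
 rewrite horner_poly; transitivity (\sum_(n < size p) (r n).[x] * t ^+ n).
 transitivity (\sum_(m < B) \sum_(n < size p) (r n)`_m * x ^+ m * t ^+ n).
 by apply: eq_bigr => m _; rewrite horner_poly mulr_suml; apply: eq_bigr => n _; rewrite mulrAC.
 rewrite exchange_big /=; apply: eq_bigr => n _; rewrite -mulr_suml (@horner_coef_wide _ B) //.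
 exact: (@leq_bigmax _ (fun n : 'I_(size p) => size (r n))).
 transitivity (d.[x] * p.[t]); last by rewrite (rootP pt) mulr0.
 by rewrite [p.[t]]horner_coef mulr_sumr; apply: eq_bigr => n _; rewrite mulrA (rP n).2.
exists Q; split; last exact/rootP.
 move=> m; rewrite coef_poly; case: ifP => _; [exact: fadj_poly|exact: (sub0 (fadj_sub t hF))].
apply/eqP => Q0; case/eqP: p0; apply/polyP => n; rewrite coef0.
have [lt|le] := ltnP n (size p); last by rewrite nth_default.
suff r0 : r n = 0 by have := (rP n).2; rewrite r0 horner0 => /eqP; rewrite mulf_eq0 (negbTE d0) => /eqP.
apply/polyP => m; rewrite coef0; have [ltm|lem] := ltnP m B; last first.
 rewrite nth_default // (leq_trans _ lem) //.
 exact: (@leq_bigmax _ (fun n : 'I_(size p) => size (r n)) (Ordinal lt)).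
have cm0 : c m = 0.
 apply: contrapT => /eqP cm; apply: nt; exists (c m); split; [exact: cF|exact: cm|apply/rootP].
 by have := congr1 (fun q : {poly Om} => q`_m) Q0; rewrite coef_poly ltm coef0.
by have := congr1 (fun q : {poly Om} => q`_n) cm0; rewrite coef_poly lt coef0.
Qed.

Lemma mk_rmorphism (R S : nzRingType) (h : R -> S) : zmod_morphism h -> monoid_morphism h -> exists h' : {rmorphism R -> S}, h' =1 h.
move=> hz hm.
pose h' : {rmorphism R -> S} := HB.pack h (GRing.isZmodMorphism.Build R S h hz) (GRing.isMonoidMorphism.Build R S h hm).
by exists h'.
Qed.

(** * Dual numbers, and derivations of etale algebras *)

Section DualNumbers.
Variable R : comNzRingType.

Definition dual_num : Type := (R * R)%type.

HB.instance Definition _ := GRing.Zmodule.copy dual_num (R * R)%type.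

Definition dual_mul (x y : dual_num) : dual_num := (x.1 * y.1, x.1 * y.2 + x.2 * y.1).

Fact dual_mulA : associative dual_mul.
move=> x y z; rewrite /dual_mul /=; congr pair; first exact: mulrA.
by rewrite mulrDr mulrDl !mulrA addrA.
Qed.

Fact dual_mulC : commutative dual_mul.
by move=> x y; rewrite /dual_mul mulrC [x.1 * y.2]mulrC [x.2 * _]mulrC addrC. Qed.

Fact dual_mul1 : left_id (1, 0) dual_mul.
by move=> [a b]; rewrite /dual_mul /= !mul1r mul0r addr0. Qed.

Fact dual_mulD : left_distributive dual_mul +%R.
move=> [a b] [c d] [e f]; congr pair => /=; first exact: mulrDl.
by rewrite !mulrDl addrACA.
Qed.

Fact dual_1neq0 : (1, 0) != 0 :> dual_num.
by apply/eqP => -[/eqP]; rewrite oner_eq0. Qed.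

HB.instance Definition _ := GRing.Zmodule_isComNzRing.Build dual_num dual_mulA dual_mulC dual_mul1 dual_mulD dual_1neq0.

(** Both b |-> (th b, 0) and b |-> (th b, D b) lift th to the dual numbers, and lifts are unique. *)
Lemma derivation_etale (A B : comNzRingType) (s : {rmorphism A -> B}) (th : {rmorphism B -> R}) (D : B -> R) : formally_etale s ->
 (forall b c, D (b - c) = D b - D c) -> (forall b c, D (b * c) = th b * D c + D b * th c) -> (forall a, D (s a) = 0) -> D =1 fun=> 0.
move=> es DB DM Ds; have D1 : D 1 = 0 by rewrite -(rmorph1 s).
have [u uE] : exists u : {rmorphism A -> dual_num}, forall a, u a = (th (s a), 0).
 apply: mk_rmorphism; first by move=> a a'; rewrite !rmorphB; congr pair; rewrite /= subr0.
 by split=> [|a a']; rewrite ?rmorph1 // !rmorphM; congr pair; rewrite /= mulr0 mul0r addr0.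
have [q qE] : exists q : {rmorphism dual_num -> R}, forall z, q z = z.1 by apply: mk_rmorphism.
have [h0 h0E] : exists h : {rmorphism B -> dual_num}, forall b, h b = (th b, 0).
 apply: mk_rmorphism; first by move=> a a'; rewrite !rmorphB; congr pair; rewrite /= subr0.
 by split=> [|a a']; rewrite ?rmorph1 // !rmorphM; congr pair; rewrite /= mulr0 mul0r addr0.
have [h1 h1E] : exists h : {rmorphism B -> dual_num}, forall b, h b = (th b, D b).
 apply: mk_rmorphism; first by move=> a a'; rewrite !rmorphB DB.
 by split=> [|a a']; rewrite ?rmorph1 ?D1 // !rmorphM DM.
have [||a|g [_ gu]] := es dual_num R u q _ _ th.
- by move=> c; exists (c, 0); rewrite qE.
- move=> [a b] [c d]; rewrite !qE /= => -> ->; congr pair; rewrite /= ?mul0r //.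
 by rewrite mulr0 addr0.
- by rewrite qE uE.
have e0 := gu h0; have e1 := gu h1; move=> b.
have : h0 b = h1 b by rewrite e0 ?e1 //; split=> c; rewrite ?qE ?h0E ?h1E ?uE ?Ds.
by rewrite h0E h1E => -[].
Qed.
End DualNumbers.

(** * Points of finite etale algebras with the same reduction *)

Section Unramified.
Variables (Om : closedFieldType) (A B : comNzRingType) (s : {rmorphism A -> B}) (x : {rmorphism A -> Om}).
Hypotheses (es : formally_etale s) (fs : module_finite s).

(** f(b) is an eigenvalue of multiplication by b on the generators, hence a root of its
    characteristic polynomial. *)
Lemma finite_root (f : {rmorphism B -> Om}) b : (forall a, f (s a) = x a) ->
 exists2 p : {poly A}, p \is monic & root (map_poly x p) (f b).
move=> fx; have [n [e eP]] := fs.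
have /choice [c cP] : forall m : 'I_n, exists c : 'I_n -> A, b * e m = \sum_k s (c k) * e k by move=> m; exact: eP.
pose M : 'M[A]_n := \matrix_(k, m) c m k.
exists (char_poly M); first exact: char_poly_monic.
rewrite map_char_poly -eigenvalue_root_char; apply/eigenvalueP; exists (\row_k f (e k)).
 apply/rowP => m; rewrite !mxE -rmorphM cP rmorph_sum; apply: eq_bigr => k _.
 by rewrite !mxE rmorphM fx mulrC.
have [c1 e1] := eP 1; apply/eqP => /rowP z; have : f 1 = 0.
 rewrite e1 rmorph_sum big1 // => k _; rewrite rmorphM.
 by have := z k; rewrite !mxE => ->; rewrite mulr0.
by rewrite rmorph1 => /eqP; rewrite oner_eq0.
Qed.

(* Two points with the same reduction agree: otherwise, dividing their difference by an element of largest absolute *)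
(* value and reducing gives a nonzero derivation of B over A with values in the residue field.                      *)
Lemma unramified (P : set (Om * Om)) (f g : {rmorphism B -> Om}) : place P -> (forall a, f (s a) = x a) -> (forall a, g (s a) = x a) ->
 (forall a, exists q, P (x a, q)) -> (forall b q, P (f b, q) -> P (g b, q)) -> f =1 g.
move=> pP fx gx xP fg; have hP := pl_hg pP.
have /choice [th thP] : forall b, exists q, P (f b, q).
 move=> b; have [p pm pb] := finite_root b fx.
 by apply: (place_integral pP (monic_map _ pm) _ pb) => n; rewrite coef_map; exact: xP.
have thu b q : P (f b, q) -> th b = q by move=> h; exact: (hg_fun hP (thP b) h).
have [t tE] : exists t : {rmorphism B -> Om}, t =1 th.
 apply: mk_rmorphism; first by move=> b c; apply: thu; rewrite rmorphB; exact: hgB.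
 by split=> [|b c]; apply: thu; rewrite ?rmorph1 ?rmorphM; [exact: hg1|exact: hgM].
have [n [e eP]] := fs; pose dl := [seq f (e m) - g (e m) | m <- enum 'I_n].
have dE b : exists c : 'I_n -> A, f b - g b = \sum_m x (c m) * (f (e m) - g (e m)).
 have [c ->] := eP b; exists c; rewrite !rmorph_sum -sumrB; apply: eq_bigr => m _.
 by rewrite !rmorphM fx gx mulrBr.
have inD m : f (e m) - g (e m) \in dl by apply: map_f; rewrite mem_enum.
have [z|[k [kd k0 kP]]] := pl_scale pP dl.
 move=> b; have [c cE] := dE b; apply/eqP; rewrite -subr_eq0 cE big1 // => m _.
 by rewrite (z _ (inD m)) mulr0.
have /choice [D DP] : forall b, exists q, P ((f b - g b) / k, q).
 move=> b; have [c ->] := dE b; rewrite mulr_suml.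
 have /choice [r rP] : forall m, exists r, P (x (c m) * (f (e m) - g (e m)) / k, r).
 move=> m; have [q1 h1] := xP (c m); have [q2 h2] := kP _ (inD m).
 by exists (q1 * q2); rewrite -mulrA; exact: hgM.
 by exists (\sum_m r m); exact: hg_sum.
have Du b q : P ((f b - g b) / k, q) -> D b = q by move=> h; exact: (hg_fun hP (DP b) h).
have D0 : D =1 fun=> 0.
 apply: (derivation_etale (th := t) es).
 - move=> b c; apply: Du; have := hgB hP (DP b) (DP c).
 by rewrite -mulrBl !rmorphB; congr (P (_ / k, _)); rewrite !opprB addrACA [RHS]addrACA; congr (_ + _); rewrite addrC.
 - move=> b c; apply: Du; rewrite !tE.
 have h1 := hgM hP (thP b) (DP c); have h2 := hgM hP (DP b) (fg _ _ (thP c)).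
 have := hgD hP h1 h2; rewrite mulrA [_ / k * g c]mulrAC -mulrDl !rmorphM mulrBr mulrBl.
 by rewrite addrA subrK.
 - by move=> a; apply: Du; rewrite fx gx subrr mul0r; exact: hg0.
have [m _ kE] := mapP kd; have := DP (e m); rewrite -kE divff // D0 => h.
by have := hg_fun hP h (hg1 hP) => /esym/eqP; rewrite oner_eq0.
Qed.
End Unramified.

(** * Inertia at a point of the t-line *)

Section InertiaLine.
Variables (Om : closedFieldType) (l : nat) (F : set Om) (t c : Om) (P : set (Om * Om)).
Hypotheses (pl : prime l) (l0 : l%:R != 0 :> Om).
Hypotheses (hF : subfield F) (Falg : forall x, alg_over F x -> F x) (Finf : infinite_set F) (Ft : ~ F t).
Hypothesis tAlg : forall x, alg_over (fadj F t) x.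
Hypotheses (Fc : F c) (pP : place P) (tP : trivial_on F P) (Pt : P (t, c)).

(** [inertia_ex] applied with F as field of constants and F(t) as function field; t - c is a
    uniformiser there. *)
Lemma inertia_line : exists s : gal (fadj F t), (forall x q, P (x, q) -> P (s x, q)) /\
 s (lroot l (t - c)) = zeta l Om * lroot l (t - c).
have hT := fadj_sub t hF; have nt : ~ alg_over F t by move=> /Falg.
have inT (a : sfield (fld hF)) : sf_val a \in fld hT by apply/fldP; apply: fadj_incl => //; apply/(fldP hF); exact: sf_valP.
have [i iE] : exists i : {rmorphism sfield (fld hF) -> sfield (fld hT)}, forall a, i a = SField (inT a).
 apply: mk_rmorphism; first by move=> a b; exact: val_inj.
 by split=> [|a b]; exact: val_inj.
pose j : {rmorphism sfield (fld hT) -> Om} := \val.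
have Omalg x : algebraicOver j x by apply/(alg_overP hT).
have inf0 : infinite_set [set: sfield (fld hF)].
 move=> fin; apply: Finf; apply: (@sub_finite_set _ _ ((@sf_val _ _) @` [set: sfield (fld hF)])); last exact: finite_image.
 by move=> x Fx; have xF : x \in fld hF by [apply/fldP]; exists (SField xF).
have kF x : x \in kbar i j -> F x.
 move=> /asboolP [p p0 px]; apply: Falg; exists (map_poly (j \o i) p); split=> //.
 move=> n; rewrite coef_map; change (F (j (i p`_n))); rewrite iE; change (F (sf_val p`_n)).
 by apply/(fldP hF); exact: sf_valP.
 by rewrite map_poly_eq0.
have KT x : x \in Kbar i j -> fadj F t x.
 apply: (fld_gen_sub hT) => z [[u _ <-]|/kF]; last exact: fadj_incl.
 by apply/(fldP hT); exact: sf_valP.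
have TK x : fadj F t x -> x \in Kbar i j by move=> /(fldP hT) xT; have := j_Kb i j (SField xT).
have oP : over_point F t c P by [].
have pK : t - c \in Kbar i j by apply: TK; apply: (subB hT); [exact: fadj_gen|exact: fadj_incl].
have p0 := tau_nz hF nt Fc; have Pp := over_tau Fc oP.
have kP x : x \in kbar i j -> P (x, x) by move=> /kF; exact: tP.
have [f /KT fT f0|s [si sa]] := inertia_ex pl l0 Omalg inf0 pP kP pK p0 Pp.
 have [n [m [r [r0 rP]]]] := Phi_unif hF nt Fc fT f0.
 by exists 1%N, n, m; rewrite coprime1n expr1; split=> //; exists r => //; exact: rP.
have [s' sE] := @gal_weaken _ (fadj F t) _ s TK; exists s'; rewrite sE; split=> // x q.
by rewrite sE; exact: si.
Qed.
End InertiaLine.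

Lemma ring_gen_sub (R : comNzRingType) (S M : set R) x : M 1 -> (forall y z, M y -> M z -> M (y - z)) ->
 (forall y z, M y -> M z -> M (y * z)) -> S `<=` M -> x \in ring_gen S -> M x.
move=> M1 MB MM SM /asboolP h; pose Mp : {pred R} := fun y => `[< M y >].
have cl : GRing.subring_closed Mp by split=> [|y z /asboolP My /asboolP Mz|y z /asboolP My /asboolP Mz]; apply/asboolP; [|exact: MB|exact: MM].
pose E : subringClosed R := HB.pack Mp (GRing.isSubringClosed.Build R Mp cl).
have : x \in E by apply: h => y Sy; apply/asboolP; exact: SM.
by move/asboolP.
Qed.

Lemma ring_gen_incl (R : comNzRingType) (S : set R) x : S x -> x \in ring_gen S.
by move=> Sx; apply/asboolP => E; apply. Qed.

(** * The finite etale algebra A[X]/(X^l - u) for a unit u and l invertible *)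

Section RootExtension.
Import -(notations) mpoly.
Local Open Scope quotient_scope.
Variables (A : comNzRingType) (l : nat) (u u' lam : A) (Om : closedFieldType) (x : {rmorphism A -> Om}).
Hypotheses (lgt : (0 < l)%N) (uu : u * u' = 1) (ll : lam * l%:R = 1).
Notation R := (mpoly.mpoly 1 A).
Notation XX := (mpoly.mpolyX A (mpoly.mnm1 (ord0 : 'I_1))).
Notation cst := (mpoly.mpolyC 1 (R := A)).

Definition rel_poly : R := XX ^+ l - cst u.

Lemma mpoly1_ind (P : R -> Prop) : (forall c, P (cst c)) -> (forall p q, P p -> P q -> P (p + q)) ->
 (forall p, P p -> P (p * XX)) -> forall p, P p.
move=> PC PD PX; apply: mpoly.mpolyind => [|c m p _ _ Pp]; first by rewrite -(mpoly.mpolyC0 1 A).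
apply: PD => //; rewrite mpoly.mpolyXE_id big_ord1 -mpoly.mul_mpolyC.
elim: (mpoly.fun_of_multinom m ord0) => [|n IH]; first by rewrite expr0 mulr1.
by rewrite exprSr mulrA; exact: PX.
Qed.

Definition ev1 (C : comNzRingType) (h : {rmorphism A -> C}) (y : C) : {rmorphism R -> C} := mpoly.mmap h (fun _ => y).

Lemma ev1C (C : comNzRingType) (h : {rmorphism A -> C}) y c : ev1 h y (cst c) = h c.
exact: mpoly.mmapC. Qed.

Lemma ev1X (C : comNzRingType) (h : {rmorphism A -> C}) y : ev1 h y XX = y.
by rewrite [LHS]mpoly.mmapX mpoly.mmap1U. Qed.

Lemma ev1_rel (C : comNzRingType) (h : {rmorphism A -> C}) y : ev1 h y rel_poly = y ^+ l - h u.
by rewrite rmorphB rmorphXn /= ev1X ev1C. Qed.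

Definition root_pred : {pred R} := fun w => `[< exists c, w = c * rel_poly >].

Lemma root_idealr : idealr_closed root_pred.
split.
- by apply/asboolP; exists 0; rewrite mul0r.
- apply/negP => /asboolP [c e]; have [y yl] := closed_nth_root (x u) lgt.
 have := congr1 (ev1 x y) e; rewrite rmorph1 rmorphM ev1_rel yl subrr mulr0 => /eqP.
 by rewrite oner_eq0.
- move=> b v w /asboolP [c ->] /asboolP [d ->]; apply/asboolP; exists (b * c + d).
 by rewrite mulrDl mulrA.
Qed.

Definition root_ideal : idealr R := HB.pack root_pred (isIdealr.Build R root_pred root_idealr).

Lemma root_idealP w : w \in root_ideal <-> exists c, w = c * rel_poly.
by split=> [/asboolP|h] //; exact/asboolP. Qed.

Notation Q := {ideal_quot root_ideal}.
Notation str := (@pres_str A 1 root_ideal).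

Lemma pi_eq v w : \pi_Q v = \pi_Q w <-> v - w \in root_ideal.
split=> [e|h]; last by apply/eqP; rewrite -Quotient.idealrBE.
by rewrite Quotient.idealrBE e.
Qed.

Lemma pi_surj (y : Q) : exists w, y = \pi_Q w. by exists (repr y); rewrite reprK. Qed.

Definition root_gen : Q := \pi_Q XX.

Lemma piM v w : \pi_Q (v * w) = \pi_Q v * \pi_Q w. exact: pi_mulr. Qed.
Lemma piD v w : \pi_Q (v + w) = \pi_Q v + \pi_Q w. exact: pi_addr. Qed.
Lemma piOne : \pi_Q 1 = 1. exact: pi_oner. Qed.

Lemma root_gen_l : root_gen ^+ l = str u.
have e n : root_gen ^+ n = \pi_Q (XX ^+ n) by elim: n => [|n IH]; rewrite ?expr0 ?piOne // !exprS IH piM.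
rewrite e; apply/pi_eq/root_idealP; exists 1; by rewrite mul1r.
Qed.

Lemma quot_ind (P : Q -> Prop) : (forall c, P (str c)) -> (forall p q, P p -> P q -> P (p + q)) ->
 (forall p, P p -> P (p * root_gen)) -> forall p, P p.
move=> PC PD PX p; have [w ->] := pi_surj p; move: w; apply: mpoly1_ind => [c|p' q' h h'|p' h].
- exact: PC.
- by rewrite piD; exact: PD.
- by rewrite piM; exact: PX.
Qed.

Lemma quot_ext (C : comNzRingType) (f g : {rmorphism Q -> C}) : (forall c, f (str c) = g (str c)) -> f root_gen = g root_gen -> f =1 g.
move=> fC fX; apply: quot_ind => [//|p q fp fq|p fp].
 by rewrite !rmorphD fp fq.
by rewrite !rmorphM /= fp fX.
Qed.

Lemma quot_lift (C : comNzRingType) (h : {rmorphism A -> C}) y : y ^+ l = h u ->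
 exists f : {rmorphism Q -> C}, (forall c, f (str c) = h c) /\ f root_gen = y.
move=> yl; have key v w : \pi_Q v = \pi_Q w -> ev1 h y v = ev1 h y w.
 move=> /pi_eq /root_idealP [c e]; apply/eqP; rewrite -subr_eq0 -rmorphB e rmorphM ev1_rel yl subrr mulr0.
 by [].
have fE (v : R) : ev1 h y (repr (\pi_Q v)) = ev1 h y v by apply: key; rewrite reprK.
have [f fF] : exists f : {rmorphism Q -> C}, forall b, f b = ev1 h y (repr b).
 apply: mk_rmorphism.
 move=> b c; rewrite -rmorphB; apply: key; rewrite reprK.
 have -> : repr b - repr c = repr b + - repr c by [].
 by rewrite piD pi_oppr !reprK.
 split; first by rewrite -(rmorph1 (ev1 h y)); apply: key; rewrite reprK piOne.
 by move=> b c; rewrite -rmorphM; apply: key; rewrite reprK piM !reprK.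
exists f; split=> [c|]; rewrite fF fE; [exact: ev1C|exact: ev1X].
Qed.

Lemma root_fg : exists r, exists g : 'I_r -> R, forall w,
 w \in root_ideal <-> exists c : 'I_r -> R, w = (\sum_i c i * g i)%R.
exists 1%N, (fun=> rel_poly) => w; rewrite root_idealP; split=> [[c ->]|[c ->]].
 by exists (fun=> c); rewrite big_ord1.
by exists (c ord0); rewrite big_ord1.
Qed.

Lemma root_finite : module_finite str.
exists l, (fun m : 'I_l => root_gen ^+ m); apply: quot_ind => [c|p q [c ->] [d ->]|p [c ->]].
- exists (fun m => if (m : nat) == 0%N then c else 0); rewrite (bigD1 (Ordinal lgt)) //= expr0 mulr1 big1 ?addr0 // => m ne.
 by case: eqP => [m0|_]; [case/eqP: ne; exact: val_inj|rewrite rmorph0 mul0r].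
- by exists (fun m => c m + d m); rewrite -big_split; apply: eq_bigr => m _; rewrite rmorphD mulrDl.
have each (k : 'I_l) : exists d : 'I_l -> A, str (c k) * root_gen ^+ k * root_gen = \sum_m str (d m) * root_gen ^+ m.
 have [lt|ge] := ltnP k.+1 l.
 exists (fun m => if (m : nat) == k.+1 then c k else 0); rewrite (bigD1 (Ordinal lt)) //= eqxx big1 ?addr0 => [|m ne].
 by rewrite -mulrA -exprSr.
 by case: eqP => [m0|_]; [case/eqP: ne; exact: val_inj|rewrite rmorph0 mul0r].
 have kl : k.+1 = l by apply/eqP; rewrite eqn_leq ltn_ord.
 exists (fun m => if (m : nat) == 0%N then c k * u else 0); rewrite (bigD1 (Ordinal lgt)) //= expr0 mulr1 big1 ?addr0 => [|m ne].
 by rewrite -mulrA -exprSr kl root_gen_l rmorphM.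
 by case: eqP => [m0|_]; [case/eqP: ne; exact: val_inj|rewrite rmorph0 mul0r].
have /choice [d dP] := each.
exists (fun m => \sum_k d k m); rewrite mulr_suml.
rewrite (eq_bigr _ (fun k _ => dP k)) exchange_big /=; apply: eq_bigr => m _.
by rewrite rmorph_sum mulr_suml.
Qed.

Lemma sq_zero_exp (C : comNzRingType) (z e : C) n : e * e = 0 -> (z + e) ^+ n = z ^+ n + (z ^+ n.-1 * e) *+ n.
move=> ee; elim: n => [|n IH]; first by rewrite !expr0 mulr0n addr0.
rewrite exprS IH mulrDl !mulrDr -exprS /=.
case: n IH => [|n] IH; first by rewrite !mulr0n !mulr0 !expr0 !addr0 mulr1 mul1r mulr1n.
rewrite -!mulrnAr /= [e * (_ * _)]mulrCA [e * (e *+ _)]mulrnAr ee mul0rn mulr0 addr0.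
by rewrite mulrA -exprS [e * _]mulrC -addrA -mulrDr -mulrSr.
Qed.

(** An l-th root of u lifts uniquely through a square-zero kernel because the derivative l X^(l-1)
    is invertible. *)
Lemma root_etale : formally_etale str.
move=> C C' h q qs q0 f fh.
have [t0 t0E] := qs (f root_gen); pose ep := t0 ^+ l - h u.
have qe : q ep = 0 by rewrite rmorphB rmorphXn /= t0E -rmorphXn /= root_gen_l fh subrr.
have huu : h u * h u' = 1 by rewrite -rmorphM uu rmorph1.
have hll : h lam * l%:R = 1 by rewrite -(rmorph_nat h) -rmorphM ll rmorph1.
(* One Newton step: the error is divided by the derivative l t0^(l-1), expressed through the
   inverses of l and u; since errors have square zero it is exact. *)
pose e := - (t0 * (ep * h lam * h u')).
have ee : e * e = 0 by rewrite /e mulrNN; apply: q0; rewrite !rmorphM qe !mul0r mulr0.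
have qe' : q e = 0 by rewrite /e rmorphN !rmorphM qe !mul0r mulr0 oppr0.
pose t1 := t0 + e.
have t0l : t0 ^+ l = h u + ep by rewrite /ep addrC subrK.
have epep : ep * ep = 0 by exact: q0.
have t1l : t1 ^+ l = h u.
 have e1 : t0 ^+ l.-1 * e = - (t0 ^+ l * (ep * h lam * h u')) by rewrite /e mulrN [t0 ^+ _ * (t0 * _)]mulrA -exprSr prednK.
 rewrite /t1 sq_zero_exp // e1 t0l mulNrn.
 have -> : (h u + ep) * (ep * h lam * h u') *+ l = ep.
 rewrite mulrDl -!mulrA [ep * (ep * _)]mulrA epep mul0r addr0 mulrCA [h lam * _]mulrC [h u * (_ * _)]mulrA huu mul1r.
 by rewrite -mulr_natr -mulrA hll mulr1.
 by rewrite addrK.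
have [g [gs gt]] := quot_lift t1l; exists g; split.
 split=> // b; apply: (quot_ext (f := q \o g)) b => [c|] /=; first by rewrite gs fh.
 by rewrite gt /t1 rmorphD qe' addr0.
move=> h' [h'q h's]; apply: quot_ext => [c|]; first by rewrite h's gs.
rewrite gt; pose et := h' root_gen - t1.
have qet : q et = 0 by rewrite rmorphB h'q /t1 rmorphD qe' addr0 t0E subrr.
have h'E : h' root_gen = t1 + et by rewrite /et addrC subrK.
have : h' root_gen ^+ l = h u by rewrite -rmorphXn /= root_gen_l h's.
rewrite h'E sq_zero_exp; last exact: q0.
rewrite t1l -[X in _ = X]addr0 => /addrI z.
suff -> : et = 0 by rewrite addr0.
have : (t1 * h lam * h u') * ((t1 ^+ l.-1 * et) *+ l) = 0 by rewrite z mulr0.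
rewrite -mulr_natr => <-.
rewrite [RHS](AC (3*(2*1)) ((2*6)*((1*4)*3)*5)) /= hll mul1r -exprS prednK // t1l huu mul1r.
by [].
Qed.

Definition root_alg : fet_alg A := FetAlg root_fg root_finite root_etale.

(** The ratio of the image of the root to the root is a continuous homomorphism [kap] to the l-th
    roots of unity, hence trivial on commutators, l-th powers and the closed subgroup they
    generate. *)
Lemma root_alg_kernel (zz : A) (p : pi1 x) (f : fibre x root_alg) : prime l -> l.-primitive_root (x zz) -> zz ^+ l = 1 ->
 G2 (pi1 x) l p -> sval (pi1_fun p f) root_gen = sval f root_gen.
move=> pl zp zl.
have u0 : x u != 0 by apply/eqP => z; have := congr1 x uu; rewrite rmorphM z mul0r rmorph1 => /esym/eqP; rewrite oner_eq0.
have fl (g : fibre x root_alg) : sval g root_gen ^+ l = x u by rewrite -rmorphXn /= root_gen_l; exact: (svalP g).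
have fn (g : fibre x root_alg) : sval g root_gen != 0 by apply: contraNneq u0 => z; rewrite -(fl g) z expr0n gtn_eqF.
have ratio (g g' : fibre x root_alg) : exists k, sval g root_gen = x zz ^+ k * sval g' root_gen.
 have : (sval g root_gen / sval g' root_gen) ^+ l = 1 by rewrite expr_div_n !fl divff.
 move=> /(prim_rootP zp) [k e]; exists k; by rewrite -e divfK.
have equiv (q : pi1 x) (g g' : fibre x root_alg) k : sval g root_gen = x zz ^+ k * sval g' root_gen ->
 sval (pi1_fun q g) root_gen = x zz ^+ k * sval (pi1_fun q g') root_gen.
 move=> e; have [|h [hs ht]] := @quot_lift _ str (str zz ^+ k * root_gen).
 by rewrite exprMn root_gen_l -exprM mulnC exprM -rmorphXn /= zl rmorph1 expr1n mul1r.
 have nat_ := @pi1_natural _ _ _ q root_alg root_alg h hs g g'.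
 have /(_ _ root_gen) := nat_; rewrite ht => ->.
 by rewrite rmorphM rmorphXn /=; congr (_ ^+ _ * _); exact: (svalP (pi1_fun q g')).
 move=> b; apply: (quot_ext (f := sval g) (g := (sval g' \o h : {rmorphism Q -> Om}))) => [c|] /=.
 by rewrite hs; etransitivity; [exact: (svalP g)|symmetry; exact: (svalP g')].
 by rewrite ht rmorphM rmorphXn /= e; congr (_ ^+ _ * _); symmetry; exact: (svalP g').
pose kap (q : pi1 x) := sval (pi1_fun q f) root_gen / sval f root_gen.
have kapM q r : kap (q * r)%g = kap q * kap r.
 rewrite /kap; have [k e] := ratio (pi1_fun r f) f.
 have -> : pi1_fun (q * r)%g f = pi1_fun q (pi1_fun r f) by [].
 by rewrite (equiv q _ _ _ e) e mulfK // -mulrA mulrC.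
have kap1 : kap 1%g = 1 by rewrite /kap divff.
have kapX q n : kap (q ^+ n)%g = kap q ^+ n by elim: n => [|n IH]; rewrite ?expg0 ?kap1 ?expr0 // expgS kapM IH exprS.
have kapl q : kap q ^+ l = 1 by rewrite /kap expr_div_n !fl divff.
have kapV q : kap q * kap q^-1%g = 1 by rewrite -kapM mulgV kap1.
have kapn q : kap q != 0 by apply/eqP => z; have := kapV q; rewrite z mul0r => /esym/eqP; rewrite oner_eq0.
move=> Gp; suff : kap p = 1 by rewrite /kap => /(congr1 (fun z => z * sval f root_gen)); rewrite divfK // mul1r.
apply: (Gp [set q | kap q = 1]); split=> /=.
- split=> //= [q r hq hr|q hq]; first by rewrite kapM hq hr mulr1.
 by have := kapV q; rewrite hq mul1r.
- rewrite -openC.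
 suff : pw_open (fun (p : {B : fet_alg A & fibre x B}) (q : pi1 x) => pi1_fun q (tagged p)) (~` [set q | kap q = 1]) by [].
 move=> q nq; exists [set (existT (fun B : fet_alg A => fibre x B) root_alg f)]; first exact: finite_set1.
 by move=> r /(_ _ erefl) /= e; rewrite /kap /= e.
- move=> _ [[q [r ->]]|[q ->]] /=; last by rewrite kapX.
 apply: (mulfI (kapn (r * q)%g)); rewrite -kapM -commgC mulr1 !kapM; exact: mulrC.
Qed.
End RootExtension.

(** * Additivity and continuity of maps of completed exterior squares *)

Section ExtHat.
Variables (l : nat) (M M' : topGroupType) (f : cont_hom M M').

Lemma ext2hat_mapD (u v : ext2hat l M) : ext2hat_map f (u + v) = ext2hat_map f u + ext2hat_map f v.
have mB (w w' : ext2hat l M) : ext2hat_map f (w - w') = ext2hat_map f w - ext2hat_map f w'.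
 apply/ext2hatP => H; rewrite /= /ext2hat_fun !eh_addE /=.
 set h := wedge2_map _.
 have hB := wedge2_mapB (l := l) (qmapM (H := preim_nsub f H) (H' := H) (@ch_morph _ _ f) (fun x h => h)).
 by rewrite !sub0r opprK; exact: hB.
have m0 : ext2hat_map f (0 : ext2hat l M) = 0 by rewrite -(subrr 0) mB subrr.
have mN (w : ext2hat l M) : ext2hat_map f (- w) = - ext2hat_map f w by rewrite -sub0r mB m0 sub0r.
by rewrite -[v in LHS]opprK mB mN opprK.
Qed.

Lemma ext2hat_map_continuous : continuous (@ext2hat_map l _ _ f).
apply/continuousP => U oU.
suff : pw_open (fun (H : open_nsub M) (w : ext2hat l M) => w H) (@ext2hat_map l _ _ f @^-1` U) by [].
move=> w Uw; have [D fD DU] := (oU : pw_open (fun (H : open_nsub M') (w : ext2hat l M') => w H) U) _ Uw.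
exists (preim_nsub f @` D); first exact: finite_image.
move=> w' e; apply: DU => H DH; rewrite /= /ext2hat_fun e //; by exists H.
Qed.

Lemma ext2hat_map_wedge x y : ext2hat_map f (hat_wedge l x y) = hat_wedge l (f x) (f y).
apply/ext2hatP => H; have fM := @ch_morph _ _ f.
by rewrite /= /ext2hat_fun /= wedge2_map_wedge ?qmapE //; exact: qmapM.
Qed.
End ExtHat.

Lemma restrict_gal (Om : fieldType) (R : set Om) (L : divringClosed Om) (T : gal R) :
 (forall x, x \in L -> T x \in L) -> (forall x, x \in L -> T^-1%g x \in L) ->
 exists T' : gal [set x : sfield L | R (sf_val x)], forall x, sf_val (T' x) = T (sf_val x).
move=> TL VL.
pose f (x : sfield L) : sfield L := SField (TL _ (sf_valP x)).
pose g (x : sfield L) : sfield L := SField (VL _ (sf_valP x)).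
have fK : cancel f g by move=> x; apply: val_inj; exact: (@bij_funK _ T).
have gK : cancel g f by move=> x; apply: val_inj; exact: (@bij_invfunK _ T).
have [TD TM TR] := galP T.
have pT : Defs.Bij fK gK \in gal_pred [set x : sfield L | R (sf_val x)] by apply/asboolP; split=> [x y|x y|x Rx]; apply: val_inj; [exact: TD|exact: TM|exact: TR].
by exists (Gal pT).
Qed.

(** * Regular function fields: places with large decomposition groups *)

Section RegularSetting.
Variables (l : nat) (k0 K0 : fieldType) (i : {rmorphism k0 -> K0}).
Variables (Om : closedFieldType) (j : {rmorphism K0 -> Om}).
Hypotheses (pl : prime l) (l0 : l%:R != 0 :> Om).
Hypothesis Omalg : forall x : Om, algebraicOver j x.
Hypothesis inf0 : infinite_set [set: k0].
Variable trdeg : nat.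
Hypothesis fg : exists n, exists x : 'I_n -> K0, forall y, y \in gen_over i x.
Hypotheses (td : has_trdeg i trdeg) (d2 : (1 < trdeg)%N).
Hypothesis reg : forall y, algebraicOver i y -> range i y.
Notation Kb := (Kbar i j).
Notation kb := (kbar i j).
Notation GO := (GOm i j).
Notation z_ := (zeta l Om).
Notation KL := (sfield (Kl l i j)).
Notation GKn := (GK l i j).
Notation G2n := (G2 GKn l).
Notation G3n := (G3 GKn l).
Notation chi := (chi l (i := i) (j := j)).

Section Core.
Notation K := [set x : Om | x \in Kb].

(** y and t are two members of a transcendence base, and F is the algebraic closure of the field
    generated by k_0 and the others; its stability under automorphisms over K is needed for
    [decomposition]. *)
Lemma two_variables : exists (F : set Om) (y t : K0), [/\ subfield F, (forall x, alg_over F x -> F x), (forall c, c \in kb -> F c),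
 ~ F (j y) /\ ~ alg_over (fadj F (j y)) (j t) &
 (forall x, alg_over (fadj (fadj F (j y)) (j t)) x) /\ (forall (g : GO) x, F x -> F (g x))].
have [x [xi xa]] := td; pose o0 := Ordinal (ltnW d2); pose o1 := Ordinal d2.
pose G2 : set Om := [set z | z \in fld_gen (range (j \o i) `|` [set z | exists2 r, r != o0 /\ r != o1 & z = j (x r)])].
have hG2 : subfield G2 by exact: div_subfield.
have GW m : m = o0 \/ m = o1 -> G2 `<=` frac_without i x m j.
 move=> mm z; apply: fld_gen_sub; first exact: frac_without_subfield.
 move=> _ [[c _ <-]|[r [r0 r1] ->]]; first exact: frac_withoutC.
 by apply: frac_withoutX; case: mm => ->.
have Gi c : G2 (j (i c)) by apply: fld_gen_incl; left; exists c.
have Gx r : r != o0 -> r != o1 -> G2 (j (x r)) by move=> r0 r1; apply: fld_gen_incl; right; exists r.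
pose F := alg_over G2.
have hF : subfield F by exact: alg_subfield.
have hL := fadj_sub (j (x o1)) hF; have hPhi := fadj_sub (j (x o0)) hL.
have FPhi z : F z -> fadj (fadj F (j (x o1))) (j (x o0)) z by move=> Fz; apply: fadj_incl => //; apply: fadj_incl.
have o10 : o1 != o0 by [].
exists F, (x o1), (x o0); split=> //; last first.
 split=> [z|g z [p [pG p0 pz]]].
 have [p p0 pz] := Omalg z; apply: (@alg_trans _ _ hPhi (range j)); last first.
 exists (map_poly j p); split=> //; last by rewrite map_poly_eq0.
 by move=> n; rewrite coef_map; exists p`_n.
 move=> _ [u _ <-]; have [q [qG q0 qu]] := xa u; exists (map_poly j q); split.
 - move=> n; rewrite coef_map.
 suff : [set w | fadj (fadj F (j (x o1))) (j (x o0)) (j w)] q`_n by [].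
 apply: (fld_gen_sub (preim_subfield j hPhi)) ((polyOverP qG) n).
 move=> _ [[c _ <-]|[r _ <-]] /=; first by apply: FPhi; apply: alg_id.
 have [->|r0] := eqVneq r o0; first exact: fadj_gen.
 have [->|r1] := eqVneq r o1; first by apply: fadj_incl => //; exact: fadj_gen.
 by apply: FPhi; apply: alg_id => //; exact: Gx.
 - by rewrite map_poly_eq0.
 - by rewrite fmorph_root.
 exists p; split=> //; have pK : coefs K p.
 move=> n; apply: (fld_gen_sub (div_subfield Kb)) (pG n).
 by move=> _ [[c _ <-]|[r _ ->]]; exact: j_Kb.
 exact: gal_root pK pz.
- split.
 by move=> h; apply: (@not_alg_without _ _ i _ x o1 xi _ j); apply: alg_mono h; apply: GW; right.
 move=> h; apply: (@not_alg_without _ _ i _ x o0 xi _ j).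
 apply: alg_trans h; first exact: frac_without_subfield.
 have hW : subfield (alg_over (frac_without i x o0 j)) by apply: alg_subfield; exact: frac_without_subfield.
 apply: (fadj_min hW); first by move=> z; apply: alg_mono; apply: GW; left.
 by apply: alg_id; [exact: frac_without_subfield|exact: frac_withoutX].
- move=> c /asboolP [p p0 pc]; exists (map_poly (j \o i) p); split=> //.
 by move=> n; rewrite coef_map; exact: Gi.
 by rewrite map_poly_eq0.
- by move=> z; apply: alg_trans.
Qed.

(** On the characters of [ns] every element of the Galois group is matched by an element of the
    decomposition group acting trivially on constants. *)
Definition decomposition_at (P : set (Om * Om)) (ns : seq Om) := forall g : GO, exists (t : GO) (f : {rmorphism Om -> Om}),
 [/\ acts_by P t f, forall c, c \in kb -> f c = c & forall n, n \in ns -> chi n t = chi n g].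

(** A Bertini line for a Galois cover of the (y, t)-plane containing K and the l-th roots of [ns].
    Inertia exists because t - a0 is a uniformiser, decomposition is large because the line stays
    irreducible. *)
Theorem core_place (a : Om) (ns D : seq Om) : a \in kb -> (forall n, n \in ns -> n \in Kb /\ n != 0) -> (forall w, w \in D -> w != 0) ->
 exists (P : set (Om * Om)) (u : K0), [/\ place P, (forall c, c \in kb -> P (c, c)), P (j u - a, 0) /\ j u \notin kb, (forall w, w \in D -> punit P w) &
 (exists s : GO, inertia P s /\ chi (j u - a) s = 1) /\ decomposition_at P ns].
move=> ak nsP D0; have [F [y [t [hF Falg kF [Fy nt] [Phialg GF]]]]] := two_variables.
have [ng [xg xgP]] := fg.
have infR : infinite_set (range (j \o i)) by exact: inf_const.
have RF : range (j \o i) `<=` F by move=> _ [c _ <-]; apply: kF; exact: i_kb.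
have Finf : infinite_set F by apply: sub_infinite_set infR.
(* Generators of K_0 together with the l-th roots to be controlled: what fixes N fixes K and these
   roots. *)
pose ds := [seq j (xg r) | r <- enum 'I_ng] ++ [seq lroot l n | n <- ns].
have hL := fadj_sub (j y) hF; have hPhi := fadj_sub (j t) hL.
have [Z [rs [urs rsP fPhi rsint Zfix]]] := primitive_setup hF Finf Phialg ds.
have FL z : F z -> fadj F (j y) z by exact: fadj_incl.
have LP z : fadj F (j y) z -> fadj (fadj F (j y)) (j t) z by exact: fadj_incl.
have hN := fadj_sub Z hPhi.
have Nfix (h : gal (fadj (fadj (fadj F (j y)) (j t)) Z)) : (forall x, x \in Kb -> h x = x) /\ (forall n, n \in ns -> h (lroot l n) = lroot l n).
 have [_ _ hfix] := galP h.
 have [h' hh'] := @gal_weaken _ (fadj (fadj F (j y)) (j t)) _ h (fadj_incl Z hPhi).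
 have dfix d0 : d0 \in ds -> h d0 = d0.
 move=> dd; rewrite -hh'; apply: (Zfix h') dd; rewrite hh'; apply: hfix; exact: (fadj_gen _ hPhi).
 have Ffix z : F z -> h z = z by move=> Fz; apply: hfix; apply: (fadj_incl Z hPhi); apply: LP; exact: FL.
 split=> [x|n nn]; last by apply: dfix; rewrite mem_cat map_f ?orbT.
 have hfx : subfield [set x | h x = x].
 split=> /= [|u v hu hv|u v hu hv]; first exact: rmorph1.
 by rewrite rmorphB /= hu hv.
 by rewrite fmorph_div /= hu hv.
 apply: (fld_gen_sub hfx) => z [[u _ <-]|kz]; last by apply: Ffix; exact: kF.
 apply: (fld_gen_sub (preim_subfield j hfx)) (xgP u) => _ [[c _ <-]|[r _ <-]] /=.
 by apply: Ffix; apply: RF; exists c.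
 by apply: dfix; rewrite mem_cat; apply/orP; left; apply: map_f; rewrite mem_enum.
pose D' := D ++ [seq w^-1 | w <- D] ++ [seq v - v' | v <- rs, v' <- [seq v' <- rs | v != v']].
have D'0 w : w \in D' -> w != 0.
 rewrite !mem_cat => /or3P[/D0 //|/mapP [v /D0 v0 ->]|/allpairsPdep [v [v' [vr]]]]; first by rewrite invr_eq0.
 by rewrite mem_filter => /andP[ne _] ->; rewrite subr_eq0.
(* Intercepts a + c with c in k_0: the equation of the line then has the form u = a with u in
   K_0. *)
pose Cb := [set a + c | c in range (j \o i)].
have infb : infinite_set Cb.
 move=> fin; apply: infR; apply: (@sub_finite_set _ _ ((fun z => z - a) @` Cb)); last exact: finite_image.
 by move=> _ [c _ <-]; exists (a + (j \o i) c); [exists ((j \o i) c) => //; exists c|rewrite addrC addKr].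
have CbF : Cb `<=` F by move=> _ [c /RF Fc <-]; apply: (subD hF) => //; exact: kF.
have [P [b [e [pP tP Pt [[_ [c _ <-] bE] [e' _ eE]] [PD tr]]]]] := bertini Falg Finf Fy nt Phialg urs rsP fPhi rsint infb CbF infR RF D'0.
rewrite -bE in Pt; set a0 := a + (j \o i) c + e * j y in Pt.
have kP z : z \in kb -> P (z, z) by move=> /kF/FL/tP.
have La0 : fadj F (j y) a0.
 apply: (subD hL); first by apply: FL; apply: CbF; exists ((j \o i) c) => //; exists c.
 by apply: (subM hL); [apply: FL; apply: RF; exists e'|exact: fadj_gen].
have oP : over_point (fadj F (j y)) (j t) a0 P by [].
have dist v v' : v \in rs -> v' \in rs -> v != v' -> ~ P (v - v', 0).
 move=> vr v'r ne; apply: PD; rewrite !mem_cat; apply/or3P; apply: Or33; apply/allpairsPdep.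
 by exists v, v'; split=> //; rewrite mem_filter ne.
pose u := t - i e' * y - i c.
have uE : j u - a = j t - a0 by rewrite /u /a0 !rmorphB rmorphM -eE /= !opprD [RHS](AC (1*((1*1)*1)) (((1*4)*3)*2)).
have Pu : P (j u - a, 0) by rewrite uE; exact: (over_tau La0 oP).
have u0 : j u - a != 0 by rewrite uE; exact: (tau_nz hL nt La0).
have uK : j u - a \in Kb by rewrite rpredB ?j_Kb ?kb_Kb.
exists P, u; split=> //.
 split=> //; apply/negP => uk; have h := kP _ (rpredB uk ak).
 by move/eqP: u0; apply; exact: (hg_fun (pl_hg pP) h Pu).
 move=> w wD; have [//|h|h] := punit_cases pP (D0 _ wD).
 by case: (PD w) => //; rewrite mem_cat wD.
 by case: (PD w^-1) => //; rewrite !mem_cat map_f ?orbT.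
split.
 apply: (inertia_chi pl l0 Omalg inf0 pP kP uK u0 Pu) => f fK f0.
 have Nalg x : alg_over (fadj (fadj (fadj F (j y)) (j t)) Z) x by apply: alg_mono (Phialg x) => z; exact: fadj_incl.
 have [h|q [q0 cq Nq]] := fixed_power hN pl l0 (Nalg f); first exact: (Nfix h).1.
 have [|n [m um]] := disc_N nt La0 urs rsP fPhi rsint oP tr dist Nq.
 by rewrite expf_neq0.
 by exists q, n, m; split=> //; rewrite uE.
move=> g; have [_ _ gK] := galP g.
have [||||h [s hs]] := decomposition Finf nt Phialg La0 urs rsP fPhi rsint oP tr dist (g := g) _ (GF g).
- by exists g^-1%g; [exact: (@bij_funK _ g)|exact: (@bij_invfunK _ g)].
- by apply: gK; exact: j_Kb.
- by apply: gK; exact: j_Kb.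
- by apply: gK; rewrite /a0 -eE /= rpredD ?rpredM ?rpredD ?j_Kb ?kb_Kb ?i_kb.
have [g1 g1E] := @gal_weaken _ set0 _ g (fun x (h : set0 x) => False_ind _ h).
have [h1 h1E] := @gal_weaken _ set0 _ h (fun x (h : set0 x) => False_ind _ h).
(* g h agrees with g on K and on the l-th roots of [ns], since h fixes them. *)
have [|T TE] := @gal_refix _ K set0 (g1 * h1)%g.
 by move=> x xK /=; rewrite h1E (Nfix h).1 // g1E gK.
have TgE x : T x = g (h x) by rewrite TE /= g1E h1E.
exists T, (g \o s : {rmorphism Om -> Om}); split.
- by move=> x q /hs; rewrite TgE.
- move=> z kz /=; have [_ _ sL] := galP s; rewrite sL; last by apply: FL; exact: kF.
 by apply: gK; exact: kb_Kb.
move=> n nn; have [nK n0] := nsP n nn.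
apply: (chi_uniq pl l0 nK (lrootP pl n) (lroot_nz pl n0)); rewrite TgE (Nfix h).2 //.
exact: (chiE pl l0 g nK (lrootP pl n)).
Qed.
End Core.

(** * Points of the constant line under Psi *)

Section Rigidity.
Implicit Type Psi : Om -> GO -> 'F_l.

(** [Psi z] stands for the character of z composed with an automorphism of G_K^a, possibly rescaled;
    this and the next two conditions are the properties of such maps that are used. *)
Definition psi_multiplicative Psi := forall z z' s, z \in Kb -> z' \in Kb -> z != 0 -> z' != 0 -> Psi (z * z') s = Psi z s + Psi z' s.

Definition psi_kummer Psi := forall z, z \in Kb -> z != 0 -> exists w, [/\ w \in Kb, w != 0 & Psi z =1 chi w].

Definition psi_steinberg Psi := forall z z' s t, z \in Kb -> z' \in Kb -> z != 0 -> z' != 0 -> z + z' = 1 ->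
 G3n [~ res l s, res l t]%g -> Psi z s * Psi z' t = Psi z t * Psi z' s.

Variable Psi : Om -> GO -> 'F_l.
Hypothesis PsiM : psi_multiplicative Psi.
Hypothesis PsiE : psi_kummer Psi.
Hypothesis PsiSt : psi_steinberg Psi.
Hypothesis PsiI : forall z, z \in Kb -> z != 0 -> (forall s, Psi z s = 0) -> forall s : GO, chi z s = 0.

Lemma Psi1 s : Psi 1 s = 0.
have := PsiM s (rpred1 Kb) (rpred1 Kb) (oner_neq0 _) (oner_neq0 _).
by rewrite mulr1 -[X in X = _]addr0 => /addrI.
Qed.

Lemma PsiX z n s : z \in Kb -> z != 0 -> Psi (z ^+ n) s = Psi z s *+ n.
move=> zK z0; elim: n => [|n IH]; first by rewrite Psi1.
by rewrite exprS PsiM ?rpredX ?expf_neq0 // IH mulrS.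
Qed.

Lemma Fl_char (a : 'F_l) : a *+ l = 0.
by rewrite -mulr_natr (pcharf0 (pchar_Fp pl)) mulr0. Qed.

Lemma PsiC c s : c \in kb -> c != 0 -> Psi c s = 0.
move=> ck c0; have [b e] := closed_nth_root c (prime_gt0 pl).
have bk : b \in kb by apply: (root_kb (prime_gt0 pl)); rewrite e.
have b0 := expf_nz pl e c0.
by rewrite -e PsiX ?kb_Kb // Fl_char.
Qed.

Lemma chiC c (s : GO) : c \in kb -> c != 0 -> chi c s = 0.
move=> ck c0; have [b e] := closed_nth_root c (prime_gt0 pl).
have bk : b \in kb by apply: (root_kb (prime_gt0 pl)); rewrite e.
have b0 := expf_nz pl e c0.
by rewrite -e chi_power ?kb_Kb.
Qed.

Lemma PsiN z s : z \in Kb -> z != 0 -> Psi (- z) s = Psi z s.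
move=> zK z0; rewrite -mulN1r PsiM ?rpredN ?rpred1 ?oppr_eq0 ?oner_eq0 //.
by rewrite PsiC ?add0r ?rpredN ?rpred1 ?oppr_eq0 ?oner_eq0.
Qed.

Lemma PsiV z s : z \in Kb -> z != 0 -> Psi z^-1 s = - Psi z s.
move=> zK z0; apply/eqP; rewrite -addr_eq0 -PsiM ?rpredV ?invr_eq0 // mulVf //.
by rewrite Psi1.
Qed.

(** The Steinberg relation for A/C + B/C = 1: s sees A only, so the determinant reduces to the
    product of Psi A s with the difference of Psi B and Psi C at t. *)
Lemma steinberg3 A B C s t : A \in Kb -> B \in Kb -> A != 0 -> B != 0 -> C != 0 -> A + B = C ->
 G3n [~ res l s, res l t]%g -> Psi A s != 0 -> Psi B s = 0 -> Psi C s = 0 -> Psi B t = Psi C t.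
move=> AK BK A0 B0 C0 e st As Bs Cs; have CK : C \in Kb by rewrite -e rpredD.
have e1 : A / C + B / C = 1 by rewrite -mulrDl e divff.
have := PsiSt (rpred_div AK CK) (rpred_div BK CK) (mulf_neq0 A0 (invr_neq0 C0)) (mulf_neq0 B0 (invr_neq0 C0)) e1 st.
rewrite !PsiM ?rpredV ?invr_eq0 // !PsiV // Bs Cs !subr0 mulr0 => /eqP.
by rewrite mulf_eq0 (negbTE As) /= subr_eq0 => /eqP.
Qed.

(** Inertia kills the characters of units and decomposition those of elements of residue 1; so Psi B
    and Psi C, the characters of w and of an element congruent to E, agree at t. *)
Lemma use_place P s t (f : {rmorphism Om -> Om}) A B C C0 E w : place P -> (forall c, c \in kb -> P (c, c)) ->
 inertia P s -> acts_by P t f -> (forall c, c \in kb -> f c = c) ->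
 [/\ A \in Kb, B \in Kb, A != 0, B != 0 & C != 0] -> A + B = C ->
 [/\ C0 \in Kb, E \in Kb, w \in Kb & Psi B =1 chi w] -> Psi C =1 chi C0 -> punit P w -> punit P E -> P (C0 - E, 0) ->
 Psi A s != 0 -> chi w t = chi E t.
move=> pP kP si ta fk [AK BK A0 B0 C_0] e [C0K EK wK Bw] CC uw uE CE As; have hP := pl_hg pP.
have E0 := punit_nz pP uE; have PCE : P (C0 / E, 1).
 have [r r0 Pr] := uE.
 have h := hgD hP (pl_div pP CE Pr r0) (hg1 hP); rewrite mul0r add0r in h.
 by rewrite mulrBl divff // subrK in h.
have C00 : C0 != 0.
 have := pl_nz pP PCE (oner_neq0 _); by apply: contraNneq => ->; rewrite mul0r.
have uC : punit P C0.
 rewrite -(divfK E0 C0); apply: (punitM pP) => //; exists 1 => //; exact: oner_neq0.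
have st : G3n [~ res l s, res l t]%g by exact: (comm_G3 pl l0 Omalg inf0 pP kP si ta fk).
have h : Psi B t = Psi C t.
 apply: (steinberg3 AK BK A0 B0 C_0 e st As).
 by rewrite Bw; exact: (chi_unit pl l0 pP kP si).
 by rewrite CC; exact: (chi_unit pl l0 pP kP si).
rewrite -Bw h CC -{1}(divfK E0 C0) (chiM pl l0) ?rpred_div ?mulf_neq0 ?invr_eq0 //.
by rewrite (chi_one pl l0 pP kP ta fk) ?rpred_div // add0r.
Qed.

(** [use_place] at a place whose decomposition group realises the characters of w and E for every g;
    the family D lists what must be a unit there. *)
Lemma core_use a E w (D : seq Om) : a \in kb -> E \in Kb -> w \in Kb -> E != 0 -> w != 0 -> (forall v, v \in D -> v != 0) ->
 (forall (P : set (Om * Om)) (u : K0), place P -> (forall c, c \in kb -> P (c, c)) -> P (j u - a, 0) -> j u \notin kb ->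
 (forall v, v \in D -> punit P v) -> punit P E -> exists A B C C0,
 [/\ [/\ A \in Kb, B \in Kb, A != 0, B != 0 & C != 0], A + B = C, C0 \in Kb /\ P (C0 - E, 0),
 Psi B =1 chi w /\ Psi C =1 chi C0 &
 forall s, inertia P s -> chi (j u - a) s = 1 -> Psi A s != 0]) ->
 forall g : GO, chi w g = chi E g.
move=> ak EK wK E0 w0 D0 H g.
have [||P [u [pP kP [Pu uk] PD [[s [si s1]] dec]]]] := core_place (a := a) (ns := [:: w; E]) (D := w :: E :: D) ak.
- by move=> n; rewrite in_cons mem_seq1 => /orP[] /eqP ->; split.
- by move=> v; rewrite !inE => /or3P[/eqP ->|/eqP ->|/D0].
have [||A [B [C [C0 [h1 h2 [h3 h4] [h5 h6] h7]]]]] := H P u pP kP Pu uk.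
 by move=> v vD; apply: PD; rewrite !inE vD !orbT.
 by apply: PD; rewrite !inE eqxx orbT.
have [t [f [ta fk tg]]] := dec g.
rewrite -(tg w) ?mem_head // -(tg E) ?inE ?eqxx ?orbT //.
apply: (use_place pP kP si ta fk h1 h2 _ h6 _ _ h4 (h7 _ si s1)).
- by split.
- by apply: PD; rewrite mem_head.
- by apply: PD; rewrite !inE eqxx orbT.
Qed.

Lemma notin_sub x c : x \notin kb -> c \in kb -> x - c != 0.
by move=> xk ck; apply: contraNneq xk => /eqP; rewrite subr_eq0 => /eqP ->. Qed.

(** An inertia element at u = c has value 1 on the character of u - c and 0 on that of u - c' for c'
    different from c. *)
Lemma distinct_points c c' : c \in kb -> c' \in kb ->
 (forall y : K0, j y \notin kb -> forall s, chi (j y - c) s = chi (j y - c') s) -> c = c'.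
move=> ck c'k h; apply/eqP; apply: contraT => ne.
have [||P [u [pP kP [Pu uk] _ [[s [si s1]] _]]]] := core_place (a := c) (ns := [::]) (D := [::]) ck => //.
have uc' : punit P (j u - c').
 exists (c - c'); first by rewrite subr_eq0.
 by have := hgD (pl_hg pP) Pu (kP _ (rpredB ck c'k)); rewrite add0r addrA subrK.
have := h u uk s; rewrite s1 (chi_unit pl l0 pP kP si _ uc') ?rpredB ?j_Kb ?kb_Kb //.
Qed.

(** c' is the point that Psi carries to c; the exclusions avoid the character of 0. *)
Definition point_rel (c c' : Om) := forall y : K0, j y != c -> j y != c' -> forall s, Psi (j y - c') s = chi (j y - c) s.

Lemma point_rel_uniq c c1 c2 : c \in kb -> c1 \in kb -> c2 \in kb -> point_rel c c1 -> point_rel c c2 -> c1 = c2.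
move=> ck c1k c2k h1 h2; apply: distinct_points => // y yk.
have n c' : c' \in kb -> j y != c' by move=> c'k; rewrite -subr_eq0; exact: notin_sub.
have K_ c' : c' \in kb -> j y - c' \in Kb by move=> c'k; rewrite rpredB ?j_Kb ?kb_Kb.
have := @PsiI ((j y - c1) / (j y - c2)) (rpred_div (K_ _ c1k) (K_ _ c2k)).
rewrite mulf_neq0 ?invr_eq0 ?notin_sub // => /(_ isT) h s; apply/eqP; rewrite -subr_eq0; apply/eqP.
have <- : chi ((j y - c1) / (j y - c2)) s = chi (j y - c1) s - chi (j y - c2) s by rewrite (chiM pl l0) ?(chiV pl l0) ?rpredV ?invr_eq0 ?K_ ?notin_sub.
apply: h => s'; rewrite PsiM ?PsiV ?rpredV ?invr_eq0 ?K_ ?notin_sub //.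
by rewrite h1 ?n // h2 ?n // subrr.
Qed.

Lemma point_rel_inj c1 c2 c : c1 \in kb -> c2 \in kb -> c \in kb -> point_rel c1 c -> point_rel c2 c -> c1 = c2.
move=> c1k c2k ck h1 h2; apply: distinct_points => // y yk s.
have n c' : c' \in kb -> j y != c' by move=> c'k; rewrite -subr_eq0; exact: notin_sub.
by rewrite -h1 ?n // -h2 ?n.
Qed.

Hypothesis PsiK0 : forall t : K0, t != 0 -> Psi (j t) =1 chi (j t).

(** [vs] are the conjugates of c over k_0. The norm of u - c lies in K_0 after raising it to a power
    q of the characteristic exponent, which is prime to l. *)
Lemma conj_norm c : c \in kb -> exists vs q, [/\ uniq vs, c \in vs, (forall v, v \in vs -> v \in kb), coprime q l &
 (forall u : K0, exists w, j w = \prod_(v <- vs) (j u - v) ^+ q) /\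
 (forall v (p : {poly Om}), v \in vs -> coefs (range (j \o i)) p -> root p c -> root p v)].
move=> ck; pose F0 := range (j \o i).
have hF0 : subfield F0 := range_subfield _.
have Fc : alg_over F0 c.
 have /asboolP [p p0 pc] := ck; exists (map_poly (j \o i) p); rewrite map_poly_eq0; split=> // n.
 by rewrite coef_map; exists p`_n.
have [r rP] := finite_orbit Fc.
pose vs := [seq v <- undup r | `[< exists g : gal F0, v = g c >]].
have vsP v : v \in vs <-> exists g : gal F0, v = g c.
 rewrite mem_filter; split=> [/andP[/asboolP]//|h]; apply/andP; split; first exact/asboolP.
 by have [g ->] := h; rewrite mem_undup.
have uvs : uniq vs by rewrite filter_uniq ?undup_uniq.
have conj v (p : {poly Om}) : v \in vs -> coefs F0 p -> root p c -> root p v by move=> /vsP [g ->] pF pc; apply: gal_root pc.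
have vk v : v \in vs -> v \in kb.
 move=> vv; apply: kb_closed; have [p [pF p0 pc]] := Fc; exists p; split=> //; last exact: conj pc.
 by move=> n; have [a _ <-] := pF n; exact: i_kb.
pose f := \prod_(v <- vs) ('X - v%:P).
have gf (g : gal F0) : map_poly g f = f.
 rewrite /f map_prod_XsubC; apply: perm_big; apply: uniq_perm => //.
 by rewrite map_inj_uniq //; exact: fmorph_inj.
 move=> v; apply/mapP/idP => [[w /vsP [h ->] ->]|/vsP [h ->]].
 by apply/vsP; exists (g * h)%g.
 exists ((g^-1 * h)%g c); first by apply/vsP; exists (g^-1 * h)%g.
 by rewrite /= (@bij_invfunK _ g).
have com (s : seq Om) : (forall x, x \in s -> exists2 q, [pchar Om].-nat q & F0 (x ^+ q)) ->
 exists2 q, [pchar Om].-nat q & forall x, x \in s -> F0 (x ^+ q).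
 elim: s => [|x s IH] sP; first by exists 1%N.
 have [q qp qP] := IH (fun z zs => sP z (mem_behead (zs : z \in behead (x :: s)))).
 have [r' rp rP'] := sP x (mem_head _ _).
 exists (q * r')%N; first by rewrite pnatM qp.
 move=> z; rewrite inE => /orP[/eqP ->|zs]; first by rewrite mulnC exprM; exact: (subX hF0).
 by rewrite exprM; apply: (subX hF0); exact: qP.
have [|q qp qP] := com f.
 move=> x /(nthP 0) [n _ <-]; apply: fixed_ppower => // [|g].
 apply: (@alg_trans _ _ hF0 [set z | z \in kb]); first by move=> z /asboolP [p p0 pz];
 exists (map_poly (j \o i) p); rewrite map_poly_eq0; split=> // m; rewrite coef_map; exists p`_m.
 apply: alg_id; first exact: div_subfield.
 by apply/polyOverP: n; rewrite /f big_seq; apply: rpred_prod => v /vk v_k; rewrite polyOverXsubC.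
 by rewrite -{2}(gf g) coef_map.
have q0 : (0 < q)%N by case/andP: qp.
exists vs, q; split=> //; first by apply/vsP; exists 1%g.
 by apply: (@pnat_coprime [pchar Om]); rewrite // -natf_neq0_pchar.
split=> // u; have gF n : F0 (map_poly (frob qp) f)`_n.
 rewrite coef_map /= /frob; have [lt|le] := ltnP n (size f); first by apply: qP; exact: mem_nth.
 by rewrite [f`_n]nth_default // expr0n eqn0Ngt q0; exact: (sub0 hF0).
have -> : \prod_(v <- vs) (j u - v) ^+ q = (map_poly (frob qp) f).[j u ^+ q].
 rewrite -[j u ^+ q]/(frob qp (j u)) horner_map /= /f horner_prod /frob prodrXl.
 by congr (_ ^+ _); apply: eq_bigr => v _; rewrite hornerXsubC.
have : range j (map_poly (frob qp) f).[j u ^+ q].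
 have hj : subfield (range j) := range_subfield j.
 apply: (sub_horner hj) => [n|]; first by have [a _ <-] := gF n; exists (i a).
 by exists (u ^+ q); rewrite ?rmorphXn.
by move=> [w _ wE]; exists w.
Qed.

Lemma sum_prod (f : Om -> GO -> 'F_l) (vs : seq Om) s : (f = Psi \/ f = chi) -> (forall v, v \in vs -> v \in Kb /\ v != 0) ->
 f (\prod_(v <- vs) v) s = \sum_(v <- vs) f v s.
move=> ff; elim: vs => [|v vs IH] h.
 by rewrite !big_nil; case: ff => ->; [exact: Psi1|exact: chi1].
have [vK v0] := h v (mem_head _ _).
have h' w : w \in vs -> w \in Kb /\ w != 0 by move=> wv; apply: h; rewrite inE wv orbT.
have pK : \prod_(w <- vs) w \in Kb by rewrite big_seq; apply: rpred_prod => w /h' [].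
have p0 : \prod_(w <- vs) w != 0 by rewrite prodf_seq_neq0; apply/allP => w /h' [].
rewrite !big_cons -IH //; case: ff => ->; [exact: PsiM|exact: (chiM pl l0)].
Qed.

(** Psi and chi agree on the norm of u - c, so near u = c some factor u - v is ramified for Psi. The
    relation (u - v) + (v - y) = u - y then identifies Psi(y - v) with the character of c - y. *)
Lemma point_rel_ex c : c \in kb -> exists c', [/\ c' \in kb, point_rel c c' &
 forall p, coefs (range (j \o i)) p -> root p c -> root p c'].
move=> ck; apply: contrapT => none; have [vs [q [uvs cvs vk cq [nrm cnj]]]] := conj_norm ck.
(* If no conjugate v is suitable, each v has a witness y v where the two characters differ. *)
have /choice [y yP] : forall v, exists y : K0, v \in vs -> [/\ j y != c, j y != v & exists s, Psi (j y - v) s <> chi (j y - c) s].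
 move=> v; have [vv|nv] := boolP (v \in vs); last by exists 0.
 apply: contrapT => no; apply: none; exists v; split; [exact: vk| |by move=> p; exact: cnj].
 move=> y yc yv s; apply: contrapT => ne; apply: no; exists y => _; split=> //; by exists s.
have KB (u : K0) v : v \in kb -> j u - v \in Kb by move=> h; rewrite rpredB ?j_Kb ?kb_Kb.
have /choice [w wP] : forall v, exists w, v \in vs -> [/\ w \in Kb, w != 0 & Psi (j (y v) - v) =1 chi w].
 move=> v; have [vv|nv] := boolP (v \in vs); last by exists 0.
 have [_ yv _] := yP v vv; have [|w wP] := @PsiE (j (y v) - v) (KB _ _ (vk _ vv)); first by rewrite subr_eq0.
 by exists w.
(* The decomposition group at the place will be asked to separate these discrepancies. *)
pose n v := w v / (j (y v) - c).
have n0 v : v \in vs -> n v \in Kb /\ n v != 0.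
 move=> vv; have [wK w0 _] := wP v vv; have [yc _ _] := yP v vv.
 by rewrite rpred_div ?KB // mulf_neq0 // invr_eq0 subr_eq0.
have [||P [u [pP kP [Pu uk] PD [[s [si s1]] dec]]]] := core_place (a := c) (ns := map n vs)
 (D := map w vs ++ [seq c - j (y v) | v <- vs]) ck.
- by move=> _ /mapP [v vv ->]; exact: n0.
- move=> z; rewrite mem_cat => /orP[] /mapP [v vv ->]; first by have [] := wP v vv.
 by have [yc _ _] := yP v vv; rewrite subr_eq0 eq_sym.
have hP := pl_hg pP.
have x0 v : v \in kb -> j u - v != 0 by move=> h; exact: notin_sub.
have [v vv Av] : exists2 v, v \in vs & Psi (j u - v) s != 0.
 apply: contrapT => no; have e0 : \sum_(v <- vs) Psi (j u - v) s = 0.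
 rewrite big_seq big1 // => v vv; apply/eqP; apply: contraT => h; by case: no; exists v.
 have [W WE] := nrm u; rewrite prodrXl in WE.
 pose Pr := \prod_(v <- [seq j u - v | v <- vs]) v.
 have PrE : Pr ^+ q = j W by rewrite WE /Pr big_map.
 have vs' v : v \in [seq j u - v | v <- vs] -> v \in Kb /\ v != 0 by move=> /mapP [v' /vk v'k ->]; rewrite KB // x0.
 have PrK : Pr \in Kb by rewrite /Pr big_seq; apply: rpred_prod => z /vs' [].
 have Pr0 : Pr != 0 by rewrite prodf_seq_neq0; apply/allP => z /vs' [].
 have W0 : W != 0 by apply: contraNneq Pr0 => W0; move: PrE; rewrite W0 rmorph0 => /eqP; rewrite expf_eq0 => /andP[].
 have h1 : Psi Pr s *+ q = chi Pr s *+ q by rewrite -PsiX // -(chiX pl l0) // PrE; exact: PsiK0.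
 have : chi Pr s *+ q = 0 by rewrite -h1 (sum_prod s (or_introl erefl) vs') big_map e0 mul0rn.
 rewrite (sum_prod s (or_intror erefl) vs') big_map (bigD1_seq c) //= s1 big_seq_cond big1 ?addr0.
 move=> /eqP; have := coprime_dvdr (dvdnn l) cq.
 rewrite -[_ == 0](dvdn_pcharf (pchar_Fp pl)) => cl dv.
 by move: cl; rewrite /coprime (gcdn_idPr dv) => /eqP l1; move: pl; rewrite l1.
 move=> v /andP[vv vc]; apply: (chi_unit pl l0 pP kP si); first by apply: KB; exact: vk.
 exists (c - v); first by rewrite subr_eq0 eq_sym.
 have := hgD hP Pu (kP _ (rpredB ck (vk _ vv))).
 by rewrite add0r addrA subrK.
have [yc yv [g gne]] := yP v vv; have [wK w0 Ww] := wP v vv.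
have [t [f [ta fk tg]]] := dec g.
have ycK : j (y v) - c \in Kb by exact: KB.
have yc0 : j (y v) - c != 0 by rewrite subr_eq0.
have uy : punit P (c - j (y v)) by apply: PD; rewrite mem_cat; apply/orP; right; apply/mapP; exists v.
have uy0 : j (u - y v) != 0.
 have [r r0 Pr] := uy; rewrite rmorphB; apply/eqP => e.
 have := hgD hP Pu Pr; rewrite addrA subrK e => h.
 by rewrite add0r in h; rewrite (hg_fun hP h (hg0 hP)) eqxx in r0.
(* At the place u is congruent to c, so u - y has the residue of c - y. *)
have e : chi (w v) t = chi (c - j (y v)) t.
 apply: (use_place pP kP si ta fk (A := j u - v) (B := v - j (y v)) (C := j (u - y v)) (C0 := j (u - y v))) => //.
 - split=> //; [exact/KB/vk|by rewrite rpredB ?j_Kb ?kb_Kb ?vk|exact/x0/vk|by rewrite subr_eq0 eq_sym].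
 - by rewrite rmorphB addrA subrK.
 - split=> //; [exact: j_Kb|by rewrite rpredB ?j_Kb ?kb_Kb|move=> s'].
 by rewrite -opprB PsiN ?Ww // ?subr_eq0 //; apply: KB; exact: vk.
 - by apply: PsiK0; rewrite -(fmorph_eq0 j).
 - by apply: PD; rewrite mem_cat map_f.
 - by rewrite rmorphB opprB addrA subrK.
have nE g' : chi (n v) g' = chi (w v) g' - chi (j (y v) - c) g' by rewrite (chiM pl l0) ?(chiV pl l0) ?rpredV ?invr_eq0.
have := tg (n v) (map_f n vv); rewrite !nE e.
have -> : chi (c - j (y v)) t = chi (j (y v) - c) t.
 rewrite -opprB -mulN1r (chiM pl l0) ?rpredN ?rpred1 ?oppr_eq0 ?oner_eq0 //.
 by rewrite chiC ?add0r ?rpredN ?rpred1 ?oppr_eq0 ?oner_eq0.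
rewrite subrr => /esym/eqP; rewrite subr_eq0 -Ww => /eqP h; exact: gne.
Qed.

(** c |-> c' is injective and maps the roots of a polynomial over k_0 to roots, hence permutes
    them. *)
Lemma point_rel_surj c' : c' \in kb -> exists c, c \in kb /\ point_rel c c'.
move=> c'k; have /choice [f fP] : forall c, exists c', (c \in kb -> [/\ c' \in kb, point_rel c c' &
 forall p, coefs (range (j \o i)) p -> root p c -> root p c']) /\ (c \notin kb -> c' = c).
 move=> c; have [ck|nk] := boolP (c \in kb); last by exists c.
 by have [c1 h] := point_rel_ex ck; exists c1.
have fk c : (f c \in kb) = (c \in kb).
 have [h1 h2] := fP c; have [ck|nk] := boolP (c \in kb); first by have [] := h1 ck.
 by rewrite (h2 nk); exact: negbTE.
have finj : injective f.
 move=> c1 c2 e; have [h1 h1'] := fP c1; have [h2 h2'] := fP c2.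
 have [k1|k1] := boolP (c1 \in kb); last first.
 by rewrite -(h1' k1) -h2' // -fk -e fk.
 have k2 : c2 \in kb by rewrite -fk -e fk.
 have [f1k r1 _] := h1 k1; have [_ r2 _] := h2 k2; rewrite -e in r2.
 exact: point_rel_inj k1 k2 f1k r1 r2.
have /asboolP [p p0 pc] := c'k.
have [|x|c pcc fc] := @perm_roots _ (map_poly (j \o i) p) f _ finj _ c' pc.
- by rewrite map_poly_eq0.
- move=> rx; have xk : x \in kb by apply/asboolP; exists p.
 have [_ _ h] := (fP x).1 xk; apply: h rx => n.
 by rewrite coef_map; exists p`_n.
have ck : c \in kb by rewrite -fk fc.
by exists c; split=> //; rewrite -fc; have [] := (fP c).1 ck.
Qed.

(** The sum (u - c1') + (y - c2') = (u + y) - (c1' + c2') near u = c1: if e is the point attached to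
    c1' + c2', then (u + y) - e reduces to y - (e - c1), whence c2 = e - c1. *)
Lemma point_relD c1 c2 c1' c2' : c1 \in kb -> c2 \in kb -> c1' \in kb -> c2' \in kb ->
 point_rel c1 c1' -> point_rel c2 c2' -> point_rel (c1 + c2) (c1' + c2').
move=> k1 k2 k1' k2' r1 r2; have [e [ek re]] := point_rel_surj (rpredD k1' k2').
suff : c2 = e - c1 by move=> ->; rewrite addrC subrK.
apply: distinct_points; rewrite ?rpredB // => y yk.
have n c : c \in kb -> j y != c by move=> ck; rewrite -subr_eq0; exact: notin_sub.
have KB (u : K0) v : v \in kb -> j u - v \in Kb by move=> h; rewrite rpredB ?j_Kb ?kb_Kb.
apply: (core_use (a := c1) (D := [:: j y - (c1' + c2' - c1)])) => //.
- by apply: KB; exact: rpredB.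
- exact: KB.
- by apply: notin_sub => //; exact: rpredB.
- exact: notin_sub.
- by move=> v; rewrite mem_seq1 => /eqP ->; apply: notin_sub => //; rewrite rpredB ?rpredD.
move=> P u pP kP Pu uk PD UE; have hP := pl_hg pP.
have PCE c : c \in kb -> P (j (u + y) - c - (j y - (c - c1)), 0).
 move=> ck; have -> // : j (u + y) - c - (j y - (c - c1)) = j u - c1.
 by rewrite rmorphD [- (j y - _)]opprB [LHS](AC (((1*1)*1)*((1*1)*1)) ((1*5)*((2*6)*(4*3)))) /= !subrr !addr0.
have nz c : punit P (j y - (c - c1)) -> c \in kb -> j (u + y) - c != 0.
 move=> [r r0 Pr] ck; apply/eqP => e0; have := hgD hP (PCE c ck) Pr.
 by rewrite e0 sub0r addNr add0r => h; rewrite (hg_fun hP h (hg0 hP)) eqxx in r0.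
have C0 : j (u + y) - (c1' + c2') != 0 by apply: nz; [apply: PD; rewrite !inE eqxx ?orbT|exact: rpredD].
have C00 : j (u + y) - e != 0 by apply: nz => //; exact: UE.
exists (j u - c1'), (j y - c2'), (j (u + y) - (c1' + c2')), (j (u + y) - e); split.
- by split; [exact: KB|exact: KB|exact: notin_sub|exact: notin_sub|].
- by rewrite rmorphD opprD [RHS]addrACA.
- by split; [exact: KB|exact: PCE].
- split=> [s|s]; first by apply: r2; exact: n.
 by apply: re; rewrite -subr_eq0.
- move=> s _ s1; rewrite r1 ?s1 ?oner_eq0 // -subr_eq0; exact: notin_sub.
Qed.

Lemma point_rel_const c : point_rel (j (i c)) (j (i c)).
move=> y yc _ s; have e : j y - j (i c) = j (y - i c) by rewrite rmorphB.
by rewrite e; apply: PsiK0; rewrite -(fmorph_eq0 j) -e subr_eq0.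
Qed.

(** The multiplicative analogue, from (u - c1') y + c1' (y - c2') = u y - c1' c2' near u = c1. *)
Lemma point_relM c1 c2 c1' c2' : c1 \in kb -> c2 \in kb -> c1' \in kb -> c2' \in kb ->
 point_rel c1 c1' -> point_rel c2 c2' -> point_rel (c1 * c2) (c1' * c2').
move=> k1 k2 k1' k2' r1 r2; have r0 : point_rel 0 0 by have := @point_rel_const 0; rewrite !rmorph0.
have k0' : 0 \in kb by exact: rpred0.
have [z1|z1] := eqVneq c1 0.
 have -> : c1' = 0 by apply: (point_rel_uniq k0' k1' k0') => //; rewrite -z1.
 by rewrite z1 !mul0r.
have z1' : c1' != 0 by apply: contraNneq z1 => z1'; rewrite z1' in r1; apply/eqP; exact: (point_rel_inj k1 k0' k0').
have [e [ek re]] := point_rel_surj (rpredM k1' k2').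
suff : c2 = e / c1 by move=> ->; rewrite mulrC divfK.
apply: distinct_points; rewrite ?rpred_div // => y yk.
have n c : c \in kb -> j y != c by move=> ck; rewrite -subr_eq0; exact: notin_sub.
have KB (u : K0) v : v \in kb -> j u - v \in Kb by move=> h; rewrite rpredB ?j_Kb ?kb_Kb.
have y0 : j y != 0 by exact: n.
have cy c : c \in kb -> c1 * (j y - c / c1) = c1 * j y - c by move=> _; rewrite mulrBr mulrCA divff ?mulr1.
have ny c : c \in kb -> c1 * j y - c != 0 by move=> ck; rewrite -cy // mulf_neq0 ?notin_sub ?rpred_div.
have E1 s : chi (c1 * j y - e) s = chi (j y - e / c1) s.
 rewrite -cy // (chiM pl l0 s (kb_Kb k1)) ?(chiC s k1 z1) ?add0r //; last by apply: notin_sub => //; exact: rpred_div.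
 by apply: KB; exact: rpred_div.
move=> s; rewrite -E1; move: s.
apply: (core_use (a := c1) (D := [:: j y; c1 * j y - c1' * c2'])) => //.
- by rewrite rpredB ?rpredM ?j_Kb ?kb_Kb.
- exact: KB.
- exact: ny.
- exact: notin_sub.
- by move=> v; rewrite in_cons mem_seq1 => /orP[] /eqP -> //; apply: ny; exact: rpredM.
move=> P u pP kP Pu uk PD UE; have hP := pl_hg pP.
have uy : punit P (j y) by apply: PD; exact: mem_head.
have PCE c : c \in kb -> P (j (u * y) - c - (c1 * j y - c), 0).
 move=> ck; have [q _ Pq] := uy; have := hgM hP Pu Pq; rewrite mul0r.
 by rewrite rmorphM opprB addrA subrK mulrBl.
have nz c : punit P (c1 * j y - c) -> c \in kb -> j (u * y) - c != 0.
 move=> [r r0_ Pr] ck; apply/eqP => e0; have := hgD hP (PCE c ck) Pr.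
 by rewrite e0 sub0r addNr add0r => h; rewrite (hg_fun hP h (hg0 hP)) eqxx in r0_.
have C0 : j (u * y) - c1' * c2' != 0 by apply: nz; [apply: PD; rewrite !inE eqxx ?orbT|exact: rpredM].
have C00 : j (u * y) - e != 0 by apply: nz => //; exact: UE.
exists ((j u - c1') * j y), (c1' * (j y - c2')), (j (u * y) - c1' * c2'), (j (u * y) - e); split.
- by split; [rewrite rpredM ?KB ?j_Kb|rewrite rpredM ?(kb_Kb k1') ?KB|rewrite mulf_neq0 ?notin_sub|rewrite mulf_neq0 ?notin_sub|].
- by rewrite rmorphM mulrBl mulrBr addrA subrK.
- by split; [exact: KB|exact: PCE].
- split=> [s|s].
 rewrite PsiM ?(kb_Kb k1') ?KB ?notin_sub // (PsiC s k1' z1') add0r.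
 by apply: r2; exact: n.
 by apply: re; rewrite -subr_eq0.
- move=> s si s1; rewrite PsiM ?KB ?j_Kb ?notin_sub //.
 rewrite PsiK0 -?(fmorph_eq0 j) // (chi_unit pl l0 pP kP si) ?j_Kb // addr0 r1 ?s1 ?oner_eq0 //.
 by rewrite -subr_eq0; exact: notin_sub.
 by rewrite -subr_eq0; exact: notin_sub.
Qed.
End Rigidity.

(** * Extending an automorphism of the constants to one over K_0 *)

Section ConstantAutomorphisms.
Notation F0 := (range (j \o i)).

Lemma kb_range u : j u \in kb -> F0 (j u).
move=> /asboolP [p p0 pu]; have [|c _ e] := reg (y := u); last by exists c; rewrite //= e.
by exists p => //; move: pu; rewrite map_poly_comp fmorph_root.
Qed.

Lemma range_alg x : alg_over (range j) x.
have [p p0 px] := Omalg x; exists (map_poly j p); rewrite map_poly_eq0; split=> // n.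
by rewrite coef_map; exists p`_n.
Qed.

Variable tau : Om -> Om.
Hypotheses (tauD : forall c c', c \in kb -> c' \in kb -> tau (c + c') = tau c + tau c')
 (tauM : forall c c', c \in kb -> c' \in kb -> tau (c * c') = tau c * tau c')
 (tau0 : forall c, F0 c -> tau c = c).

Lemma F0_kb c : F0 c -> c \in kb.
by move=> [a _ <-]; exact: i_kb. Qed.

Lemma tau_sum n (f : 'I_n -> Om) : (forall k, f k \in kb) -> tau (\sum_k f k) = \sum_k tau (f k).
elim: n f => [|n IH] f fk; first by rewrite !big_ord0 tau0 //; exact: (sub0 (range_subfield _)).
by rewrite !big_ord_recl tauD ?IH // rpred_sum.
Qed.

Lemma tau_horner (p : {poly Om}) c : coefs F0 p -> c \in kb -> tau p.[c] = p.[tau c].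
move=> pF ck; have tX n : tau (c ^+ n) = tau c ^+ n.
 elim: n => [|n IH]; first by rewrite !expr0 tau0 //; exact: (sub1 (range_subfield _)).
 by rewrite !exprS tauM ?IH ?rpredX.
rewrite !horner_coef tau_sum => [|k]; last by rewrite rpredM ?rpredX //; exact: F0_kb.
apply: eq_bigr => k _; have pk : p`_k \in kb by exact: F0_kb.
by rewrite tauM ?rpredX // tX tau0.
Qed.

(* The minimal polynomial of a constant over K_0 has coefficients in k_0. *)
Lemma lift_one c : c \in kb -> exists h : gal (range j), h c = tau c.
move=> ck; have [m [mF mm mc _ mconj]] := minpol_ex (range_subfield j) (range_alg c).
have mF0 : coefs F0 m.
 have [r Dm] := closed_field_poly_normal m; rewrite (monicP mm) scale1r in Dm.
 have rk v : v \in r -> v \in kb.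
 move=> vr; have [|s <-] := mconj v; first by rewrite Dm root_prod_XsubC.
 have /asboolP [p p0 pc] := ck; apply/asboolP; exists p => //.
 apply: (gal_root (F := range j)) pc => n; rewrite coef_map; by exists (i p`_n).
 move=> n; have [u _ uE] := mF n; rewrite -uE; apply: kb_range; rewrite uE Dm.
 by move: n {uE u}; apply/polyOverP; rewrite big_seq; apply: rpred_prod => v /rk vk; rewrite polyOverXsubC.
apply: mconj; apply/rootP; rewrite -tau_horner // (rootP mc) tau0 //; exact: (sub0 (range_subfield _)).
Qed.

(** A combination of D at a separating point of k_0 is lifted by [lift_one]; agreement there forces
    agreement on each element of D. *)
Lemma lift_finite (D : seq Om) : (forall c, c \in D -> c \in kb) -> exists h : gal (range j), {in D, forall c, h c = tau c}.
move=> Dk; have [L LP] := @orbit_seqs Om (range j) setT D (fun x _ => let: ex_intro r h := finite_orbit (range_alg x) in ex_intro _ r (fun h' _ => h h')).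
pose T := [seq tau c | c <- D].
have [c Fc sep] := separating_point L T (@inf_const _ _ i _ j inf0); have ck := F0_kb Fc.
have xk : (Poly D).[c] \in kb.
 rewrite rpred_horner //; apply/polyOverP => n; rewrite coef_Poly.
 by have [lt|le] := ltnP n (size D); [apply: Dk; exact: mem_nth|rewrite nth_default ?rpred0].
have [h hx] := lift_one xk; exists h.
have gP : map_poly h (Poly D) = Poly [seq h d | d <- D] := map_Poly_id0 D (rmorph0 h).
have hc : h c = c by have [_ _ hF] := galP h; apply: hF; have [a _ <-] := Fc; exists (i a).
have e1 : h (Poly D).[c] = (Poly [seq h d | d <- D]).[c] by rewrite -gP -{2}hc horner_map.
have e2 : tau (Poly D).[c] = (Poly T).[c].
 have szP := size_Poly D; rewrite (horner_coef_wide _ szP) tau_sum => [|k]; last first.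
 by rewrite coef_Poly rpredM ?rpredX //; apply: Dk; exact: mem_nth.
 have szT : (size (Poly T) <= size D)%N by rewrite (leq_trans (size_Poly _)) // size_map.
 rewrite (horner_coef_wide _ szT); apply: eq_bigr => k _; rewrite !coef_Poly (nth_map 0) //.
 rewrite tauM ?rpredX //; last by apply: Dk; exact: mem_nth.
 by congr (_ * _); apply: tau0; apply: subX => //; exact: range_subfield.
have e : Poly [seq h d | d <- D] = Poly T by apply: sep; rewrite ?LP // -e1 -e2 hx.
move=> d /(nthP 0) [n ln <-]; have := congr1 (fun p : {poly Om} => p`_n) e.
by rewrite !coef_Poly !(nth_map 0).
Qed.

Lemma lift_constants : exists T : gal (range j), forall c, c \in kb -> T c = tau c.
(* The pairs whose second member is the image of the first under every automorphism over K_0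
   agreeing with tau on some finite set D of constants; by [lift_finite] such automorphisms
   exist. *)
pose G0 : set (Om * Om) := [set z | exists D : seq Om, (forall c, c \in D -> c \in kb) /\
 forall h : gal (range j), {in D, forall c, h c = tau c} -> z.2 = h z.1].
have catk (D D' : seq Om) : (forall c, c \in D -> c \in kb) -> (forall c, c \in D' -> c \in kb) -> forall c, c \in D ++ D' -> c \in kb.
 by move=> h h' c; rewrite mem_cat => /orP[/h|/h'].
have inl (D D' : seq Om) (h : gal (range j)) : {in D ++ D', forall c, h c = tau c} -> {in D, forall c, h c = tau c} /\ {in D', forall c, h c = tau c}.
 by move=> H; split=> c cD; apply: H; rewrite mem_cat cD ?orbT.
have G0j u : G0 (j u, j u) by exists [::]; split=> // h _ /=; have [_ _ ->] := galP h => //; exists u.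
have fG : field_graph G0.
 split=> [|z [D [Dk Dh]]]; last first.
 by exists D; split=> // h hD /=; rewrite (Dh h hD) fmorphV.
 split.
 - by exists [::]; split=> // h _ /=; rewrite rmorph1.
 - move=> z w [D [Dk Dh]] [D' [Dk' Dh']]; exists (D ++ D'); split; first exact: catk.
 by move=> h /inl [h1 h2] /=; rewrite rmorphB (Dh h h1) (Dh' h h2).
 - move=> z w [D [Dk Dh]] [D' [Dk' Dh']]; exists (D ++ D'); split; first exact: catk.
 by move=> h /inl [h1 h2] /=; rewrite rmorphM (Dh h h1) (Dh' h h2).
 by move=> z [D [Dk Dh]]; have [h hD] := lift_finite Dk; rewrite (Dh h hD) fmorph_eq0.
have dG : range j `<=` diag G0 by move=> _ [u _ <-]; exact: G0j.
have [s sG] := aut_extension fG (fun a b _ => conj (alg_mono dG (range_alg a)) (alg_mono dG (range_alg b))).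
have [T TE] := gal_weaken s dG; exists T => c ck; rewrite TE; apply: sG.
exists [:: c]; split=> [z|h hc /=]; first by rewrite mem_seq1 => /eqP ->.
by rewrite hc ?mem_head.
Qed.
End ConstantAutomorphisms.

(** * Psi is determined by its values on K_0 *)

Section RigidityTheorem.
Definition comb (L : seq (K0 * Om)) : Om := \sum_(p <- L) j p.1 * p.2.
Definition combs : set Om := [set z | exists2 L, (forall p, p \in L -> p.2 \in kb) & z = comb L].

Lemma comb_cat L L' : comb (L ++ L') = comb L + comb L'.
exact: big_cat. Qed.

Lemma combs1 : combs 1.
by exists [:: (1, 1)]; [move=> p; rewrite mem_seq1 => /eqP ->; exact: rpred1|rewrite /comb big_seq1 rmorph1 mulr1]. Qed.

Lemma combsB x y : combs x -> combs y -> combs (x - y).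
move=> [L Lk ->] [L' Lk' ->]; exists (L ++ [seq (- p.1, p.2) | p <- L']).
 by move=> p; rewrite mem_cat => /orP[/Lk//|/mapP [p' /Lk' h ->]].
rewrite comb_cat; congr (_ + _); rewrite /comb big_map -sumrN.
by apply: eq_bigr => p _; rewrite rmorphN mulNr.
Qed.

Lemma combsM x y : combs x -> combs y -> combs (x * y).
move=> [L Lk ->] [L' Lk' ->]; exists [seq (p.1 * p'.1, p.2 * p'.2) | p <- L, p' <- L'].
 by move=> _ /allpairsP [[p p'] /= [pL p'L ->]] /=; apply: rpredM; [exact: Lk|exact: Lk'].
rewrite /comb big_allpairs_dep mulr_suml; apply: eq_bigr => p _; rewrite mulr_sumr.
by apply: eq_bigr => p' _; rewrite /= rmorphM mulrACA.
Qed.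

Lemma Kb_comb z : z \in Kb -> exists u v, [/\ combs u, combs v & z = u / v].
apply: (fld_gen_sub (frac_subfield combs1 combsB combsM)).
move=> x xx; exists x, 1; rewrite divr1; split=> //; last exact: combs1.
case: xx => [[u _ <-]|xk].
 by exists [:: (u, 1)]; [move=> p; rewrite mem_seq1 => /eqP ->; exact: rpred1|rewrite /comb big_seq1 mulr1].
by exists [:: (1, x)]; [move=> p; rewrite mem_seq1 => /eqP ->|rewrite /comb big_seq1 rmorph1 mul1r].
Qed.

Lemma gal_j_kb (T : gal (range j)) c : c \in kb -> T c \in kb.
move=> /asboolP [p p0 pc]; apply/asboolP; exists p => //; apply: (gal_root (F := range j)) pc => n.
by rewrite coef_map; exists (i p`_n).
Qed.

Lemma gal_j (T : gal (range j)) u : T (j u) = j u.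
by have [_ _ ->] := galP T => //; exists u. Qed.

Lemma gal_j_Kb (T : gal (range j)) z : z \in Kb -> T z \in Kb.
apply: (fld_gen_sub (preim_subfield T (div_subfield Kb))) => x [[u _ <-]|xk] /=.
 by rewrite gal_j j_Kb.
by apply: kb_Kb; exact: gal_j_kb.
Qed.

Section Known.
Variable Psi : Om -> GO -> 'F_l.
Hypothesis PsiM : psi_multiplicative Psi.
Hypothesis PsiE : psi_kummer Psi.
Hypothesis PsiSt : psi_steinberg Psi.
Hypothesis points : forall (y : K0) c, c \in kb -> j y != c -> forall s, Psi (j y - c) s = chi (j y - c) s.

(** The relation (u - lam) + z = (v + u) + r near u = lam: the right side is one term shorter than z
    and reduces to the residue of z, so Psi z agrees with chi z. *)
Lemma known_step (v : K0) r z lam : lam \in kb -> z = j v + r + lam -> z \in Kb -> z != 0 ->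
 (forall x : K0, j x + r \in Kb -> j x + r != 0 -> forall s, Psi (j x + r) s = chi (j x + r) s) -> forall s, Psi z s = chi z s.
move=> lk zE zK z0 IH s; have [w [wK w0 Pw]] := PsiE zK z0.
rewrite Pw; move: s.
apply: (core_use PsiM PsiSt (a := lam) (D := [::])) => //.
move=> P u pP kP Pu uk _ [q q0 Pq]; have hP := pl_hg pP.
have xl : j u != lam by rewrite -subr_eq0; exact: (notin_sub uk lk).
have CE : j (v + u) + r = z + (j u - lam) by rewrite zE rmorphD [RHS](AC (((1*1)*1)*(1*1)) (((1*4)*2)*(3*5))) /= subrr addr0.
have C0 : j (v + u) + r != 0.
 have h := hgD hP Pq Pu; rewrite addr0 in h.
 by rewrite CE; exact: (pl_nz pP h).
have CK : j (v + u) + r \in Kb by rewrite CE rpredD // rpredB ?j_Kb // kb_Kb.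
exists (j u - lam), z, (j (v + u) + r), (j (v + u) + r); split.
- by split; [rewrite rpredB ?j_Kb // kb_Kb| |rewrite subr_eq0| |].
- by rewrite CE addrC.
- by split=> //; rewrite CE addrAC subrr add0r.
- by split=> // s'; exact: IH.
- by move=> s _ s1; rewrite points // s1 oner_neq0.
Qed.

(** Induction on the number of terms. A nonzero sum is divided by a product with one factor from K_0
    and one constant, so that one term lies in K_0 and another is constant, as [known_step]
    requires. *)
Lemma known_comb L : (forall p, p \in L -> p.2 \in kb) -> comb L != 0 -> forall s, Psi (comb L) s = chi (comb L) s.
have known1 (u : K0) c : c \in kb -> j u * c != 0 -> forall s, Psi (j u * c) s = chi (j u * c) s.
 move=> ck; rewrite mulf_eq0 negb_or => /andP[u0 c0] s.
 rewrite PsiM ?j_Kb ?(kb_Kb ck) // (chiM pl l0) ?j_Kb ?(kb_Kb ck) //.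
 rewrite (PsiC PsiM s ck c0) (@chiC c s ck c0) !addr0.
 by have := @points u 0 (rpred0 _) u0 s; rewrite subr0.
have [n] := ubnP (size L); elim: n L => // n IH [|[um cm] [|[u1 c1] L]] lt Lk.
- by rewrite /comb big_nil eqxx.
- by rewrite /comb big_seq1 /=; apply: known1; exact: (Lk (um, cm) (mem_head _ _)).
have cmk : cm \in kb by exact: (Lk (um, cm) (mem_head _ _)).
have c1k : c1 \in kb by apply: (Lk (u1, c1)); rewrite !inE eqxx orbT.
have Lk' p : p \in L -> p.2 \in kb by move=> pL; apply: Lk; rewrite !inE pL !orbT.
have [um0|um0] := eqVneq um 0.
 have -> : comb [:: (um, cm), (u1, c1) & L] = comb ((u1, c1) :: L) by rewrite {1}/comb big_cons um0 /= rmorph0 mul0r add0r.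
 by apply: IH => // p pL; apply: Lk; rewrite inE pL orbT.
have [c10|c10] := eqVneq c1 0.
 have -> : comb [:: (um, cm), (u1, c1) & L] = comb ((um, cm) :: L) by rewrite {1}/comb !big_cons c10 /= mulr0 add0r /comb big_cons.
 by apply: IH => // p; rewrite inE => /orP[/eqP ->//|/Lk'].
pose L2 := [seq (p.1 / um, p.2 / c1) | p <- L].
have L2k p : p \in L2 -> p.2 \in kb by move=> /mapP [p' /Lk' h ->] /=; rewrite rpred_div.
have jm0 : j um != 0 by rewrite fmorph_eq0.
(* Division by um c1, factors of two different terms, turns these into an element of K_0 and a
   constant. *)
set z := j (u1 / um) + comb L2 + cm / c1.
have zE : comb [:: (um, cm), (u1, c1) & L] = j um * c1 * z.
 rewrite /z !mulrDr /comb !big_cons /= big_map mulr_sumr fmorph_div [RHS]addrC; congr (_ + (_ + _)).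
 - by rewrite -mulrA [c1 * _]mulrCA divff ?mulr1.
 - by rewrite mulrAC mulrCA divff ?mulr1.
 - apply: eq_bigr => p _; rewrite /= fmorph_div mulrACA [j um * _]mulrCA divff // mulr1.
 by rewrite [c1 * _]mulrCA divff // mulr1.
rewrite zE !mulf_eq0 !negb_or => /andP[_ z0].
have combK M : (forall p, p \in M -> p.2 \in kb) -> comb M \in Kb by move=> Mk; rewrite /comb big_seq rpred_sum // => p /Mk h; rewrite rpredM ?j_Kb ?kb_Kb.
have zK : z \in Kb by rewrite rpredD ?rpredD ?j_Kb ?combK // kb_Kb // rpred_div.
have kz := @known_step (u1 / um) (comb L2) z (cm / c1) (rpred_div cmk c1k) erefl zK z0.
have kz' : forall s, Psi z s = chi z s.
 apply: kz => x xK x0; have e : j x + comb L2 = comb ((x, 1) :: L2) by rewrite {2}/comb big_cons /= mulr1.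
 rewrite e in x0 *; apply: IH => //.
 by rewrite /= size_map -ltnS.
 by move=> p; rewrite inE => /orP[/eqP -> /=|/L2k//]; rewrite rpred1.
have jc : j um * c1 \in Kb by rewrite rpredM ?j_Kb ?(kb_Kb c1k).
have jc0 : j um * c1 != 0 by rewrite mulf_neq0.
by move=> s; rewrite PsiM // (chiM pl l0) // kz' known1.
Qed.

Lemma known z : z \in Kb -> z != 0 -> forall s, Psi z s = chi z s.
move=> zK z0 s; have [_ [_ [[L Lk ->] [L' Lk' ->] zE]]] := Kb_comb zK.
have c0 : comb L != 0 by apply: contraNneq z0 => c0; rewrite zE c0 mul0r.
have c0' : comb L' != 0 by apply: contraNneq z0 => c0'; rewrite zE c0' invr0 mulr0.
have combK M : (forall p, p \in M -> p.2 \in kb) -> comb M \in Kb by move=> Mk; rewrite /comb big_seq rpred_sum // => p /Mk h; rewrite rpredM ?j_Kb ?kb_Kb.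
rewrite zE PsiM ?(PsiV PsiM) ?rpredV ?invr_eq0 ?combK //.
by rewrite (chiM pl l0) ?(chiV pl l0) ?rpredV ?invr_eq0 ?combK // (known_comb Lk c0) (known_comb Lk' c0').
Qed.
End Known.

Section Main.
Variable Psi : Om -> GO -> 'F_l.
Hypothesis PsiM : psi_multiplicative Psi.
Hypothesis PsiE : psi_kummer Psi.
Hypothesis PsiSt : psi_steinberg Psi.
Hypothesis PsiI : forall z, z \in Kb -> z != 0 -> (forall s, Psi z s = 0) -> forall s : GO, chi z s = 0.
Hypothesis PsiK0 : forall t : K0, t != 0 -> Psi (j t) =1 chi (j t).

(** The point map is a ring homomorphism on constants fixing k_0; its extension T straightens Psi so
    that all y - c are known. *)
Theorem rigidity : exists T : gal (range j), forall z, z \in Kb -> z != 0 -> forall s, Psi (T z) s = chi z s.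
have /choice [tau tauP] : forall c, exists c', c \in kb -> c' \in kb /\ point_rel Psi c c'.
 move=> c; have [ck|nk] := boolP (c \in kb); last by exists 0.
 by have [c' [h1 h2 _]] := point_rel_ex PsiM PsiE PsiSt PsiK0 ck; exists c'.
have tk c : c \in kb -> tau c \in kb by move=> /tauP[].
have tr c : c \in kb -> point_rel Psi c (tau c) by move=> /tauP[].
have uniq_ c c1 c2 := @point_rel_uniq Psi PsiM PsiI c c1 c2.
have [|||T TE] := lift_constants (tau := tau).
- move=> c c' ck ck'; apply: (uniq_ (c + c')); [exact: rpredD|apply: tk; exact: rpredD|by rewrite rpredD ?tk|apply: tr; exact: rpredD|].
 exact: (point_relD PsiM PsiE PsiSt PsiK0 ck ck' (tk _ ck) (tk _ ck') (tr _ ck) (tr _ ck')).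
- move=> c c' ck ck'; apply: (uniq_ (c * c')); [exact: rpredM|apply: tk; exact: rpredM|by rewrite rpredM ?tk|apply: tr; exact: rpredM|].
 exact: (point_relM PsiM PsiE PsiSt PsiI PsiK0 ck ck' (tk _ ck) (tk _ ck') (tr _ ck) (tr _ ck')).
- move=> _ [c _ <-]; have ck : j (i c) \in kb by exact: i_kb.
 by apply: (uniq_ (j (i c))) => //; [exact: tk|exact: tr|exact: point_rel_const].
exists T => z zK z0 s.
have TK x : x \in Kb -> T x \in Kb by exact: gal_j_Kb.
apply: (@known (fun z => Psi (T z))) => //.
- by move=> x x' s' xK xK' x0 x0'; rewrite rmorphM PsiM ?TK ?fmorph_eq0.
- by move=> x xK x0; apply: PsiE; rewrite ?TK ?fmorph_eq0.
- move=> x x' s' t xK xK' x0 x0' e; apply: PsiSt; rewrite ?TK ?fmorph_eq0 //.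
 by rewrite -rmorphD e rmorph1.
- move=> y c ck yc s'; have -> : T (j y - c) = j y - tau c by rewrite -TE // -{2}(gal_j T y) -rmorphB.
 apply: (tr c ck) => //.
 by apply: contraNneq yc => e; apply/eqP; apply: (fmorph_inj T); rewrite [RHS]TE // -e; exact: gal_j.
Qed.
End Main.
End RigidityTheorem.

(** * The effect of the groups H_t: Psi on K_0 *)

Section StageZero.
(** Constants of k are enlarged step by step with generators of K_0 as long as t stays
    transcendental; [exchange] makes the remaining generators algebraic over F(t). *)
Lemma coordinate_field (t : K0) : nonconstant i t -> exists F : set Om, [/\ subfield F, (forall x, alg_over F x -> F x),
 (forall c, c \in kb -> F c), ~ F (j t) & forall x, alg_over (fadj F (j t)) x].
move=> nt; have [n [x xg]] := fg.
have step (s : seq Om) : exists F : set Om, [/\ subfield F, (forall x, alg_over F x -> F x),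
 (forall c, c \in kb -> F c), ~ F (j t) & forall x, x \in s -> alg_over (fadj F (j t)) x].
 elim: s => [|z s [F [hF Falg kF Ft Fs]]].
 exists [set c | c \in kb]; split=> //; first exact: div_subfield.
 by move=> c; exact: kb_closed.
 by move=> /(kb_range) [c _ /(fmorph_inj j) e]; apply: nt; exists c.
 have nFt : ~ alg_over F (j t) by move=> /Falg.
 have [h|h] := pselect (alg_over (fadj F z) (j t)).
 exists F; split=> // w; rewrite inE => /orP[/eqP ->|/Fs //]; exact: exchange h.
 have hz := fadj_sub z hF.
 exists (alg_over (fadj F z)); split=> //; first exact: alg_subfield.
 - by move=> w; apply: alg_trans.
 - by move=> c ck; apply: alg_id => //; apply: fadj_incl => //; exact: kF.
 have hA := alg_subfield hz; have ht := fadj_sub (j t) hA.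
 move=> w; rewrite inE => /orP[/eqP ->|/Fs]; last first.
 apply: alg_mono; apply: (fadj_min ht); last exact: fadj_gen.
 by move=> v Fv; apply: fadj_incl => //; apply: alg_id => //; exact: fadj_incl.
 apply: alg_id => //; apply: fadj_incl => //; apply: alg_id => //; exact: fadj_gen.
have [F [hF Falg kF Ft Fs]] := step [seq j (x r) | r <- enum 'I_n]; exists F; split=> // z.
have ht := fadj_sub (j t) hF.
apply: (@alg_trans _ _ ht (range j)) (range_alg z) => _ [u _ <-].
apply: (fld_gen_sub (preim_subfield j (alg_subfield ht))) (xg u) => _ [[c _ <-]|[r _ <-]] /=.
 by apply: alg_id => //; apply: fadj_incl => //; apply: kF; exact: i_kb.
by apply: Fs; apply: map_f; rewrite mem_enum.
Qed.

Lemma span_Kb (F : set Om) : subfield F -> (forall c, c \in kb -> F c) ->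
 exists ds : seq Om, forall g h : gal F, {in ds, g =1 h} -> forall z, z \in Kb -> g z = h z.
move=> hF kF; have [n [x xg]] := fg; exists [seq j (x r) | r <- enum 'I_n] => g h gh.
have eq_sub : subfield [set z | g z = h z].
 split=> /= [|u v e e'|u v e e']; first by rewrite !rmorph1.
 by rewrite !rmorphB /= e e'.
 by rewrite !fmorph_div /= e e'.
have ck z : F z -> g z = h z by move=> Fz; have [_ _ ->] := galP g => //; have [_ _ ->] := galP h.
move=> z; apply: (fld_gen_sub eq_sub) => w [[u _ <-]|wk]; last by apply: ck; exact: kF.
apply: (fld_gen_sub (preim_subfield j eq_sub)) (xg u) => _ [[c _ <-]|[r _ <-]] /=.
 by apply: ck; apply: kF; exact: i_kb.
by apply: gh; apply: map_f; rewrite mem_enum.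
Qed.

Variables (as_ : seq k0) (Psi : Om -> GO -> 'F_l).
Hypotheses (uas : uniq as_).
Hypothesis PsiM : psi_multiplicative Psi.
Hypothesis PsiE : psi_kummer Psi.
Hypothesis PsiH : forall (t : K0) (s : GO), nonconstant i t -> (forall b, b \in as_ -> chi (j t - j (i b)) s = 0) -> Psi (j t) s = 0.

Let sh (t : K0) (e b : k0) := j t - j (i (b / e)).

Lemma nonconst_nz t b : nonconstant i t -> j t - j (i b) != 0.
by move=> nt; rewrite subr_eq0; apply/eqP => /(fmorph_inj j) e; apply: nt; exists b. Qed.

(** The kernel condition for e t in place of t; constants have trivial characters, so only the
    points move, from b to b / e. *)
Lemma Psi_span (t : K0) (e : k0) : nonconstant i t -> e != 0 ->
 exists c : k0 -> 'F_l, forall s, Psi (j t) s = \sum_(b <- as_) c b * chi (sh t e b) s.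
move=> nt e0; have net : nonconstant i (i e * t).
 move=> [c _ ce]; apply: nt; exists (c / e) => //; rewrite fmorph_div ce mulrC mulKf // fmorph_eq0.
 by [].
have jk c : j (i c) \in kb by exact: i_kb.
have shE b : j (i e * t) - j (i b) = j (i e) * sh t e b by rewrite /sh mulrBr -!rmorphM /= [e * _]mulrC divfK.
have ie0 : j (i e) != 0 by rewrite !fmorph_eq0.
have shK b : sh t e b \in Kb by rewrite rpredB ?j_Kb.
have e1 s : Psi (j (i e * t)) s = Psi (j t) s.
 have jt0 : j t != 0 by have := nonconst_nz 0 nt; rewrite !rmorph0 subr0.
 by rewrite rmorphM PsiM ?j_Kb // (PsiC PsiM s (jk e) ie0) add0r.
have e2 b s : chi (j (i e * t) - j (i b)) s = chi (sh t e b) s by rewrite shE (chiM pl l0) ?j_Kb ?nonconst_nz // (chiC s (jk e) ie0) add0r.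
have jt0 : j t != 0 by have := nonconst_nz 0 nt; rewrite !rmorph0 subr0.
have [w [wK w0 Pw]] := PsiE (j_Kb i j t) jt0.
have [s t'|b s t'|s hs|c cP] := @hom_span GO l k0 as_ (fun b => chi (sh t e b)) (Psi (j t)) pl uas.
- by rewrite !Pw (chi_mul pl l0).
- by rewrite (chi_mul pl l0) ?nonconst_nz.
- by rewrite -e1; apply: PsiH => // b ba; rewrite e2; exact: hs.
by exists c.
Qed.

Hypothesis zero_as : 0 \in as_.

(** If a nonzero b had a nonzero coefficient, infinitely many products of powers of the t - b/e
    would lie in one l-th power class of K. Since K has finitely many generators, two of them would
    agree in F(t) up to l-th powers, contradicting the multiplicity of a zero. *)
Lemma Psi_line (t : K0) : nonconstant i t -> exists n : 'F_l, forall s, Psi (j t) s = n * chi (j t) s.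
move=> nt; have [Vs VsP] := choices (nseq (size as_) (enum 'F_l)).
pose cv (v : seq 'F_l) b := nth 0 v (index b as_).
pose R (e : k0) (v : seq 'F_l) := forall s, Psi (j t) s = \sum_(b <- as_) cv v b * chi (sh t e b) s.
have inf' : infinite_set ([set: k0] `\` [set 0]) by apply: infinite_setD => //; exact: finite_set1.
(* There are finitely many coefficient vectors, so one of them serves infinitely many e. *)
have [e [_ /eqP e0]|v vV infE] := @infinite_fiber _ _ _ Vs R inf'.
 have [c cP] := Psi_span nt e0; exists [seq c b | b <- as_].
 apply: VsP; rewrite ?size_map ?size_nseq // => n ln x0; rewrite nth_nseq ln.
 by rewrite mem_enum.
 move=> s; rewrite cP !big_seq; apply: eq_bigr => b ba; congr (_ * _).
 by rewrite /cv (nth_map 0) ?index_mem // nth_index.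
set E := [set e | _] in infE.
have [c0|ne] := pselect (forall b, b \in as_ -> b != 0 -> cv v b = 0).
 have [e [_ eR]] := infinite_nonempty infE; exists (cv v 0) => s; rewrite eR (bigD1_seq 0) //=.
 rewrite big_seq_cond big1 ?addr0 /sh ?mul0r ?rmorph0 ?subr0 // => b /andP[ba b0].
 by rewrite c0 // mul0r.
have [b0 [b0a b00 cb0]] : exists b0, [/\ b0 \in as_, b0 != 0 & cv v b0 != 0].
 apply: contrapT => none; apply: ne => b ba b0; apply/eqP; apply: contraT => h.
 by case: none; exists b.
exfalso; have [F [hF Falg kF Ft Phialg]] := coordinate_field nt.
have hT := fadj_sub (j t) hF.
pose T e := \prod_(b <- as_) sh t e b ^+ (cv v b : nat).
have shK e b : sh t e b \in Kb by rewrite rpredB ?j_Kb.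
have sh0 e b : sh t e b != 0 by exact: nonconst_nz.
have TK e : T e \in Kb by apply: rpred_prod => b _; rewrite rpredX.
have T0 e : T e != 0 by rewrite prodf_seq_neq0; apply/allP => b _; rewrite expf_neq0.
have TF e : fadj F (j t) (T e).
 apply: (sub_prod hT) => b _; apply: (subX hT); apply: (subB hT); first exact: fadj_gen.
 by apply: fadj_incl => //; apply: kF; exact: i_kb.
have chiT e s : chi (T e) s = \sum_(b <- as_) cv v b * chi (sh t e b) s.
 rewrite /T; elim: as_ => [|b bs IH]; first by rewrite !big_nil (chi1 pl l0).
 have PK : \prod_(b' <- bs) sh t e b' ^+ (cv v b' : nat) \in Kb by apply: rpred_prod => b' _; rewrite rpredX.
 have P0 : \prod_(b' <- bs) sh t e b' ^+ (cv v b' : nat) != 0 by rewrite prodf_seq_neq0; apply/allP => b' _; rewrite expf_neq0.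
 by rewrite !big_cons (chiM pl l0) ?rpredX ?expf_neq0 // IH (chiX pl l0) // -mulr_natl -(Fl_nat (cv v b)).
have [e0 [_ R0]] := infinite_nonempty infE.
have /choice [be beP] : forall e, exists b, E e -> b \in Kb /\ b ^+ l = T e / T e0.
 move=> e; have [[_ Re]|nE] := pselect (E e); last by exists 0.
 have [|||b bK bE] := @chi_trivial l k0 K0 i Om j pl l0 (T e / T e0); last by exists b.
 - by rewrite rpred_div.
 - by rewrite mulf_neq0 ?invr_eq0.
 - by move=> s; rewrite (chiM pl l0) ?(chiV pl l0) ?rpredV ?invr_eq0 // !chiT -Re -R0 subrr.
have [ds dsP] := span_Kb hF kF.
have dsP' (g h : gal (fadj F (j t))) : {in ds, g =1 h} -> forall z, z \in Kb -> g z = h z.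
 have [g' gE] := @gal_weaken _ F _ g (fadj_incl (j t) hF); have [h' hE] := @gal_weaken _ F _ h (fadj_incl (j t) hF).
 by move=> gh z zK; rewrite -gE -hE; apply: dsP => // x xd; rewrite gE hE; exact: gh.
have [L LP] := @orbit_seqs Om (fadj F (j t)) setT ds (fun x _ => let: ex_intro r h := finite_orbit (Phialg x) in ex_intro _ r (fun h' _ => h h')).
have /choice [gr grP] : forall r : seq Om, exists g : gal (fadj F (j t)), forall h : gal (fadj F (j t)), [seq h x | x <- ds] = r -> [seq g x | x <- ds] = r.
 move=> r; have [[g gE]|none] := pselect (exists g : gal (fadj F (j t)), [seq g x | x <- ds] = r); first by exists g.
 by exists 1%g => h hr; case: none; exists h.
(* The behaviour of [be e] under Gal(F(t)) is given by l-th roots of unity on finitely many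
   representatives, hence is the same for infinitely many e. *)
have [Ws WsP] := choices (nseq (size L) [seq z_ ^+ k | k <- iota 0 l]).
pose N e := [seq gr r (be e) / be e | r <- L].
have zp := zeta_prim l0.
have b0' e : E e -> be e != 0.
 move=> Ee; have [_ h] := beP e Ee; apply: contraTneq (T0 e) => z; move: h; rewrite z expr0n gtn_eqF ?prime_gt0 //.
 by move/esym/eqP; rewrite mulf_eq0 invr_eq0 (negbTE (T0 e0)) orbF negbK.
have [e Ee|w wW infE'] := @infinite_fiber _ _ E Ws (fun e w => N e = w) infE.
 exists (N e) => //; apply: WsP; rewrite ?size_map ?size_nseq // => n ln x0.
 rewrite nth_nseq ln (nth_map [::]) //.
 have [bK bE] := beP e Ee; have [|k kl ->] := @kummer_conj Om l z_ zp _ (gr (nth [::] L n)) (be e).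
 by rewrite bE; apply: (sub_div hT); exact: TF.
 by rewrite mulfK ?b0' //; apply: map_f; rewrite mem_iota.
have [e [Ee Ne]] := infinite_nonempty infE'.
(* This choice of e' ensures that no b / e' equals b0 / e, the zero examined below. *)
have [e' [[Ee' Ne'] bad]] : exists e', (E e' /\ N e' = w) /\ ~ (e' \in [seq e * b / b0 | b <- as_]).
 have := @infinite_setD _ _ [set e' | e' \in [seq e * b / b0 | b <- as_]] infE' (finite_seq _).
 by move=> /infinite_nonempty [e' [h1 h2]]; exists e'.
have be0 := b0' _ Ee; have be0' := b0' _ Ee'.
have fixb (g : gal (fadj F (j t))) : g (be e / be e') = be e / be e'.
 have gL : [seq g x | x <- ds] \in L by exact: LP.
 have gE z : z \in Kb -> g z = gr [seq g x | x <- ds] z.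
 apply: dsP' => x /(nthP 0) [n ln <-]; have := congr1 (fun s : seq Om => s`_n) (grP _ g erefl).
 by rewrite !(nth_map 0).
 have : gr [seq g x | x <- ds] (be e) / be e = gr [seq g x | x <- ds] (be e') / be e'.
 move: gL => /(nthP [::]) [n ln <-]; have := congr1 (fun s : seq Om => s`_n) (etrans Ne (esym Ne')).
 by rewrite /N !(nth_map [::]).
 rewrite -!gE ?(beP _ Ee).1 ?(beP _ Ee').1 // => h; rewrite fmorph_div /=.
 apply/eqP; rewrite eqr_div ?fmorph_eq0 //; apply/eqP.
 move/eqP: h; rewrite eqr_div // => /eqP ->; exact: mulrC.
have [q [q0 cq [A [B [AF BF qE]]]]] := fixed_power hT pl l0 (Phialg _) fixb.
have B0 : B.[j t] != 0.
 apply: contraTneq (expf_neq0 q (mulf_neq0 be0 (invr_neq0 be0'))) => z.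
 by rewrite qE z invr0 mulr0 eqxx.
have A0 : A.[j t] != 0.
 apply: contraTneq (expf_neq0 q (mulf_neq0 be0 (invr_neq0 be0'))) => z.
 by rewrite qE z mul0r eqxx.
pose Tp e := \prod_(b <- as_) ('X - (j (i (b / e)))%:P) ^+ (cv v b : nat).
have TpE e1 : (Tp e1).[j t] = T e1 by rewrite horner_prod; apply: eq_bigr => b _; rewrite horner_exp hornerXsubC.
have TpF e1 : coefs F (Tp e1).
 apply: (@big_ind _ (coefs F)) => [|u w'|b _].
 - exact: (coefsC hF (sub1 hF)).
 - exact: coefsM.
 elim: (cv v b : nat) => [|n IH]; first by rewrite expr0; exact: (coefsC hF (sub1 hF)).
 rewrite exprS; apply: coefsM => //; apply: coefsB => //; first exact: coefsX.
 by apply: coefsC => //; apply: kF; exact: i_kb.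
have XF n (p : {poly Om}) : coefs F p -> coefs F (p ^+ n) by move=> pF; elim: n => [|n IH]; rewrite ?expr0 ?exprS; [exact: (coefsC hF (sub1 hF))|exact: coefsM].
have pE : Tp e ^+ q * B ^+ l = Tp e' ^+ q * A ^+ l.
 apply/eqP; rewrite -subr_eq0; apply/eqP; apply: (transc_poly Falg Ft).
 by apply: (coefsB hF); apply: (coefsM hF); apply: XF.
 rewrite hornerD hornerN !hornerM !horner_exp !TpE; apply/eqP; rewrite subr_eq0.
 have e1 : T e / T e' = (be e / be e') ^+ l by rewrite expr_div_n (beP _ Ee).2 (beP _ Ee').2 invf_div mulrA divfK.
 by rewrite [X in _ == X]mulrC -eqr_div ?expf_neq0 ?T0 // -!expr_div_n -qE e1 -!exprM mulnC.
have xt0 (p : {poly Om}) : p.[j t] != 0 -> p != 0 by apply: contraNneq => ->; rewrite horner0.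
have T0p e1 : Tp e1 != 0 by apply: xt0; rewrite TpE.
have A0p := xt0 _ A0; have B0p := xt0 _ B0.
pose al := j (i (b0 / e)).
have mupX n (p : {poly Om}) : p != 0 -> mup al (p ^+ n) = (n * mup al p)%N.
 move=> p0; elim: n => [|n IH]; first by rewrite expr0 mul0n mupNroot // rootC oner_eq0.
 by rewrite exprS mupM ?expf_neq0 // IH mulSn.
have e0' : e != 0 by case: Ee => -[_ /eqP].
have e0'' : e' != 0 by case: Ee' => -[_ /eqP].
have mT e1 : mup al (Tp e1) = (\sum_(b <- as_) if (b / e1 == b0 / e)%R then (cv v b : nat) else 0)%N.
 rewrite /Tp; elim: as_ => [|b bs IH]; first by rewrite !big_nil mupNroot // rootC oner_eq0.
 rewrite !big_cons mupM ?expf_neq0 ?polyXsubC_eq0 //; last first.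
 by rewrite prodf_seq_neq0; apply/allP => b' _; rewrite expf_neq0 // polyXsubC_eq0.
 by rewrite IH mup_XsubCX /al !(inj_eq (fmorph_inj _)).
have m1 : mup al (Tp e) = (cv v b0 : nat).
 rewrite mT (bigD1_seq b0) //= eqxx big1 ?addn0 // => b bb.
 by rewrite (inj_eq (mulIf _)) ?invr_eq0 // (negbTE bb).
have m2 : mup al (Tp e') = 0%N.
 rewrite mT big_seq big1 // => b ba; case: eqP => // eq; case: bad; apply/mapP; exists b => //.
 move/eqP: eq; rewrite eqr_div // => /eqP eq; apply: (mulIf b00); rewrite divfK // mulrC -eq; exact: mulrC.
have := congr1 (mup al) pE; rewrite !mupM ?expf_neq0 // !mupX // m1 m2 muln0 add0n => h.
have : (l %| q * (cv v b0 : nat) + l * mup al B)%N by rewrite h dvdn_mulr.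
rewrite (dvdn_addl _ (dvdn_mulr _ (dvdnn l))) Gauss_dvdr 1?coprime_sym // => dv.
have lt : ((cv v b0 : nat) < l)%N by have := ltn_ord (cv v b0); rewrite [X in (_ < X)%N]Fp_cast.
by move/eqP: cb0; apply; rewrite (Fl_nat (cv v b0)) [X in X%:R](eqP (_ : _ == 0%N)) // -leqn0 leqNgt; apply/negP => pos; have := dvdn_leq pos dv; rewrite leqNgt lt.
Qed.

(** Comparison of t, t0 and t t0: the factors agree if the characters of t and t0 are independent;
    otherwise t is a power of t0 times an l-th power. *)
Lemma Psi_scalar (t0 : K0) (s0 : GO) : nonconstant i t0 -> chi (j t0) s0 != 0 ->
 exists n : 'F_l, forall t : K0, t != 0 -> forall s, Psi (j t) s = n * chi (j t) s.
move=> nt0 c0; have [n nP] := Psi_line nt0; exists n => t tn0 s.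
have jt0 : j t != 0 by rewrite fmorph_eq0.
have nz (u : K0) : nonconstant i u -> j u != 0 by move=> /(nonconst_nz 0); rewrite !rmorph0 subr0.
have jt00 := nz _ nt0.
have const (u : K0) : ~ nonconstant i u -> u != 0 -> forall s, Psi (j u) s = 0 /\ chi (j u) s = 0.
 move=> /contrapT [c _ <-] u0 s1; have ic : j (i c) != 0 by rewrite fmorph_eq0.
 by split; [exact: (PsiC PsiM s1 (i_kb i j c) ic)|exact: (chiC s1 (i_kb i j c) ic)].
have [nt|ct] := pselect (nonconstant i t); last first.
 by have [-> ->] := const _ ct tn0 s; rewrite mulr0.
have PM s1 : Psi (j (t * t0)) s1 = Psi (j t) s1 + Psi (j t0) s1 by rewrite rmorphM PsiM ?j_Kb.
have CM s1 : chi (j (t * t0)) s1 = chi (j t) s1 + chi (j t0) s1 by rewrite rmorphM (chiM pl l0) ?j_Kb.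
have tt0 : t * t0 != 0 by rewrite mulf_neq0 // -(fmorph_eq0 j).
have [ntt|ctt] := pselect (nonconstant i (t * t0)); last first.
 have [] := const _ ctt tt0 s; rewrite PM CM nP => /eqP; rewrite addr_eq0 => /eqP -> /eqP.
 by rewrite addr_eq0 => /eqP ->; rewrite mulrN.
have [m mP] := Psi_line nt; have [p pP] := Psi_line ntt.
have rel s1 : (p - m) * chi (j t) s1 = (n - p) * chi (j t0) s1.
 have e := pP s1; rewrite PM CM mP nP mulrDr in e.
 have pa : p * chi (j t) s1 = m * chi (j t) s1 + n * chi (j t0) s1 - p * chi (j t0) s1 by rewrite e addrK.
 by rewrite !mulrBl pa [LHS](AC (((1*1)*1)*1) ((1*4)*(2*3))) /= subrr add0r.
have [pm|pm] := eqVneq p m.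
 have := rel s0; rewrite pm subrr mul0r => /esym/eqP; rewrite mulf_eq0 (negbTE c0) orbF subr_eq0 => /eqP nm.
 by rewrite mP nm.
pose r := (n - p) / (p - m).
have cr s1 : chi (j t) s1 = r * chi (j t0) s1.
 have pm0 : p - m != 0 by rewrite subr_eq0.
 by apply: (mulfI pm0); rewrite rel /r mulrA [(p - m) * _]mulrC divfK.
have rK : j t / j t0 ^+ (r : nat) \in Kb by rewrite rpred_div ?rpredX ?j_Kb.
have r0 : j t / j t0 ^+ (r : nat) != 0 by rewrite mulf_neq0 ?invr_eq0 ?expf_neq0.
have [s1|b bK bE] := chi_trivial pl l0 rK r0.
 rewrite (chiM pl l0) ?(chiV pl l0) ?rpredV ?rpredX ?invr_eq0 ?expf_neq0 ?j_Kb //.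
 by rewrite (chiX pl l0) ?j_Kb // cr -mulr_natl -(Fl_nat r) subrr.
have b0 := expf_nz pl bE r0.
have : Psi (j t / j t0 ^+ (r : nat)) s = 0 by rewrite -bE (PsiX PsiM) // Fl_char.
rewrite PsiM ?(PsiV PsiM) ?rpredV ?rpredX ?invr_eq0 ?expf_neq0 ?j_Kb //.
rewrite (PsiX PsiM) ?j_Kb // -mulr_natl -(Fl_nat r) => /eqP; rewrite subr_eq0 => /eqP ->.
by rewrite nP cr mulrCA.
Qed.
End StageZero.

(** * Etale covers of the punctured line and Kummer theory *)

Section EtaleQuotient.
Variables (a : seq k0) (t : K0).
Hypothesis nt : nonconstant i t.

Notation UA := (Ua_ring i j a t).
Notation x := (Ua_point i j a t).
Notation AO := [set z : Om | z \in UA].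
Notation S := (gal AO).
Notation pi := (pi1 x).

Lemma UA_kb c : c \in kb -> c \in UA.
by move=> ck; apply: ring_gen_incl; left; left. Qed.

Lemma UA_t : j t \in UA. by apply: ring_gen_incl; left; right; left. Qed.

Lemma UA_inv b : b \in 0 :: a -> (j t - j (i b))^-1 \in UA.
rewrite inE => /orP[/eqP ->|ba]; apply: ring_gen_incl; last by right; exists b.
by left; right; right; rewrite !rmorph0 subr0.
Qed.

Lemma AO_K z : z \in UA -> z \in Kb.
by move=> zU; exact: (@Ua_ring_sub _ _ i _ j a t (SRing zU)). Qed.

Lemma UA_sub (M : set Om) z : M 1 -> (forall y w, M y -> M w -> M (y - w)) -> (forall y w, M y -> M w -> M (y * w)) ->
 (forall c, c \in kb -> M c) -> M (j t) -> (forall b, b \in 0 :: a -> M (j t - j (i b))^-1) -> z \in UA -> M z.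
move=> M1 MB MM Mk Mt Mb; apply: ring_gen_sub => // w [[wk|[->|->]]|[b ba ->]] //; first exact: Mk.
 by have := Mb 0 (mem_head _ _); rewrite !rmorph0 subr0.
by apply: Mb; rewrite inE ba orbT.
Qed.

Lemma x_AO (u : sring UA) : AO (x u). exact: sr_valP. Qed.

Definition pg (h : S) : pi := pi1_of_gal x_AO h.

Lemma pgM g h : pg (g * h)%g = (pg g * pg h)%g. by apply/pi1P => B f; apply: fibreP. Qed.
Lemma pg1 : pg 1%g = 1%g. by apply/pi1P => B f; apply: fibreP. Qed.
Lemma pgV h : pg h^-1%g = (pg h)^-1%g. by apply/pi1P => B f; apply: fibreP. Qed.
Lemma pgX h n : pg (h ^+ n)%g = (pg h ^+ n)%g.
by elim: n => [|n IH]; rewrite ?expg0 ?pg1 // !expgS pgM IH. Qed.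

(** The ring generated in Om by all points of finite etale algebras; it plays the part of the
    universal cover of the punctured line. *)
Definition PP : set Om := [set z | z \in ring_gen (AO `|` [set z : Om | exists (B : fet_alg (sring UA)) (f : fibre x B) (b : B), z = sval f b])].

Lemma PP_sub (M : set Om) z : M 1 -> (forall y w, M y -> M w -> M (y - w)) -> (forall y w, M y -> M w -> M (y * w)) ->
 AO `<=` M -> (forall (B : fet_alg (sring UA)) (f : fibre x B) (b : B), M (sval f b)) -> PP z -> M z.
by move=> M1 MB MM AM fM; apply: ring_gen_sub => // w [/AM //|[B [f [b ->]]]].
Qed.

Lemma PP_gal (g : S) z : PP z -> PP (g z).
apply: (@PP_sub [set z | PP (g z)]) => /= [|y w|y w|y Ay|B f b].
- by rewrite rmorph1; exact: rpred1.
- by rewrite rmorphB; exact: rpredB.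
- by rewrite rmorphM; exact: rpredM.
- by have [_ _ h] := galP g; rewrite /= h //; apply: ring_gen_incl; left.
- by apply: ring_gen_incl; right; exists B, (gal_fibre x_AO g f), b.
Qed.

Lemma fibre_root (B : fet_alg (sring UA)) (f : fibre x B) b : exists p, [/\ coefs AO p, p \is monic & root p (sval f b)].
have [p pm pb] := finite_root (fet_finite B) b (svalP f); exists (map_poly x p); split=> //; last exact: monic_map.
by move=> n; rewrite coef_map; exact: x_AO.
Qed.

Notation kt := (fadj [set c : Om | c \in kb] (j t)).
Let hk : subfield [set c : Om | c \in kb]. exact: div_subfield. Qed.
Let hkt : subfield kt. exact: fadj_sub. Qed.

Lemma AO_kt : AO `<=` kt.
move=> z; apply: UA_sub.
- exact: sub1.
- by move=> *; exact: subB.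
- by move=> *; exact: subM.
- by move=> c ck; exact: fadj_incl.
- exact: fadj_gen.
- move=> b _; apply: (subV hkt); apply: (subB hkt); first exact: fadj_gen.
 by apply: fadj_incl => //; exact: i_kb.
Qed.

Lemma PP_alg z : PP z -> alg_over kt z.
have hA := alg_subfield hkt; apply: PP_sub.
- exact: sub1.
- by move=> *; exact: (subB hA).
- by move=> *; exact: (subM hA).
- by move=> y /AO_kt; exact: alg_id.
- move=> B f b; have [p [pA pm pb]] := fibre_root f b; exists p; split=> //; last exact: monic_neq0.
 by move=> n; exact/AO_kt/pA.
Qed.

(** At a point c that is not removed, an inertia element keeps the reduction of every point of an
    etale algebra, hence fixes the point by [unramified], while it moves the l-th root of t - c. *)
Lemma notbad_inertia (c : Om) : c \in kb -> (forall b, b \in 0 :: a -> c != j (i b)) ->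
 exists (P : set (Om * Om)) (g : S), [/\ place P, (forall d, d \in kb -> P (d, d)), P (j t, c),
 (forall z q, P (z, q) -> P (g z, q)) & (forall z, PP z -> g z = z) /\ g (lroot l (j t - c)) = z_ * lroot l (j t - c)].
move=> ck good; have [F [hF Falg kF Ft tAlg]] := coordinate_field nt.
have nF : ~ alg_over F (j t) by move=> /Falg.
have [P [pP tP Pt]] := place_at c hF nF; have hP := pl_hg pP.
have Finf : infinite_set F by apply: sub_infinite_set (@inf_const _ _ i _ j inf0) => _ [d _ <-]; apply: kF; exact: i_kb.
have [g [gP gr]] := inertia_line pl l0 hF Falg Finf Ft tAlg (kF c ck) pP tP Pt.
have hT := fadj_sub (j t) hF.
have AT : AO `<=` fadj F (j t).
 move=> z /AO_kt; apply: (fadj_min hT); last exact: fadj_gen.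
 by move=> w wk; apply: fadj_incl => //; exact: kF.
have [g' gE] := gal_weaken g AT; exists P, g'; split=> //.
- by move=> d dk; apply: tP; exact: kF.
- by move=> z q; rewrite gE; exact: gP.
split; last by rewrite gE.
have xP (u : sring UA) : exists q, P (x u, q).
 apply: (@UA_sub [set z | exists q, P (z, q)]) (sr_valP u).
 - by exists 1; exact: hg1.
 - by move=> y w [q h] [q' h']; exists (q - q'); exact: hgB.
 - by move=> y w [q h] [q' h']; exists (q * q'); exact: hgM.
 - by move=> d dk; exists d; apply: tP; exact: kF.
 - by exists c.
 - move=> b ba; exists (c - j (i b))^-1; apply: (plV pP); last by rewrite subr_eq0; exact: good.
 by apply: (hgB hP) => //; apply: tP; apply: kF; exact: i_kb.
move=> z; apply: (@PP_sub [set z | g' z = z]) => [|y w /= ey ew|y w /= ey ew|y Ay|B f b] /=.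
- exact: rmorph1.
- by rewrite rmorphB /= ey ew.
- by rewrite rmorphM /= ey ew.
- by have [_ _ h] := galP g'; exact: h.
have e : sval f =1 (g' \o sval f : {rmorphism B -> Om}).
 apply: (unramified (@fet_etale _ B) (@fet_finite _ B) pP (svalP f) _ xP).
 by move=> u /=; have [_ _ gA] := galP g'; rewrite (svalP f) gA //; exact: x_AO.
 by move=> b' q h /=; rewrite gE; exact: gP.
by rewrite [RHS]e.
Qed.

(** Up to exponents prime to l, al is an l-th root of a polynomial in t. Inertia shows that its
    zeros outside the removed points have multiplicity divisible by l, so its character is a
    combination of those of t - b. *)
Lemma D1_eigen (s : GO) al : (forall b, b \in 0 :: a -> chi (j t - j (i b)) s = 0) -> PP al ->
 (forall g : S, exists k, g al = z_ ^+ k * al) -> s al = al.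
move=> sb Pal eig; have [->|al0] := eqVneq al 0; first exact: rmorph0.
have zp := zeta_prim l0; have zk : z_ \in kb by exact: zeta_kb.
have lgt : (0 < l)%N := prime_gt0 pl.
have wS (F' : set Om) (g : gal F') : AO `<=` F' -> exists k, g al = z_ ^+ k * al by move=> /(gal_weaken g) [g' gE]; have [k kE] := eig g'; exists k; rewrite -gE.
have [|g|q [q0 cq [p [r [pk rk qE]]]]] := @fixed_power _ kt (al ^+ l) l hkt pl l0.
- exact: (subX (alg_subfield hkt)) (PP_alg Pal).
- have [k kE] := wS _ g AO_kt; rewrite rmorphXn /= kE exprMn -exprM mulnC exprM (prim_expr_order zp).
 by rewrite expr1n mul1r.
have r0 : r.[j t] != 0.
 apply: contraTneq (expf_neq0 q (expf_neq0 l al0)) => z; by rewrite qE z invr0 mulr0 eqxx.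
have rK : r.[j t] \in Kb by apply: (sub_horner (div_subfield Kb)) => [n|]; [apply: kb_Kb; exact: rk|exact: j_Kb].
(* Multiplying by the denominator makes the l-th power the polynomial value h(t). *)
pose rho := al ^+ q * r.[j t]; pose h := p * r ^+ l.-1.
have rhoE : rho ^+ l = h.[j t].
 rewrite /rho exprMn -exprM mulnC exprM qE /h hornerM horner_exp.
 have -> : r.[j t] ^+ l = r.[j t] * r.[j t] ^+ l.-1 by rewrite -exprS prednK.
 by rewrite mulrA divfK.
have rho0 : rho != 0 by rewrite mulf_neq0 ?expf_neq0.
have h0 : h != 0 by apply: contraNneq (expf_neq0 l rho0) => h0; rewrite rhoE h0 horner0.
have hk' : coefs [set c : Om | c \in kb] h.
 apply: coefsM => //; elim: l.-1 => [|n IH]; rewrite ?expr0 ?exprS.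
 exact: (coefsC hk (sub1 hk)).
 exact: coefsM.
have [rs hE] := closed_field_poly_normal h; set ld := lead_coef h in hE.
have ldk : ld \in kb by rewrite /ld lead_coefE; exact: hk'.
have ld0 : ld != 0 by rewrite lead_coef_eq0.
have rsk v : v \in rs -> v \in kb.
 move=> vr; apply: kb_closed; exists h; split=> //.
 by rewrite hE rootZ // root_prod_XsubC.
have nzk v : v \in kb -> j t - v != 0.
 move=> vk; rewrite subr_eq0; apply/eqP => e; have [c _ ce] : range (j \o i) (j t) by apply: kb_range; rewrite e.
 by apply: nt; exists c => //; exact: (fmorph_inj j ce).
have htE : h.[j t] = ld * \prod_(v <- rs) (j t - v) by rewrite {1}hE hornerZ horner_prod; congr (_ * _); apply: eq_bigr => v _; rewrite hornerXsubC.
have Kv v : v \in rs -> j t - v \in Kb by move=> /rsk vk; rewrite rpredB ?j_Kb ?kb_Kb.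
have cnt c : c \in rs -> (forall b, b \in 0 :: a -> c != j (i b)) -> (l %| count_mem c rs)%N.
 move=> cr good; have ck := rsk c cr; have [P [g [pP kP Pt gi [gP gr]]]] := notbad_inertia ck good.
 have hP := pl_hg pP; set m := count_mem c rs; pose be := lroot l (j t - c).
 have be0 : be != 0 by apply: (lroot_nz pl); exact: nzk.
 pose h1 := ld * \prod_(v <- rs | v != c) (j t - v).
 have hm : h.[j t] = (j t - c) ^+ m * h1.
 rewrite htE (bigID (fun v => v == c)) /= mulrCA; congr (_ * _).
 rewrite (eq_bigr (fun _ => j t - c)) => [|v /eqP -> //].
 by rewrite big_const_seq iter_mulr_1; congr (_ ^+ _); apply: eq_count => v; rewrite andbC.
 have grho : g rho = rho.
 have [_ _ gA] := galP g; rewrite /rho rmorphM rmorphXn /= (gP _ Pal); congr (_ * _).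
 apply: gA; apply: (@UA_sub AO) => //; [exact: rpred1|exact: rpredB|exact: rpredM|exact: UA_kb|exact: UA_t|exact: UA_inv|].
 by rewrite rpred_horner ?UA_t //; apply/polyOverP => n; apply: UA_kb; exact: rk.
 pose w := rho / be ^+ m.
 have wl : w ^+ l = h1.
 rewrite expr_div_n rhoE -exprM mulnC exprM (lrootP pl) hm mulrC mulKf //.
 by rewrite expf_neq0 // nzk.
 have w0 : w != 0 by rewrite mulf_neq0 ?invr_eq0 ?expf_neq0.
 have uh : punit P h1.
 exists (ld * \prod_(v <- rs | v != c) (c - v)).
 rewrite mulf_neq0 // prodf_seq_neq0; apply/allP => v _; apply/implyP; by rewrite subr_eq0 eq_sym.
 apply: (hgM hP); first exact: kP.
 rewrite -!(big_filter _ (fun v => v != c)) big_seq [X in P (_, X)]big_seq.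
 have : forall v, v \in [seq v <- rs | v != c] -> v \in kb by move=> v; rewrite mem_filter => /andP[_ /rsk].
 rewrite -!big_seq; elim: [seq v <- rs | v != c] => [|v vs IH] vk; first by rewrite !big_nil; exact: hg1.
 rewrite !big_cons; apply: (hgM hP); last by apply: IH => v' v's; apply: vk; rewrite inE v's orbT.
 by apply: (hgB hP) => //; apply: kP; apply: vk; exact: mem_head.
 have [w1 w10 Pw] : punit P w by apply: (punit_root pP lgt w0); rewrite wl.
 have gw : g w = w / z_ ^+ m by rewrite /w rmorphM fmorphV rmorphXn /= grho gr exprMn invfM mulrA mulrAC.
 have zmk : (z_ ^+ m)^-1 \in kb by rewrite rpredV rpredX.
 have := gi _ _ Pw; rewrite gw => h2; have := hg_fun hP h2 (hgM hP Pw (kP _ zmk)).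
 rewrite -[X in X = _]mulr1 => /(mulfI w10) => /esym/eqP; rewrite invr_eq1 => e.
 by rewrite (prim_order_dvd zp).
have chh : chi h.[j t] s = 0.
 have sp vs : {subset vs <= rs} -> chi (\prod_(v <- vs) (j t - v)) s = \sum_(v <- vs) chi (j t - v) s.
 elim: vs => [|v vs IH] sub; first by rewrite !big_nil (chi1 pl l0).
 have sub' : {subset vs <= rs} by move=> w ws; apply: sub; rewrite inE ws orbT.
 have vr := sub v (mem_head _ _).
 rewrite !big_cons (chiM pl l0) ?IH ?Kv ?nzk ?rsk //.
 by rewrite big_seq; apply: rpred_prod => w /sub'; exact: Kv.
 by rewrite prodf_seq_neq0; apply/allP => w /sub' /rsk; exact: nzk.
 rewrite htE (chiM pl l0) ?(kb_Kb ldk) ?(chiC s ldk ld0) ?add0r //; last 2 first.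
 - by rewrite big_seq; apply: rpred_prod => w; exact: Kv.
 - by rewrite prodf_seq_neq0; apply/allP => w /rsk; exact: nzk.
 rewrite sp // -big_undup_iterop_count big_seq big1 // => v; rewrite mem_undup => vr.
 have [[b ba vb]|nb] := pselect (exists2 b, b \in 0 :: a & v = j (i b)).
 by rewrite vb sb // -[iterop _ _ _ _]/(0 *+ _) mul0rn.
 have [|m ->] := dvdnP (cnt v vr _).
 by move=> b ba; apply/eqP => e; apply: nb; exists b.
 by rewrite -[iterop _ _ _ _]/(_ *+ _) mulnC mulrnA Fl_char // mul0rn.
have hK : h.[j t] \in Kb by rewrite -rhoE rhoE; apply: (sub_horner (div_subfield Kb)) => [n|]; [apply: kb_Kb; exact: hk'|exact: j_Kb].
have ht0 : h.[j t] != 0 by rewrite -rhoE expf_neq0.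
have srho : s rho = rho by apply/(chi_fix pl l0 s hK ht0 rhoE).
have [_ _ sK] := galP s; have [k kE] := wS _ s (fun z zA => AO_K zA).
have : s (al ^+ q) = al ^+ q by apply: (mulIf r0); move: srho; rewrite /rho rmorphM /= (sK _ rK).
rewrite rmorphXn /= kE exprMn -exprM -[X in _ = X]mul1r => /(mulIf (expf_neq0 q al0)) /eqP.
rewrite -(prim_order_dvd zp) Gauss_dvdl 1?coprime_sym // (prim_order_dvd zp) => /eqP ->.
by rewrite mul1r.
Qed.

(** For a closed subgroup containing commutators and l-th powers, its fixed elements in [PP] are
    sums of eigenvectors, which s fixes by [D1_eigen]; [krull_density] then approximates s by
    elements of the subgroup. *)
Theorem etale_kernel (s : GO) : (forall b, b \in 0 :: a -> chi (j t - j (i b)) s = 0) ->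
 G2 pi l (pi1_of_gal (@Ua_ring_sub _ _ i _ j a t) s).
move=> sb H' [[H1 HM HV] cH SH]; apply: contrapT => nH; set u := pi1_of_gal _ s in nH.
(* Finitely many module generators control the action on a point of an etale algebra. *)
have /choice [fr frP] : forall p : {B : fet_alg (sring UA) & fibre x B}, exists r : seq Om, (forall z, z \in r -> PP z) /\
 forall h : S, {in r, h =1 s} -> forall b, h (sval (tagged p) b) = s (sval (tagged p) b).
 move=> [B f] /=; have [n [e eP]] := @fet_finite _ B; exists [seq sval f (e m) | m <- enum 'I_n]; split.
 by move=> _ /mapP [m _ ->]; apply: ring_gen_incl; right; exists B, f, (e m).
 move=> h hs b; have [c ->] := eP b; rewrite !rmorph_sum; apply: eq_bigr => m _; rewrite !rmorphM.
 have -> : sval f (fet_str B (c m)) = x (c m) by exact: (svalP f).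
 have [_ _ hA] := galP h; have [_ _ sK] := galP s.
 have e1 : h (x (c m)) = x (c m) by apply: hA; exact: x_AO.
 have e2 : s (x (c m)) = x (c m) by apply: sK; apply: AO_K; exact: x_AO.
 rewrite /= e1 e2; congr (_ * _).
 by apply: hs; apply: map_f; rewrite mem_enum.
have oH : open (~` H') by rewrite openC.
have [D fD DU] := (oH : pw_open _ (~` H')) u nH.
have /finite_seqP [r rD] : finite_set (D : set {classic {B : fet_alg (sring UA) & fibre x B}}) by exact: fD.
pose fr' : {classic {B : fet_alg (sring UA) & fibre x B}} -> seq Om := fr.
pose Dl := flatten [seq fr' p | p <- r].
pose H := [set h : S | H' (pg h)].
have sH : is_subgroup H.
 split; rewrite /H /=; first by rewrite pg1.
 by move=> g h Hg Hh; rewrite pgM; exact: HM.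
 by move=> g Hg; rewrite pgV; exact: HV.
have HR (g h : S) : H [~ g, h]%g.
 apply: SH; left; exists (pg g), (pg h).
 by rewrite /commg /conjg !(pgM, pgV).
have HX (g : S) : H (g ^+ l)%g by apply: SH; right; exists (pg g); rewrite pgX.
have lgt : (0 < l)%N := prime_gt0 pl.
pose A := [set z | PP z /\ forall h : S, H h -> h z = z].
have Pk c : c \in kb -> PP c by move=> ck; apply: ring_gen_incl; left; exact: UA_kb.
have Sk c (g : S) : c \in kb -> g c = c by move=> ck; have [_ _ h] := galP g; apply: h; exact: UA_kb.
have Skt (h : S) z : kt z -> h z = z.
 have hfx : subfield [set z | h z = z].
 split=> /= [|v w hv hw|v w hv hw]; first exact: rmorph1.
 by rewrite rmorphB /= hv hw.
 by rewrite fmorph_div /= hv hw.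
 apply: (fadj_min hfx) => [c ck|]; first exact: Sk.
 by have [_ _ hA] := galP h; apply: hA; exact: UA_t.
have orb z : PP z -> exists r : seq Om, forall h : S, h z \in r.
 move=> Pz; have [r' rP] := finite_orbit (PP_alg Pz); exists r' => h.
 by have [h' hE] := gal_refix (Skt h); rewrite -hE.
have HA z : PP z -> (forall h : S, H h -> h z = z) -> s z = z.
 move=> Pz Hz; have zk : z_ \in kb by exact: zeta_kb.
 have lk : l%:R^-1 \in kb by rewrite rpredV rpred_nat.
 have Pz' c w : c \in kb -> A w -> A (c * w).
 move=> ck [Pw Hw]; split; first by apply: rpredM => //; exact: Pk.
 by move=> h Hh; rewrite rmorphM /= (Sk c) // Hw.
 have [||||||||||L [-> LP]] := @kummer_decomp Om AO setT l z_ A _ (prime_gt0 pl) l0 (zeta_prim l0) _ _ _ _ _ _ _ _ z (conj Pz Hz).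
 - by split.
 - by move=> g _; exact: Sk.
 - move=> v w [Pv Hv] [Pw Hw]; split; first exact: rpredD.
 by move=> h Hh; rewrite rmorphD /= Hv // Hw.
 - by split; [exact: rpred0|move=> h _; exact: rmorph0].
 - by move=> w; exact: Pz'.
 - by move=> w; exact: Pz'.
 - move=> g w _ [Pw Hw]; split; first exact: PP_gal.
 move=> h Hh; have Hc : H (h * [~ h, g])%g by have [_ M _] := sH; apply: M.
 by have := congr1 g (Hw _ Hc); rewrite /commg /conjg mulgA mulgV mul1g /= (@bij_invfunK _ g).
 - move=> g g' w _ _ [Pw Hw]; have e := congr1 (g' * g)%g (Hw _ (HR g g')).
 by change ((g * g')%g w = (g' * g)%g w); rewrite commgC.
 - by move=> g w _ [Pw Hw]; exact: Hw.
 - by have [r' rP'] := orb z Pz; exists r' => g _.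
 rewrite rmorph_sum; apply: eq_big_seq => al alL; have [[Pal _] eig] := LP al alL.
 by apply: (D1_eigen sb Pal) => g; exact: eig.
have infC : infinite_set (range (j \o i)) by exact: inf_const.
have [|z|D' [D'H D'P D'PP]] := krull_density (D := Dl) (C := range (j \o i)) sH infC.
- by move=> _ h [c _ <-] _; apply: Sk; exact: i_kb.
- move=> /flattenP [_ /mapP [p _ ->]] zp; have [r' rP'] := orb z ((frP p).1 z zp); by exists r' => h _.
have [z zD'|h Hh hs] := D'P s.
 apply: HA => [|h Hh]; last exact: D'H.
 apply: D'PP zD' => [|v w|v w|_ [c _ <-]|v h /flattenP [_ /mapP [p _ ->]] vp _].
 - exact: rpred1.
 - exact: rpredB.
 - exact: rpredM.
 - by apply: Pk; exact: i_kb.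
 - by apply: PP_gal; exact: (frP p).1 vp.
apply: (DU (pg h)) Hh => p Dp; apply: fibreP => b /=; apply: ((frP p).2 h) => v vp.
apply: hs; apply/flattenP; exists (fr p) => //; apply: map_f.
have : (D : set {classic {B : fet_alg (sring UA) & fibre x B}}) p by [].
by rewrite rD.
Qed.
End EtaleQuotient.

(** * The groups H_t in terms of Kummer characters *)

Section KernelOfPi.
Variables (a : seq k0) (t : K0).
Hypothesis nt : nonconstant i t.

Notation UA := (Ua_ring i j a t).

Lemma nonconstant_sub b : j t - j (i b) != 0.
rewrite subr_eq0; apply/eqP => /(fmorph_inj j) e; apply: nt; exists b => //.
Qed.

Lemma sub_Kb b : j t - j (i b) \in Kb.
by rewrite rpredB ?j_Kb. Qed.

(** t - b is a unit on the punctured line, so its l-th root generates an etale algebra, on which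
    G^(2) acts trivially. *)
Lemma etale_kernel_conv (s : GO) b : b \in 0 :: a ->
 G2 (pi1 (Ua_point i j a t)) l (pi1_of_gal (@Ua_ring_sub _ _ i _ j a t) s) -> chi (j t - j (i b)) s = 0.
move=> ba h; have ub : j t - j (i b) \in UA.
 by rewrite rpredB ?UA_t // UA_kb // i_kb.
have lgt := prime_gt0 pl.
have lU : (l%:R : Om)^-1 \in UA by apply: UA_kb; rewrite rpredV rpred_nat.
have zU : z_ \in UA by apply: UA_kb; exact: zeta_kb.
pose u : sring UA := SRing ub; pose u' : sring UA := SRing (UA_inv t ba).
have uu : u * u' = 1 by apply: val_inj; rewrite /= divff ?nonconstant_sub.
have ll : SRing lU * l%:R = 1 by apply: val_inj; rewrite rmorphM rmorph_nat rmorph1 /= mulVf.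
have yl : lroot l (j t - j (i b)) ^+ l = Ua_point i j a t u by rewrite lrootP.
have [f [fs fr]] := quot_lift (Ua_point i j a t) lgt yl.
pose fb : fibre (Ua_point i j a t) (root_alg (Ua_point i j a t) lgt uu ll) := exist _ f fs.
have := @root_alg_kernel _ _ _ _ _ _ (Ua_point i j a t) lgt uu ll (SRing zU) _ fb pl _ _ h.
move=> /(_ (zeta_prim l0)) /= e; apply/(chi_fix pl l0 s (sub_Kb b) (nonconstant_sub b) (lrootP pl _)).
rewrite -fr e // ; apply: val_inj; rewrite rmorphXn rmorph1 /=; exact/prim_expr_order/zeta_prim.
Qed.

Lemma Ht_char (s : GO) : @Ht l _ _ i _ j a t (to_a l (res l s)) <-> forall b, b \in 0 :: a -> chi (j t - j (i b)) s = 0.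
rewrite /Ht /pi_t /=; set A := (X in xget _ X); set r := xget _ A.
have [u /extends_res <- e] : A r by apply: xgetPex; exists s, (res l s) => //; exact/extends_res.
have re b : chi (j t - j (i b)) r = chi (j t - j (i b)) s by move/(to_a_eq pl l0 Omalg inf0): e => ->; rewrite ?sub_Kb ?nonconstant_sub.
rewrite /to_a qclass_eq1; split=> [h b ba|h]; first by rewrite -re; exact: etale_kernel_conv.
by apply: etale_kernel => // b ba; rewrite re h.
Qed.
End KernelOfPi.

(** * Conjugation by lifts to K(l) of elements of Gal(k|k_0) *)

Section GaloisAction.
Notation GT := (gal [set x : KL | range j (sf_val x)]).
Notation Gk := (Gal_k0 i j).

Definition lifts (T : GT) (tau : Gk) : Prop := forall (x : sfield kb) (y : KL), sf_val y = sf_val x -> sf_val (T y) = sf_val (tau x).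

Lemma lifts_M T T' tau tau' : lifts T tau -> lifts T' tau' -> lifts (T * T')%g (tau * tau')%g.
by move=> h h' x y /h' /h. Qed.

Lemma lifts_V T tau : lifts T tau -> lifts T^-1%g tau^-1%g.
move=> h x y e; have zK : sf_val (tau^-1%g x) \in Kl l i j by apply/Kb_Kl/kb_Kb/sf_valP.
have Tz : T (SField zK) = y.
 apply: val_inj; rewrite /= (h (tau^-1%g x)) // e; congr sf_val; exact: (@bij_invfunK _ tau).
by rewrite -Tz [T^-1%g _](@bij_funK _ T).
Qed.

Lemma lifts_Kb T tau y : lifts T tau -> sf_val y \in Kb -> sf_val (T y) \in Kb.
move=> h yK; pose P : set Om := [set z | forall y : KL, sf_val y = z -> sf_val (T y) \in Kb].
suff : P (sf_val y) by move=> /(_ y erefl).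
pose Q : set Om := [set z | exists2 y : KL, sf_val y = z & sf_val (T y) \in Kb].
have hQ : subfield Q.
 split=> [|_ _ [x <- xT] [z <- zT]|_ _ [x <- xT] [z <- zT]].
 - by exists 1 => //; rewrite rmorph1 rpred1.
 - by exists (x - z); rewrite // rmorphB rpredB.
 - by exists (x / z); rewrite ?fmorph_div // rpred_div.
suff [z /val_inj -> zT] : Q (sf_val y) by move=> w /val_inj ->.
apply: (fld_gen_sub hQ) yK => x [[u _ <-]|xk].
 exists (SField (Kb_Kl l (j_Kb i j u))) => //; have [_ _ ->] := galP T; first exact: j_Kb.
 by exists u.
exists (SField (Kb_Kl l (kb_Kb xk))) => //.
by rewrite (h (SField xk)) // kb_Kb ?sf_valP.
Qed.

Section Conjugation.
Variables (T : GT) (tau : Gk).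
Hypothesis hT : lifts T tau.

Lemma conj_gal (u : GKn) : (gal_bij T * gal_bij u * (gal_bij T)^-1)%g \in gal_pred [set x : KL | sf_val x \in Kb].
have [TD TM _] := galP T; have [VD VM _] := galP T^-1%g; have [uD uM uF] := galP u.
apply/asboolP; split=> [x y|x y|x xK] /=.
- by rewrite -TD -uD; congr (T (u _)); exact: VD.
- by rewrite -TM -uM; congr (T (u _)); exact: VM.
- rewrite uF; first exact: (@bij_invfunK _ T).
 exact: (lifts_Kb (lifts_V hT) xK).
Qed.

Definition conj_GK (u : GKn) : GKn := Gal (conj_gal u).

Lemma conj_GK_M : {morph conj_GK : u v / (u * v)%g}.
by move=> u v; apply: gal_eq => x /=; rewrite bij_funK. Qed.

Lemma conj_GK_continuous : continuous conj_GK.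
apply/continuousP => U oU; apply/open_galP => g Ug; have [D DU] := (open_galP U).1 oU _ Ug.
exists [seq bij_invfun T x | x <- D] => h hg; apply: DU => x xD /=.
by rewrite hg //; exact: map_f.
Qed.

Lemma conj_G2 u : G2n u -> G2n (conj_GK u).
move=> /(G2_kummer pl l0 Omalg inf0) h; apply/(G2_kummer pl l0 Omalg inf0) => x xK /=.
rewrite h; first exact: (@bij_invfunK _ T).
have : sf_val (T^-1%g (x ^+ l)) \in Kb by apply: (lifts_Kb (lifts_V hT)); rewrite sf_valX.
by rewrite rmorphXn sf_valX.
Qed.

Lemma conj_GK1 : conj_GK 1%g = 1%g.
exact: (morph1 conj_GK_M). Qed.

Lemma conj_GK_V u : conj_GK u^-1%g = (conj_GK u)^-1%g.
exact: (morphV conj_GK_M). Qed.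

Lemma conj_GK_X u n : conj_GK (u ^+ n)%g = (conj_GK u ^+ n)%g.
by elim: n => [|n IH]; rewrite ?expg0 ?conj_GK1 // !expgS conj_GK_M IH. Qed.

Lemma conj_G3 u : G3n u -> G3n (conj_GK u).
apply: (closed_gen_min (H := [set u | G3n (conj_GK u)])).
- split=> [|v w hv hw|v hv]; rewrite /mkset ?conj_GK1 ?conj_GK_M ?conj_GK_V; [exact: nsub1|exact: nsubM|exact: nsubV].
- suff : closed (conj_GK @^-1` nsub_set G3n) by [].
 apply: closed_comp; [by move=> v _; exact: conj_GK_continuous|exact: closed_gen_closed].
move=> _ [[x [y [Gy ->]]]|[x ->]] /=; last by rewrite conj_GK_X; exact: G3_exp.
have -> : conj_GK [~ x, y]%g = [~ conj_GK x, conj_GK y]%g by rewrite /commg /conjg !conj_GK_M !conj_GK_V.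
by apply: G3_comm; exact: conj_G2.
Qed.

Definition conj_a : Ga GKn l -> Ga GKn l := @qmap _ _ G2n G2n conj_GK.

Lemma conj_aE u : conj_a (to_a l u) = to_a l (conj_GK u).
exact: (qmapE conj_GK_M conj_G2). Qed.

Definition conj_c : Gc GKn l -> Gc GKn l := @qmap _ _ G3n G3n conj_GK.

Lemma conj_cE u : conj_c (to_c l u) = to_c l (conj_GK u).
exact: (qmapE conj_GK_M conj_G3). Qed.

Lemma conj_aM : {morph conj_a : x y / (x * y)%g}.
exact: (qmapM conj_GK_M conj_G2). Qed.

Lemma conj_cM : {morph conj_c : x y / (x * y)%g}.
exact: (qmapM conj_GK_M conj_G3). Qed.

Lemma qmap_continuous (N N' : nsubgroup GKn) : (forall u, N u -> N' (conj_GK u)) -> continuous (@qmap _ _ N N' conj_GK).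
move=> NN; apply/continuousP => U oU.
suff : open (qclass N @^-1` (qmap N' conj_GK @^-1` U)) by [].
have -> : qclass N @^-1` (qmap N' conj_GK @^-1` U) = conj_GK @^-1` (qclass N' @^-1` U) by apply/seteqP; split=> u /=; rewrite (qmapE conj_GK_M NN).
by move/continuousP: conj_GK_continuous; apply; exact: oU.
Qed.
End Conjugation.

Lemma conj_a_comp T tau (hT : lifts T tau) T' tau' (hT' : lifts T' tau') T'' tau'' (hT'' : lifts T'' tau'') :
 T'' = (T * T')%g -> forall x, conj_a hT (conj_a hT' x) = conj_a hT'' x.
move=> e x; subst T''; have [u ->] := qclass_surj x; rewrite -/(to_a l u) !conj_aE; congr to_a.
exact: gal_eq.
Qed.

Lemma lifts1 : lifts 1%g 1%g. by move=> x y. Qed.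

Lemma conj_a1 x : conj_a lifts1 x = x.
by have [u ->] := qclass_surj x; rewrite -/(to_a l u) conj_aE; congr to_a; apply: gal_eq. Qed.

Lemma conj_aK T tau (hT : lifts T tau) : cancel (conj_a hT) (conj_a (lifts_V hT)).
by move=> x; rewrite (conj_a_comp (lifts_V hT) hT lifts1) ?mulVg // conj_a1. Qed.

Lemma conj_aVK T tau (hT : lifts T tau) : cancel (conj_a (lifts_V hT)) (conj_a hT).
by move=> x; rewrite (conj_a_comp hT (lifts_V hT) lifts1) ?mulgV // conj_a1. Qed.

Lemma conj_autg_pred T tau (hT : lifts T tau) : Defs.Bij (conj_aK hT) (conj_aVK hT) \in @autg_pred (Ga GKn l).
apply/asboolP; split=> /=; first exact: conj_aM.
 by apply: qmap_continuous; exact: conj_G2.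
by apply: qmap_continuous; exact: conj_G2.
Qed.

Definition conj_autg T tau (hT : lifts T tau) : autg (Ga GKn l) := Autg (conj_autg_pred hT).

(** A commutator map conjugated on source and target is again a commutator map, so conjugation
    preserves the kernel R. *)
Lemma conj_autc_half T tau (hT : lifts T tau) (p q : autg (Ga GKn l)) : p =1 conj_a hT -> q =1 conj_a (lifts_V hT) ->
 forall w, commutator_kernel w -> commutator_kernel (ext2hat_map (autg_hom p) w).
move=> pE qE w [b [bD bc bw] b1].
have c1 : conj_c hT 1%g = 1%g by exact: (morph1 (conj_cM hT)).
exists (fun v => conj_c hT (b (ext2hat_map (autg_hom q) v))); last first.
 have pq : autg_hom (q * p)%g =1 (autg_hom q : cont_hom _ _) \o (autg_hom p : cont_hom _ _) by [].
 rewrite (ext2hat_map_comp w pq) ext2hat_map_id ?b1 //.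
 by move=> x /=; rewrite pE qE conj_aK.
split=> [u v||s t].
- by rewrite ext2hat_mapD bD conj_cM.
- have c3 : continuous (conj_c hT) by apply: qmap_continuous; exact: conj_G3.
 have cq : continuous (@ext2hat_map l _ _ (autg_hom q)) by exact: ext2hat_map_continuous.
 move=> x; apply: (continuous_comp (f := @ext2hat_map l _ _ (autg_hom q)) (g := fun v => conj_c hT (b v))); first exact: cq.
 apply: (continuous_comp (f := b) (g := conj_c hT)); [exact: bc|exact: c3].
- rewrite ext2hat_map_wedge /= !qE !conj_aE bw.
 have cR (x y : Gc GKn l) : conj_c hT [~ x, y]%g = [~ conj_c hT x, conj_c hT y]%g by rewrite /commg /conjg !(conj_cM hT) !(morphV (conj_cM hT)).
 rewrite cR !conj_cE; congr ([~ to_c l _, to_c l _])%g; apply: gal_eq => x /=.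
 by rewrite !bij_invfunK.
 by rewrite !bij_invfunK.
Qed.

Lemma conj_autc T tau (hT : lifts T tau) : is_autc (conj_autg hT).
split; first by apply: (conj_autc_half (hT := hT) (q := (conj_autg hT)^-1%g)).
apply: (conj_autc_half (hT := lifts_V hT) (q := conj_autg hT)) => // x /=.
apply: (can_inj (conj_aK (lifts_V hT))).
by rewrite conj_aK conj_aVK.
Qed.
End GaloisAction.

(** * The canonical map *)

Section CanonicalMap.
Notation GT := (gal [set x : KL | range j (sf_val x)]).
Notation Gk := (Gal_k0 i j).

Lemma gal_j_Kl (T : gal (range j)) x : x \in Kl l i j -> T x \in Kl l i j.
have KK := @gal_j_Kb.
have hP : subfield [set y | T y \in Kl l i j].
 split=> [|y z|y z] /=; first by rewrite rmorph1 rpred1.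
 by rewrite rmorphB; exact: rpredB.
 by rewrite fmorph_div; exact: rpred_div.
apply: (fld_gen_sub hP) => y [L [[KL Lgal] [n [b [bL bP]]] yL]] /=; apply: fld_gen_incl.
have hTL := preim_subfield T^-1%g (div_subfield L); pose TL := fld hTL.
have TLP z : (z \in TL) <-> T^-1%g z \in L by exact: fldP.
have TK z : T^-1%g (T z) = z by exact: (@bij_funK _ T).
have VK z : T (T^-1%g z) = z by exact: (@bij_invfunK _ T).
have TLT z : z \in L -> T z \in TL by move=> zL; apply/TLP; rewrite TK.
exists TL; split; last exact: TLT.
 split=> [z zK|z /TLP /Lgal [s [us sL zs sK]]]; first by apply/TLP/KL/KK.
 exists [seq T w | w <- s]; split.
 - by rewrite map_inj_uniq //; exact: fmorph_inj.
 - by move=> _ /mapP [w /sL wL ->]; exact: TLT.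
 - by apply/mapP; exists (T^-1%g z); rewrite ?VK.
 have -> : \prod_(w <- [seq T w | w <- s]) ('X - w%:P) = map_poly T (\prod_(w <- s) ('X - w%:P)).
 by rewrite rmorph_prod big_map; apply: eq_bigr => w _; rewrite rmorphB /= map_polyX map_polyC.
 by apply/polyOverP => m; rewrite coef_map; apply: KK; exact: (polyOverP sK).
exists n, (T \o b); split=> [m|z /TLP /bP [c [[cK zc] cU]]]; first by apply: TLT.
exists [ffun m => T (c m)]; split=> [|c' [c'K zc']].
 split=> [m|]; first by rewrite ffunE; exact: KK.
 by rewrite -[z]VK zc rmorph_sum; apply: eq_bigr => m _; rewrite ffunE rmorphM.
have -> : c = [ffun m => T^-1%g (c' m)].
 apply: cU; split=> [m|]; first by rewrite ffunE; exact: KK.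
 by rewrite zc' rmorph_sum; apply: eq_bigr => m _; rewrite ffunE rmorphM /= -[X in _ * X]/(T^-1%g (T (b m))) TK.
by apply/ffunP => m; rewrite !ffunE VK.
Qed.

Lemma restrict_Kl (T0 : gal (range j)) : exists T : GT, forall y, sf_val (T y) = T0 (sf_val y).
by apply: restrict_gal => x; exact: gal_j_Kl. Qed.

Lemma restrict_kb (T0 : gal (range j)) : exists tau : Gk, forall x, sf_val (tau x) = T0 (sf_val x).
have [|//|T TE] := @restrict_gal Om (range j) kb T0; first exact: gal_j_kb.
 by move=> x; exact: (@gal_j_kb T0^-1%g).
have [TD TM TF] := galP T.
have pT : gal_bij T \in gal_pred [set x : sfield kb | range (j \o i) (sf_val x)] by apply/asboolP; split=> // x [c _ cx]; apply: TF; exists (i c).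
by exists (Gal pT).
Qed.

Lemma lifts_restrict (T0 : gal (range j)) (T : GT) (tau : Gk) : (forall y, sf_val (T y) = T0 (sf_val y)) ->
 (forall x, sf_val (tau x) = T0 (sf_val x)) -> lifts T tau.
by move=> TE tE x y e; rewrite TE tE e. Qed.

(** An automorphism of k over k_0 extends to Om over K_0 because K_0 is regular; this is
    [lift_constants]. *)
Lemma extend_tau (tau : Gk) : exists T0 : gal (range j), forall x, sf_val (tau x) = T0 (sf_val x).
pose f c := if insub c is Some x then sf_val (tau (x : sfield kb)) else 0.
have fE (x : sfield kb) : f (sf_val x) = sf_val (tau x) by rewrite /f valK.
have [tD tM tF] := galP tau.
have [|||T0 T0P] := lift_constants (tau := f).
- by move=> c c' ck c'k; have := fE (SField ck + SField c'k); rewrite tD /= => ->; rewrite -!fE.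
- by move=> c c' ck c'k; have := fE (SField ck * SField c'k); rewrite tM /= => ->; rewrite -!fE.
- by move=> _ [c _ <-]; have := fE (SField (i_kb i j c)) => /= ->; rewrite tF //; exists c.
by exists T0 => x; rewrite T0P ?sf_valP // fE.
Qed.

Lemma lifts_ex (tau : Gk) : exists T : GT, lifts T tau.
have [T0 tE] := extend_tau tau; have [T TE] := restrict_Kl T0.
by exists T; exact: lifts_restrict TE tE.
Qed.

Lemma lifts1_Kb (T : GT) y : lifts T 1%g -> sf_val y \in Kb -> T y = y.
move=> h yK; pose Q : set Om := [set z | exists2 y : KL, sf_val y = z & T y = y].
have hQ : subfield Q.
 split=> [|_ _ [x <- xT] [z <- zT]|_ _ [x <- xT] [z <- zT]].
 - by exists 1 => //; rewrite rmorph1.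
 - by exists (x - z); rewrite // rmorphB /= xT zT.
 - by exists (x / z); rewrite ?fmorph_div //= xT zT.
suff [z /val_inj ->] : Q (sf_val y) by [].
apply: (fld_gen_sub hQ) yK => x [[u _ <-]|xk].
 by exists (SField (Kb_Kl l (j_Kb i j u))) => //; have [_ _ ->] := galP T => //; exists u.
by exists (SField (Kb_Kl l (kb_Kb xk))) => //; apply: val_inj; exact: (h (SField xk)).
Qed.

(** Two lifts differ by an element of G_K, and inner automorphisms act trivially on G_K^a. *)
Lemma conj_a_uniq (T T' : GT) (tau : Gk) (hT : lifts T tau) (hT' : lifts T' tau) : conj_a hT =1 conj_a hT'.
have h1 : lifts (T^-1 * T')%g 1%g by rewrite -(mulVg tau); exact: lifts_M (lifts_V hT) hT'.
move=> x; rewrite -(@conj_a_comp _ _ hT _ _ h1 _ _ hT'); last by rewrite mulgA mulgV mul1g.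
congr conj_a; have [u ->] := qclass_surj x; rewrite -/(to_a l u) conj_aE.
set v := (T^-1 * T')%g in h1 *.
have vG : gal_bij v \in gal_pred [set x : KL | sf_val x \in Kb] by have [vD vM _] := galP v; apply/asboolP; split=> // y yK; exact: lifts1_Kb.
pose w : GKn := Gal vG.
have -> : conj_GK h1 u = (w * u * w^-1)%g by apply: gal_eq.
apply/qclassP; have -> : (u^-1 * (w * u * w^-1))%g = [~ u, w^-1]%g by rewrite /commg /conjg invgK !mulgA.
exact: G2_comm.
Qed.

Lemma inducesP (tau : Gk) phi (T : GT) (hT : lifts T tau) : induces tau phi <-> phi =1 conj_a hT.
split=> [[T' [hT' uP]] x|e].
 rewrite (conj_a_uniq hT hT'); have [u ->] := qclass_surj x.
 have [u' u'E] := uP u; rewrite -/(to_a l u) => ->; rewrite conj_aE; congr to_a.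
 by apply: val_inj; exact: u'E.
by exists T; split=> // u; exists (conj_GK hT u) => //; rewrite e conj_aE.
Qed.

Section Family.
Variable a : seq k0.

Lemma Ht_fix t (u : GKn) : nonconstant i t -> @Ht l _ _ i _ j a t (to_a l u) <->
 forall b, b \in 0 :: a -> forall x : KL, sf_val x ^+ l = j t - j (i b) -> u x = x.
move=> nt; have [s <-] := res_surj Omalg u; rewrite (Ht_char a nt).
have zK b := sub_Kb t b; have z0 b := nonconstant_sub nt b.
split=> h b ba => [x xz|].
 by apply: val_inj; rewrite /=; apply/(chi_fix pl l0 s (zK b) (z0 b) xz); exact: h.
have rK : lroot l (j t - j (i b)) \in Kl l i j by apply: root_Kl; rewrite // lrootP.
have := h b ba (SField rK) (lrootP pl _) => /(congr1 (@sf_val _ _)) /= e.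
by apply/(chi_fix pl l0 s (zK b) (z0 b) (lrootP pl _)).
Qed.

(** H_t is described by l-th roots of t - b with b in k_0, and a lift of tau permutes these because
    it fixes K_0. *)
Lemma conj_Ht_sub (T : GT) (tau : Gk) (hT : lifts T tau) t g : nonconstant i t -> Ht a t g -> Ht a t (conj_a hT g).
move=> nt; have [u ->] := qclass_surj g; rewrite -/(to_a l u) conj_aE.
move=> /(Ht_fix _ nt) h; apply/(Ht_fix _ nt) => b ba x xz.
have := h b ba (T^-1%g x); move=> /(_ _)/(congr1 T) /= => ->; first exact: (@bij_invfunK _ T).
have -> : sf_val (bij_invfun T x) ^+ l = sf_val (T^-1%g (x ^+ l)) by rewrite rmorphXn sf_valX.
have [_ _ ->] := galP T^-1%g; rewrite ?sf_valX //.
by exists (t - i b); rewrite // rmorphB -xz sf_valX.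
Qed.

Lemma conj_autg_fix (T : GT) (tau : Gk) (hT : lifts T tau) :
 conj_autg hT \in autc_fix_pred (@Ht_family l _ _ i _ j a).
apply/asboolP; split=> [|_ [t nt ->]]; first exact: conj_autc.
apply/seteqP; split=> [_ [g gH <-]|g gH]; first exact: conj_Ht_sub.
exists (conj_a (lifts_V hT) g); first exact: conj_Ht_sub.
exact: conj_aVK.
Qed.

Definition conj_fix (T : GT) (tau : Gk) (hT : lifts T tau) : autc_fix (@Ht_family l _ _ i _ j a) := AutcFix (conj_autg_fix hT).

Lemma canonical_map_ex : exists rho : Gk -> Autca_mod l i j a, [/\ is_canonical_map rho,
 {morph rho : s t / (s * t)%g} &
 forall (T : GT) (tau : Gk) (hT : lifts T tau), rho tau = qclass _ (conj_fix hT)].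
have /choice [T hT] := lifts_ex.
have uniq_ (T' : GT) (tau : Gk) (hT' : lifts T' tau) : conj_fix (hT tau) = conj_fix hT' by apply: autc_fixP; exact: conj_a_uniq.
exists (fun tau => qclass _ (conj_fix (hT tau))); split=> [tau c|s t|T' tau hT']; last by rewrite (uniq_ _ _ hT').
 split=> [<-|[phi phiP ->]]; first by exists (conj_fix (hT tau)) => //; apply/(inducesP _ (hT tau)).
 by congr qclass; apply: autc_fixP => x; have /(inducesP _ (hT tau)) -> := phiP.
rewrite -qclassM; congr qclass; rewrite (uniq_ _ _ (lifts_M (hT s) (hT t))).
by apply: autc_fixP => x /=; rewrite (conj_a_comp (hT s) (hT t) (lifts_M (hT s) (hT t))).
Qed.
End Family.
End CanonicalMap.

(** * Injectivity and surjectivity *)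

Section Isomorphism.
Variable a : seq k0.

Notation GT := (gal [set x : KL | range j (sf_val x)]).
Notation Gk := (Gal_k0 i j).
Notation cls s := (to_a l (res l s) : Ga GKn l).
Notation conj_fix := (conj_fix a).

Lemma to_a_res_X (s : GO) n : cls (s ^+ n)%g = (cls s ^+ n)%g.
rewrite -qclassX; congr to_a; elim: n => [|n IH]; last by rewrite !expgS resM IH.
by rewrite !expg0; apply: gal_eq => x; apply: val_inj.
Qed.

Lemma chi_grpX z (s : GO) n : z \in Kb -> z != 0 -> chi z (s ^+ n)%g = chi z s *+ n.
move=> zK z0; elim: n => [|n IH]; first by rewrite expg0 (chi_grp1 pl l0).
by rewrite expgS (chi_mul pl l0) // IH mulrS.
Qed.

Lemma sep_point : exists (y : K0) (s : GO), nonconstant i y /\ chi (j y) s != 0.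
have [||P [u [_ _ [_ uk] _ [[s [_ s1]] _]]]] := core_place (a := 0) (ns := [::]) (D := [::]) (rpred0 _) => //.
exists u, s; split; first by move=> [c _ e]; move/negP: uk; apply; rewrite -e; exact: i_kb.
by move: s1; rewrite subr0 => ->; exact: oner_neq0.
Qed.

Lemma cyclotomic (T0 : gal (range j)) : exists2 ka : 'F_l, ka != 0 & forall c, T0 (zpow Om c) = zpow Om (ka * c).
have zp := zeta_prim l0.
have [|k _ kE] := @root_of_unityE Om l z_ zp (T0 z_).
 by rewrite -rmorphXn /= (prim_expr_order zp) rmorph1.
exists k%:R => [|c].
 apply/eqP => k0'; have : T0 z_ = 1 by rewrite kE -(zpow_nat pl l0) k0' (zpow0 pl l0).
 rewrite -[X in _ = X](rmorph1 T0) => /(fmorph_inj T0) z1.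
 by have := prim_order_dvd zp 1; rewrite z1 eqxx dvdn1 => /eqP e; move: pl; rewrite e.
transitivity (zpow Om (k%:R *+ (c : nat) : 'F_l)); last by rewrite -mulr_natr -(Fl_nat c).
by rewrite -(zpowX pl l0) zpow_nat // -kE -rmorphXn.
Qed.

Section Extension.
Variables (T0 : gal (range j)) (T : GT) (tau : Gk) (hT : lifts T tau).
Hypothesis TE : forall y, sf_val (T y) = T0 (sf_val y).

Lemma conj_res (s : GO) : exists s' : GO, (forall x, s' (T0 x) = T0 (s x)) /\ conj_GK hT (res l s) = res l s'.
have [TD TM _] := galP T0; have [VD VM _] := galP T0^-1%g; have [sD sM sF] := galP s.
have TK x : T0^-1%g (T0 x) = x by exact: (@bij_funK _ T0).
have VK x : T0 (T0^-1%g x) = x by exact: (@bij_invfunK _ T0).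
have sP : (gal_bij T0 * gal_bij s * (gal_bij T0)^-1)%g \in gal_pred [set x : Om | x \in Kb].
 apply/asboolP; split=> [x y|x y|x xK] /=.
 - by rewrite -TD -sD; congr (T0 (s _)); exact: VD.
 - by rewrite -TM -sM; congr (T0 (s _)); exact: VM.
 - by rewrite sF; [exact: VK|exact: (@gal_j_Kb T0^-1%g)].
exists (Gal sP); split=> [x|]; first by rewrite /= (@bij_funK _ T0).
apply: gal_eq => y; apply: val_inj.
have y_ : sf_val (bij_invfun T y) = T0^-1%g (sf_val y) by apply: (can_inj TK); rewrite VK -TE; congr sf_val; exact: (@bij_invfunK _ T).
by rewrite /= TE /= y_.
Qed.

(** Conjugation carries the character of z to that of T0 z, up to the factor [ka] by which T0 acts
    on l-th roots of unity. *)
Lemma conj_chi : exists2 ka : 'F_l, ka != 0 & forall s : GO, exists s' : GO, conj_a hT (cls s) = cls s' /\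
 forall z, z \in Kb -> z != 0 -> chi (T0 z) s' = ka * chi z s.
have [ka ka0 kaE] := cyclotomic T0; exists ka => // s.
have [s' [s'E s'c]] := conj_res s; exists s'; split=> [|z zK z0]; first by rewrite conj_aE s'c.
apply: (chi_uniq pl l0 (a := T0 (lroot l z))); rewrite ?gal_j_Kb ?fmorph_eq0 ?lroot_nz //.
 by rewrite -rmorphXn /= lrootP.
by rewrite s'E (chiE pl l0 s zK (lrootP pl z)) rmorphM /= kaE.
Qed.

(** A nonzero character of an element of K_0 identifies m with the cyclotomic factor; then y - c and
    y - T0 c have the same character for every y, and [distinct_points] applies. *)
Lemma scalar_trivial m : (forall x, conj_a hT x = x ^+ m)%g -> forall c, c \in kb -> T0 c = c.
move=> hm c ck; have [ka ka0 kaE] := conj_chi.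
have key s z : z \in Kb -> z != 0 -> ka * chi z s = m%:R * chi (T0 z) s.
 move=> zK z0; have [s' [e <-//]] := kaE s; move: e; rewrite hm -to_a_res_X.
 move/(to_a_eq pl l0 Omalg inf0) => <-; rewrite ?gal_j_Kb ?fmorph_eq0 // chi_grpX ?gal_j_Kb ?fmorph_eq0 //.
 by rewrite mulr_natl.
have [y [s [ny ys]]] := sep_point.
have y0 : j y != 0 by have := nonconstant_sub ny 0; rewrite !rmorph0 subr0.
have mk : m%:R = ka by have := key s (j y) (j_Kb i j y) y0; rewrite gal_j => /(mulIf ys).
apply/esym; have Tk := gal_j_kb T0 ck; apply: (distinct_points ck Tk) => z zk s1.
have zc : j z - c != 0 by exact: notin_sub zk ck.
have := key s1 (j z - c); rewrite rpredB ?j_Kb ?kb_Kb // => /(_ isT zc).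
by rewrite mk rmorphB /= gal_j => /(mulfI ka0).
Qed.

(** The power m combines the factor n with the inverse of the cyclotomic factor. *)
Lemma scalar_of_chi (phi : Ga GKn l -> Ga GKn l) n : n != 0 ->
 (forall s t : GO, phi (cls s) = cls t -> forall z, z \in Kb -> z != 0 -> chi (T0 z) t = n * chi z s) ->
 exists m, coprime m l /\ forall x, phi x = (conj_a hT x ^+ m)%g.
move=> n0 h; have [ka ka0 kaE] := conj_chi; pose m := n / ka.
have m0 : m != 0 by rewrite mulf_neq0 ?invr_eq0.
exists (m : nat); split.
 rewrite coprime_sym prime_coprime // gtnNdvd ?lt0n //.
 by have := ltn_ord m; rewrite [X in (_ < X)%N -> _](Fp_cast pl).
move=> x; have [u ->] := qclass_surj x; have [s <-] := res_surj Omalg u; rewrite -/(to_a l _).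
have [u' e] := qclass_surj (phi (cls s)); have [t tE] := res_surj Omalg u'; rewrite -tE -/(to_a l _) in e.
have [s' [-> s'E]] := kaE s; rewrite e -to_a_res_X; apply/(to_a_eq pl l0 Omalg inf0) => z zK z0.
have VK : T0 (T0^-1%g z) = z by exact: (@bij_invfunK _ T0).
have wK : T0^-1%g z \in Kb by exact: (@gal_j_Kb T0^-1%g).
have w0 : T0^-1%g z != 0 by rewrite fmorph_eq0.
rewrite -VK (h _ _ e) // chi_grpX ?VK // -{2}VK s'E // -mulr_natl -(Fl_nat m) mulrA /m divfK //.
Qed.
End Extension.

Section Surjectivity.
Variable phi : autc_fix (@Ht_family l _ _ i _ j a).
Variable g : GKn -> GO.
Hypothesis gP : forall u, phi (to_a l u) = cls (g u).

Let Psi0 z s := chi z (g (res l s)).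

Let phi_autg : autg (Ga GKn l) := acf_aut phi.

Let gE z (s t : GO) : z \in Kb -> z != 0 -> phi (cls s) = cls t -> chi z t = Psi0 z s.
by rewrite gP => zK z0 /(to_a_eq pl l0 Omalg inf0) h; rewrite /Psi0 h. Qed.

Lemma dual_ex z : z \in Kb -> z != 0 -> exists w, [/\ w \in Kb, w != 0 & Psi0 z =1 chi w].
move=> zK z0.
have [u v||w [wK w0 wE]] := @character_kummer l k0 K0 i Om j pl l0 Omalg inf0 (fun u => chi z (g u)); last by exists w.
 rewrite -(chi_mul pl l0) //; have /(to_a_eq pl l0 Omalg inf0) -> // : cls (g (u * v)%g) = cls (g u * g v)%g.
 by rewrite resM to_aM -!gP to_aM; exact: autc_fix_morph.
have rK : lroot l z \in Kl l i j by apply: root_Kl; rewrite // lrootP.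
pose O : set GKn := [set u | u (SField rK) = SField rK].
have oO : open O by apply/open_galP => u uO; exists [:: SField rK] => h /(_ _ (mem_head _ _)); rewrite /O /= uO.
have [_ phic _] := autgP phi_autg.
have oV : open (to_a l @^-1` (phi_autg @^-1` (to_a l @` O))).
 have h : open (phi_autg @^-1` (to_a l @` O)) by move/continuousP: phic; apply; exact: qclass_open.
 exact: h.
have [|D DP] := (open_galP _).1 oV 1%g.
 by exists 1%g => //; apply/esym; exact: (morph1 (@autc_fix_morph _ _ _ phi)).
exists D => u uD; have [o oO' oE] : (to_a l @` O) (phi (to_a l u)) by apply: DP => x xD; rewrite uD.
have [r rE] := res_surj Omalg o; move: oE; rewrite gP -rE => /(to_a_eq pl l0 Omalg inf0) <- //.
apply/(chi_fix pl l0 r zK z0 (lrootP pl z)); move: oO'; rewrite -rE => /(congr1 (@sf_val _ _)).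
by [].
Qed.

(** Invariance of the H_t gives a common factor n on K_0, the kernel R gives the Steinberg
    relations, and [rigidity] applies to Psi divided by n. *)
Lemma phi_rigid : exists n (T0 : gal (range j)), n != 0 /\
 forall s t : GO, phi (cls s) = cls t -> forall z, z \in Kb -> z != 0 -> chi (T0 z) t = n * chi z s.
have /asboolP [phic phiH] := acf_autP phi.
have PM z z' s : z \in Kb -> z' \in Kb -> z != 0 -> z' != 0 -> Psi0 (z * z') s = Psi0 z s + Psi0 z' s by move=> *; rewrite /Psi0 (chiM pl l0).
have PI z : z \in Kb -> z != 0 -> (forall s, Psi0 z s = 0) -> forall s : GO, chi z s = 0.
 move=> zK z0 h t; have [u uE] := qclass_surj (bij_invfun phi_autg (cls t)).
 have [s sE] := res_surj Omalg u; rewrite (@gE z s) // sE -/(to_a l u) -[to_a l u]uE.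
 exact: (@bij_invfunK _ phi_autg).
pose as_ := undup (0 :: a).
have PH (t : K0) (s : GO) : nonconstant i t -> (forall b, b \in as_ -> chi (j t - j (i b)) s = 0) -> Psi0 (j t) s = 0.
 move=> nt h; have Hs : Ht a t (cls s).
 by apply/(Ht_char a nt) => b ba; apply: h; rewrite mem_undup.
 have : Ht a t (phi (cls s)) by rewrite -[Ht a t]phiH; [exists (cls s)|exists t].
 by rewrite gP => /(Ht_char a nt) /(_ 0 (mem_head _ _)); rewrite !rmorph0 subr0.
have [y [s0 [ny ys]]] := sep_point.
have [|n nP] := Psi_scalar (undup_uniq (0 :: a)) PM dual_ex PH _ ny ys.
 by rewrite mem_undup mem_head.
have y0 : j y != 0 by have := nonconstant_sub ny 0; rewrite !rmorph0 subr0.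
have n0 : n != 0.
 apply: contra_neq ys => n0; apply: PI; rewrite ?j_Kb // => s.
 by rewrite nP ?n0 ?mul0r // -(fmorph_eq0 j).
(* Dividing a Kummer character by n amounts to raising w to a power representing the inverse of n
   modulo l. *)
have VE z : z \in Kb -> z != 0 -> exists w, [/\ w \in Kb, w != 0 & (fun s => n^-1 * Psi0 z s) =1 chi w].
 move=> zK z0; have [w [wK w0 wE]] := dual_ex zK z0; exists (w ^+ (n^-1 : 'F_l)).
 by rewrite rpredX // expf_neq0 //; split=> // s; rewrite (chiX pl l0) // -mulr_natl -(Fl_nat n^-1) -wE.
have [||||T0 T0P] := @rigidity (fun z s => n^-1 * Psi0 z s) _ VE.
- by move=> z z' s *; rewrite PM // mulrDr.
- move=> z z' s t zK z'K z0 z'0 zz st; rewrite !mulrA ![_ * _ * n^-1]mulrAC -!mulrA; congr (_ * (_ * _)).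
 have [w [wK w0 wE]] := dual_ex zK z0; have [w' [wK' w0' wE']] := dual_ex z'K z'0.
 rewrite !wE !wE'.
 apply: (autc_steinberg pl l0 Omalg inf0 phic zK z'K z0 z'0 zz _ _ st) => r r' e; rewrite -?wE -?wE'; exact: gE.
- move=> z zK z0 h; apply: PI => // s.
 by have /eqP := h s; rewrite mulf_eq0 invr_eq0 (negbTE n0) => /eqP.
- by move=> t t0 s; rewrite nP // mulKf.
exists n, T0; split=> // s t e z zK z0.
by rewrite -(T0P z zK z0) mulVKf //; apply: gE; rewrite ?gal_j_Kb ?fmorph_eq0.
Qed.
End Surjectivity.

Theorem canonical_map_bijective : exists rho : Gk -> Autca_mod l i j a,
 [/\ is_canonical_map rho, {morph rho : s t / (s * t)%g} & bijective rho].
have [rho [rhoC rhoM rhoE]] := canonical_map_ex a.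
exists rho; split=> //.
have inj1 tau : rho tau = 1%g -> tau = 1%g.
 have [T0 tE] := extend_tau tau; have [T TE] := restrict_Kl T0.
 have hT := lifts_restrict TE tE; rewrite (rhoE _ _ hT) => /esym/(qclassP _ 1%g) [m [_]].
 rewrite invg1 mul1g => mE.
 apply: gal_eq => x; apply: val_inj; apply: (etrans (tE x)).
 have h := @scalar_trivial T0 T tau hT TE m mE; exact: (h _ (sf_valP x)).
have rho_inj : injective rho.
 move=> s t e; have : (s * t^-1)%g = 1%g by apply: inj1; rewrite rhoM (morphV rhoM) e mulgV.
 by move=> /(congr1 (fun x => (x * t)%g)); rewrite mulgVK mul1g.
have rho_surj c : exists tau, rho tau = c.
 have [phi ->] := qclass_surj c.
 have /choice [g gP] : forall u : GKn, exists t : GO, phi (to_a l u) = cls t by move=> u; have [s <-] := res_surj Omalg u; exact: (autg_lift Omalg (acf_aut phi)).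
 have [n [T0 [n0 hn]]] := phi_rigid gP.
 have [T TE] := restrict_Kl T0; have [tau tE] := restrict_kb T0.
 have hT := lifts_restrict TE tE; exists tau; rewrite (rhoE _ _ hT); apply/qclassP.
 have [m [cm mE]] := scalar_of_chi hT TE n0 hn; exists m; split=> // x.
 have -> : ((conj_fix hT)^-1 * phi)%g x = (conj_fix hT)^-1%g (phi x) by [].
 by rewrite mE autc_fixX; congr (_ ^+ m)%g; exact: conj_aK.
have /choice [inv invP] := rho_surj.
by exists inv => x //; apply: rho_inj; rewrite invP.
Qed.
End Isomorphism.
End RegularSetting.

Local Close Scope ring_scope.
Local Close Scope classical_set_scope.

Theorem theorem3 (l : nat) (k0 K0 : fieldType) (i : {rmorphism k0 -> K0})
    (d : nat) (Om : closedFieldType) (j : {rmorphism K0 -> Om}) (a : seq k0) :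
  prime l ->
  infinite_set [set: k0]%classic ->
  perfect_field k0 ->
  l \notin [pchar k0]%R ->
  regular_function_field i ->
  has_trdeg i d -> 5 <= d ->
  (forall x : Om, algebraicOver j x) ->
  0%R \notin a ->
  exists rho : Gal_k0 i j -> Autca_mod l i j a,
    [/\ is_canonical_map rho,
        {morph rho : s t / (s * t)%g} &
        bijective rho].
Proof.
move=> pl inf0 _ lk [fg _ reg] td d5 Omalg _.
have l0 : (l%:R != 0 :> Om)%R.
  rewrite -(rmorph_nat (j \o i)) fmorph_eq0.
  by apply: contraNneq lk => l0; rewrite inE pl l0 eqxx.
exact: (canonical_map_bijective pl l0 Omalg inf0 fg td (ltnW (ltnW (ltnW d5))) reg).
Qed.
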